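(* Let $(M,g)$ be an $n$-dimensional complete Riemannian manifold and $U$ an open subset of $M$. Assume that $E := M-\overline{U}$ is an end with radial coordinates and set $r=\mathrm{dist}(U,\ast)$. Assume that there exists a constant $r_0>0$ such that the second fundamental forms $\nabla dr$ of the level hypersurfaces $\{S(r)\}_{r\ge r_0}$ satisfy $$\frac{a}{r}\,(g-dr\otimes dr)\le \nabla dr\le \frac{b}{r}\,(g-dr\otimes dr)\qquad\text{on } B(r_0,\infty),$$ where $a>0$ and $b>0$ are constants satisfying $$a\le b\quad\text{and}\quad \frac{n+1}{n-1}\,a>b.$$ In addition, assume that $$\mathrm{Ric}(\nabla r,\nabla r)\ge -(n-1)\frac{b_1(r)}{r}\qquad\text{on } B(r_0,\infty),$$ where $b_1(t)$ is a positive-valued decreasing function of $t\in[r_0,\infty)$ satisfying $\lim_{t\to\infty}b_1(t)=0$. Let $\lambda>0$ be a constant and $u$ a nontrivial solution to the equation $$\Delta u+\lambda u=0\qquad\text{on } B(r_0,\infty).$$ Then, for any $\gamma>\frac{n-1}{2}(b-a)$, we have $$\liminf_{t\to\infty}\; t^{\gamma}\int_{S(t)}\left\{\left(\frac{\partial u}{\partial r}\right)^2+|u|^2\right\}dA\neq 0.$$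
   Context: Here $n\ge 2$ (implicit in the division by $n-1$), and functions are real-valued. Let $U\subset M$ be open. One says that $M-U$ (equivalently $E=M-\overline{U}$) is an end with radial coordinates if the boundary $\partial U$ is compact, connected and $C^\infty$, and the outward normal exponential map $\exp^{\perp}_{\partial U}:N^{+}(\partial U)\to M-\overline{U}$ is a diffeomorphism, where $N^{+}(\partial U)$ is the set of vectors $v$ tangent to $M$ at points of $\partial U$ that are outward normal to $\partial U$ (positive multiples of the unit normal pointing out of $U$). $U$ need not be relatively compact. The function $r$ is the distance function from $\partial U$ on the end (equal to $\mathrm{dist}(U,\ast)$ there). Notation: $B(s,\infty)=\{x\in M-\overline{U}\mid s<r(x)\}$ for $0\le s<\infty$; $S(t)=\{x\in M-\overline{U}\mid r(x)=t\}$ for $t>0$; $dA$ is the measure on $S(t)$ induced from the Riemannian measure $dv_g$ of $(M,g)$; $\nabla dr$ is the Hessian of $r$; inequalities between symmetric $2$-tensors are inequalities of quadratic forms; $\mathrm{Ric}$ is the Ricci tensor; $\partial u/\partial r=\langle\nabla r,\nabla u\rangle$; $\Delta=\mathrm{div}\,\nabla$ is the Laplace-Beltrami operator (so $-\Delta\ge 0$). A nontrivial solution is one that is not identically zero. *)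

(* Defs.v *)
From HB Require Import structures.
From mathcomp Require Import all_boot all_order all_algebra.
From mathcomp Require Import all_classical all_reals all_analysis.

Set Implicit Arguments.
Unset Strict Implicit.
Unset Printing Implicit Defensive.

Import Order.TTheory GRing.Theory Num.Theory.
Import numFieldNormedType.Exports.

Local Open Scope classical_set_scope.
Local Open Scope ring_scope.

(* The class C^k on an open set, with k = None for C^oo: the iterated
   directional derivatives up to order k exist and are continuous. *)

Definition order_le (k : option nat) (l : nat) : Prop :=
  if k is Some k' then (l <= k')%N else True.

Fixpoint iterD (R : realType) (V W : normedModType R) (s : seq V) (f : V -> W)
    : V -> W :=
  if s is v :: s' then 'D_v (iterD s' f) else f.

Definition Ck (R : realType) (V W : normedModType R) (k : option nat)
    (O : set V) (f : V -> W) : Prop :=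
  forall (s : seq V) (x : V), O x ->
    (order_le k (size s) -> {for x, continuous (iterD s f)}) /\
    (order_le k (size s).+1 -> forall v, derivable (iterD s f) x v).

Record charts (R : realType) (V : normedModType R) (X : Type) := Charts {
  idx : Type;
  dom : idx -> set X;
  crd : idx -> X -> V
}.

Definition id_chart (R : realType) (V : normedModType R) : charts V V :=
  @Charts R V V unit (fun=> setT) (fun=> id).

(* C^k maps between charted spaces on an arbitrary subset A: near each point of
   A, f maps A into the domain of any chart at the image point and, read in
   charts, is the restriction to A of a C^k map defined on an open set.  This
   is the usual notion when A is open, and when A is an embedded
   submanifold. *)
Definition Cmap (R : realType) (V W : normedModType R) (X Y : Type)
    (CX : charts V X) (CY : charts W Y) (k : option nat) (A : set X)
    (f : X -> Y) : Prop :=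
  forall (i : idx CX) (j : idx CY) (x : X),
    A x -> dom i x -> dom j (f x) ->
    exists (O : set V) (F : V -> W),
      [/\ open O, O (crd i x), Ck k O F &
          forall y, A y -> dom i y -> O (crd i y) ->
            dom j (f y) /\ F (crd i y) = crd j (f y)].

Definition diffeo_on (R : realType) (V W : normedModType R) (X Y : Type)
    (CX : charts V X) (CY : charts W Y) (A : set X) (B : set Y)
    (f : X -> Y) : Prop :=
  [/\ set_bij A B f, Cmap CX CY None A f &
      exists2 h : Y -> X, (forall x, A x -> h (f x) = x) & Cmap CY CX None B h].

Record manifold (R : realType) (n : nat) (M : topologicalType) := Manifold {
  atlas :> charts 'rV[R]_n M;
  pt : idx atlas -> 'rV[R]_n -> M;
  chart_at : M -> idx atlas;
  chart_atP : forall p, dom (chart_at p) p;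
  dom_open : forall i : idx atlas, open (dom i);
  img_open : forall i : idx atlas, open (crd i @` dom i);
  crdK : forall (i : idx atlas) p, dom i p -> pt i (crd i p) = p;
  crd_continuous : forall (i : idx atlas) p, dom i p ->
    {for p, continuous (crd i)};
  pt_continuous : forall (i : idx atlas) p, dom i p ->
    {for crd i p, continuous (pt i)};
  transition_smooth : Cmap atlas atlas None setT id;
  manifold_hausdorff : hausdorff_space M;
  manifold_second_countable : @second_countable M
}.

Section RiemannianManifold.
Context {R : realType} {n : nat} {M : topologicalType}.

(* Jacobian matrices act on row vectors on the right: 'd f x v = v *m 'J f x. *)
Definition transition (X : manifold R n M) (i j : idx X) (p : M) : 'M[R]_n :=
  'J (crd j \o pt i) (crd i p).

Record metric (X : manifold R n M) := Metric {
  gmx : idx X -> 'rV[R]_n -> 'M[R]_n;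
  gmx_sym : forall (i : idx X) p, dom i p ->
    (gmx i (crd i p))^T = gmx i (crd i p);
  gmx_pos : forall (i : idx X) p, dom i p -> forall v : 'rV[R]_n, v != 0 ->
    0 < (v *m gmx i (crd i p) *m v^T) 0 0;
  gmx_smooth : forall (i : idx X) a b,
    Ck None (crd i @` dom i) (fun x => gmx i x a b : R^o);
  gmx_change : forall (i j : idx X) p, dom i p -> dom j p ->
    gmx i (crd i p) =
    transition i j p *m gmx j (crd j p) *m (transition i j p)^T
}.

Context {X : manifold R n M} (g : metric X).
Implicit Types (i : idx X) (x v w : 'rV[R]_n) (p q : M) (f : M -> R).

Definition partial (a : 'I_n) (h : 'rV[R]_n -> R) x : R :=
  'D_(delta_mx 0 a) (h : 'rV[R]_n -> R^o) x.

Definition ginv i x : 'M[R]_n := invmx (gmx g i x).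

(* [christoffel i x a b c] is Gamma^c_ab. *)
Definition christoffel i x (a b c : 'I_n) : R :=
  2^-1 * \sum_d ginv i x c d *
    (partial a (fun y => gmx g i y b d) x + partial b (fun y => gmx g i y a d) x
     - partial d (fun y => gmx g i y a b) x).

(* R_ab = d_c Gamma^c_ab - d_b Gamma^c_ac
          + Gamma^c_cd Gamma^d_ab - Gamma^c_bd Gamma^d_ac,
   nonnegative on round spheres. *)
Definition ricci_mx i x : 'M[R]_n := \matrix_(a, b) \sum_c
  (partial c (fun y => christoffel i y a b c) x
   - partial b (fun y => christoffel i y a c c) x
   + \sum_d (christoffel i x c d c * christoffel i x a b d
             - christoffel i x b d c * christoffel i x a c d)).

Definition hessian_mx i f x : 'M[R]_n := \matrix_(a, b)
  (partial a (partial b (f \o pt i)) x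
   - \sum_c christoffel i x a b c * partial c (f \o pt i) x).

Definition local_grad i f x : 'rV[R]_n :=
  (\row_a partial a (f \o pt i) x) *m ginv i x.

Definition local_div i (Y : 'rV[R]_n -> 'rV[R]_n) x : R :=
  (Num.sqrt (\det (gmx g i x)))^-1 *
  \sum_a partial a (fun y => Num.sqrt (\det (gmx g i y)) * Y y 0 a) x.

(* A tangent vector at p is the row of its components in the chart
   [chart_at p]; the tangent bundle is M * 'rV_n. *)

Definition ev p (B : idx X -> 'rV[R]_n -> 'M[R]_n) v w : R :=
  (v *m B (chart_at X p) (crd (chart_at X p) p) *m w^T) 0 0.

Definition inner p v w : R := ev p (gmx g) v w.

Definition ricci p v w : R := ev p ricci_mx v w.

Definition hessian f p v w : R := ev p (fun i => hessian_mx i f) v w.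

Definition grad f p : 'rV[R]_n :=
  local_grad (chart_at X p) f (crd (chart_at X p) p).

Definition differential f p v : R := inner p (grad f p) v.

Definition laplacian f p : R :=
  local_div (chart_at X p) (local_grad (chart_at X p) f)
    (crd (chart_at X p) p).

Definition Cfun (k : option nat) (W : set M) f : Prop :=
  Cmap X (id_chart (R^o : normedModType R)) k W f.

Definition tangent_charts :
    charts ('rV[R]_n * 'rV[R]_n : normedModType R)%type (M * 'rV[R]_n) :=
  @Charts R ('rV[R]_n * 'rV[R]_n : normedModType R)%type (M * 'rV[R]_n) (idx X)
    (fun i z => dom i z.1)
    (fun i z => (crd i z.1, z.2 *m transition (chart_at X z.1) i z.1)).

Definition Ccurve (k : option nat) (c : R -> M) : Prop :=
  Cmap (id_chart (R^o : normedModType R)) X k setT c.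

Definition velocity (c : R -> M) (t : R) : 'rV[R]_n :=
  derive1 (crd (chart_at X (c t)) \o c) t.

Definition speed (c : R -> M) (t : R) : R :=
  Num.sqrt (inner (c t) (velocity c t) (velocity c t)).

(* Velocities may vanish, so piecewise C^1 curves can be reparametrized (with
   the same length) to be C^1, and these curves define the usual distance.  It
   is +oo between different components. *)
Definition edist p q : \bar R := ereal_inf
  [set (\int[lebesgue_measure]_(t in `[0%R, 1%R]) (speed c t)%:E)%E |
    c in [set c : R -> M | [/\ Ccurve (Some 1%N) c, c 0 = p & c 1 = q]]].

Definition dist_set (A : set M) p : R :=
  fine (ereal_inf [set edist q p | q in A]).

Definition complete_metric : Prop :=
  forall s : nat -> M,
    (forall e : R, 0 < e -> exists N, forall j k,
       (N <= j)%N -> (N <= k)%N -> (edist (s j) (s k) < e%:E)%E) ->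
    exists p, s @ \oo --> p.

Definition geodesic (c : R -> M) : Prop :=
  Ccurve (Some 2%N) c /\
  forall i t, dom i (c t) ->
    let x := crd i \o c in
    forall k, derive1 (derive1 x) t 0 k +
      \sum_a \sum_b christoffel i (x t) a b k *
        derive1 x t 0 a * derive1 x t 0 b = 0.

(* On a complete manifold there is exactly one such geodesic. *)
Definition expm (z : M * 'rV[R]_n) : M :=
  xget z.1 [set c 1 | c in
    [set c : R -> M | [/\ geodesic c, c 0 = z.1 & velocity c 0 = z.2]]].

Definition boundary (U : set M) : set M := closure U `\` interior U.

Definition defining_function (U W : set M) f : Prop :=
  [/\ open W, Cfun None W f, (forall p, W p -> (U p <-> f p < 0)) &
      forall p, W p -> f p = 0 -> grad f p != 0].

Definition smooth_boundary (U : set M) : Prop :=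
  forall p, boundary U p -> exists W f, defining_function U W f /\ W p.

(* The normal space of the hypersurface {f = 0} is spanned by grad f, which
   points to {f > 0}, out of U. *)
Definition outward_normal_bundle (U : set M) : set (M * 'rV[R]_n) :=
  [set z | boundary U z.1 /\ exists W f (k : R),
     [/\ defining_function U W f, W z.1, 0 < k & z.2 = k *: grad f z.1]].

Definition radial_end (U : set M) : Prop :=
  [/\ compact (boundary U), connected (boundary U), smooth_boundary U &
      diffeo_on tangent_charts X (outward_normal_bundle U) (~` closure U) expm].

Definition outer_region (U : set M) (s : R) : set M :=
  [set p | ~ closure U p /\ s < dist_set U p].

Definition level_set (U : set M) (t : R) : set M :=
  [set p | ~ closure U p /\ dist_set U p = t].

End RiemannianManifold.

Arguments Cfun {R n M} X k W f.

(* Lebesgue integral over R^m of a nonnegative Borel function, as an iterated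
   integral. *)
Fixpoint integral_rV (R : realType) (m : nat) :
    ('rV[R]_m -> \bar R) -> \bar R :=
  match m with
  | 0 => fun f => f 0
  | k.+1 => fun f => (\int[lebesgue_measure]_(s in [set: R])
      integral_rV (fun v : 'rV[R]_k => f (row_mx (s%:M : 'rV[R]_1) v)))%E
  end.

Notation borel M := (g_sigma_algebraType (@open M)).

Section AreaMeasure.
Context {R : realType} {n : nat} {M : ptopologicalType}.
Context {X : manifold R n M} (g : metric X).

Definition pullback_metric (psi : 'rV[R]_n.-1 -> M) (y : 'rV[R]_n.-1) :
    'M[R]_n.-1 :=
  let i := chart_at X (psi y) in
  let J := 'J (crd i \o psi) y in
  J *m gmx g i (crd i (psi y)) *m J^T.

(* mu restricted to the hypersurface S is the Riemannian measure of the metric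
   induced on S: in a local parametrization psi of S it has density
   sqrt (det psi^*g) with respect to Lebesgue measure. *)
Definition area_measure (S : set M)
    (mu : {measure set (borel M) -> \bar R}) : Prop :=
  forall (V : set 'rV[R]_n.-1) (psi : 'rV[R]_n.-1 -> M),
    open V -> Cmap (id_chart 'rV[R]_n.-1) X None V psi ->
    set_inj V psi -> psi @` V `<=` S ->
    (forall y, V y -> 0 < \det (pullback_metric psi y)) ->
    forall A : set (borel M), measurable A -> A `<=` psi @` V ->
      mu A = integral_rV (fun y : 'rV[R]_n.-1 =>
        if `[< V y /\ A (psi y) >]
        then (Num.sqrt (\det (pullback_metric psi y)))%:E else 0%E).

End AreaMeasure.

(* Main.v *)
(* Write n = N + 1 and u_r = <grad r, grad u>.  Every weight phi with p = phi' gives a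
   field
     Y = A (2 u_r grad u - |grad u|^2 grad r) + B u grad u + C u^2 grad r,
     A = e^(2 phi) r^gamma, B = A (2p + c/r), C = A (lambda + 2p^2 + cp/r).
   With c = gamma + kappa, max(0, N b - 2 min(a, gamma)) < kappa < N a, the bounds on the Hessian
   of r make div Y nonnegative for suitable slowly varying p, so the flux F(t) of Y
   through S(t) is nondecreasing.  If phi is bounded then
   F(t) <= C' t^gamma int_{S(t)} (u_r^2 + u^2) dA, so a zero lower limit forces F <= 0.
   On the other hand p may be chosen larger than any constant on a given interval
   (r0, t0], and F(t0) / A(t0) >= p(t0)^2 int_{S(t0)} u^2 - const: hence u = 0.

   The geometry needed for this is the first variation of integrals over S(t).  In the
   polar coordinates given by the normal exponential map the metric is dr^2 + g_r (Gauss
   lemma), so r is the coordinate s and the divergence theorem reduces to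
   differentiation under an iterated integral, with a partition of unity on the
   compact boundary. *)
Require Import Defs.
From HB Require Import structures.
From mathcomp Require Import all_boot all_order all_algebra.
From mathcomp Require Import all_classical all_reals all_analysis.
From mathcomp Require Import measurable_realfun.
From mathcomp Require Import ring lra.

Set Implicit Arguments.
Unset Strict Implicit.
Unset Printing Implicit Defensive.

Import Order.TTheory GRing.Theory Num.Theory.
Import numFieldNormedType.Exports.

Local Open Scope classical_set_scope.
Local Open Scope ring_scope.

(** * Calculus on row vectors *)

(** Multiplied by r, div Y is a quadratic form in V = u_r + p u, in u and in the tangential part of
    grad u. The tangential coefficient is at least 2a + kappa - N b; up to small terms those of u^2
    and V^2 are at least (N a - kappa)(lambda + p^2) and 2 gamma + kappa - N b + 4 r p. So kappa
    exists because N b - 2a < N a, which is the pinching (n+1) a > (n-1) b, and N b - 2 gamma < N a,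
    which is the bound on gamma. The demands on the weight conflict: p is huge on (r0, t0], phi is
    bounded, and r p' >= -eta with eta small whatever the size of p. Hence p decays over a very long
    range of radii.

    Two obstacles are geometric. Derivatives of the partition of unity cancel only in the sum over
    patches, which use different coordinates; the area measure, blind to coordinates, allows the
    comparison. And the mixed components of the polar metric must vanish although the hypothesis
    controls the exponential map only on nonzero normal vectors: they are constant along rays and
    tend to 0 at the boundary, by Lipschitz dependence of geodesics on their initial data. *)

Section Calculus.
Context {R : realType}.

Lemma coord_le n (x : 'rV[R]_n) j : `|x 0 j| <= `|x|.
Proof.
rewrite [leRHS]/Num.Def.normr/= mx_normrE.
exact: (le_bigmax _ (fun ij : 'I_1 * 'I_n => `|x ij.1 ij.2|) (0, j)).
Qed.

Lemma norm_le_coord n (x : 'rV[R]_n) e :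
  0 <= e -> (forall j, `|x 0 j| <= e) -> `|x| <= e.
Proof.
move=> e0 H; rewrite [leLHS]/Num.Def.normr/= mx_normrE.
by apply: bigmax_le => // -[i j] _ /=; rewrite ord1.
Qed.

Lemma row_decomp n (x : 'rV[R]_n) : x = \sum_j x 0 j *: delta_mx 0 j.
Proof. exact: row_sum_delta. Qed.

Lemma line_derive (V : normedModType R) (f : V -> R) z v (t : R) :
  derivable f (t *: v + z) v ->
  is_derive t 1 (fun s : R => f (s *: v + z)) ('D_v f (t *: v + z)).
Proof.
move=> df.
have E : (fun h : R => h^-1 *: (((fun s : R => f (s *: v + z)) \o shift t) (h *: 1) - f (t *: v + z)))
   = (fun h : R => h^-1 *: ((f \o shift (t *: v + z)) (h *: v) - f (t *: v + z))).
  by apply/funext => h /=; rewrite /shift /= [h *: 1]mulr1 scalerDl addrA.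
by split; [rewrite /derivable E|rewrite /derive E].
Qed.

Lemma mvt_line (V : normedModType R) (f : V -> R) z v :
  (forall t : R, 0 <= t <= 1 -> derivable f (t *: v + z) v) ->
  exists2 c : R, 0 <= c <= 1 & f (v + z) - f z = 'D_v f (c *: v + z).
Proof.
move=> df.
have D (t : R) : 0 <= t <= 1 ->
    is_derive t 1 (fun s : R => f (s *: v + z)) ('D_v f (t *: v + z)).
  by move=> /df/line_derive.
have [|||c c01] := @MVT_segment R (fun s => f (s *: v + z))
    (fun t => 'D_v f (t *: v + z)) 0 1.
- exact: ler01.
- by move=> x; rewrite in_itv/= => /andP[x0 x1]; apply: D; rewrite !ltW.
- apply: derivable_within_continuous => x; rewrite in_itv/= => x01.
  by have [] := D _ x01.
- rewrite scale1r scale0r add0r subr0 mulr1 => ->.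
  by exists c => //; move: c01; rewrite in_itv.
Qed.

Lemma derivableZv (V W : normedModType R) (f : V -> W) x v (k : R) :
  derivable f x v -> derivable f x (k *: v).
Proof.
have [->|k0] := eqVneq k 0; first by rewrite scale0r => _; exact: derivable0.
move=> df; apply/derivable1P.
have /derivable1P := df => df1.
have -> : (fun h : R => f (h *: (k *: v) + x)) = (fun h : R => f (h *: v + x)) \o ( *:%R k : R -> R).
  by apply/funext => h /=; rewrite scalerA [_ *: h]mulrC.
apply: diff_derivable; apply: differentiable_comp.
  exact: ex_diff.
by rewrite scaler0; apply/derivable1_diffP.
Qed.

Lemma deriveZv (V W : normedModType R) (f : V -> W) x v (k : R) :
  derivable f x v -> 'D_(k *: v) f x = k *: 'D_v f x.
Proof.
have [->|k0] := eqVneq k 0; first by rewrite !scale0r derive0.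
move=> df; rewrite /derive; apply/cvg_lim => //.
have -> : (fun h : R => h^-1 *: ((f \o shift x) (h *: (k *: v)) - f x)) =
   (fun h : R => k *: ((fun h => h^-1 *: ((f \o shift x) (h *: v) - f x)) (h * k))).
  apply/funext => h /=; rewrite !scalerA; congr (_ *: _).
  have [->|h0] := eqVneq h 0; first by rewrite mul0r !invr0 mulr0.
  by rewrite invfM mulrCA divff// mulr1.
have L : (fun h : R => h * k) @ 0^' --> 0^'.
  move=> A [e /= e0 eA]; exists (e / `|k|) => /=; first by rewrite divr_gt0// normr_gt0.
  move=> h /=; rewrite !sub0r !normrN => hk h0; apply: eA => /=.
    by rewrite sub0r normrN normrM -ltr_pdivlMr ?normr_gt0.
  by rewrite mulf_neq0.
apply: cvgZl_tmp.
exact: (@cvg_comp _ _ _ (fun h : R => h * k)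
  (fun h => h^-1 *: ((f \o shift x) (h *: v) - f x)) _ _ _ L df).
Qed.

End Calculus.

(** * Differentiability from continuous partial derivatives *)

Section SmoothFunctions.
Context {R : realType}.

Lemma differentiable_row (V : normedModType R) n (F : V -> 'rV[R]_n) x :
  (forall j, differentiable (fun y => F y 0 j) x) -> differentiable F x.
Proof.
move=> H.
have -> : F = \sum_(j < n) (fun y => F y 0 j *: (delta_mx 0 j : 'rV[R]_n)).
  by apply/funext => y; rewrite fct_sumE; exact: row_decomp.
by apply: differentiable_sum => j; apply: differentiableZl.
Qed.

Lemma continuous_row (T : topologicalType) n (F : T -> 'rV[R]_n) x :
  (forall j, {for x, continuous (fun y => F y 0 j)}) -> {for x, continuous F}.
Proof.
move=> H; apply/cvgrPdist_le => /= e e0.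
have : \forall y \near x, forall j, `|F x 0 j - F y 0 j| <= e.
  apply: filter_forall => j.
  by have /cvgrPdist_le := H j; apply.
apply: filterS => y yj; apply: norm_le_coord; first exact: ltW.
by move=> j; rewrite !mxE.
Qed.

Lemma continuous_coord n j (x : 'rV[R]_n) :
  {for x, continuous (fun y : 'rV[R]_n => y 0 j)}.
Proof. exact/differentiable_continuous/differentiable_coord. Qed.

Lemma derive_partial n (f : 'rV[R]_n -> R) x v : differentiable f x ->
  'D_v f x = \sum_j v 0 j * partial j f x.
Proof.
move=> df; rewrite deriveE// [in LHS](row_decomp v) linear_sum.
by apply: eq_bigr => j _; rewrite linearZ /partial deriveE.
Qed.

Let cut n (h : 'rV[R]_n) (k : nat) : 'rV[R]_n :=
  \row_j (if (j < k)%N then h 0 j else 0).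

(** The increment f(h + x) - f(x) is telescoped over the vectors [cut h k], which keep only the
    first k coordinates of h. Each step moves along one axis, where the mean value theorem yields a
    value of [partial a f] at a point still within |h| of x. *)
Lemma differentiable_partial n (f : 'rV[R]_n -> R) x :
  (\forall y \near x, forall a, derivable f y (delta_mx 0 a)) ->
  (forall a, {for x, continuous (partial a f)}) ->
  differentiable f x.
Proof.
move=> df cf.
pose L : 'rV[R]_n -> R := fun h => \sum_j h 0 j * partial j f x.
have Lc : linear L.
  move=> k u v; rewrite /L scaler_sumr -big_split /=; apply: eq_bigr => j _.
  by rewrite !mxE mulrDl -mulrA.
pose L' : {linear 'rV[R]_n -> R} := HB.pack L (GRing.isLinear.Build _ _ _ _ _ Lc).
have cL : continuous L'.
  move=> z; apply: differentiable_continuous.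
  rewrite (_ : (L' : _ -> _) = \sum_(j < n) (fun h : 'rV[R]_n => partial j f x *: (h 0 j))); last first.
    by apply/funext => h; rewrite fct_sumE; apply: eq_bigr => j _; rewrite mulrC.
  by apply: differentiable_sum => j; apply: differentiableZ; exact: differentiable_coord.
have E : f \o shift x = cst (f x) + L' +o_ 0 id.
  apply/eqaddoP => _/posnumP[e].
  (* Each of the n steps costs at most |h| e1, in total at most e |h|; the extra 1 covers n = 0. *)
  pose e1 := e%:num / (n%:R + 1).
  have n1 : 0 < n%:R + 1 :> R by rewrite ltr_wpDl.
  have e10 : 0 < e1 by rewrite divr_gt0.
  have : \forall y \near x, forall a, derivable f y (delta_mx 0 a) /\
      `|partial a f x - partial a f y| <= e1.
    have cf' : \forall y \near x, forall a, `|partial a f x - partial a f y| <= e1.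
      have H (a : 'I_n) : \forall y \near nbhs x, `|partial a f x - partial a f y| <= e1.
        by have /cvgrPdist_le := cf a; apply.
      exact: (@filter_forall _ _ _ _ _ H).
    by near=> y => a; split; [move: a; near: y; exact: df|move: a; near: y; exact: cf'].
  move=> /nbhs_ballP[d /= d0 dP].
  apply/nbhs_ballP; exists d => //= h; rewrite -ball_normE /ball_ /= sub0r normrN => hd.
  have cutb k (t : R) (a : 'I_n) : k = a :> nat -> 0 <= t <= 1 ->
      `|t *: (h 0 a *: delta_mx 0 a) + cut h k| <= `|h|.
    move=> ka /andP[t0 t1]; apply: norm_le_coord => // j; rewrite !mxE eqxx /= ka.
    have [->|ja] := eqVneq j a.
      rewrite ltnn addr0 mulr1 normrM ger0_norm//.
      by rewrite (le_trans _ (coord_le h a))// ler_piMl.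
    rewrite !mulr0 add0r; case: ifP => _; last by rewrite normr0.
    exact: coord_le.
  have step (a : 'I_n) : `|f (cut h a.+1 + x) - f (cut h a + x) - h 0 a * partial a f x| <= `|h| * e1.
    have cutS : cut h a.+1 = h 0 a *: delta_mx 0 a + cut h a.
      apply/rowP => j; rewrite !mxE eqxx /= ltnS leq_eqVlt.
      have [<-|ja] := eqVneq j a; first by rewrite ltnn eqxx /= mulr1 addr0.
      by rewrite (negbTE (_ : (j : nat) != a))//= mulr0 add0r.
    have db (t : R) : 0 <= t <= 1 ->
        ball x d (t *: (h 0 a *: delta_mx 0 a) + (cut h a + x)).
      move=> t01; rewrite -ball_normE /ball_ /= addrA opprD addrCA subrr addr0 normrN.
      exact: le_lt_trans (cutb _ t a erefl t01) hd.
    rewrite cutS -[_ *: _ + _ + x]addrA.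
    have [|c c01 ->] := @mvt_line _ _ f (cut h a + x) (h 0 a *: delta_mx 0 a).
      by move=> t t01; apply: derivableZv; case: (dP _ (db _ t01) a).
    have [D1 D2] := dP _ (db _ c01) a.
    rewrite deriveZv// -[_ *: _]/(_ * _) -mulrBr normrM ler_pM//; first exact: coord_le.
    by rewrite distrC.
  rewrite /= -![(_ + _ : _ -> _) _]/(_ + _) -![(- _ : _ -> _) _]/(- _) /=.
  have tele : f (h + x) - f x = \sum_(a < n) (f (cut h a.+1 + x) - f (cut h a + x)).
    rewrite -(big_mkord xpredT (fun a => f (cut h a.+1 + x) - f (cut h a + x))).
    rewrite (telescope_sumr (fun a => f (cut h a + x)))//; congr (f (_ + _) - f _).
      by apply/rowP => j; rewrite mxE ltn_ord.
    by rewrite (_ : cut h 0 = 0) ?add0r//; apply/rowP => j; rewrite !mxE.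
  rewrite /cst /shift /= opprD addrA tele -sumrB.
  apply: (le_trans (ler_norm_sum _ _ _)).
  apply: (@le_trans _ _ (\sum_(a < n) `|h| * e1)).
    by apply: ler_sum => a _; exact: step.
  rewrite sumr_const card_ord -mulr_natr -mulrA mulrC; apply: ler_wpM2r => //.
  by rewrite /e1 mulrAC ler_pdivrMr// ler_wpM2l// lerDl.
apply/diff_locallyP.
by have -> := @diff_unique _ _ _ f L' x cL E.
Unshelve. all: by end_near. Qed.

End SmoothFunctions.

(** * Calculus of functions of class C^k near a point *)

Section SmoothAt.
Context {R : realType}.

(* [Cat k f x] : f is of class C^k in a neighbourhood of x. *)
Fixpoint Cat n (k : nat) (f : 'rV[R]_n -> R) (x : 'rV[R]_n) : Prop :=
  if k is k'.+1 then
    (\forall y \near x, differentiable f y) /\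
    forall a, Cat k' (partial a f) x
  else \forall y \near x, {for y, continuous f}.

Lemma near_forall (T : topologicalType) (x : T) (I : finType) (P : I -> T -> Prop) :
  (forall i, \forall y \near x, P i y) -> \forall y \near x, forall i, P i y.
Proof. by move=> H; apply: (@filter_forall _ _ _ _ _ H). Qed.

Lemma near_all (T : topologicalType) (x : T) (P : T -> Prop) :
  (forall y, P y) -> \forall y \near x, P y.
Proof. by move=> H; apply: (@filterS _ _ _ setT) => //; exact: filterT. Qed.

Lemma near_eq_continuous (T U : topologicalType) (f g : T -> U) x :
  (\forall y \near x, f y = g y) -> {for x, continuous f} -> {for x, continuous g}.
Proof.
move=> fg cf; rewrite /prop_for /continuous_at -(nbhs_singleton fg).
by apply: cvg_trans cf; apply: near_eq_cvg.
Qed.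

Lemma near_eq_differentiable (V W : normedModType R) (f g : V -> W) x :
  (\forall y \near x, f y = g y) -> differentiable f x -> differentiable g x.
Proof.
move=> fg df; have /diff_locallyP [cL E] := df.
have E' : g \o shift x = cst (g x) + 'd f x +o_ 0 id.
  apply/eqaddoP => e e0.
  have /eqaddoP /(_ e e0) := E.
  have /nbhs_ballP[d /= d0 dP] := fg.
  have : \forall h \near (0 : V), f (h + x) = g (h + x).
    apply/nbhs_ballP; exists d => //= h.
    rewrite -ball_normE /ball_ /= sub0r normrN => hd; apply: dP.
    by rewrite -ball_normE /ball_ /= opprD addrCA subrr addr0 normrN.
  apply: filterS2 => h eh.
  rewrite /= -![(_ + _ : _ -> _) _]/(_ + _) -![(- _ : _ -> _) _]/(- _) /= /cst.
  by rewrite !eh (nbhs_singleton fg).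
by apply/diff_locallyP; have -> := @diff_unique _ _ _ g ('d f x) x cL E'.
Qed.

Lemma near_eq_partial n (f g : 'rV[R]_n -> R) (x : 'rV[R]_n) a :
  (\forall y \near x, f y = g y) ->
  \forall y \near x, partial a f y = partial a g y.
Proof.
by move=> /near_join; apply: filterS => y fg; apply: near_eq_derive.
Qed.

Lemma Cat_ext n k (f g : 'rV[R]_n -> R) (x : 'rV[R]_n) :
  (\forall y \near x, f y = g y) -> Cat k f x -> Cat k g x.
Proof.
elim: k f g => [|k IH] f g fg /=.
  move/near_join: fg; apply: filterS2 => y; exact: near_eq_continuous.
move=> [df pf]; split.
  by move/near_join: (fg); apply: filterS2 df => y dfy fgy; exact: near_eq_differentiable fgy dfy.
by move=> a; apply: IH (pf a); exact: near_eq_partial.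
Qed.

Lemma eq_Cat n k (f g : 'rV[R]_n -> R) (x : 'rV[R]_n) : f =1 g -> Cat k f x -> Cat k g x.
Proof. by move=> /funext ->. Qed.

Lemma Cat_near n k (f : 'rV[R]_n -> R) (x : 'rV[R]_n) :
  Cat k f x -> \forall y \near x, Cat k f y.
Proof.
elim: k f => [|k IH] f /=; first exact: near_join.
move=> [/near_join df pf].
have H : \forall y \near x, forall a : 'I_n, Cat k (partial a f) y.
  by apply: near_forall => a; exact: IH.
by apply: filterS2 df H.
Qed.

Lemma Cat_differentiable n k (f : 'rV[R]_n -> R) (x : 'rV[R]_n) : Cat k.+1 f x -> differentiable f x.
Proof. by move=> [/nbhs_singleton]. Qed.

Lemma CatW n k (f : 'rV[R]_n -> R) (x : 'rV[R]_n) : Cat k.+1 f x -> Cat k f x.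
Proof.
elim: k f => [|k IH] f /= [df pf].
  by apply: filterS df => y; exact: differentiable_continuous.
by split => // a; apply: IH.
Qed.

Lemma Cat_le n j k (f : 'rV[R]_n -> R) (x : 'rV[R]_n) : (j <= k)%N -> Cat k f x -> Cat j f x.
Proof. by move=> /subnK <-; elim: (k - j)%N => //= m IH /CatW. Qed.

Lemma Cat_continuous n k (f : 'rV[R]_n -> R) (x : 'rV[R]_n) : Cat k f x -> {for x, continuous f}.
Proof. by move=> /(Cat_le (leq0n k)) /nbhs_singleton. Qed.

Lemma Cat_partial n k (f : 'rV[R]_n -> R) (x : 'rV[R]_n) a : Cat k.+1 f x -> Cat k (partial a f) x.
Proof. by move=> [_ pf]; exact: pf. Qed.

Lemma partial_cst n (c : R) a (x : 'rV[R]_n) : partial a (fun=> c) x = 0.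
Proof. exact: derive_cst. Qed.

Lemma Cat_cst n k (c : R) (x : 'rV[R]_n) : Cat k (fun=> c) x.
Proof.
elim: k c => [|k IH] c /=; first by apply: near_all => y; exact: cst_continuous.
split; first by apply: near_all => y; exact: differentiable_cst.
by move=> a; apply: eq_Cat (IH 0) => y; rewrite partial_cst.
Qed.

Lemma partial_coord n a j (x : 'rV[R]_n) :
  partial a (fun y : 'rV[R]_n => y 0 j) x = (j == a)%:R.
Proof.
rewrite /partial; have : derivable (@id 'rV[R]_n) x (delta_mx 0 a) by exact: derivable_id.
move/derive_mx; rewrite derive_id => /(congr1 (fun M : 'rV[R]_n => M 0 j)).
by rewrite !mxE eqxx /= => <-.
Qed.

Lemma Cat_coord n k j (x : 'rV[R]_n) : Cat k (fun y : 'rV[R]_n => y 0 j) x.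
Proof.
case: k => [|k] /=; first by apply: near_all => y; exact: continuous_coord.
split; first by apply: near_all => y; exact: differentiable_coord.
by move=> a; apply: eq_Cat (Cat_cst k (j == a)%:R x) => y; rewrite partial_coord.
Qed.

Lemma partialD n (f g : 'rV[R]_n -> R) (x : 'rV[R]_n) a : differentiable f x -> differentiable g x ->
  partial a (fun y => f y + g y) x = partial a f x + partial a g x.
Proof. by move=> df dg; apply: deriveD; exact: diff_derivable. Qed.

Lemma partialM n (f g : 'rV[R]_n -> R) (x : 'rV[R]_n) a : differentiable f x -> differentiable g x ->
  partial a (fun y => f y * g y) x = partial a f x * g x + f x * partial a g x.
Proof.
move=> df dg.
have E := deriveM (@diff_derivable _ _ _ f x (delta_mx 0 a) df)
  (@diff_derivable _ _ _ g x (delta_mx 0 a) dg).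
by apply: etrans E _; rewrite addrC; congr (_ + _); exact: mulrC.
Qed.

Lemma CatD n k (f g : 'rV[R]_n -> R) (x : 'rV[R]_n) :
  Cat k f x -> Cat k g x -> Cat k (fun y => f y + g y) x.
Proof.
elim: k f g => [|k IH] f g /=; first by apply: filterS2 => y; exact: continuousD.
move=> [df pf] [dg pg]; split.
  by apply: filterS2 df dg => y; exact: differentiableD.
move=> a; apply: Cat_ext (IH _ _ (pf a) (pg a)).
by apply: filterS2 df dg => y dfy dgy; rewrite partialD.
Qed.

Lemma CatM n k (f g : 'rV[R]_n -> R) (x : 'rV[R]_n) :
  Cat k f x -> Cat k g x -> Cat k (fun y => f y * g y) x.
Proof.
elim: k f g => [|k IH] f g; first by apply: filterS2 => y; exact: continuousM.
move=> Cf Cg; have [df pf] := Cf; have [dg pg] := Cg; split.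
  by apply: filterS2 df dg => y; exact: differentiableM.
move=> a; apply: Cat_ext (CatD (IH _ _ (pf a) (CatW Cg)) (IH _ _ (CatW Cf) (pg a))).
by apply: filterS2 df dg => y dfy dgy; rewrite partialM.
Qed.

Lemma CatZ n k c (f : 'rV[R]_n -> R) (x : 'rV[R]_n) : Cat k f x -> Cat k (fun y => c * f y) x.
Proof. by apply: CatM; exact: Cat_cst. Qed.

Lemma CatN n k (f : 'rV[R]_n -> R) (x : 'rV[R]_n) : Cat k f x -> Cat k (fun y => - f y) x.
Proof. by move=> /(CatZ (- 1)); apply: eq_Cat => y; rewrite mulN1r. Qed.

Lemma CatB n k (f g : 'rV[R]_n -> R) (x : 'rV[R]_n) :
  Cat k f x -> Cat k g x -> Cat k (fun y => f y - g y) x.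
Proof. by move=> cf /CatN; exact: CatD. Qed.

Lemma Cat_sum n k I (r : seq I) (P : pred I) (F : I -> 'rV[R]_n -> R) (x : 'rV[R]_n) :
  (forall i, Cat k (F i) x) -> Cat k (fun y => \sum_(i <- r | P i) F i y) x.
Proof.
move=> H; elim: r => [|i r IH].
  by apply: eq_Cat (Cat_cst k 0 x) => y; rewrite big_nil.
case Pi : (P i).
  by apply: eq_Cat (CatD (H i) IH) => y; rewrite big_cons Pi.
by apply: eq_Cat IH => y; rewrite big_cons Pi.
Qed.

Lemma Cat_prod n k I (r : seq I) (P : pred I) (F : I -> 'rV[R]_n -> R) (x : 'rV[R]_n) :
  (forall i, Cat k (F i) x) -> Cat k (fun y => \prod_(i <- r | P i) F i y) x.
Proof.
move=> H; elim: r => [|i r IH].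
  by apply: eq_Cat (Cat_cst k 1 x) => y; rewrite big_nil.
case Pi : (P i).
  by apply: eq_Cat (CatM (H i) IH) => y; rewrite big_cons Pi.
by apply: eq_Cat IH => y; rewrite big_cons Pi.
Qed.

Lemma near_comp_cont (T U : topologicalType) (f : T -> U) x (P : set U) :
  {for x, continuous f} -> (\forall t \near f x, P t) -> \forall y \near x, P (f y).
Proof. by move=> cf; exact: cf. Qed.

Lemma near_gt (t c : R) : c < t -> \forall s \near t, c < s.
Proof. exact: lt_nbhsr. Qed.

Lemma near_neq0 (t : R) : t != 0 -> \forall s \near t, s != 0.
Proof. by move=> t0; apply: (@open_nbhs_nbhs _ t [set s | s != 0]); split; [exact: open_neq|]. Qed.

Lemma differentiable_comp1 n (g : R -> R) (f : 'rV[R]_n -> R) (x : 'rV[R]_n) :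
  differentiable f x -> derivable g (f x) 1 -> differentiable (fun y => g (f y)) x.
Proof. by move=> df /derivable1_diffP; exact: differentiable_comp. Qed.

Lemma partial_comp1 n (g : R -> R) (f : 'rV[R]_n -> R) (x : 'rV[R]_n) a :
  differentiable f x -> derivable g (f x) 1 ->
  partial a (fun y => g (f y)) x = 'D_1 g (f x) * partial a f x.
Proof.
move=> df dg; have dg' : differentiable g (f x) by exact/derivable1_diffP.
have dgf : differentiable (g \o f) x by exact: differentiable_comp.
rewrite /partial -[LHS]/('D__ (g \o f) x) deriveE// diff_comp//=.
by rewrite deriv1E// derive1E mulrC [in RHS]deriveE.
Qed.

Lemma Cat_comp1 n k (g : R -> R) (f : 'rV[R]_n -> R) (x : 'rV[R]_n) :
  Cat k.+1 f x -> (\forall t \near f x, derivable g t 1) ->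
  Cat k (fun y => 'D_1 g (f y)) x -> Cat k.+1 (fun y => g (f y)) x.
Proof.
move=> Cf dg C'; have [df pf] := Cf.
have dg' : \forall y \near x, derivable g (f y) 1 by exact: near_comp_cont (Cat_continuous Cf) dg.
split; first by apply: filterS2 df dg' => y; exact: differentiable_comp1.
move=> a; apply: Cat_ext (CatM C' (pf a)).
by apply: filterS2 df dg' => y *; rewrite partial_comp1.
Qed.

(** The derivative of 1/f is -(1/f)^2 f', so the induction hypothesis for 1/f itself, one order
    lower, controls it. *)
Lemma CatV n k (f : 'rV[R]_n -> R) (x : 'rV[R]_n) :
  f x != 0 -> Cat k f x -> Cat k (fun y => (f y)^-1) x.
Proof.
move=> f0; elim: k => [|k IH] Cf.
  have := near_comp_cont (Cat_continuous Cf) (near_neq0 f0).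
  by apply: filterS2 Cf => y cf ?; exact: continuousV.
have f0' := near_comp_cont (Cat_continuous Cf) (near_neq0 f0).
have [df pf] := Cf.
have C1 := IH (CatW Cf).
split; first by apply: filterS2 df f0' => y dfy ?; exact: differentiableV.
move=> a; apply: Cat_ext (CatN (CatM (CatM C1 C1) (pf a))).
apply: filterS2 df f0' => y dfy fy0; rewrite /partial deriveV//; last exact: diff_derivable.
by rewrite -[_ *: _]/(_ * _) mulNr expr2 invfM.
Qed.

Lemma Cat_sqrt n k (f : 'rV[R]_n -> R) (x : 'rV[R]_n) :
  0 < f x -> Cat k f x -> Cat k (fun y => Num.sqrt (f y)) x.
Proof.
move=> f0; elim: k => [|k IH] Cf.
  apply: filterS Cf => y cf.
  exact: (@continuous_comp _ _ _ f Num.sqrt _ cf (@sqrt_continuous _ _)).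
have f0' := near_comp_cont (Cat_continuous Cf) (near_gt f0).
apply: Cat_comp1 => //.
  by apply: filterS (near_gt f0) => t t0; have [] := is_derive1_sqrt t0.
apply: Cat_ext (CatV _ (CatZ 2 (IH (CatW Cf)))).
  by apply: filterS f0' => y fy0; rewrite derive_sqrt.
by rewrite mulf_neq0 ?sqrtr_eq0 -?ltNge// gt_eqF.
Qed.

Lemma partial_comp m n (f : 'rV[R]_n -> R) (F : 'rV[R]_m -> 'rV[R]_n) (x : 'rV[R]_m) a :
  differentiable f (F x) -> (forall j, differentiable (fun y => F y 0 j) x) ->
  partial a (fun y => f (F y)) x =
  \sum_j partial j f (F x) * partial a (fun y => F y 0 j) x.
Proof.
move=> df dF; have dF' := differentiable_row dF.
have dfF : differentiable (f \o F) x by exact: differentiable_comp.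
rewrite /partial -[LHS]/('D__ (f \o F) x) deriveE// diff_comp//= -deriveE// derive_partial//.
apply: eq_bigr => j _; rewrite mulrC -deriveE// derive_mx; last exact: diff_derivable.
by rewrite mxE.
Qed.

(** By the chain rule a partial derivative of the composite is a sum of products of some
    [partial j f] after F with a derivative of F, so the order drops by one in both factors at
    once. *)
Lemma Cat_comp m n k (f : 'rV[R]_n -> R) (F : 'rV[R]_m -> 'rV[R]_n) (x : 'rV[R]_m) :
  Cat k f (F x) -> (forall j, Cat k (fun y => F y 0 j) x) ->
  Cat k (fun y => f (F y)) x.
Proof.
elim: k f => [|k IH] f Cf CF.
  have H : \forall y \near x, forall j : 'I_n, {for y, continuous (fun y => F y 0 j)}.
    by apply: near_forall => j; exact: CF.
  have cF : {for x, continuous F} by apply: continuous_row; exact: (nbhs_singleton H).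
  apply: filterS2 (near_comp_cont cF Cf) H => y cf cFy.
  exact: continuous_comp (continuous_row cFy) cf.
have [df pf] := Cf.
have H : \forall y \near x, forall j : 'I_n, differentiable (fun y => F y 0 j) y.
  by apply: near_forall => j; have [] := CF j.
have cF : {for x, continuous F}.
  by apply: continuous_row => j; exact: Cat_continuous (CF j).
have H2 := near_comp_cont cF df.
split.
  apply: filterS2 H2 H => y dfy dFy.
  exact: differentiable_comp (differentiable_row dFy) dfy.
move=> a; apply: Cat_ext (@Cat_sum _ _ _ (index_enum _) xpredT
  (fun j y => partial j f (F y) * partial a (fun y => F y 0 j) y) x _).
  by apply: filterS2 H2 H => y dfy dFy; rewrite partial_comp.
move=> j; apply: CatM; last exact: Cat_partial (CF j).
by apply: IH => [|i]; [exact: Cat_partial Cf|exact: CatW].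
Qed.

End SmoothAt.
Arguments Cat : simpl never.

(** * Symmetry of second derivatives, and the passage between [Ck] and [Cat] *)

Section Bridge.
Context {R : realType}.

Lemma dist_le_half (u v w e : R) : `|u - w| <= e / 2 -> `|v - w| <= e / 2 -> `|u - v| <= e.
Proof. by move=> Y Z; rewrite (splitr e) (le_trans (ler_distD w _ _))// lerD// distrC. Qed.

(** Two applications of the mean value theorem: to [phi], the difference of f in direction b, along
    direction a, and then to [partial a f] along direction b. *)
Lemma mixed_difference n (f : 'rV[R]_n -> R) (x : 'rV[R]_n) a b e : 0 < e ->
  Cat 2 f x ->
  \forall h \near 0^'+, exists2 y, `|y - x| < e &
    f (h *: delta_mx 0 b + (h *: delta_mx 0 a + x)) - f (h *: delta_mx 0 a + x)
    - (f (h *: delta_mx 0 b + x) - f x) = h ^+ 2 * partial b (partial a f) y.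
Proof.
move=> e0 Cf; pose ea : 'rV[R]_n := delta_mx 0 a; pose eb : 'rV[R]_n := delta_mx 0 b.
have /nbhs_ballP[d /= d0 dP] := Cat_near Cf.
pose m := Num.min e d.
have m0 : 0 < m by rewrite lt_min e0.
have ne (j : 'I_n) : `|delta_mx 0 j : 'rV[R]_n| <= 1.
  by apply: norm_le_coord => // i; rewrite !mxE; case: (_ && _); rewrite ?normr1 ?normr0.
near=> h.
have h0 : 0 < h by near: h; exact: nbhs_right_gt.
have hm : h + h < m.
  rewrite -mulr2n -mulr_natr -ltr_pdivlMr//; near: h; apply: nbhs_right_lt; exact: divr_gt0.
have bd (s t : R) : `|s| <= h -> `|t| <= h -> `|(s *: eb + (t *: ea + x)) - x| < m.
  move=> sh th; rewrite addrA addrK (le_lt_trans (ler_normD _ _))// !normrZ.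
  apply: le_lt_trans hm; rewrite lerD//.
    by rewrite (le_trans _ sh)// ler_piMr//; exact: ne.
  by rewrite (le_trans _ th)// ler_piMr//; exact: ne.
have D (s t : R) : `|s| <= h -> `|t| <= h -> Cat 2 f (s *: eb + (t *: ea + x)).
  move=> sh th; apply: dP; rewrite -ball_normE /ball_ /= distrC.
  by apply: lt_le_trans (bd _ _ sh th) _; rewrite ge_min lexx orbT.
have hh (c : R) : 0 <= c <= 1 -> `|c * h| <= h.
  by move=> /andP[c0 c1]; rewrite ger0_norm ?mulr_ge0 ?(ltW h0)// ler_piMl// ltW.
have h00 : `|0 : R| <= h by rewrite normr0 ltW.
have h1 : `|h| <= h by rewrite ger0_norm// ltW.
pose phi := fun y => f (h *: eb + y) - f y.
have dsh y : differentiable f (h *: eb + y) ->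
    is_derive y ea (fun z => f (h *: eb + z)) ('D_ea f (h *: eb + y)).
  move=> df.
  have E : (fun t : R => t^-1 *: (((fun z => f (h *: eb + z)) \o shift y) (t *: ea) - f (h *: eb + y)))
    = (fun t : R => t^-1 *: ((f \o shift (h *: eb + y)) (t *: ea) - f (h *: eb + y))).
    by apply/funext => t /=; rewrite addrCA.
  by split; [rewrite /derivable E; exact: diff_derivable|rewrite /derive E].
have dphi (t : R) : `|t| <= h -> is_derive (t *: ea + x) ea phi
    ('D_ea f (h *: eb + (t *: ea + x)) - 'D_ea f (t *: ea + x)).
  move=> th; have D1 := Cat_differentiable (D _ _ h1 th).
  have D2 := Cat_differentiable (D _ _ h00 th); rewrite scale0r add0r in D2.
  have H2 : is_derive (t *: ea + x) ea f ('D_ea f (t *: ea + x)).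
    exact/derivableP/diff_derivable.
  exact: (@is_deriveB _ _ _ (fun z => f (h *: eb + z)) f _ _ _ _ (dsh _ D1) H2).
have [|c c01] := @mvt_line _ _ phi x (h *: ea).
  move=> t t01; rewrite scalerA; apply: derivableZv.
  by have [] := dphi _ (hh _ t01).
rewrite /phi scalerA => ->; have [P1 P2] := dphi _ (hh _ c01).
rewrite deriveZv// P2.
have [|c' c01'] := @mvt_line _ _ (partial a f) (c * h *: ea + x) (h *: eb).
  move=> t t01; rewrite scalerA; apply: derivableZv; apply: diff_derivable.
  exact: Cat_differentiable (Cat_partial a (D _ _ (hh _ t01) (hh _ c01))).
rewrite /partial => ->; rewrite scalerA.
exists (c' * h *: eb + (c * h *: ea + x)).
  by apply: lt_le_trans (bd _ _ (hh _ c01') (hh _ c01)) _; rewrite ge_min lexx.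
rewrite deriveZv; first by rewrite -[_ *: _]/(_ * _) -[_ *: _]/(_ * _) mulrA expr2.
apply: diff_derivable.
exact: Cat_differentiable (Cat_partial a (D _ _ (hh _ c01') (hh _ c01))).
Unshelve. all: by end_near. Qed.

(** The second difference is symmetric in a and b, so the two mixed derivatives agree at points y
    and z arbitrarily close to x, and by continuity at x. *)
Lemma partial_sym n (f : 'rV[R]_n -> R) (x : 'rV[R]_n) a b :
  Cat 2 f x -> partial a (partial b f) x = partial b (partial a f) x.
Proof.
move=> Cf; apply/eqP; rewrite -subr_eq0 -normr_le0; apply/ler_addgt0Pl => e e0; rewrite addr0.
have near_x (i j : 'I_n) : exists2 d : R, 0 < d & forall y, `|y - x| < d ->
    `|partial i (partial j f) x - partial i (partial j f) y| <= e / 2.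
  have /cvgrPdist_le/(_ (e / 2)) := Cat_continuous (Cat_partial i (Cat_partial j Cf)).
  rewrite divr_gt0// => /(_ isT) /nbhs_ballP[d /= d0 dP]; exists d => // y yx.
  by apply: dP; rewrite -ball_normE /ball_ /= distrC.
have [d1 d10 D1] := near_x a b; have [d2 d20 D2] := near_x b a.
have [h [[h0 [y /D1 Y yE]] [z /D2 Z zE]]] := filter_ex (filterI (filterI
  (nbhs_right_gt (0 : R)) (mixed_difference b a d10 Cf)) (mixed_difference a b d20 Cf)).
have E : partial a (partial b f) y = partial b (partial a f) z.
  have h20 : h ^+ 2 != 0 by rewrite expf_neq0// gt_eqF.
  have C : h *: delta_mx 0 b + (h *: delta_mx 0 a + x) =
    h *: delta_mx 0 a + (h *: delta_mx 0 b + x) :> 'rV[R]_n by exact: addrCA.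
  move: yE zE; rewrite C; move: (partial a _ y) (partial b _ z) => u w.
  move: (f _) (f _) (f _) (f _) => p q r t yE zE.
  by apply: (@mulfI R _ h20); rewrite -yE -zE; ring.
move: Y Z; rewrite E; move: (partial a _ x) (partial b _ x) (partial b _ z) => u v w Y Z.
exact: dist_le_half Y Z.
Qed.

Lemma iterD_rcons (V W : normedModType R) s v (f : V -> W) :
  Defs.iterD (rcons s v) f = Defs.iterD s ('D_v f).
Proof. by elim: s => //= w s ->. Qed.

Lemma Ck_Some (V W : normedModType R) o k (O : set V) (f : V -> W) :
  order_le o k -> Ck o O f -> Ck (Some k) O f.
Proof.
have tr j : order_le o k -> (j <= k)%N -> order_le o j.
  by case: o => //= k' kk' jk; exact: leq_trans kk'.
move=> ok Cf s x Ox; have [H1 H2] := Cf s x Ox.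
by split => [sk|sk v]; [apply: H1|apply: H2]; exact: tr.
Qed.

Lemma Ck_derive (V W : normedModType R) k (O : set V) (f : V -> W) v :
  Ck (Some k.+1) O f -> Ck (Some k) O ('D_v f).
Proof.
move=> Cf s x Ox; have := Cf (rcons s v) x Ox.
by rewrite size_rcons iterD_rcons.
Qed.

(** [Ck] speaks of iterated directional derivatives and [Cat] of differentiability;
    [differentiable_partial] closes the gap at each order. *)
Lemma Ck_Cat n k (O : set 'rV[R]_n) (f : 'rV[R]_n -> R) x :
  open O -> O x -> @Ck R 'rV[R]_n R^o (Some k) O f -> Cat k f x.
Proof.
move=> oO; have nO y : O y -> \forall z \near y, O z.
  by move=> Oy; exact: open_nbhs_nbhs.
elim: k f x => [|k IH] f x Ox Cf /=.
  by apply: filterS (nO _ Ox) => y Oy; have [+ _] := Cf [::] y Oy; apply.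
split; last by move=> a; apply: IH => //; exact: Ck_derive.
apply: filterS (nO _ Ox) => y Oy; apply: differentiable_partial.
  by apply: filterS (nO _ Oy) => z Oz a; have [_] := Cf [::] z Oz; apply.
by move=> a; have [+ _] := Cf [:: delta_mx 0 a] y Oy; apply.
Qed.

Lemma Cat_Dv n k (f : 'rV[R]_n -> R) (x v : 'rV[R]_n) :
  Cat k.+1 f x -> Cat k ('D_v f) x.
Proof.
move=> [df pf]; apply: Cat_ext (@Cat_sum _ _ _ _ (index_enum _) xpredT
  (fun j y => v 0 j * partial j f y) x _).
  by apply: filterS df => y dfy; rewrite derive_partial.
by move=> j; apply: CatZ; exact: pf.
Qed.

(** A directional derivative is a combination of partial derivatives ([Cat_Dv]) and costs one order,
    which is harmless because all orders are assumed at every point of O. *)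
Lemma Cat_Ck m n (O : set 'rV[R]_m) (F : 'rV[R]_m -> 'rV[R]_n) :
  open O -> (forall x, O x -> forall k j, Cat k (fun y => F y 0 j) x) ->
  Ck None O F.
Proof.
move=> oO CF.
have nO y : O y -> \forall z \near y, O z.
  by move=> Oy; exact: open_nbhs_nbhs.
have C s x : O x -> forall k j, Cat k (fun y => Defs.iterD s F y 0 j) x.
  elim: s x => [|v s IH] x Ox k j /=; first exact: CF.
  apply: Cat_ext (Cat_Dv v (IH x Ox k.+1 j)).
  apply: filterS (nO _ Ox) => y Oy; rewrite derive_mx ?mxE//.
  apply/derivable_mxP => i' j'; rewrite ord1; apply: diff_derivable.
  exact: Cat_differentiable (IH y Oy 1%N j').
move=> s x Ox; split => [_|_ v].
  by apply: continuous_row => j; exact: Cat_continuous (C s x Ox 0%N j).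
apply/derivable_mxP => i' j'; rewrite ord1; apply: diff_derivable.
exact: Cat_differentiable (C s x Ox 1%N j').
Qed.

Lemma linear_is_derive (V W W' : normedModType R) (L : {linear W -> W'}) (f : V -> W) x v :
  continuous L -> derivable f x v -> is_derive x v (L \o f) (L ('D_v f x)).
Proof.
move=> cL df.
have E : (fun h : R => h^-1 *: (((L \o f) \o shift x) (h *: v) - (L \o f) x)) =
  L \o (fun h : R => h^-1 *: ((f \o shift x) (h *: v) - f x)).
  by apply/funext => h; rewrite [RHS]/= linearZ /=; congr (_ *: _); rewrite linearB.
have H : (fun h : R => h^-1 *: (((L \o f) \o shift x) (h *: v) - (L \o f) x)) @ 0^' -->
   L ('D_v f x).
  rewrite E; apply: continuous_cvg; [exact: cL|exact: df].
by split; [apply/cvg_ex; eexists; exact: H|apply/cvg_lim].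
Qed.

Lemma Ck_linear (V W W' : normedModType R) (L : {linear W -> W'}) o (O : set V) (f : V -> W) :
  continuous L -> open O -> Ck o O f -> Ck o O (L \o f).
Proof.
move=> cL oO Cf.
have nO y : O y -> \forall z \near y, O z.
  by move=> Oy; exact: open_nbhs_nbhs.
have E s : order_le o (size s) -> forall x, O x -> Defs.iterD s (L \o f) x = L (Defs.iterD s f x).
  elim: s => [|v s IH] //= os x Ox.
  have os' : order_le o (size s) by case: o os {Cf IH} => //= k; exact: ltnW.
  have [_ /(_ os v) df] := Cf s x Ox.
  rewrite (@near_eq_derive _ _ _ _ (L \o Defs.iterD s f)); last first.
    by apply: filterS (nO _ Ox) => y Oy; exact: IH.
  by have [_ ->] := linear_is_derive cL df.
move=> s x Ox; have [H1 H2] := Cf s x Ox; split => [os|os v].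
  apply: (@near_eq_continuous _ _ (L \o Defs.iterD s f)).
    by apply: filterS (nO _ Ox) => y Oy; rewrite E.
  by apply: continuous_comp; [exact: H1|exact: cL].
have os' : order_le o (size s) by case: o os {Cf H1 H2 E} => //= k; exact: ltnW.
apply: (@near_eq_derivable _ _ _ (L \o Defs.iterD s f)).
  by apply: filterS (nO _ Ox) => y Oy; rewrite E.
by have [] := linear_is_derive cL (H2 os v).
Qed.

(** A derivative of the composite along v is the derivative of f along L v, so iterated derivatives
    match once the list of directions is mapped by L. *)
Lemma Ck_precomp (V V' W : normedModType R) (L : {linear V -> V'}) o (O : set V')
    (f : V' -> W) :
  continuous L -> Ck o O f -> Ck o (L @^-1` O) (f \o L).
Proof.
move=> cL Cf.
have D g x v : (fun h : R => h^-1 *: (((g \o L) \o shift x) (h *: v) - (g \o L) x)) =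
   (fun h : R => h^-1 *: ((g \o shift (L x)) (h *: L v) - (g (L x) : W))).
  by apply/funext => h; rewrite /shift /= (linearD L) (linearZ_LR L).
have E s : Defs.iterD s (f \o L) = Defs.iterD (map L s) f \o L.
  elim: s => //= v s ->; apply/funext => x /=; rewrite /derive D; reflexivity.
move=> s x Ox; have [H1 H2] := Cf (map L s) (L x) Ox; rewrite size_map in H1 H2.
rewrite E; split => [os|os v].
  by apply: continuous_comp; [exact: cL|exact: H1].
by rewrite /derivable D; exact: H2.
Qed.

End Bridge.

(** * Riemannian calculus in coordinates *)

Opaque partial.

Section MatrixCalculus.
Context {R : realType} {n : nat}.
Implicit Types (x : 'rV[R]_n).

Lemma eq_partial (f h : 'rV[R]_n -> R) x a : f =1 h -> partial a f x = partial a h x.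
Proof. by move=> /funext ->. Qed.

Lemma near_partial (f h : 'rV[R]_n -> R) x a :
  (\forall y \near x, f y = h y) -> partial a f x = partial a h x.
Proof. by move=> /(near_eq_partial a) /nbhs_singleton. Qed.

Lemma partialZ (c : R) (f : 'rV[R]_n -> R) x a : differentiable f x ->
  partial a (fun y => c * f y) x = c * partial a f x.
Proof.
move=> df; have E := partialM a (differentiable_cst c x) df.
by apply: etrans E _; rewrite partial_cst mul0r add0r.
Qed.

Lemma differentiable_sumf (I : Type) (r : seq I) (P : pred I) (F : I -> 'rV[R]_n -> R) x :
  (forall i, differentiable (F i) x) -> differentiable (fun y => \sum_(i <- r | P i) F i y) x.
Proof.
move=> dF; elim: r => [|i r IH].
  by under eq_fun do rewrite big_nil; exact: differentiable_cst.
by under eq_fun do rewrite big_cons; case: (P i) => //; exact: differentiableD.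
Qed.

Lemma partial_sum (I : Type) (r : seq I) (P : pred I) (F : I -> 'rV[R]_n -> R) x a :
  (forall i, differentiable (F i) x) ->
  partial a (fun y => \sum_(i <- r | P i) F i y) x = \sum_(i <- r | P i) partial a (F i) x.
Proof.
move=> dF; elim: r => [|i r IH].
  by under eq_partial do rewrite big_nil; rewrite partial_cst big_nil.
under eq_partial do rewrite big_cons; rewrite big_cons; case: (P i) => //.
by rewrite partialD// ?IH//; exact: differentiable_sumf.
Qed.

Definition dM p q (k : 'I_n) (A : 'rV[R]_n -> 'M[R]_(p, q)) x : 'M[R]_(p, q) :=
  \matrix_(i, j) partial k (fun y => A y i j) x.

Definition diffM p q (A : 'rV[R]_n -> 'M[R]_(p, q)) x :=
  forall i j, differentiable (fun y => A y i j) x.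

Definition CatMx p q k (A : 'rV[R]_n -> 'M[R]_(p, q)) x :=
  forall i j, Cat k (fun y => A y i j) x.

Lemma CatMx_diff p q k (A : 'rV[R]_n -> 'M[R]_(p, q)) x : CatMx k.+1 A x -> diffM A x.
Proof. by move=> CA i j; exact: Cat_differentiable (CA i j). Qed.

Lemma CatMx_mul p q s k (A : 'rV[R]_n -> 'M[R]_(p, q)) (B : 'rV[R]_n -> 'M[R]_(q, s)) x :
  CatMx k A x -> CatMx k B x -> CatMx k (fun y => A y *m B y) x.
Proof.
move=> CA CB i j; apply: (@eq_Cat _ _ _ (fun y => \sum_l A y i l * B y l j)).
  by move=> y; rewrite mxE.
by apply: Cat_sum => l; apply: CatM.
Qed.

Lemma CatMx_tr p q k (A : 'rV[R]_n -> 'M[R]_(p, q)) x :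
  CatMx k A x -> CatMx k (fun y => (A y)^T) x.
Proof. by move=> CA i j; apply: eq_Cat (CA j i) => y; rewrite mxE. Qed.

Lemma Cat_det p k (A : 'rV[R]_n -> 'M[R]_p) x : CatMx k A x -> Cat k (fun y => \det (A y)) x.
Proof.
move=> CA; apply: Cat_sum => s; apply: CatZ; apply: Cat_prod => i; exact: CA.
Qed.

(** Cramer's rule: near x the inverse is the cofactor matrix divided by the determinant. *)
Lemma CatMx_inv p k (A : 'rV[R]_n -> 'M[R]_p) x :
  CatMx k A x -> \det (A x) != 0 -> CatMx k (fun y => invmx (A y)) x.
Proof.
move=> CA d0 i j; have Cd := Cat_det CA.
have nd := near_comp_cont (Cat_continuous Cd) (near_neq0 d0).
apply: (@Cat_ext _ _ _ (fun y => (\det (A y))^-1 * ((-1) ^+ (j + i) * \det (row' j (col' i (A y)))))).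
  apply: filterS nd => y dy; rewrite /invmx unitmxE unitfE dy !mxE /cofactor.
  by [].
apply: CatM; first exact: CatV.
apply: CatZ; apply: Cat_det => a b; apply: eq_Cat (CA (lift j a) (lift i b)) => y.
by rewrite !mxE.
Qed.

Lemma dM_mul p q s k (A : 'rV[R]_n -> 'M[R]_(p, q)) (B : 'rV[R]_n -> 'M[R]_(q, s)) x :
  diffM A x -> diffM B x ->
  dM k (fun y => A y *m B y) x = dM k A x *m B x + A x *m dM k B x.
Proof.
move=> dA dB; apply/matrixP => i j; rewrite !mxE.
under eq_partial do rewrite mxE.
rewrite partial_sum; last by move=> l; apply: differentiableM.
rewrite -big_split /=; apply: eq_bigr => l _; rewrite !mxE partialM//.
Qed.

Lemma dM_tr p q k (A : 'rV[R]_n -> 'M[R]_(p, q)) x :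
  dM k (fun y => (A y)^T) x = (dM k A x)^T.
Proof. by apply/matrixP => i j; rewrite !mxE; under eq_partial do rewrite mxE. Qed.

Lemma near_dM p q k (A B : 'rV[R]_n -> 'M[R]_(p, q)) x :
  (\forall y \near x, A y = B y) -> dM k A x = dM k B x.
Proof.
move=> AB; apply/matrixP => i j; rewrite !mxE; apply: near_partial.
by apply: filterS AB => y ->.
Qed.

(** Obtained by differentiating the identity of A with its inverse, which holds near x and not only
    at x. *)
Lemma dM_inv p k (A : 'rV[R]_n -> 'M[R]_p) x :
  CatMx 1 A x -> \det (A x) != 0 ->
  dM k (fun y => invmx (A y)) x = - (invmx (A x) *m dM k A x *m invmx (A x)).
Proof.
move=> CA d0; have CI := CatMx_inv CA d0.
have nd := near_comp_cont (Cat_continuous (Cat_det CA)) (near_neq0 d0).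
have U : A x \in unitmx by rewrite unitmxE unitfE.
have := dM_mul k (CatMx_diff CA) (CatMx_diff CI).
rewrite (@near_dM _ _ _ _ (fun=> 1%:M)); last first.
  by apply: filterS nd => y dy; rewrite mulmxV// unitmxE unitfE.
have -> : dM k (fun=> 1%:M) x = 0 :> 'M[R]_p.
  by apply/matrixP => i j; rewrite !mxE partial_cst.
move/esym/eqP; rewrite addrC addr_eq0 => /eqP E.
have := congr1 (mulmx (invmx (A x))) E.
by rewrite mulmxA mulVmx// mul1mx => ->; rewrite mulmxN mulmxA.
Qed.

Lemma partial_prod (I : finType) (F : I -> 'rV[R]_n -> R) x a :
  (forall i, differentiable (F i) x) ->
  partial a (fun y => \prod_i F i y) x =
  \sum_i partial a (F i) x * \prod_(j | j != i) F j x.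
Proof.
move=> dF.
have dP (r : seq I) : differentiable (fun y => \prod_(i <- r) F i y) x.
  elim: r => [|i r IH].
    by under eq_fun do rewrite big_nil; exact: differentiable_cst.
  by under eq_fun do rewrite big_cons; exact: differentiableM.
suff H (r : seq I) : uniq r -> partial a (fun y => \prod_(i <- r) F i y) x =
   \sum_(i <- r) partial a (F i) x * \prod_(j <- r | j != i) F j x.
  by rewrite H ?index_enum_uniq.
elim: r => [|i r IH].
  by under eq_partial do rewrite big_nil; rewrite partial_cst big_nil.
move=> /= /andP[ir ur]; under eq_partial do rewrite big_cons.
rewrite partialM// IH// [in RHS]big_cons big_cons eqxx /=; congr (_ * _ + _).
  rewrite big_seq [in RHS]big_seq_cond; apply: eq_bigl => j.
  by case jr : (j \in r) => //=; apply/esym; apply: contraNneq ir => <-.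
rewrite mulr_sumr big_seq [in RHS]big_seq; apply: eq_bigr => j jr.
have ij : i != j by apply: contraNneq ir => ->.
by rewrite big_cons ij mulrCA.
Qed.

(** Jacobi's formula. By multilinearity the derivative is the sum over i of the determinants of
    [B i], in which row i alone is differentiated; expansion along that row produces the
    cofactors. *)
Lemma partial_det p (A : 'rV[R]_n -> 'M[R]_p) x k : diffM A x ->
  partial k (fun y => \det (A y)) x = \tr (\adj (A x) *m dM k A x).
Proof.
move=> dA; rewrite /determinant partial_sum; last first.
  move=> s; apply: differentiableM; first exact: differentiable_cst.
  elim: (index_enum _) => [|i r IH].
    by under eq_fun do rewrite big_nil; exact: differentiable_cst.
  by under eq_fun do rewrite big_cons; exact: differentiableM.
pose B (i : 'I_p) : 'M[R]_p := \matrix_(a, b) if a == i then dM k A x i b else A x a b.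
transitivity (\sum_i \det (B i)).
  rewrite /determinant exchange_big /=; apply: eq_bigr => s _.
  rewrite partialZ; last first.
    elim: (index_enum _) => [|i r IH].
      by under eq_fun do rewrite big_nil; exact: differentiable_cst.
    by under eq_fun do rewrite big_cons; exact: differentiableM.
  rewrite partial_prod// -mulr_sumr; congr (_ * _); apply: eq_bigr => i _.
  rewrite [RHS](bigD1 i)//= !mxE eqxx; congr (_ * _); apply: eq_bigr => j ji.
  by rewrite mxE (negbTE ji).
rewrite mxtrace_mulC /mxtrace; apply: eq_bigr => i _.
rewrite (expand_det_row _ i) mxE; apply: eq_bigr => j _; rewrite mxE eqxx; congr (_ * _).
rewrite mxE /cofactor; congr (_ * \det _); apply/matrixP => a b.
by rewrite !mxE eq_sym (negbTE (neq_lift _ _)).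
Qed.

Lemma partial_sqrt_det p (A : 'rV[R]_n -> 'M[R]_p) x k : diffM A x -> 0 < \det (A x) ->
  partial k (fun y => Num.sqrt (\det (A y))) x =
  Num.sqrt (\det (A x)) * (2^-1 * \tr (invmx (A x) *m dM k A x)).
Proof.
move=> dA d0.
have dd : differentiable (fun y => \det (A y)) x.
  apply: differentiable_sumf => s; apply: differentiableM; first exact: differentiable_cst.
  elim: (index_enum _) => [|i r IH].
    by under eq_fun do rewrite big_nil; exact: differentiable_cst.
  by under eq_fun do rewrite big_cons; exact: differentiableM.
rewrite partial_comp1//; last by have [] := is_derive1_sqrt d0.
rewrite derive_sqrt// partial_det// /invmx unitmxE unitfE gt_eqF// -scalemxAl mxtraceZ.
move: (\tr _) => t; set d := \det _.
have s0 : Num.sqrt d != 0 by rewrite sqrtr_eq0 -ltNge.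
have -> : d = Num.sqrt d * Num.sqrt d by rewrite -expr2 sqr_sqrtr// ltW.
rewrite -expr2 sqrtr_sqr ger0_norm ?sqrtr_ge0//.
by field; rewrite s0.
Qed.

End MatrixCalculus.

Opaque partial Cat.

(** * Positive definite matrices *)

Section LinearAlgebra.
Context {R : realType}.

Definition posdef n (A : 'M[R]_n) :=
  A^T = A /\ forall v : 'rV[R]_n, v != 0 -> 0 < (v *m A *m v^T) 0 0.

Lemma mx11 (A : 'M[R]_1) : A^T = A.
Proof. by apply/matrixP => i j; rewrite !ord1 mxE. Qed.

(** Induction on the size: once the first row is split off, the Schur complement [S] of the corner
    is again positive definite, and its factor Q completes the block triangular factor [F]. *)
Lemma cholesky n (A : 'M[R]_n) : posdef A -> exists Q : 'M[R]_n, A = Q^T *m Q.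
Proof.
elim: n A => [|n IH] A [As Ap]; first by exists 0; apply/matrixP => -[].
pose B : 'M[R]_(1 + n) := A.
pose al := ulsubmx B; pose b := ursubmx B; pose C := drsubmx B.
have BE : B = block_mx al b b^T C.
  rewrite -[LHS]submxK; congr block_mx.
  by rewrite /b trmx_ursub (_ : B^T = B).
have al0 : 0 < al 0 0.
  have := Ap (row_mx 1%:M 0 : 'rV[R]_(1 + n)).
  have -> : (row_mx 1%:M 0 *m B *m (row_mx 1%:M 0)^T) = al.
    by rewrite BE mul_row_block tr_row_mx mul_row_col !mul1mx !mul0mx !addr0 trmx1 trmx0 mulmx0 addr0 mulmx1.
  apply; apply/eqP => /(congr1 (fun M : 'rV[R]_(1 + n) => M 0 (lshift n 0))).
  by rewrite row_mxEl !mxE eqxx => /eqP; rewrite oner_eq0.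
have Cs : C^T = C by rewrite /C trmx_drsub (_ : B^T = B).
pose S := C - (al 0 0)^-1 *: (b^T *m b).
have Sp : posdef S.
  split.
    by rewrite /S linearB /= linearZ /= trmx_mul trmxK Cs.
  move=> v v0.
  (* The first coordinate is the one that makes the first entry of w B vanish, so the form of B at w
     is that of S at v. *)
  pose w : 'rV[R]_(1 + n) := row_mx (- (al 0 0)^-1 *: (v *m b^T)) v.
  have w0 : w != 0.
    apply: contraNneq v0 => /(congr1 rsubmx); rewrite row_mxKr => ->.
    by apply/eqP/rowP => j; rewrite !mxE.
  suff <- : (w *m B *m w^T) 0 0 = (v *m S *m v^T) 0 0 by exact: Ap.
  have alE : al = (al 0 0)%:M by rewrite [LHS]mx11_scalar.
  rewrite BE mul_row_block tr_row_mx mul_row_col.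
  have -> : - (al 0 0)^-1 *: (v *m b^T) *m al + v *m b^T = 0.
    by rewrite [X in _ *m X + _]alE mul_mx_scalar scalerA mulrN mulfV ?gt_eqF// scaleN1r addNr.
  rewrite mul0mx add0r; congr ((_ *m _) 0 0).
  by rewrite mulmxBr -scalemxAl -scalemxAr mulmxA scaleNr addrC.
have [Q SE] := IH _ Sp.
have s0 : Num.sqrt (al 0 0) != 0 by rewrite sqrtr_eq0 -ltNge.
pose F : 'M[R]_(1 + n) := block_mx ((Num.sqrt (al 0 0))%:M) ((Num.sqrt (al 0 0))^-1 *: b) 0 Q.
suff E : B = F^T *m F by exists F.
rewrite BE /F tr_block_mx mulmx_block tr_scalar_mx trmx0 !mul0mx !mulmx0 !addr0.
congr block_mx.
- by rewrite [LHS]mx11_scalar -scalar_mxM -expr2 sqr_sqrtr// ltW.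
- by rewrite mul_scalar_mx scalerA mulfV// scale1r.
- by rewrite linearZ /= mul_mx_scalar scalerA mulfV// scale1r.
- rewrite -SE /S [(_ *: b)^T]linearZ /= -scalemxAl -scalemxAr scalerA -invfM -expr2 sqr_sqrtr ?ltW//.
  by rewrite addrC subrK.
Qed.

Lemma posdef_unit n (A : 'M[R]_n) : posdef A -> A \in unitmx.
Proof.
move=> [_ Ap]; rewrite unitmxE unitfE; apply/negP => /det0P[v v0 vA].
by have := Ap v v0; rewrite vA mul0mx mxE ltxx.
Qed.

Lemma posdef_det n (A : 'M[R]_n) : posdef A -> 0 < \det A.
Proof.
move=> Ap; have U := posdef_unit Ap; have [Q E] := cholesky Ap.
move: U; rewrite unitmxE unitfE E det_mulmx det_tr -expr2 => d0.
by rewrite lt_neqAle eq_sym d0 sqr_ge0.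
Qed.

Lemma posdef_inv_sym n (A : 'M[R]_n) : posdef A -> (invmx A)^T = invmx A.
Proof. by move=> [As _]; rewrite trmx_inv As. Qed.

Lemma posdef_ge0 n (A : 'M[R]_n) : posdef A -> forall v : 'rV[R]_n, 0 <= (v *m A *m v^T) 0 0.
Proof.
move=> [_ Ap] v; have [->|/Ap/ltW //] := eqVneq v 0.
by rewrite !mul0mx mxE.
Qed.

Lemma posdef_pull n (A J : 'M[R]_n) : posdef A -> J \in unitmx -> posdef (J *m A *m J^T).
Proof.
move=> [As Ap] U; split; first by rewrite !trmx_mul trmxK As mulmxA.
move=> v v0; have -> : v *m (J *m A *m J^T) *m v^T = (v *m J) *m A *m (v *m J)^T.
  by rewrite trmx_mul !mulmxA.
apply: Ap; apply: contraNneq v0 => /(congr1 (mulmxr (invmx J))) /=.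
by rewrite -mulmxA mulmxV// mulmx1 mul0mx => ->.
Qed.

(** With A = Q^T Q and P the inverse of Q, the trace is that of P^T S P, whose diagonal entries are
    the values of S at the rows of P^T. *)
Lemma trace_posdef_ge0 n (A S : 'M[R]_n) : posdef A ->
  (forall v : 'rV[R]_n, 0 <= (v *m S *m v^T) 0 0) -> 0 <= \tr (invmx A *m S).
Proof.
move=> Ap Sp; have [Q E] := cholesky Ap; have := posdef_unit Ap.
rewrite E unitmx_mul unitmx_tr andbb => U.
set P := invmx Q.
have -> : invmx (Q^T *m Q) = P *m P^T.
  have UA : Q^T *m Q \in unitmx by rewrite unitmx_mul unitmx_tr U.
  apply: (can_inj (mulKmx UA)); rewrite mulmxV// mulmxA -[Q^T *m Q *m P]mulmxA mulmxV// mulmx1.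
  by rewrite -trmx_mul mulVmx// trmx1.
rewrite -mulmxA mxtrace_mulC; apply: sumr_ge0 => i _.
have := Sp (row i P^T).
have -> : row i P^T *m S *m (row i P^T)^T = row i (P^T *m S *m P) *m (delta_mx 0 i)^T.
  by rewrite !rowE trmx_mul trmxK !mulmxA.
by rewrite trmx_delta -colE !mxE.
Qed.

End LinearAlgebra.

(** * Gradient, Laplacian and Hessian of a metric in coordinates *)

Section Coordinates.
Context {R : realType} {n : nat}.
Implicit Types (x : 'rV[R]_n) (f h r : 'rV[R]_n -> R) (a : 'rV[R]_n -> 'M[R]_n).

Definition dvec f x : 'rV[R]_n := \row_k partial k f x.

Definition gpair a f h x : R := (dvec f x *m invmx (a x) *m (dvec h x)^T) 0 0.

Definition cgrad a f x : 'rV[R]_n := dvec f x *m invmx (a x).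

Definition lap a f x : R := (Num.sqrt (\det (a x)))^-1 *
  \sum_k partial k (fun y => Num.sqrt (\det (a y)) * cgrad a f y 0 k) x.

Lemma Cat_dvec k f x : Cat k.+1 f x -> CatMx k (dvec f) x.
Proof.
by move=> Cf i j; apply: eq_Cat (Cat_partial j Cf) => y; rewrite mxE.
Qed.

Lemma Cat_cgrad k a f x : CatMx k a x -> posdef (a x) -> Cat k.+1 f x ->
  CatMx k (cgrad a f) x.
Proof.
move=> Ca pa Cf; apply: CatMx_mul; first exact: Cat_dvec.
by apply: CatMx_inv => //; rewrite gt_eqF// posdef_det.
Qed.

Lemma gpairE a f h x : gpair a f h x = \sum_k cgrad a f x 0 k * partial k h x.
Proof. by rewrite /gpair mxE; apply: eq_bigr => k _; rewrite !mxE. Qed.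

Lemma gpairC a f h x : posdef (a x) -> gpair a f h x = gpair a h f x.
Proof.
move=> pa; rewrite /gpair -[LHS]/((_ *m _) 0 0) -[in LHS](mx11 (_ *m _)).
by rewrite !trmx_mul trmxK posdef_inv_sym// mulmxA.
Qed.

Lemma Cat_gpair k a f h x : CatMx k a x -> posdef (a x) -> Cat k.+1 f x -> Cat k.+1 h x ->
  Cat k (gpair a f h) x.
Proof.
move=> Ca pa Cf Ch; apply: eq_Cat (Cat_sum (index_enum _) xpredT
  (fun k0 => CatM (Cat_cgrad Ca pa Cf 0 k0) (Cat_partial k0 Ch))) => y.
by rewrite gpairE.
Qed.

(** The product rule for the divergence of phi grad f, multiplied by the volume density. This form
    is needed because the flux is differentiated in coordinates, where the density is part of the
    integrand. *)
Lemma div_scaled a f phi x : CatMx 1 a x -> posdef (a x) -> Cat 2 f x -> Cat 1 phi x ->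
  \sum_k partial k (fun y => Num.sqrt (\det (a y)) * (phi y * cgrad a f y 0 k)) x =
  Num.sqrt (\det (a x)) * (gpair a f phi x + phi x * lap a f x).
Proof.
move=> Ca pa Cf Cp.
have d0 := posdef_det pa; have s0 : Num.sqrt (\det (a x)) != 0 by rewrite sqrtr_eq0 -ltNge.
have Cs : Cat 1 (fun y => Num.sqrt (\det (a y))) x := Cat_sqrt d0 (Cat_det Ca).
have Cg k : Cat 1 (fun y => cgrad a f y 0 k) x by exact: Cat_cgrad.
have E k : partial k (fun y => Num.sqrt (\det (a y)) * (phi y * cgrad a f y 0 k)) x =
   partial k phi x * (Num.sqrt (\det (a x)) * cgrad a f x 0 k) +
   phi x * partial k (fun y => Num.sqrt (\det (a y)) * cgrad a f y 0 k) x.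
  rewrite -partialM; first by apply: eq_partial => y; rewrite mulrCA.
    exact: Cat_differentiable Cp.
  exact: Cat_differentiable (CatM Cs (Cg k)).
rewrite (eq_bigr _ (fun k _ => E k)) big_split /= -mulr_sumr mulrDr; congr (_ + _).
  by rewrite gpairE mulr_sumr; apply: eq_bigr => k _; rewrite mulrCA [partial _ _ _ * _]mulrC.
rewrite /lap; move: (\sum_(k < n) _) s0 => S; move: (Num.sqrt _) => s s0.
by field.
Qed.

Lemma lapE a f x : CatMx 1 a x -> posdef (a x) -> Cat 2 f x ->
  lap a f x = \sum_k (partial k (fun y => cgrad a f y 0 k) x +
     2^-1 * \tr (invmx (a x) *m dM k a x) * cgrad a f x 0 k).
Proof.
move=> Ca pa Cf; have d0 := posdef_det pa.
have s0 : Num.sqrt (\det (a x)) != 0 by rewrite sqrtr_eq0 -ltNge.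
have Cs : Cat 1 (fun y => Num.sqrt (\det (a y))) x := Cat_sqrt d0 (Cat_det Ca).
have Cg k : Cat 1 (fun y => cgrad a f y 0 k) x by exact: Cat_cgrad.
rewrite /lap mulr_sumr; apply: eq_bigr => k _.
rewrite partialM; [|exact: Cat_differentiable Cs|exact: Cat_differentiable (Cg k)].
rewrite partial_sqrt_det//; last exact: CatMx_diff.
move: (\tr _) (partial _ _ _) (cgrad _ _ _ _ _) s0 => t p q; move: (Num.sqrt _) => s s0.
by field.
Qed.


Definition dsec f x : 'M[R]_n := \matrix_(i, j) partial i (partial j f) x.

Lemma dsec_sym f x : Cat 2 f x -> (dsec f x)^T = dsec f x.
Proof. by move=> Cf; apply/matrixP => i j; rewrite !mxE partial_sym. Qed.

Lemma dM_dvec k f x : dM k (dvec f) x = row k (dsec f x).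
Proof.
by apply/matrixP => i j; rewrite !mxE; apply: eq_partial => y; rewrite mxE.
Qed.

(** The Christoffel symbols of the first kind contracted with the vector P. For P = grad f this is
    the sum over c of Gamma^c_ij d_c f, without any inverse matrix in the formula. *)
Definition chris a x (P : 'rV[R]_n) : 'M[R]_n := \matrix_(i, j)
  (2^-1 * \sum_d P 0 d * (partial i (fun y => a y j d) x + partial j (fun y => a y i d) x
    - partial d (fun y => a y i j) x)).

Definition chess a f x : 'M[R]_n := dsec f x - chris a x (cgrad a f x).

Lemma dM_cgrad a f x k : CatMx 1 a x -> posdef (a x) -> Cat 2 f x ->
  dM k (cgrad a f) x = row k (dsec f x) *m invmx (a x)
     - cgrad a f x *m dM k a x *m invmx (a x).
Proof.
move=> Ca pa Cf; have d0 : \det (a x) != 0 by rewrite gt_eqF// posdef_det.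
rewrite dM_mul; [|exact: CatMx_diff (Cat_dvec Cf)|exact: CatMx_diff (CatMx_inv Ca d0)].
by rewrite dM_dvec dM_inv// mulmxN !mulmxA.
Qed.

Lemma dM_sym k a x : (\forall y \near x, (a y)^T = a y) -> (dM k a x)^T = dM k a x.
Proof. by move=> H; rewrite -dM_tr; apply: near_dM. Qed.

Lemma partial_gpair a f h x k : CatMx 1 a x -> posdef (a x) -> Cat 2 f x -> Cat 2 h x ->
  partial k (gpair a f h) x =
   (row k (dsec f x) *m (cgrad a h x)^T) 0 0
   - (cgrad a f x *m dM k a x *m (cgrad a h x)^T) 0 0
   + (cgrad a f x *m (row k (dsec h x))^T) 0 0.
Proof.
move=> Ca pa Cf Ch.
have E : partial k (gpair a f h) x = (dM k (fun y => cgrad a f y *m (dvec h y)^T) x) 0 0.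
  by rewrite mxE; apply: eq_partial.
rewrite E dM_mul; [|exact: CatMx_diff (Cat_cgrad Ca pa Cf)|exact: CatMx_diff (CatMx_tr (Cat_dvec Ch))].
rewrite dM_tr dM_dvec dM_cgrad// mulmxBl.
have -> : (cgrad a h x)^T = invmx (a x) *m (dvec h x)^T.
  by rewrite /cgrad trmx_mul posdef_inv_sym.
by rewrite !mulmxA mxE [X in X + _ = _]mxE [X in _ + X + _ = _]mxE.
Qed.

Lemma sum_row_form (U V : 'rV[R]_n) (A : 'M[R]_n) :
  \sum_k U 0 k * (row k A *m V^T) 0 0 = (U *m A *m V^T) 0 0.
Proof.
rewrite -mulmxA [RHS]mxE; apply: eq_bigr => k _; congr (_ * _).
by rewrite -row_mul mxE.
Qed.

Lemma form_tr (U V : 'rV[R]_n) (A : 'M[R]_n) :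
  (U *m A *m V^T) 0 0 = (V *m A^T *m U^T) 0 0.
Proof. by rewrite -[in LHS](mx11 (_ *m _)) !trmx_mul trmxK mulmxA. Qed.

Lemma formE (U V : 'rV[R]_n) (A : 'M[R]_n) :
  (U *m A *m V^T) 0 0 = \sum_i \sum_j U 0 i * A i j * V 0 j.
Proof.
rewrite mxE exchange_big /=; apply: eq_bigr => j _; rewrite mxE mulr_suml.
by apply: eq_bigr => i _; rewrite mxE.
Qed.

(** On a single vector U the first two terms of each symbol give the same sum after an exchange of
    indices, by symmetry of the metric. *)
Lemma chris_form a x (P U : 'rV[R]_n) : (\forall y \near x, (a y)^T = a y) ->
  (U *m chris a x P *m U^T) 0 0 =
  \sum_k U 0 k * (P *m dM k a x *m U^T) 0 0 - 2^-1 * \sum_k P 0 k * (U *m dM k a x *m U^T) 0 0.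
Proof.
move=> asym.
have sym k i j : partial k (fun y => a y i j) x = partial k (fun y => a y j i) x.
  by apply: near_partial; apply: filterS asym => y {2}<-; rewrite mxE.
rewrite formE.
have E i j : U 0 i * chris a x P i j * U 0 j =
  2^-1 * (\sum_d U 0 i * P 0 d * partial i (fun y => a y d j) x * U 0 j)
  + 2^-1 * (\sum_d U 0 j * P 0 d * partial j (fun y => a y d i) x * U 0 i)
  - 2^-1 * (\sum_d P 0 d * U 0 i * partial d (fun y => a y i j) x * U 0 j).
  rewrite mxE -!mulrDr -mulrBr mulrCA -mulrA; congr (_ * _).
  rewrite -big_split -sumrB /= mulr_sumr mulr_suml; apply: eq_bigr => d _.
  rewrite [partial i _ _]sym [partial j _ _]sym.
  by move: (partial _ _ _) (partial _ _ _) (partial _ _ _) => p q s; ring.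
under eq_bigr do under eq_bigr do rewrite E.
under eq_bigr do rewrite sumrB big_split /= -!mulr_sumr.
rewrite sumrB big_split /= -!mulr_sumr.
have -> : \sum_i \sum_j \sum_d U 0 j * P 0 d * partial j (fun y => a y d i) x * U 0 i =
   \sum_k U 0 k * (P *m dM k a x *m U^T) 0 0.
  rewrite exchange_big /=; apply: eq_bigr => k _; rewrite formE exchange_big /= mulr_sumr.
  apply: eq_bigr => i _; rewrite mulr_sumr; apply: eq_bigr => d _.
  by rewrite mxE !mulrA.
have -> : \sum_i \sum_j \sum_d U 0 i * P 0 d * partial i (fun y => a y d j) x * U 0 j =
   \sum_k U 0 k * (P *m dM k a x *m U^T) 0 0.
  apply: eq_bigr => k _; rewrite formE exchange_big /= mulr_sumr.
  apply: eq_bigr => d _; rewrite mulr_sumr; apply: eq_bigr => i _.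
  by rewrite mxE !mulrA.
have -> : \sum_i \sum_j \sum_d P 0 d * U 0 i * partial d (fun y => a y i j) x * U 0 j =
   \sum_k P 0 k * (U *m dM k a x *m U^T) 0 0.
  under eq_bigr do rewrite exchange_big /=.
  rewrite exchange_big /=; apply: eq_bigr => k _; rewrite formE mulr_sumr.
  apply: eq_bigr => i _; rewrite mulr_sumr; apply: eq_bigr => j _.
  by rewrite mxE !mulrA.
by move: (\sum_k _) (\sum_k _) => p q; field.
Qed.

(** The second derivatives of f cancel because [dsec f] is symmetric, and the derivatives of the
    metric that remain are exactly the Christoffel term of [chess]. Through this identity the
    Hessian of r enters divergences that are computed from pairings of functions only. *)
Lemma hess_gpair a f r x : (\forall y \near x, (a y)^T = a y) ->
  CatMx 1 a x -> posdef (a x) -> Cat 2 f x -> Cat 2 r x ->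
  gpair a f (gpair a r f) x *+ 2 - gpair a r (gpair a f f) x =
  (cgrad a f x *m chess a r x *m (cgrad a f x)^T) 0 0 *+ 2.
Proof.
move=> asym Ca pa Cf Cr.
rewrite /chess mulmxBr mulmxBl [in RHS]mxE [X in _ = (_ + X) *+ 2]mxE chris_form//.
rewrite !gpairE; set U := cgrad a f x; set P := cgrad a r x.
have E1 : \sum_k U 0 k * partial k (gpair a r f) x =
  (U *m dsec r x *m U^T) 0 0 - \sum_k U 0 k * (P *m dM k a x *m U^T) 0 0
  + (U *m dsec f x *m P^T) 0 0.
  under eq_bigr do rewrite partial_gpair// -/U -/P mulrDr mulrBr.
  rewrite big_split sumrB /= sum_row_form; congr (_ + _).
  rewrite -sum_row_form; apply: eq_bigr => k _; congr (_ * _).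
  by rewrite -[in LHS](mx11 (_ *m _)) trmx_mul trmxK.
have E2 : \sum_k P 0 k * partial k (gpair a f f) x =
  (U *m dsec f x *m P^T) 0 0 *+ 2 - \sum_k P 0 k * (U *m dM k a x *m U^T) 0 0.
  under eq_bigr do rewrite partial_gpair// -/U mulrDr mulrBr.
  rewrite big_split sumrB /= sum_row_form.
  have -> : \sum_k P 0 k * (U *m (row k (dsec f x))^T) 0 0 = (P *m dsec f x *m U^T) 0 0.
    rewrite -sum_row_form; apply: eq_bigr => k _; congr (_ * _).
    by rewrite -[in LHS](mx11 (_ *m _)) trmx_mul trmxK.
  rewrite [X in _ = X *+ 2 - _]form_tr (dsec_sym Cf).
  by move: (\sum_k _) ((_ *m _) 0 0) => p q; ring.
rewrite [X in X *+ 2 - _ = _]E1 [X in _ - X = _]E2.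
have alg (p q s t : R) : (s - p + t) *+ 2 - (t *+ 2 - q) = (s - (p - 2^-1 * q)) *+ 2 by field.
exact: alg.
Qed.

(** The trace of the Christoffel term supplies both the derivative of the inverse matrix ([E1] and
    [E2], one half each) and the logarithmic derivative of the density ([E3]). *)
Lemma lap_trace a f x : (\forall y \near x, (a y)^T = a y) ->
  CatMx 1 a x -> posdef (a x) -> Cat 2 f x ->
  lap a f x = \tr (invmx (a x) *m chess a f x).
Proof.
move=> asym Ca pa Cf; rewrite lapE// big_split /=.
set U := cgrad a f x; set A := invmx (a x).
have AT : A^T = A := posdef_inv_sym pa.
have As i j : A i j = A j i by rewrite -[in LHS]AT mxE.
have -> : \sum_k partial k (fun y => cgrad a f y 0 k) x =
   \tr (A *m dsec f x) - \sum_k (U *m dM k a x *m A) 0 k.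
  rewrite mxtrace_mulC /mxtrace -sumrB; apply: eq_bigr => k _.
  have := congr1 (fun B : 'rV[R]_n => B 0 k) (dM_cgrad k Ca pa Cf).
  by rewrite mxE -row_mul mxE => ->; rewrite mxE [X in _ + X]mxE.
rewrite /chess mulmxBr linearB /= -addrA; congr (_ + _).
have sym k i j : partial k (fun y => a y i j) x = partial k (fun y => a y j i) x.
  by apply: near_partial; apply: filterS asym => y {2}<-; rewrite mxE.
have -> : \tr (A *m chris a x U) =
  \sum_i \sum_j 2^-1 * (\sum_d A i j * U 0 d * partial j (fun y => a y i d) x)
  + \sum_i \sum_j 2^-1 * (\sum_d A i j * U 0 d * partial i (fun y => a y j d) x)
  - \sum_i \sum_j 2^-1 * (\sum_d A i j * U 0 d * partial d (fun y => a y i j) x).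
  rewrite /mxtrace -big_split -sumrB /=; apply: eq_bigr => i _.
  rewrite mxE -big_split -sumrB /=; apply: eq_bigr => j _.
  rewrite mxE -mulrDr -mulrBr mulrCA; congr (_ * _).
  rewrite -big_split -sumrB mulr_sumr /=; apply: eq_bigr => d _.
  rewrite [partial d _ _]sym.
  by move: (partial _ _ _) (partial _ _ _) (partial _ _ _) => p q s; ring.
have E1 : \sum_i \sum_j 2^-1 * (\sum_d A i j * U 0 d * partial j (fun y => a y i d) x) =
  2^-1 * \sum_k (U *m dM k a x *m A) 0 k.
  rewrite exchange_big /= mulr_sumr; apply: eq_bigr => k _; rewrite -mulr_sumr; congr (_ * _).
  rewrite mxE; apply: eq_bigr => i _; rewrite mxE mulr_suml; apply: eq_bigr => d _.
  by rewrite [dM _ _ _ _ _]mxE [in RHS]sym; move: (partial _ _ _) => p; ring.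
have E2 : \sum_i \sum_j 2^-1 * (\sum_d A i j * U 0 d * partial i (fun y => a y j d) x) =
  2^-1 * \sum_k (U *m dM k a x *m A) 0 k.
  rewrite -E1 exchange_big /=; apply: eq_bigr => i _; apply: eq_bigr => j _.
  by congr (_ * _); apply: eq_bigr => d _; rewrite As.
have E3 : \sum_i \sum_j 2^-1 * (\sum_d A i j * U 0 d * partial d (fun y => a y i j) x) =
  \sum_k 2^-1 * \tr (A *m dM k a x) * U 0 k.
  under eq_bigr do rewrite -mulr_sumr exchange_big /=.
  rewrite -mulr_sumr exchange_big /= mulr_sumr; apply: eq_bigr => d _.
  rewrite -mulrA; congr (_ * _); rewrite /mxtrace mulr_suml; apply: eq_bigr => i _.
  rewrite [in RHS]mxE mulr_suml; apply: eq_bigr => j _; rewrite [dM _ _ _ _ _]mxE [in RHS]sym.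
  by move: (partial _ _ _) => p; ring.
rewrite E1 E2 E3.
by move: (\sum_k _) (\sum_k _) => p q; field.
Qed.

End Coordinates.

(** * Iterated integrals and the area measure *)

Section IteratedIntegral.
Context {R : realType}.
Local Notation mu := (@lebesgue_measure R).

Definition cs k (s : R) (v : 'rV[R]_k) : 'rV[R]_(1 + k) := row_mx (s%:M : 'rV[R]_1) v.

Lemma for_cst (T U : topologicalType) (c : U) (x : T) : {for x, continuous (fun _ : T => c)}.
Proof. exact: cst_continuous. Qed.

Lemma for_id (T : topologicalType) (x : T) : {for x, continuous (fun y : T => y)}.
Proof. by rewrite /prop_for /continuous_at; exact: cvg_id. Qed.

Lemma csl k s (v : 'rV[R]_k) : cs s v 0 (lshift k 0) = s.
Proof. by rewrite /cs row_mxEl mxE eqxx. Qed.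

Lemma csr k s (v : 'rV[R]_k) j : cs s v 0 (rshift 1 j) = v 0 j.
Proof. by rewrite /cs row_mxEr. Qed.

Lemma split_ord1 k (P : 'I_(1 + k) -> Prop) :
  P (lshift k 0) -> (forall i, P (rshift 1 i)) -> forall j, P j.
Proof.
move=> P0 P1 j; case: (splitP j) => i ij.
  by rewrite (_ : j = lshift k 0)//; apply: val_inj; rewrite /= ij; case: i {ij} => -[].
by rewrite (_ : j = rshift 1 i)//; exact: val_inj.
Qed.

Lemma csP k (w : 'rV[R]_(1 + k)) : w = cs (w 0 (lshift k 0)) (rsubmx w).
Proof. by apply/rowP; apply: split_ord1 => [|i]; rewrite ?csl ?csr ?mxE. Qed.

Lemma continuous_cs (T : topologicalType) k (s : T -> R) (v : T -> 'rV[R]_k) x :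
  {for x, continuous s} -> {for x, continuous v} ->
  {for x, continuous (fun y => cs (s y) (v y))}.
Proof.
move=> cf cv; apply: continuous_row; apply: split_ord1 => [|i].
  by apply: near_eq_continuous cf; apply: near_all => y; rewrite csl.
have H := @continuous_comp _ _ _ v (fun w : 'rV[R]_k => w 0 i) x cv (@continuous_coord _ _ _ _).
by apply: near_eq_continuous H; apply: near_all => y; rewrite csr.
Qed.

Lemma norm_cs k s (v : 'rV[R]_k) : `|s| <= `|cs s v| /\ `|v| <= `|cs s v|.
Proof.
split; first by rewrite -{1}(csl s v); exact: coord_le.
by apply: norm_le_coord => // j; rewrite -(csr s); exact: coord_le.
Qed.

(** The class on which iterated integrals are finite. One radius B serves the function and all of
    its sections, so that it survives the induction on the dimension. *)
Definition KB k (B : R) (f : 'rV[R]_k -> R) := continuous f /\ forall v, f v != 0 -> `|v| <= B.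

(** The real-valued counterpart of [integral_rV]; the two agree on [KB] by [It_props]. *)
Fixpoint It k : ('rV[R]_k -> R) -> R :=
  match k with
  | 0 => fun f => f 0
  | k'.+1 => fun f => \int[mu]_(s in [set: R]) It (fun v : 'rV[R]_k' => f (cs s v))
  end.

Lemma compact_ball k (B : R) : compact [set v : 'rV[R]_k | `|v| <= B].
Proof.
apply: bounded_closed_compact.
  exists B; split; first by rewrite num_real.
  by move=> x xB v /= vB; exact: le_trans vB (ltW xB).
rewrite (_ : [set v | _] = (fun v : 'rV[R]_k => `|v|) @^-1` [set x | x <= B])//.
by apply: closed_comp; [move=> v _; exact: norm_continuous|exact: closed_le].
Qed.

(** Compactness of K, in its near-covering form, makes continuity in the first variable uniform in
    the others. *)
Lemma tube k (f : 'rV[R]_(1 + k) -> R) (K : set 'rV[R]_k) t0 e :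
  compact K -> (forall v, K v -> {for cs t0 v, continuous f}) -> 0 < e ->
  \forall t \near t0, forall v, K v -> `|f (cs t v) - f (cs t0 v)| <= e.
Proof.
move=> /compact_near_coveringP cK cf e0.
have e2 : 0 < e / 2 by rewrite divr_gt0.
apply: (cK R (nbhs t0) (fun t v => `|f (cs t v) - f (cs t0 v)| <= e)) => v Kv.
have H : \forall w \near cs t0 v, `|f (cs t0 v) - f w| <= e / 2.
  by have /cvgrPdist_le := cf v Kv; apply.
have c1 : {for (v, t0), continuous (fun z : 'rV[R]_k * R => cs z.2 z.1)}.
  by apply: continuous_cs; [exact: cvg_snd|exact: cvg_fst].
have c2 : {for (v, t0), continuous (fun z : 'rV[R]_k * R => cs t0 z.1)}.
  by apply: continuous_cs; [exact: for_cst|exact: cvg_fst].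
have H1 := near_comp_cont c1 H; have H2 := near_comp_cont c2 H.
apply: filterS2 H1 H2 => -[w t] /= H1 H2.
by rewrite distrC in H1; rewrite distrC in H2; exact: dist_le_half H1 H2.
Qed.

Lemma integrable_KB (B : R) (g : R -> R) : continuous g -> (forall s, g s != 0 -> `|s| <= B) ->
  mu.-integrable [set: R] (EFin \o g) /\
  \int[mu]_(s in [set: R]) g s = \int[mu]_(s in `[- B, B]) g s.
Proof.
move=> cg gB.
have E : g = g \_ `[- B, B].
  apply/funext => s; rewrite /patch; case: ifPn => // /negP sB.
  apply/eqP; apply: contrapT => /negP /gB; rewrite ler_norml => ?; apply: sB.
  by rewrite inE /= in_itv.
have I : mu.-integrable `[- B, B] (EFin \o g).
  apply: continuous_compact_integrable; first exact: segment_compact.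
  exact: continuous_subspaceT.
split; last by rewrite [RHS]Rintegral_mkcond -E.
have : mu.-integrable [set: R] ((EFin \o g) \_ `[- B, B]).
  by rewrite -integrable_mkcond.
rewrite (_ : (EFin \o g) \_ `[- B, B] = EFin \o g)//.
by rewrite [in RHS]E; apply/funext => s; rewrite /patch /=; case: ifP.
Qed.

Lemma KB_cs k B (f : 'rV[R]_(1 + k) -> R) s : KB B f -> KB B (fun v => f (cs s v)).
Proof.
move=> [cf sf]; split => [v|v /sf]; last by apply: le_trans; case: (norm_cs s v).
apply: (@continuous_comp _ _ _ (fun v => cs s v) f); last exact: cf.
by apply: continuous_cs; [exact: for_cst|exact: for_id].
Qed.

Lemma KBD k B (f g : 'rV[R]_k -> R) : KB B f -> KB B g -> KB B (fun v => f v + g v).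
Proof.
move=> [cf sf] [cg sg]; split => [v|v].
  by apply: continuousD; [exact: cf|exact: cg].
have [->|/sf //] := eqVneq (f v) 0; by rewrite add0r => /sg.
Qed.

Lemma KBZ k B c (f : 'rV[R]_k -> R) : KB B f -> KB B (fun v => c * f v).
Proof.
move=> [cf sf]; split => [v|v]; first by apply: continuousM; [exact: for_cst|exact: cf].
by rewrite mulf_eq0 negb_or => /andP[_ /sf].
Qed.

(** All the rules are proved in one induction: the outer integral obeys them only once the section
    integrals are known to be continuous with bounded support ([H]), and that continuity uses
    linearity and the bound one dimension lower. *)
Lemma It_props k B : 0 <= B ->
  [/\ forall f g : 'rV[R]_k -> R, KB B f -> KB B g -> It (fun v => f v + g v) = It f + It g,
      forall c (f : 'rV[R]_k -> R), KB B f -> It (fun v => c * f v) = c * It f,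
      forall f g : 'rV[R]_k -> R, KB B f -> KB B g -> (forall v, f v <= g v) -> It f <= It g
    & forall (f : 'rV[R]_k -> R) (M : R), KB B f -> (forall v, `|f v| <= M) ->
        `|It f| <= (2 * B) ^+ k * M] /\
  forall f : 'rV[R]_k -> R, KB B f -> integral_rV (fun v => (f v)%:E) = (It f)%:E.
Proof.
move=> B0; elim: k => [|k [[ID IZ Ile Ibd] IE]].
  split; [split|] => //= f M _ H; by rewrite expr0 mul1r.
have I0 : It (fun _ : 'rV[R]_k => 0) = 0.
  have K0 : KB B (fun _ : 'rV[R]_k => 0 : R).
    by split=> [v|v]; [exact: for_cst|rewrite eqxx].
  rewrite -[RHS](mul0r (It (fun _ : 'rV[R]_k => 0))) -(IZ _ _ K0); congr It.
  by apply/funext => v; rewrite mul0r.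
have H (f : 'rV[R]_k.+1 -> R) : KB B f ->
    continuous (fun s => It (fun v : 'rV[R]_k => f (cs s v))) /\
    forall s, It (fun v : 'rV[R]_k => f (cs s v)) != 0 -> `|s| <= B.
  move=> Kf; have [cf sf] := Kf; split => [s|s].
    apply/cvgrPdist_le => /= e e0.
    pose c := (2 * B) ^+ k; have c0 : 0 <= c by rewrite exprn_ge0// mulr_ge0.
    have e1 : 0 < e / (c + 1) by rewrite divr_gt0// ltr_wpDl.
    have := tube (@compact_ball k B) (fun v _ => cf (cs s v)) e1.
    apply: filterS => t Ht.
    have K1 := KB_cs s Kf; have K2 := KB_cs t Kf.
    have K3 := KBZ (- 1) K2.
    have -> : It (fun v => f (cs s v)) - It (fun v => f (cs t v)) =
        It (fun v => f (cs s v) + - 1 * f (cs t v)).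
      by rewrite ID// IZ// mulN1r.
    apply: le_trans (Ibd _ (e / (c + 1)) (KBD K1 K3) _) _; last first.
      by rewrite -/c mulrCA ler_piMr ?(ltW e0)// ler_pdivrMr ?ltr_wpDl// mul1r lerDl.
    move=> v; rewrite mulN1r distrC.
    have [vB|vB] := leP `|v| B; first exact: Ht.
    have Z u : f (cs u v) = 0.
      apply: contrapT => /eqP /sf uB; move: vB; rewrite ltNge.
      by rewrite (le_trans _ uB)//; case: (norm_cs u v).
    by rewrite !Z subrr normr0 ltW.
  move=> sI; rewrite leNgt; apply: contraNN sI => sB.
  rewrite (_ : (fun v => _) = (fun=> 0)) ?I0//; apply/funext => v.
  apply: contrapT => /eqP /sf uB; move: sB; rewrite ltNge.
  by rewrite (le_trans _ uB)//; case: (norm_cs s v).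
have Int f : KB B f -> mu.-integrable [set: R] (EFin \o (fun s => It (fun v : 'rV[R]_k => f (cs s v)))).
  by move=> /H[c s]; case: (integrable_KB c s).
split; last first.
  move=> f Kf /=.
  have -> : (fun s : R => integral_rV (fun v : 'rV[R]_k => (f (row_mx s%:M v))%:E)) =
      (fun s => (It (fun v : 'rV[R]_k => f (cs s v)))%:E).
    by apply/funext => s; exact: (IE _ (KB_cs s Kf)).
  by rewrite /Rintegral fineK// integrable_fin_num//; exact: Int.
split.
- move=> f g Kf Kg /=; rewrite -RintegralD ?Int//; congr Rintegral.
  by apply/funext => s; rewrite ID//; exact: KB_cs.
- move=> c f Kf /=; rewrite -RintegralZl ?Int//; congr Rintegral.
  by apply/funext => s; rewrite IZ//; exact: KB_cs.
- move=> f g Kf Kg fg /=; apply: le_Rintegral; rewrite ?Int// => s _.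
  by apply: Ile => //; exact: KB_cs.
- move=> f M Kf fM /=; have [cI sI] := H f Kf.
  have [J JE] := integrable_KB cI sI.
  have J' : mu.-integrable `[- B, B] (EFin \o (fun s => It (fun v : 'rV[R]_k => f (cs s v)))).
    by apply: integrableS J.
  rewrite JE; apply: le_trans (le_normr_Rintegral _ J') _ => //.
  apply: (@le_trans _ _ (\int[mu]_(t in `[- B, B]) ((2 * B) ^+ k * M))).
    apply: le_Rintegral => //.
    + exact: integrable_norm.
    + apply: continuous_compact_integrable; first exact: segment_compact.
      by apply: continuous_subspaceT => ?; exact: for_cst.
    + by move=> s _; apply: Ibd => //; exact: KB_cs.
  have wE : fine (mu `[- B, B]%classic) = 2 * B.
    rewrite lebesgue_measure_itv /= lte_fin; case: ifPn => [_|].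
      by rewrite opprK -mulr2n mulr_natl.
    rewrite -leNgt => BB; have -> : B = 0 by apply/eqP; rewrite eq_le B0 andbT; move: BB B0; lra.
    by rewrite /= mulr0.
  rewrite Rintegral_cst// -[X in _ * X]/(fine (mu `[- B, B]%classic)) wE.
  by rewrite exprS mulrC mulrA.
Qed.

Lemma ItD k B (f g : 'rV[R]_k -> R) : 0 <= B -> KB B f -> KB B g ->
  It (fun v => f v + g v) = It f + It g.
Proof. by move=> B0; have [[H _ _ _] _] := It_props k B0; exact: H. Qed.

Lemma ItZ k B c (f : 'rV[R]_k -> R) : 0 <= B -> KB B f -> It (fun v => c * f v) = c * It f.
Proof. by move=> B0; have [[_ H _ _] _] := It_props k B0; exact: H. Qed.

Lemma It_le k B (f g : 'rV[R]_k -> R) : 0 <= B -> KB B f -> KB B g ->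
  (forall v, f v <= g v) -> It f <= It g.
Proof. by move=> B0; have [[_ _ H _] _] := It_props k B0; exact: H. Qed.

Lemma It_bound k B (f : 'rV[R]_k -> R) (M : R) : 0 <= B -> KB B f ->
  (forall v, `|f v| <= M) -> `|It f| <= (2 * B) ^+ k * M.
Proof. by move=> B0; have [[_ _ _ H] _] := It_props k B0; exact: H. Qed.

Lemma KB0 k B : KB B (fun _ : 'rV[R]_k => 0).
Proof. by split=> [v|v]; [exact: for_cst|rewrite eqxx]. Qed.

Lemma It0 k : It (fun _ : 'rV[R]_k => 0) = 0.
Proof.
rewrite -[RHS](mul0r (It (fun _ : 'rV[R]_k => 0))) -(@ItZ _ 0 0 _ _ (KB0 _ _)) //; congr It.
by apply/funext => v; rewrite mul0r.
Qed.

Lemma It_ge0 k B (f : 'rV[R]_k -> R) : 0 <= B -> KB B f -> (forall v, 0 <= f v) -> 0 <= It f.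
Proof. by move=> B0 Kf f0; rewrite -(It0 k); apply: It_le Kf f0 => //; exact: KB0. Qed.

Lemma It_section k B (f : 'rV[R]_(1 + k) -> R) : 0 <= B -> KB B f ->
  continuous (fun s => It (fun v => f (cs s v))) /\
  forall s, It (fun v => f (cs s v)) != 0 -> `|s| <= B.
Proof.
move=> B0 Kf; have [cf sf] := Kf; split => [s|s].
  apply/cvgrPdist_le => /= e e0.
  pose c := (2 * B) ^+ k; have c0 : 0 <= c by rewrite exprn_ge0// mulr_ge0.
  have e1 : 0 < e / (c + 1) by rewrite divr_gt0// ltr_wpDl.
  have := tube (@compact_ball k B) (fun v _ => cf (cs s v)) e1.
  apply: filterS => t Ht.
  have K1 := KB_cs s Kf; have K2 := KB_cs t Kf; have K3 := KBZ (- 1) K2.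
  have -> : It (fun v => f (cs s v)) - It (fun v => f (cs t v)) =
      It (fun v => f (cs s v) + - 1 * f (cs t v)).
    by rewrite (ItD B0 K1 K3) (ItZ _ B0 K2) mulN1r.
  apply: le_trans (@It_bound _ _ _ (e / (c + 1)) B0 (KBD K1 K3) _) _; last first.
    by rewrite -/c mulrCA ler_piMr ?(ltW e0)// ler_pdivrMr ?ltr_wpDl// mul1r lerDl.
  move=> v; rewrite mulN1r distrC.
  have [vB|vB] := leP `|v| B; first exact: Ht.
  have Z u : f (cs u v) = 0.
    apply: contrapT => /eqP /sf uB; move: vB; rewrite ltNge.
    by rewrite (le_trans _ uB)//; case: (norm_cs u v).
  by rewrite !Z subrr normr0 ltW.
move=> sI; rewrite leNgt; apply: contraNN sI => sB.
rewrite (_ : (fun v => _) = (fun=> 0)) ?It0//; apply/funext => v.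
apply: contrapT => /eqP /sf uB; move: sB; rewrite ltNge.
by rewrite (le_trans _ uB)//; case: (norm_cs s v).
Qed.

(** Monotone convergence in one variable after the other. The limit f may be discontinuous: it will
    be a density cut off by the indicator of a superlevel set. *)
Lemma integral_rV_cvg k B (f_ : nat -> 'rV[R]_k -> R) (f : 'rV[R]_k -> R) : 0 <= B ->
  (forall n, KB B (f_ n)) -> (forall n v, 0 <= f_ n v) ->
  (forall v n m, (n <= m)%N -> f_ n v <= f_ m v) ->
  (forall v, f_ n v @[n --> \oo] --> f v) ->
  (It (f_ n))%:E @[n --> \oo] --> integral_rV (fun v => (f v)%:E).
Proof.
move=> B0; elim: k f_ f => [|k IH] f_ f Kf f0 fle fc; first by apply: cvg_EFin; [exact: nearW|exact: (fc 0)].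
have H s : (It (fun v : 'rV[R]_k => f_ n (cs s v)))%:E @[n --> \oo] -->
     integral_rV (fun v : 'rV[R]_k => (f (cs s v))%:E).
  apply: (IH (fun n v => f_ n (cs s v)) (fun v => f (cs s v))) => [n|n v|v n m nm|v].
  - exact: KB_cs.
  - exact: f0.
  - exact: fle.
  - exact: fc.
rewrite /=.
have -> : (fun s : R => integral_rV (fun v : 'rV[R]_k => (f (row_mx s%:M v))%:E)) =
    (fun s => limn (fun n => (It (fun v : 'rV[R]_k => f_ n (cs s v)))%:E)).
  by apply/funext => s; apply/esym/cvg_lim; [|exact: H].
have E n : (It (f_ n))%:E = (\int[mu]_(s in [set: R]) (It (fun v : 'rV[R]_k => f_ n (cs s v)))%:E)%E.
  have [c s] := It_section B0 (Kf n).
  have [J _] := integrable_KB c s.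
  by rewrite /= /Rintegral fineK// integrable_fin_num.
rewrite (_ : (fun n => _) = (fun n => \int[mu]_(s in [set: R]) (It (fun v : 'rV[R]_k => f_ n (cs s v)))%:E)%E); last first.
  by apply/funext => n; exact: E.
apply: cvg_monotone_convergence => //.
- move=> n; apply/measurable_EFinP; apply: continuous_measurable_fun.
  by have [] := It_section B0 (Kf n).
- by move=> n s _; rewrite lee_fin; apply: It_ge0 B0 (KB_cs s (Kf n)) _.
- move=> s _ n m nm; rewrite lee_fin; apply: It_le B0 (KB_cs s (Kf n)) (KB_cs s (Kf m)) _.
  by move=> v; exact: fle.
Qed.

Lemma is_derive_bound (F : R -> R) (t0 l : R) :
  (forall e, 0 < e -> \forall t \near t0, `|F t - F t0 - (t - t0) * l| <= e * `|t - t0|) ->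
  is_derive t0 1 F l.
Proof.
move=> H; suff C : (fun h : R => h^-1 *: ((F \o shift t0) (h *: 1) - F t0)) @ 0^' --> l.
  by split; [apply/cvg_ex; exists l|apply/cvg_lim].
apply/cvgrPdist_le => /= e /H /nbhs_ballP[d /= d0 dP].
rewrite near_withinE; apply/nbhs_ballP; exists d => //= h.
rewrite -ball_normE /ball_ /= sub0r normrN => hd h0.
have := dP (h + t0); rewrite -ball_normE /ball_ /= opprD addrCA subrr addr0 normrN => /(_ hd).
rewrite addrK -ler_pdivrMr ?normr_gt0// -normfV -normrM => E.
apply: le_trans E; rewrite [h *: 1]mulr1 -[_ *: _]/(_ * _) distrC le_eqVlt; apply/orP; left.
apply/eqP; congr `| _ |; move: (F _) (F _) => p q; by field.
Qed.

Lemma It_derive k B (h : R -> 'rV[R]_k -> R) (g : 'rV[R]_k -> R) (t0 : R) : 0 <= B ->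
  (\forall t \near t0, KB B (h t)) -> KB B g ->
  (forall e, 0 < e -> \forall t \near t0, forall v,
     `|h t v - h t0 v - (t - t0) * g v| <= e * `|t - t0|) ->
  is_derive t0 1 (fun t => It (h t)) (It g).
Proof.
move=> B0 Kh Kg H; apply: is_derive_bound => e e0.
pose c := (2 * B) ^+ k; have c0 : 0 <= c by rewrite exprn_ge0// mulr_ge0.
have e1 : 0 < e / (c + 1) by rewrite divr_gt0// ltr_wpDl.
have K0 := nbhs_singleton Kh.
apply: filterS2 Kh (H _ e1) => t Kt Ht.
have K1 := KBZ (- 1) K0; have K2 := KBZ (- (t - t0)) Kg.
have -> : It (h t) - It (h t0) - (t - t0) * It g =
   It (fun v => h t v + - 1 * h t0 v + - (t - t0) * g v).
  by rewrite (ItD B0 (KBD Kt K1) K2) (ItD B0 Kt K1) (ItZ _ B0 K0) (ItZ _ B0 Kg) mulN1r mulNr.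
apply: le_trans (@It_bound _ _ _ (e / (c + 1) * `|t - t0|) B0 (KBD (KBD Kt K1) K2) _) _.
  by move=> v; rewrite mulN1r mulNr; exact: Ht.
rewrite -/c mulrA; apply: ler_wpM2r => //.
by rewrite mulrCA ler_piMr ?(ltW e0)// ler_pdivrMr ?ltr_wpDl// mul1r lerDl.
Qed.

Lemma cs_shift k (t t0 : R) (v : 'rV[R]_k) :
  cs t v = (t - t0) *: delta_mx 0 (lshift k 0) + cs t0 v.
Proof.
apply/rowP; apply: split_ord1 => [|i]; rewrite [RHS]mxE [X in X + _]mxE [X in _ * X + _]mxE.
  by rewrite !csl !eqxx mulr1 subrK.
rewrite !csr (_ : (rshift 1 i == lshift k 0) = false) ?andbF ?mulr0 ?add0r//.
Qed.

Lemma zero_partial k (f : 'rV[R]_k -> R) B v b : (forall w, f w != 0 -> `|w| <= B) ->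
  B < `|v| -> partial b f v = 0.
Proof.
move=> sf vB; rewrite -[RHS](partial_cst 0 b v); apply: near_partial.
have := near_comp_cont (@norm_continuous _ _ v) (near_gt vB).
by apply: filterS => w wB; apply: contrapT => /eqP /sf; rewrite leNgt wB.
Qed.

(** On the ball of radius B the mean value theorem and [tube] bring the difference quotient
    uniformly close to the partial derivative; outside the ball everything vanishes. *)
Lemma It_param_derive k B (f : 'rV[R]_(1 + k) -> R) (t0 : R) : 0 <= B ->
  (\forall t \near t0, forall v, Cat 1 f (cs t v)) ->
  (\forall t \near t0, forall v, f (cs t v) != 0 -> `|v| <= B) ->
  KB B (fun v => partial (lshift k 0) f (cs t0 v)) /\
  is_derive t0 1 (fun t => It (fun v => f (cs t v))) (It (fun v => partial (lshift k 0) f (cs t0 v))).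
Proof.
move=> B0 Cf sf.
have cp (v : 'rV[R]_k) : {for cs t0 v, continuous (partial (lshift k 0) f)}.
  exact: Cat_continuous (Cat_partial (lshift k 0) (nbhs_singleton Cf v)).
have Kg : KB B (fun v => partial (lshift k 0) f (cs t0 v)).
  split=> v.
    apply: (@continuous_comp _ _ _ (fun v : 'rV[R]_k => cs t0 v) (partial (lshift k 0) f)); last exact: cp.
    by apply: continuous_cs; [exact: for_cst|exact: for_id].
  apply: contra_neqT; rewrite -ltNge => vB.
  rewrite /= -[RHS](partial_cst 0 (lshift k 0) (cs t0 v)); apply: near_partial.
  have c1 : {for cs t0 v, continuous (fun w : 'rV[R]_(1 + k) => `|rsubmx w : 'rV[R]_k|)}.
    apply: (@continuous_comp _ _ _ (fun w : 'rV[R]_(1 + k) => rsubmx w : 'rV[R]_k) (fun v => `|v|)).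
      by apply: differentiable_continuous; exact: differentiable_rsubmx.
    exact: norm_continuous.
  have c2 := @continuous_coord R _ (lshift k 0) (cs t0 v).
  have H1 : \forall w \near cs t0 v, B < `|rsubmx w : 'rV[R]_k|.
    by apply: (near_comp_cont c1 (P := fun x => B < x)); apply: near_gt; rewrite /cs row_mxKr.
  have H2 : \forall w \near cs t0 v, forall u : 'rV[R]_k, f (cs ((w : 'rV[R]_(1 + k)) 0 (lshift k 0)) u) != 0 -> `|u| <= B.
    by apply: (near_comp_cont c2 (P := fun s => forall u : 'rV[R]_k, f (cs s u) != 0 -> `|u| <= B)); rewrite csl.
  apply: filterS2 H1 H2 => w wB; rewrite {2}(csP w) => H.
  by apply: contrapT => /eqP /H; rewrite leNgt wB.
split=> //; apply: (@It_derive k B (fun t v => f (cs t v))) => //.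
  apply: filterS2 Cf sf => t Ct st; split=> [v|]; last exact: st.
  apply: (@continuous_comp _ _ _ (fun v : 'rV[R]_k => cs t v) f); last exact: Cat_continuous (Ct v).
  by apply: continuous_cs; [exact: for_cst|exact: for_id].
move=> e e0.
have tb := tube (@compact_ball k B) (fun v _ => cp v) e0.
have /nbhs_ballP[d /= d0 dP] : \forall t \near t0,
    ((forall v, Cat 1 f (cs t v)) /\ (forall v, f (cs t v) != 0 -> `|v| <= B)) /\
    (forall v : 'rV[R]_k, `|v| <= B ->
      `|partial (lshift k 0) f (cs t v) - partial (lshift k 0) f (cs t0 v)| <= e).
  exact: filterI (filterI Cf sf) tb.
apply/nbhs_ballP; exists d => //= t td v.
have bt (c : R) : 0 <= c <= 1 -> ball t0 d (c * (t - t0) + t0).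
  move=> /andP[c0 c1]; move: td; rewrite -!ball_normE /ball_ /= => td.
  rewrite opprD addrCA subrr addr0 normrN normrM ger0_norm//.
  by apply: le_lt_trans (ler_piMl _ c1) _ => //; rewrite distrC.
have ce (c : R) : cs (c * (t - t0) + t0) v =
    c *: ((t - t0) *: delta_mx 0 (lshift k 0)) + cs t0 v.
  by rewrite (cs_shift _ t0) addrK scalerA.
have [vB|vB] := leP `|v| B; last first.
  have [[_ s1] _] := dP t td; have s0 := nbhs_singleton sf.
  have -> : f (cs t v) = 0 by apply: contrapT => /eqP /s1; rewrite leNgt vB.
  have -> : f (cs t0 v) = 0 by apply: contrapT => /eqP /s0; rewrite leNgt vB.
  have -> : partial (lshift k 0) f (cs t0 v) = 0.
    by apply: contrapT => /eqP /(Kg.2 v); rewrite leNgt vB.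
  by rewrite mulr0 !subr0 normr0 mulr_ge0 ?(ltW e0).
have [|c c01 E] := @mvt_line _ _ f (cs t0 v) ((t - t0) *: delta_mx 0 (lshift k 0)).
  move=> c c01; rewrite -ce; apply: diff_derivable.
  by have [[C1 _] _] := dP _ (bt _ c01); exact: Cat_differentiable (C1 v).
rewrite -(cs_shift t t0 v) -ce in E; rewrite E.
have [[C1 _] T1] := dP _ (bt _ c01).
rewrite deriveZv; last exact: diff_derivable (Cat_differentiable (C1 v)).
rewrite -[_ *: _]/(_ * _) -mulrBr normrM mulrC; apply: ler_wpM2r => //.
exact: (T1 v vB).
Qed.

Lemma partial_cs k (f : 'rV[R]_(1 + k) -> R) s (v : 'rV[R]_k) b : differentiable f (cs s v) ->
  partial b (fun w => f (cs s w)) v = partial (rshift 1 b) f (cs s v).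
Proof.
move=> df; rewrite partial_comp//; last first.
  apply: split_ord1 => [|i].
    by rewrite (_ : (fun w => _) = (fun=> s)); [exact: differentiable_cst|apply/funext => w; rewrite csl].
  rewrite (_ : (fun w => _) = (fun w : 'rV[R]_k => w 0 i)); first exact: differentiable_coord.
  by apply/funext => w; rewrite csr.
rewrite (bigD1 (rshift 1 b))//= big1 ?addr0 => [|j].
  rewrite (_ : partial b _ v = 1) ?mulr1//.
  by under eq_partial do rewrite csr; rewrite partial_coord eqxx.
move: j; apply: split_ord1 => [_|i ib].
  by under [X in _ * X]eq_partial do rewrite csl; rewrite partial_cst mulr0.
under [X in _ * X]eq_partial do rewrite csr.
by rewrite partial_coord (_ : (i == b) = false) ?mulr0//; apply: contra_neqF ib => /eqP ->.
Qed.

(** The divergence theorem for compact support: the inner variables are handled by induction, the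
    outermost one by the fundamental theorem of calculus. *)
Lemma It_partial k B (f : 'rV[R]_k -> R) b : 0 <= B -> (forall v, Cat 1 f v) ->
  (forall v, f v != 0 -> `|v| <= B) -> It (partial b f) = 0.
Proof.
move=> B0; elim: k f b => [|k IH] f b Cf sf; first by case: b.
have sfs s (v : 'rV[R]_k) : f (cs s v) != 0 -> `|v| <= B.
  by move=> /sf; apply: le_trans; case: (norm_cs s v).
have Cs s (v : 'rV[R]_k) : Cat 1 (fun w => f (cs s w)) v.
  apply: (@Cat_comp _ _ _ _ f (fun w => cs s w)); first exact: Cf.
  apply: (@split_ord1 k) => [|i].
    by apply: eq_Cat (Cat_cst _ s _) => w; rewrite csl.
  by apply: eq_Cat (Cat_coord _ i _) => w; rewrite csr.
have Kp : KB B (partial b f).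
  split=> v; first exact: Cat_continuous (Cat_partial b (Cf v)).
  by apply: contra_neqT; rewrite -ltNge => vB; exact: zero_partial sf vB.
move: (b : 'I_(1 + k)) Kp; apply: split_ord1 => [|i] Kp; last first.
  rewrite /= (_ : (fun s => _) = (fun=> 0)) ?Rintegral_cst ?mul0r//.
  apply/funext => s; rewrite -(IH (fun v => f (cs s v)) i (Cs s) (sfs s)); congr It.
  by apply/funext => v; rewrite partial_cs//; exact: Cat_differentiable (Cf _).
pose F s := It (fun v : 'rV[R]_k => f (cs s v)).
have dF (s : R) : is_derive s 1 F (It (fun v : 'rV[R]_k => @partial R (1 + k) (lshift k 0) f (cs s v))).
  by have [] := @It_param_derive k B f s B0 (@near_all _ s _ (fun t v => Cf (cs t v)))
    (@near_all _ s _ (fun t v => sfs t v)).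
have [cI sI] := It_section B0 Kp.
(* The interval of integration is enlarged to radius B + 1 because [F] is known to vanish only where
   B < |s|, hence not at the points B and -B. *)
have B1 : 0 < B + 1 by rewrite ltr_wpDl.
have sI' (s : R) : It (fun v : 'rV[R]_k => @partial R (1 + k) (lshift k 0) f (cs s v)) != 0 -> `|s| <= B + 1.
  by move=> /sI h; apply: le_trans h _; rewrite lerDl.
have [_ E] := @integrable_KB (B + 1) _ cI sI'.
rewrite /= E.
have FB s : B < `|s| -> F s = 0.
  move=> sB; rewrite /F (_ : (fun v => _) = (fun=> 0)) ?It0//; apply/funext => v.
  apply: contrapT => /eqP /sf uB; move: sB; rewrite ltNge.
  by rewrite (le_trans _ uB)//; case: (norm_cs s v).
have cF s : {for s, continuous F}.
  by apply: differentiable_continuous; apply/derivable1_diffP; have [] := dF s.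
rewrite /Rintegral (@continuous_FTC2 _ _ F).
- by rewrite !FB ?subee// ?normrN ger0_norm ?(ltW B1)// ltrDl.
- by rewrite gtrN.
- exact: continuous_subspaceT.
- split; [by move=> s _; have [] := dF s| |].
    by apply: cvg_at_right_filter; exact: cF.
  by apply: cvg_at_left_filter; exact: cF.
- by move=> s _; rewrite derive1E; have [_ ->] := dF s.
Qed.

End IteratedIntegral.

(** * Horizontal layers and continuous approximations of superlevel sets *)

Section LayerCake.
Context {R : realType}.

(** The part of x that lies between the heights j e and (j+1) e. *)
Definition layer (e x : R) (j : nat) : R := Num.min x (j.+1%:R * e) - Num.min x (j%:R * e).

(** Continuous functions that increase with n to the indicator of x > c ([ramp_cvg]). *)
Definition ramp (n : nat) (c x : R) : R := Num.min 1 (n%:R * Num.max 0 (x - c)).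

Lemma sum_layer (e x : R) N : 0 <= x -> x <= N%:R * e -> \sum_(j < N) layer e x j = x.
Proof.
move=> x0 xN; rewrite -(big_mkord xpredT (layer e x)) /layer.
rewrite (telescope_sumr (fun j => Num.min x (j%:R * e)))// mul0r.
by rewrite (min_idPl xN) (min_idPr x0) subr0.
Qed.

Lemma ramp_ge0 n (c x : R) : 0 <= ramp n c x.
Proof. by rewrite le_min ler01 mulr_ge0// le_max lexx. Qed.

Lemma ramp_le1 n (c x : R) : ramp n c x <= 1.
Proof. by rewrite ge_min lexx. Qed.

Lemma ramp_mono n m (c x : R) : (n <= m)%N -> ramp n c x <= ramp m c x.
Proof.
move=> nm; rewrite le_min ramp_le1 /= ge_min; apply/orP; right.
by apply: ler_wpM2r; rewrite ?le_max ?lexx// ler_nat.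
Qed.

Lemma ramp_cvg (c x : R) : ramp n c x @[n --> \oo] --> ((c < x)%R%:R : R).
Proof.
case: ltP => cx.
  apply: cvg_near_cst; have xc : 0 < x - c by rewrite subr_gt0.
  near=> n; rewrite /ramp (max_idPr (ltW xc)); apply/min_idPl.
  rewrite -ler_pdivrMr// div1r; near: n; exact: nbhs_infty_ger.
apply: cvg_near_cst; apply: nearW => n.
by rewrite /ramp (max_idPl _) ?subr_le0// mulr0 (min_idPr _).
Unshelve. all: by end_near. Qed.

Lemma layerE (e x : R) j : 0 < e -> layer e x j = Num.min e (Num.max 0 (x - j%:R * e)).
Proof.
move=> e0; rewrite /layer -natr1 mulrDl mul1r; move: (j%:R * e) => w.
by case: (leP x (w + e)); case: (leP x w); case: (leP 0 (x - w)); case: (leP e _); lra.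
Qed.

Lemma layer_ge0 (e x : R) j : 0 < e -> 0 <= layer e x j.
Proof. by move=> e0; rewrite layerE// le_min (ltW e0) le_max lexx. Qed.

Lemma layer_lower (e x : R) j n : 0 < e -> e * ramp n (j.+1%:R * e) x <= layer e x j.
Proof.
move=> e0; rewrite layerE// /ramp -natr1 mulrDl mul1r; move: (j%:R * e) => w.
have [ux|ux] := leP x (w + e).
  rewrite (max_idPl _) ?subr_le0// mulr0 (min_idPr _)// mulr0 le_min (ltW e0) le_max lexx//.
rewrite [leRHS](min_idPl _); last by rewrite le_max; apply/orP; right; move: ux; lra.
by rewrite ler_piMr ?(ltW e0)// ge_min lexx.
Qed.

(** The layer rises with slope 1 from height j e, and e times the ramp with slope n e; both are
    capped at e, so the ramp lies above as soon as n e >= 1. *)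
Lemma layer_upper (e x : R) j n : 0 < e -> 1 <= n%:R * e ->
  layer e x j <= e * ramp n (j%:R * e) x.
Proof.
move=> e0 ne; rewrite layerE// /ramp; move: (j%:R * e) => w.
rewrite minr_pMr ?(ltW e0)// mulr1 le_min ge_min lexx /= ge_min; apply/orP; right.
by rewrite mulrA [e * _]mulrC ler_peMl// le_max lexx.
Qed.

Lemma layer_le (e x : R) j : 0 < e -> layer e x j <= e * (j%:R * e < x)%R%:R.
Proof.
move=> e0; rewrite layerE//; case: ltP => [xj|xj]; first by rewrite mulr1 ge_min lexx.
by rewrite mulr0 ge_min (max_idPl _) ?subr_le0// lexx orbT.
Qed.

Lemma layer_ge (e x : R) j : 0 < e -> e * (j.+1%:R * e < x)%R%:R <= layer e x j.
Proof.
move=> e0; rewrite layerE//; case: ltP => [xj|_]; last by rewrite mulr0 le_min (ltW e0) le_max lexx.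
rewrite mulr1 le_min lexx /= le_max; apply/orP; right.
by move: xj; rewrite -natr1 mulrDl mul1r => /ltW; rewrite -lerBrDl.
Qed.

Lemma continuous_ramp n (c : R) : continuous (ramp n c).
Proof.
move=> x; rewrite /ramp.
apply: (@continuous_min _ _ (fun=> 1) (fun x => n%:R * Num.max 0 (x - c))); first exact: for_cst.
apply: continuousM; first exact: for_cst.
apply: (@continuous_max _ _ (fun=> 0) (fun x => x - c)); first exact: for_cst.
by apply: continuousB; [exact: for_id|exact: for_cst].
Qed.

Lemma continuous_layer (e : R) j : continuous (fun x => layer e x j).
Proof.
move=> x; rewrite /layer.
apply: (@continuousB R R R (fun x : R => Num.min x (j.+1%:R * e)) (fun x : R => Num.min x (j%:R * e))).
  by apply: (@continuous_min _ _ (fun x => x) (fun=> _)); [exact: for_id|exact: for_cst].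
by apply: (@continuous_min _ _ (fun x => x) (fun=> _)); [exact: for_id|exact: for_cst].
Qed.

Lemma ramp0 n (c : R) : 0 <= c -> ramp n c 0 = 0.
Proof. by move=> c0; rewrite /ramp sub0r (max_idPl _) ?oppr_le0// mulr0 (min_idPr _). Qed.

Lemma layer0 (e : R) j : 0 < e -> layer e 0 j = 0.
Proof.
move=> e0; rewrite layerE// sub0r (max_idPl _) ?oppr_le0 ?mulr_ge0 ?(ltW e0)//.
by rewrite (min_idPr _)// ltW.
Qed.

End LayerCake.

(** * Integrals against a measure whose values are iterated integrals *)

Section MeasureLink.
Context {R : realType} {M : ptopologicalType} {k : nat}.
Context (mu : {measure set (borel M) -> \bar R}).

Lemma continuous_zero_ext (V K : set 'rV[R]_k) (G : 'rV[R]_k -> R) : open V -> closed K ->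
  K `<=` V -> (forall y, V y -> {for y, continuous G}) -> (forall y, ~ K y -> G y = 0) ->
  continuous G.
Proof.
move=> oV cK KV cG G0 y; have [Vy|Vy] := pselect (V y); first exact: cG.
apply: (@near_eq_continuous _ _ (fun=> 0)); last exact: for_cst.
have : \forall z \near y, ~ K z.
  by apply: open_nbhs_nbhs; split; [exact: closed_openC|move=> /KV].
by apply: filterS => z /G0.
Qed.

(** Only the measures of sets are given as iterated integrals, so q is recovered by the layer-cake
    formula. Let a(c) be the measure of {q > c}. For every thickness e, layer j contributes between
    e a((j+1) e) and e a(j e) to both sides, so the two sides differ by a telescoping sum, at most e
    a(0), and e is arbitrary. *)
Lemma integral_local (V K : set 'rV[R]_k) (psi : 'rV[R]_k -> M) (D : 'rV[R]_k -> R)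
    (q : M -> R) (B : R) :
  0 <= B -> open V -> compact K -> K `<=` V -> (forall y, K y -> `|y| <= B) ->
  (forall y, V y -> 0 <= D y) -> (forall y, V y -> {for y, continuous D}) ->
  (forall A : set (borel M), measurable A -> A `<=` psi @` V ->
     mu A = integral_rV (fun y => if `[< V y /\ A (psi y) >] then (D y)%:E else 0%E)) ->
  measurable_fun [set: borel M] (q : borel M -> R) ->
  (forall p, 0 <= q p) -> (forall p, q p != 0 -> (psi @` V) p) ->
  (forall y, V y -> {for y, continuous (q \o psi)}) ->
  (forall y, V y -> q (psi y) != 0 -> K y) ->
  (\int[mu]_(p in [set: borel M]) (q p)%:E)%E =
    (It (fun y => if `[< V y >] then q (psi y) * D y else 0))%:E.
Proof.
move=> B0 oV cK KV KB_ D0 cD H mq q0 qV cq qK.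
have clK : closed K by apply: compact_closed => //; exact: norm_hausdorff.
have nV y : V y -> \forall z \near y, V z by move=> Vy; exact: open_nbhs_nbhs.
pose T (F : R -> R) y := if `[< V y >] then F (q (psi y)) * D y else 0.
have KT (F : R -> R) : continuous F -> F 0 = 0 -> KB B (T F).
  move=> cF F0; have T0 y : ~ K y -> T F y = 0.
    move=> Ky; rewrite /T; case: asboolP => // Vy.
    have -> : q (psi y) = 0 by apply: contrapT => /eqP /(qK _ Vy).
    by rewrite F0 mul0r.
  split; last by move=> y; have [/KB_//|/T0 ->] := pselect (K y); rewrite eqxx.
  apply: (continuous_zero_ext oV clK KV) T0 => y Vy.
  have c1 := @continuous_comp _ _ _ (q \o psi) F y (cq y Vy) (cF _).
  apply: near_eq_continuous (continuousM c1 (cD y Vy)).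
  by apply: filterS (nV y Vy) => z Vz; rewrite /T asboolT.
have T_ge0 (F : R -> R) y : (forall x, 0 <= F x) -> 0 <= T F y.
  by move=> F0; rewrite /T; case: asboolP => // Vy; rewrite mulr_ge0 ?D0.
have T_le (F F' : R -> R) y : (forall x, 0 <= x -> F x <= F' x) -> T F y <= T F' y.
  by move=> FF; rewrite /T; case: asboolP => // Vy; apply: ler_wpM2r; [exact: D0|exact: FF].
pose A (c : R) : set (borel M) := [set p | c < q p].
have mA c : measurable (A c).
  have := mq measurableT _ (measurable_itv `]c, +oo[); rewrite setTI.
  by rewrite (_ : _ @^-1` _ = A c)//; apply/seteqP; split => p /=; rewrite in_itv/= andbT.
(* The ramps increase to the indicator of {q > c}; as c >= 0, this set lies in the image of psi,
   where mu is known. *)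
have L (c : R) : 0 <= c -> (It (T (ramp n c)))%:E @[n --> \oo] --> mu (A c).
  move=> c0; rewrite H//; last by move=> p cp; apply: qV; rewrite gt_eqF// (le_lt_trans c0).
  have -> : (fun y => if `[< V y /\ A c (psi y) >] then (D y)%:E else 0%E) =
     (fun y => (T (fun x => (c < x)%R%:R) y)%:E).
    apply/funext => y; rewrite /T /A /=; case: (asboolP (V y)) => Vy; last first.
      by rewrite asboolF// => -[].
    case: ltP => cx; first by rewrite asboolT// mul1r.
    by rewrite asboolF ?mul0r// => -[].
  apply: integral_rV_cvg B0 _ _ _ _.
  - by move=> n; apply: KT; [exact: continuous_ramp|exact: ramp0].
  - by move=> n y; apply: T_ge0 => x; exact: ramp_ge0.
  - by move=> y n m nm; apply: T_le => x _; exact: ramp_mono.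
  - move=> y; rewrite /T; case: asboolP => Vy; last exact: cvg_cst.
    by apply: cvgM; [exact: ramp_cvg|exact: cvg_cst].
have bounded (G : 'rV[R]_k -> R) : (forall y, V y -> {for y, continuous G}) ->
    exists Q : R, 0 <= Q /\ forall y, K y -> `|G y| <= Q.
  move=> cG.
  have : \forall N \near +oo, K `<=` (fun y => `|G y| <= N).
    apply: ((compact_near_coveringP K).1 cK R (pinfty_nbhs R) (fun N y => `|G y| <= N)) => y Ky.
    have H1 : \forall z \near y, `|G y - G z| <= 1.
      by have /cvgrPdist_le := cG y (KV _ Ky); apply.
    have H2 : \forall N \near +oo, `|G y| + 1 <= N by exact: nbhs_pinfty_ge.
    exists ([set z | `|G y - G z| <= 1], [set N | `|G y| + 1 <= N]) => // -[z N] /= [h1 h2].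
    apply: le_trans h2; rewrite -lerBlDl; apply: le_trans (lerB_dist _ _) _.
    by rewrite distrC.
  case/filter_ex => N KN; exists (Num.max 0 N); rewrite le_max lexx; split => // y /KN h.
  by rewrite le_max h orbT.
have [DM [DM0 DMP]] := bounded D cD.
have [QM [QM0 QMP]] := bounded (q \o psi) cq.
have fin (c : R) : 0 <= c -> exists a : R, mu (A c) = a%:E.
  move=> c0; exists (fine (mu (A c))); rewrite fineK// ge0_fin_numE//.
  apply: (@le_lt_trans _ _ ((2 * B) ^+ k * DM)%:E); last exact: ltry.
  rewrite -(cvg_lim _ (L c c0))//; apply: lime_le; first by apply/cvg_ex; eexists; exact: L.
  apply: nearW => n; rewrite lee_fin; apply: le_trans (ler_norm _) _.
  apply: It_bound B0 (KT _ (@continuous_ramp R n c) (ramp0 n c0)) _ => y.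
  rewrite /T; case: asboolP => Vy; last by rewrite normr0.
  have [Ky|Ky] := pselect (K y).
    rewrite normrM -[leRHS]mul1r ler_pM//; first by rewrite ger0_norm ?ramp_le1// ramp_ge0.
    exact: DMP.
  have -> : q (psi y) = 0 by apply: contrapT => /eqP /(qK _ Vy).
  by rewrite ramp0// mul0r normr0.
have [a aE] : exists a : R -> R, forall c, 0 <= c -> mu (A c) = (a c)%:E.
  exists (fun c => fine (mu (A c))) => c c0; have [b ->] := fin c c0.
  by [].
have La (c : R) : 0 <= c -> It (T (ramp n c)) @[n --> \oo] --> a c.
  by move=> c0; have := L c c0; rewrite aE// => /fine_cvgP[_].
have qle p : q p <= QM.
  have [->|qp] := eqVneq (q p) 0; first by [].
  have [y Vy yp] := qV p qp; move: (qp); rewrite -yp => /(qK y Vy) Ky.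
  exact: le_trans (ler_norm _) (QMP _ Ky).
have ne (e : R) (c : nat) : 0 < e -> 0 <= c%:R * e by move=> e0; rewrite mulr_ge0// ltW.
have KL (e : R) j (e0 : 0 < e) := KT _ (@continuous_layer R e j) (layer0 j e0).
(* The estimate of a layer on the side of [It]: it sits between e times two ramps, whose integrals
   converge to e times the measures at the two ends of the layer. *)
have X (e : R) j : 0 < e -> e * a (j.+1%:R * e) <= It (T (fun x => layer e x j)) <= e * a (j%:R * e).
  move=> e0; have KR n c := KT _ (@continuous_ramp R n (c%:R * e)) (ramp0 n (ne e c e0)).
  have C (c : nat) : It (fun y => e * T (ramp n (c%:R * e)) y) @[n --> \oo] --> e * a (c%:R * e).
    rewrite (_ : (fun n => _) = (fun n => e * It (T (ramp n (c%:R * e))))).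
      by apply: cvgM; [exact: cvg_cst|exact: La (ne e c e0)].
    by apply/funext => n; rewrite (ItZ e B0 (KR n c)).
  have C' (c : nat) : cvg (It (fun y => e * T (ramp n (c%:R * e)) y) @[n --> \oo]).
    by apply/cvg_ex; eexists; exact: C.
  apply/andP; split.
    rewrite -(cvg_lim _ (C j.+1))//; apply: limr_le => //; apply: nearW => n.
    apply: It_le B0 (KBZ e (KR n j.+1)) (KL e j e0) _ => y; rewrite /T.
    case: asboolP => Vy; last by rewrite mulr0.
    by rewrite mulrA; apply: ler_wpM2r; [exact: D0|exact: layer_lower].
  rewrite -(cvg_lim _ (C j))//; apply: limr_ge => //; near=> n.
  apply: It_le B0 (KL e j e0) (KBZ e (KR n j)) _ => y; rewrite /T.
  case: asboolP => Vy; last by rewrite mulr0.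
  rewrite mulrA; apply: ler_wpM2r; [exact: D0|apply: layer_upper => //].
  by rewrite -ler_pdivrMr// div1r; near: n; exact: nbhs_infty_ger.
have XS (e : R) N : 0 < e -> KB B (T (fun x => \sum_(j < N) layer e x j)) /\
    It (T (fun x => \sum_(j < N) layer e x j)) = \sum_(j < N) It (T (fun x => layer e x j)).
  move=> e0; elim: N => [|N [IK IE]].
    rewrite (_ : T _ = fun=> 0) ?big_ord0 ?It0; first by split=> //; exact: KB0.
    by apply/funext => y; rewrite /T big_ord0 mul0r; case: ifP.
  rewrite (_ : T _ = fun y => T (fun x => \sum_(j < N) layer e x j) y + T (fun x => layer e x N) y).
    by rewrite big_ord_recr /= -IE -(ItD B0 IK (KL e N e0)); split=> //; exact: KBD (KL e N e0).
  by apply/funext => y; rewrite /T big_ord_recr /= mulrDl; case: ifP; rewrite ?addr0.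
have mL (e : R) j : measurable_fun [set: borel M] (fun p : borel M => (layer e (q p) j)%:E).
  apply/measurable_EFinP.
  by apply: (measurableT_comp (continuous_measurable_fun (@continuous_layer R e j)) mq).
have mI (c : R) : measurable_fun [set: borel M] (fun p : borel M => (\1_(A c) p : R)%:E).
  by apply/measurable_EFinP; exact: measurable_indic.
have IA (e c : R) : 0 < e -> 0 <= c ->
    (\int[mu]_(p in [set: borel M]) (e%:E * (\1_(A c) p : R)%:E))%E = (e * a c)%:E.
  move=> e0 c0.
  have P0 (p : borel M) : [set: borel M] p -> (0 <= (\1_(A c) p : R)%:E)%E by rewrite lee_fin.
  rewrite (@ge0_integralZl_EFin _ _ R mu _ measurableT _ P0 (mI c) e (ltW e0)).
  by rewrite integral_indic// setIT aE.
have indE (c : R) p : (\1_(A c) p : R) = (c < q p)%R%:R.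
  rewrite indicE; case: (boolP (c < q p)) => h; first by rewrite mem_set.
  by rewrite memNset//; exact/negP.
have Y (e : R) j : 0 < e -> exists b, [/\ (\int[mu]_(p in [set: borel M]) (layer e (q p) j)%:E)%E = b%:E,
    e * a (j.+1%:R * e) <= b & b <= e * a (j%:R * e)].
  move=> e0; set I := (\int[mu]_(p in _) _)%E.
  have I0 : (0 <= I)%E by apply: integral_ge0 => p _; rewrite lee_fin layer_ge0.
  have I1 : (I <= (e * a (j%:R * e))%:E)%E.
    rewrite -IA ?ne//; apply: ge0_le_integral => //.
    - by move=> p _; rewrite lee_fin layer_ge0.
    - by apply: emeasurable_funM => //; exact: mI.
    - by move=> p _; rewrite -EFinM lee_fin indE; exact: layer_le.
  have I2 : ((e * a (j.+1%:R * e))%:E <= I)%E.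
    rewrite -IA ?ne//; apply: ge0_le_integral => //.
    - by move=> p _; rewrite -EFinM lee_fin mulr_ge0 ?(ltW e0)// indE.
    - by apply: emeasurable_funM => //; exact: mI.
    - by move=> p _; rewrite -EFinM lee_fin indE; exact: layer_ge.
  have If : I \is a fin_num by rewrite ge0_fin_numE// (le_lt_trans I1)// ltry.
  by exists (fine I); rewrite fineK//; split => //; rewrite -lee_fin fineK.
have ages c : 0 <= c -> 0 <= a c by move=> c0; rewrite -lee_fin -aE.
have key (e : R) : 0 < e -> exists b : R, (\int[mu]_(p in [set: borel M]) (q p)%:E)%E = b%:E /\
    `|It (T id) - b| <= e * a 0.
  (* Enough layers of thickness e to exceed [QM], a bound for q. *)
  move=> e0; pose N := (Num.bound (QM / e)).
  have QN : QM <= N%:R * e.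
    by rewrite -ler_pdivrMr// ltW// archi_boundP// divr_ge0// ltW.
  have [b bP] := choice (fun j => Y e j e0).
  exists (\sum_(j < N) b j); split.
    rewrite -sumEFin.
    have -> : (\sum_(j < N) (b j)%:E)%E =
        (\sum_(j < N) \int[mu]_(p in [set: borel M]) (layer e (q p) j)%:E)%E.
      by apply: eq_bigr => j _; have [] := bP j.
    rewrite -ge0_integral_sum//; last by move=> j p _; rewrite lee_fin layer_ge0.
    apply: eq_integral => p _; rewrite sumEFin sum_layer//; exact: le_trans (qle p) QN.
  have [_] := XS e N e0.
  rewrite (_ : T _ = T id); last first.
    apply/funext => y; rewrite /T; case: asboolP => // Vy; rewrite sum_layer//.
    exact: le_trans (qle _) QN.
  move=> ->; rewrite -sumrB; apply: le_trans (ler_norm_sum _ _ _) _.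
  apply: (@le_trans _ _ (\sum_(j < N) (e * a (j%:R * e) - e * a (j.+1%:R * e)))).
    apply: ler_sum => j _; have /andP[x1 x2] := X e j e0; have [_ b1 b2] := bP j.
    by rewrite ler_norml; apply/andP; split; move: x1 x2 b1 b2; lra.
  rewrite -(big_mkord xpredT (fun j => e * a (j%:R * e) - e * a (j.+1%:R * e))).
  under eq_bigr do rewrite -opprB; rewrite sumrN.
  rewrite (telescope_sumr (fun j => e * a (j%:R * e)))// mul0r opprB.
  by rewrite lerBlDr lerDl mulr_ge0 ?(ltW e0)// ages// ne.
have [b [bE _]] := key 1 ltr01.
rewrite bE; congr (_%:E); apply/eqP; rewrite eq_sym -subr_eq0 -normr_le0.
apply/ler_addgt0Pl => e e0; rewrite addr0.
have a1 : 0 < a 0 + 1 by rewrite ltr_wpDl// ages.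
have [b' [b'E]] := key (e / (a 0 + 1)) (divr_gt0 e0 a1).
have <- : b = b' by apply: EFin_inj; rewrite -bE.
move=> h; apply: le_trans h _; rewrite mulrAC ler_pdivrMr// ler_wpM2l ?(ltW e0)//.
by rewrite lerDl.
Unshelve. all: by end_near. Qed.

End MeasureLink.

(** * Changes of coordinates *)

Section Jacobian.
Context {R : realType}.

Definition jac m n (psi : 'rV[R]_m -> 'rV[R]_n) (z : 'rV[R]_m) : 'M[R]_(m, n) :=
  \matrix_(i, j) partial i (fun y => psi y 0 j) z.

Lemma jacobianE m n (psi : 'rV[R]_m -> 'rV[R]_n) (z : 'rV[R]_m) :
  (forall j, differentiable (fun y => psi y 0 j) z) -> 'J psi z = jac psi z.
Proof.
move=> dp; have dp' := differentiable_row dp.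
apply/matrixP => i j; rewrite !mxE -deriveE//.
by rewrite derive_mx; [rewrite mxE|exact: diff_derivable].
Qed.

Lemma Cat_jac m n k (psi : 'rV[R]_m -> 'rV[R]_n) (z : 'rV[R]_m) :
  (forall j, Cat k.+1 (fun y => psi y 0 j) z) -> CatMx k (jac psi) z.
Proof. by move=> Cp i j; apply: eq_Cat (Cat_partial i (Cp j)) => y; rewrite mxE. Qed.

Lemma dvec_comp m n (psi : 'rV[R]_m -> 'rV[R]_n) (f : 'rV[R]_n -> R) (z : 'rV[R]_m) :
  differentiable f (psi z) -> (forall j, differentiable (fun y => psi y 0 j) z) ->
  dvec (fun y => f (psi y)) z = dvec f (psi z) *m (jac psi z)^T.
Proof.
move=> df dp; apply/rowP => i; rewrite !mxE partial_comp//.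
by apply: eq_bigr => j _; rewrite !mxE.
Qed.

Lemma jac_comp m n p (psi : 'rV[R]_m -> 'rV[R]_n) (phi : 'rV[R]_p -> 'rV[R]_m) (z : 'rV[R]_p) :
  (forall j, differentiable (fun y => psi y 0 j) (phi z)) ->
  (forall j, differentiable (fun y => phi y 0 j) z) ->
  jac (fun y => psi (phi y)) z = jac phi z *m jac psi (phi z).
Proof.
move=> dp dq; apply/matrixP => i j; rewrite !mxE (@partial_comp _ _ _ (fun x => psi x 0 j) phi)//.
by apply: eq_bigr => l _; rewrite !mxE mulrC.
Qed.

End Jacobian.

Section ChangeOfCoordinates.
Context {R : realType} {n : nat}.
Implicit Types (z : 'rV[R]_n) (f h : 'rV[R]_n -> R) (a : 'rV[R]_n -> 'M[R]_n).

Context (psi : 'rV[R]_n -> 'rV[R]_n).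
Local Notation J := (jac psi).

Definition pull a z : 'M[R]_n := J z *m a (psi z) *m (J z)^T.

Lemma cgrad_comp a f z : differentiable f (psi z) ->
  (forall j, differentiable (fun y => psi y 0 j) z) ->
  J z \in unitmx -> a (psi z) \in unitmx ->
  cgrad (pull a) (fun y => f (psi y)) z *m J z = cgrad a f (psi z).
Proof.
move=> df dp uJ ua; rewrite /cgrad dvec_comp// /pull.
have uJt : (J z)^T \in unitmx by rewrite unitmx_tr.
have uJa : J z *m a (psi z) \in unitmx by rewrite unitmx_mul uJ.
set P := J z *m a (psi z) *m (J z)^T.
have uP : P \in unitmx by rewrite unitmx_mul uJa.
suff E : (J z)^T *m invmx P *m J z = invmx (a (psi z)) by rewrite -!mulmxA (mulmxA (J z)^T) E.
apply: (can_inj (mulKmx ua)); rewrite mulmxV//.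
apply: (can_inj (mulKmx uJ)); rewrite mulmx1 !mulmxA -/P mulmxV//.
by rewrite mul1mx.
Qed.

Lemma gpair_comp a f h z : differentiable f (psi z) -> differentiable h (psi z) ->
  (forall j, differentiable (fun y => psi y 0 j) z) ->
  J z \in unitmx -> a (psi z) \in unitmx ->
  gpair (pull a) (fun y => f (psi y)) (fun y => h (psi y)) z = gpair a f h (psi z).
Proof.
move=> df dh dp uJ ua; rewrite /gpair -/(cgrad _ _ _) -/(cgrad _ _ _).
by rewrite (dvec_comp dh dp) trmx_mul trmxK mulmxA cgrad_comp.
Qed.

Lemma tr_dM_mul3 k (A B C : 'rV[R]_n -> 'M[R]_n) z : diffM A z -> diffM B z -> diffM C z ->
  dM k (fun y => A y *m B y *m C y) z =
  dM k A z *m B z *m C z + A z *m dM k B z *m C z + A z *m B z *m dM k C z.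
Proof.
move=> dA dB dC; rewrite (@dM_mul _ _ _ _ _ k (fun y => A y *m B y))//; last first.
  move=> i j; apply: (near_eq_differentiable (f := fun y => \sum_l A y i l * B y l j)).
    by apply: near_all => y; rewrite mxE.
  by apply: differentiable_sumf => l; exact: differentiableM.
by rewrite dM_mul// mulmxDl.
Qed.

(** In the form [lapE], a change of coordinates creates the terms tr(J^-1 d_k J) twice: the
    divergence of the components of the gradient gains them ([divE]), and the logarithmic derivative
    of the density gains the same ones ([trE]), so the total is invariant. The first computation
    uses the symmetry [sym] of the second derivatives of psi. *)
Lemma lap_comp a f z : CatMx 1 a (psi z) -> posdef (a (psi z)) -> Cat 2 f (psi z) ->
  (forall j, Cat 2 (fun y => psi y 0 j) z) -> J z \in unitmx ->
  lap (pull a) (fun y => f (psi y)) z = lap a f (psi z).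
Proof.
move=> Ca pa Cf Cp uJ.
have dp j : differentiable (fun y => psi y 0 j) z by exact: Cat_differentiable (Cp j).
have cpsi : {for z, continuous psi}.
  by apply: continuous_row => j; exact: Cat_continuous (Cp j).
have CJ : CatMx 1 J z := Cat_jac Cp.
have Cap : CatMx 1 (fun y => a (psi y)) z.
  by move=> i j; apply: (@Cat_comp _ _ _ 1 (fun x => a x i j) psi z (Ca i j)) => l; exact: CatW (Cp l).
have Cb : CatMx 1 (pull a) z := CatMx_mul (CatMx_mul CJ Cap) (CatMx_tr CJ).
have pb : posdef (pull a z) by exact: posdef_pull.
have Cft : Cat 2 (fun y => f (psi y)) z := @Cat_comp _ _ _ 2 f psi z Cf Cp.
rewrite (lapE Cb pb Cft) (lapE Ca pa Cf) !big_split /=.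
set Yt := cgrad (pull a) (fun y => f (psi y)).
set Y := cgrad a f; set K := invmx (J z).
have CYt : CatMx 1 Yt z := Cat_cgrad Cb pb Cft.
have CY : CatMx 1 Y (psi z) := Cat_cgrad Ca pa Cf.
have d0J : \det (J z) != 0 by move: uJ; rewrite unitmxE unitfE.
have d0a : \det (a (psi z)) != 0 by rewrite gt_eqF// posdef_det.
have YE : \forall y \near z, Y (psi y) = Yt y *m J y.
  have H1 := near_comp_cont (Cat_continuous (Cat_det CJ)) (near_neq0 d0J).
  have H2 := near_comp_cont (Cat_continuous (Cat_det Cap)) (near_neq0 d0a).
  have [H3 _] := Cf.
  have H4 := near_comp_cont cpsi H3.
  have H5 : \forall y \near z, forall j, differentiable (fun y => psi y 0 j) y.
    by apply: near_forall => j; have [] := Cp j.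
  apply: filterS2 (filterI H1 H2) (filterI H4 H5) => y [h1 h2] [h4 h5].
  by rewrite /Y /Yt cgrad_comp// unitmxE unitfE.
pose D : 'M[R]_n := \matrix_(d, l) partial d (fun y => Y y 0 l) (psi z).
have PE c : row c (J z *m D) = dM c Yt z *m J z + Yt z *m dM c J z.
  rewrite -(dM_mul c (CatMx_diff CYt) (CatMx_diff CJ)).
  rewrite -(near_dM c YE); apply/rowP => l; rewrite !mxE.
  rewrite (@partial_comp _ _ _ (fun x => Y x 0 l) psi)//; last exact: Cat_differentiable (CY 0 l).
  by apply: eq_bigr => d _; rewrite !mxE mulrC.
have sym c k l : dM c J z k l = dM k J z c l.
  have E d i : partial d (fun y => J y i l) z = partial d (partial i (fun y => psi y 0 l)) z.
    by apply: eq_partial => y; rewrite mxE.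
  by rewrite [LHS]mxE [RHS]mxE !E; exact: partial_sym (Cp l).
have divE : \sum_l partial l (fun y => Y y 0 l) (psi z) =
   \sum_c partial c (fun y => Yt y 0 c) z + \sum_k \tr (K *m dM k J z) * Yt z 0 k.
  have -> : \sum_l partial l (fun y => Y y 0 l) (psi z) = \tr (J z *m D *m K).
    by rewrite mxtrace_mulC mulmxA mulVmx// mul1mx; apply: eq_bigr => l _; rewrite mxE.
  have -> : \tr (J z *m D *m K) = \sum_c ((dM c Yt z *m J z + Yt z *m dM c J z) *m K) 0 c.
    by apply: eq_bigr => c _; rewrite -PE -row_mul [RHS]mxE.
  have E c : ((dM c Yt z *m J z + Yt z *m dM c J z) *m K) 0 c =
     partial c (fun y => Yt y 0 c) z + \sum_k Yt z 0 k * (dM c J z *m K) k c.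
    by rewrite mulmxDl -mulmxA mulmxV// mulmx1 -mulmxA mxE mxE [X in _ + X]mxE.
  rewrite (eq_bigr _ (fun c _ => E c)) big_split /=; congr (_ + _).
  rewrite exchange_big /=; apply: eq_bigr => k _; rewrite -mulr_sumr mulrC; congr (_ * _).
  rewrite mxtrace_mulC; apply: eq_bigr => c _; rewrite [LHS]mxE [RHS]mxE; apply: eq_bigr => l _.
  by congr (_ * _); exact: sym.
have trE k : 2^-1 * \tr (invmx (pull a z) *m dM k (pull a) z) =
   \tr (K *m dM k J z) + \sum_d J z k d * (2^-1 * \tr (invmx (a (psi z)) *m dM d a (psi z))).
  have ua := posdef_unit pa; set A := invmx (a (psi z)).
  have uJt : (J z)^T \in unitmx by rewrite unitmx_tr.
  have uP := posdef_unit pb.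
  have invE : invmx (pull a z) = K^T *m A *m K.
    apply: (can_inj (mulKmx uP)); rewrite mulmxV// /pull !mulmxA.
    rewrite -(mulmxA _ (J z)^T K^T) -trmx_mul mulVmx// trmx1 mulmx1.
    by rewrite -(mulmxA _ _ A) mulmxV// mulmx1 mulmxV.
  have dE : dM k (fun y => a (psi y)) z = \sum_d J z k d *: dM d a (psi z).
    apply/matrixP => i j; rewrite mxE summxE.
    rewrite (@partial_comp _ _ _ (fun x => a x i j) psi)//; last exact: Cat_differentiable (Ca i j).
    by apply: eq_bigr => d _; rewrite !mxE mulrC.
  have asym := pa.1.
  rewrite /pull tr_dM_mul3; [|exact: CatMx_diff CJ|exact: CatMx_diff Cap|exact: CatMx_diff (CatMx_tr CJ)].
  rewrite invE !mulmxDr !linearD /= dM_tr.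
  have -> : \tr (K^T *m A *m K *m (dM k J z *m a (psi z) *m (J z)^T)) = \tr (K *m dM k J z).
    rewrite mulmxA mxtrace_mulC !mulmxA -trmx_mul mulVmx// trmx1 mul1mx.
    by rewrite -!mulmxA mxtrace_mulC -!mulmxA mulmxV// mulmx1.
  have -> : \tr (K^T *m A *m K *m (J z *m a (psi z) *m (dM k J z)^T)) = \tr (K *m dM k J z).
    rewrite -!mulmxA (mulmxA K) mulVmx// mul1mx (mulmxA A) mulVmx// mul1mx.
    by rewrite -trmx_mul mxtrace_tr mxtrace_mulC.
  have -> : \tr (K^T *m A *m K *m (J z *m dM k (fun y => a (psi y)) z *m (J z)^T)) =
     \sum_d J z k d * \tr (A *m dM d a (psi z)).
    rewrite -!mulmxA (mulmxA K) mulVmx// mul1mx mxtrace_mulC -!mulmxA.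
    rewrite -trmx_mul mulVmx// trmx1 mulmx1 dE mulmx_sumr linear_sum /=.
    by apply: eq_bigr => d _; rewrite -scalemxAr mxtraceZ.
  under [X in _ = _ + X]eq_bigr do rewrite mulrCA.
  rewrite -mulr_sumr; move: (\sum_d _) (\tr _) => p q; by field.
rewrite divE -addrA; congr (_ + _).
under eq_bigr do rewrite trE mulrDl.
rewrite big_split /=; congr (_ + _).
under eq_bigr do rewrite mulr_suml.
rewrite exchange_big /=; apply: eq_bigr => d _.
have -> : Y (psi z) 0 d = \sum_k Yt z 0 k * J z k d by rewrite (nbhs_singleton YE) mxE.
set t := 2^-1 * \tr _; clearbody t; rewrite mulr_sumr; apply: eq_bigr => k _.
by move: (J z k d) (Yt z 0 k) => p q; ring.
Qed.

End ChangeOfCoordinates.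

(** * The quadratic form behind the monotonicity of the flux *)

Section PointwiseInequality.
Context {R : realType}.

(* With V = X + p w the form is a positive definite quadratic form in (V, w)
   plus a nonnegative multiple of Z. *)
Lemma weighted_form_ge0 (N a b lam al c p p' r X w Z H L e1 e2 eta : R) :
  0 < r -> 0 <= p -> 0 <= Z -> 0 < lam -> 0 <= c -> 0 <= N -> 0 <= a ->
  a * Z <= r * H -> N * a <= r * L -> r * L <= N * b ->
  0 < e1 -> e1 <= N * a - (c - al) -> N * b <= 2 * a + (c - al) ->
  0 < e2 -> e2 <= al + c - N * b ->
  - eta <= r * p' -> p' <= 0 -> 0 <= eta ->
  2 * p * eta <= e1 / 4 * (lam + p ^+ 2) -> c * eta <= r * (e1 / 4 * lam) ->
  (2 * eta + 2 * p * (N * b + c) + c * `|al - 1| / r) ^+ 2 <=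
     2 * (e2 + 4 * r * p) * (e1 * (lam + p ^+ 2)) ->
  0 <= (2 * p + al / r) * (X ^+ 2 - Z) + (2 * X * (- lam * w) + 2 * H - (X ^+ 2 + Z) * L)
    + ((2 * p + al / r) * (2 * p + c / r) + (2 * p' - c / r ^+ 2)) * (w * X)
    + (2 * p + c / r) * (X ^+ 2 + Z - lam * w ^+ 2)
    + ((2 * p + al / r) * (lam + 2 * p ^+ 2 + c * p / r)
        + (4 * p * p' + c * p' / r - c * p / r ^+ 2)) * w ^+ 2
    + 2 * (lam + 2 * p ^+ 2 + c * p / r) * w * X + (lam + 2 * p ^+ 2 + c * p / r) * w ^+ 2 * L.
Proof.
move=> r0 p0 Z0 l0 c0 N0 a0 HH La Lb e10 h1 h2 e20 h3 p1 p2 eta0 q1 q2 q3.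
(* In the application X = u_r, w = u, Z is the square of the tangential gradient, H the Hessian of r
   at grad u and L the Laplacian of r. [al1], [be1] and [g1] are the exact coefficients after
   multiplication by r; [al0], [be0] and [G] are the bounds that the hypotheses give for them. The
   last hypothesis is the discriminant condition G^2 <= 4 al0 be0. *)
set E := (X in 0 <= X); pose V := X + p * w; pose th := r * L.
pose al0 := e2 + 4 * r * p; pose be0 := e1 / 2 * (lam + p ^+ 2).
pose G := 2 * eta + 2 * p * (N * b + c) + c * `|al - 1| / r.
pose al1 := al + c - th + 4 * r * p.
pose be1 := (al + th - c) * (lam + p ^+ 2) + 2 * r * p * p' + c * (p' + p * th / r).
pose g1 := 2 * r * p' + 2 * p * th + 2 * c * p + c * (al - 1) / r.
have rn0 : r != 0 by rewrite gt_eqF.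
have EE : r * E = al1 * V ^+ 2 + (2 * (r * H) + (c - al - th) * Z) + be1 * w ^+ 2 + g1 * (w * V).
  by rewrite /E /al1 /be1 /g1 /V /th; field; rewrite rn0.
rewrite -(pmulr_rge0 _ r0) EE.
have thb : th <= N * b by [].
have tha : N * a <= th by [].
have th0 : 0 <= th by apply: le_trans tha; rewrite mulr_ge0.
have T1 : al0 * V ^+ 2 <= al1 * V ^+ 2 by rewrite ler_wpM2r ?sqr_ge0// /al0 /al1; lra.
(* After the lower bound on the Hessian, the factor of Z is at least 2 a + c - al - N b. *)
have T2 : 0 <= 2 * (r * H) + (c - al - th) * Z.
  have : 0 <= (2 * a + (c - al - th)) * Z by rewrite mulr_ge0//; lra.
  by move: HH; rewrite mulrDl; lra.
have pt : 0 <= c * (p * th / r) by rewrite mulr_ge0// divr_ge0 ?(ltW r0)// mulr_ge0.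
have T3 : be0 * w ^+ 2 <= be1 * w ^+ 2.
  rewrite ler_wpM2r ?sqr_ge0// /be0 /be1.
  have k1 : e1 * (lam + p ^+ 2) <= (al + th - c) * (lam + p ^+ 2).
    by rewrite ler_wpM2r ?addr_ge0 ?sqr_ge0 ?(ltW l0)//; lra.
  have k2 : - (2 * p * eta) <= 2 * r * p * p'.
    by have := ler_wpM2l p0 p1; rewrite mulrN; lra.
  have k3 : - (e1 / 4 * lam) <= c * p'.
    rewrite -(ler_pM2l r0); have := ler_wpM2l c0 p1; move: q2; rewrite mulrN mulrN mulrCA; lra.
  have k4 : 0 <= e1 / 4 * p ^+ 2 by rewrite mulr_ge0 ?sqr_ge0//; lra.
  by rewrite [c * (_ + _)]mulrDr; lra.
have T4 : `|g1| <= G.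
  rewrite /g1 /G -[c * _ / r]mulrAC -[c * `|_| / r]mulrAC.
  have k1 : `|2 * r * p'| <= 2 * eta.
    by rewrite ler0_norm -?mulrA; [lra|rewrite pmulr_rle0// pmulr_rle0].
  have k2 : `|2 * p * th + 2 * c * p| <= 2 * p * (N * b + c).
    have u1 : 0 <= p * th by rewrite mulr_ge0.
    have u2 : 0 <= c * p by rewrite mulr_ge0.
    by have := ler_wpM2l p0 thb; rewrite ger0_norm; lra.
  have k3 : `|c / r * (al - 1)| <= c / r * `|al - 1|.
    by rewrite normrM ger0_norm// divr_ge0// ltW.
  rewrite -(addrA (2 * r * p')).
  by apply: le_trans (ler_normD _ _) _; rewrite lerD// (le_trans (ler_normD _ _))// lerD.
have al00 : 0 < al0 by rewrite /al0 ltr_wpDr// mulr_ge0// mulr_ge0// ltW.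
have be00 : 0 <= be0 by rewrite mulr_ge0 ?addr_ge0 ?sqr_ge0 ?(ltW l0)//; lra.
have T5 : - (G * (`|w| * `|V|)) <= g1 * (w * V).
  rewrite lerNl -mulNr; apply: le_trans (ler_norm _) _.
  by rewrite !normrM normrN ler_wpM2r ?mulr_ge0.
have T6 : 0 <= al0 * V ^+ 2 + be0 * w ^+ 2 - G * (`|w| * `|V|).
  have GG : G ^+ 2 <= 4 * al0 * be0 by apply: le_trans q3 _; rewrite /al0 /be0; lra.
  rewrite -(pmulr_rge0 _ al00) -[V ^+ 2]real_normK ?num_real// -[w ^+ 2]real_normK ?num_real//.
  have := sqr_ge0 (al0 * `|V| - 2^-1 * G * `|w|).
  have := ler_wpM2r (sqr_ge0 `|w|) GG.
  by move: `|w| `|V| => x y; lra.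
by move: T1 T2 T3 T5 T6; lra.
Qed.

End PointwiseInequality.

(** * Implicit functions *)

Lemma continuous_near_le (R : realType) (k : nat) (f : 'rV[R]_k -> R) (x : 'rV[R]_k) :
  (forall e : R, 0 < e -> \forall y \near x, `|f x - f y| <= e) -> {for x, continuous f}.
Proof. by move=> H; apply/(@cvgrPdist_le _ _ _ _ (nbhs_filter x) f (f x)) => e /H. Qed.

Lemma conv_norm_le (R : realType) (c a b e : R) :
  0 <= c <= 1 -> `|a| <= e -> `|b| <= e -> `|c * a + (1 - c) * b| <= e.
Proof.
move=> /andP[c0 c1]; rewrite !ler_norml => /andP[? ?] /andP[? ?].
by apply/andP; split; nra.
Qed.

Section ImplicitFunction.
Context {R : realType} {m : nat}.

Definition ins (j : 'I_m.+1) (t : R) (y : 'rV[R]_m) : 'rV[R]_m.+1 :=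
  \row_i (if unlift j i is Some b then y 0 b else t).

Definition del (j : 'I_m.+1) (x : 'rV[R]_m.+1) : 'rV[R]_m := \row_b x 0 (lift j b).

Lemma lift_neq (j : 'I_m.+1) b : (lift j b == j) = false.
Proof. by rewrite eq_sym; apply/negbTE/neq_lift. Qed.

Lemma ins_j j t y : ins j t y 0 j = t.
Proof. by rewrite mxE unlift_none. Qed.

Lemma ins_lift j t y b : ins j t y 0 (lift j b) = y 0 b.
Proof. by rewrite mxE liftK. Qed.

Lemma insK j (x : 'rV[R]_m.+1) : ins j (x 0 j) (del j x) = x.
Proof.
apply/rowP => i; rewrite mxE; case: unliftP => [b ->|-> //].
by rewrite mxE.
Qed.

Lemma del_ins j t y : del j (ins j t y) = y.
Proof. by apply/rowP => b; rewrite mxE ins_lift. Qed.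

Lemma ins_norm j t y s w e : `|t - s| <= e -> `|y - w| <= e -> `|ins j t y - ins j s w| <= e.
Proof.
move=> ts yw; apply: norm_le_coord => [|i]; first exact: le_trans ts.
rewrite !mxE; case: unliftP => [b _|_ //].
by apply: le_trans yw; rewrite -[y 0 b - w 0 b](_ : (y - w) 0 b = _) ?coord_le// !mxE.
Qed.

Lemma mono_j (f : 'rV[R]_m.+1 -> R) j (y : 'rV[R]_m) (t s : R) : t < s ->
  (forall c, t <= c <= s -> differentiable f (ins j c y) /\ 0 < partial j f (ins j c y)) ->
  f (ins j t y) < f (ins j s y).
Proof.
move=> ts H.
have E (c : R) : c *: ((s - t) *: delta_mx 0 j) + ins j t y = ins j (c * (s - t) + t) y.
  apply/rowP => i; rewrite !mxE eqxx /=; case: unliftP => [b ->|->].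
    by rewrite lift_neq !mulr0 add0r.
  by rewrite eqxx mulr1.
have ct (c : R) : 0 <= c <= 1 -> t <= c * (s - t) + t <= s.
  move=> /andP[c0 c1]; rewrite lerDr mulr_ge0 ?subr_ge0 ?(ltW ts)//=.
  by rewrite -lerBrDr ler_piMl// subr_ge0 ltW.
have [|c c01] := @mvt_line _ _ f (ins j t y) ((s - t) *: delta_mx 0 j).
  by move=> c c01; rewrite E; apply: diff_derivable; have [] := H _ (ct _ c01).
have := E 1; rewrite scale1r mul1r subrK => ->; rewrite E => fE.
have [df pf] := H _ (ct _ c01).
rewrite -subr_gt0 fE deriveZv; last exact: diff_derivable.
by rewrite -[_ *: _]/(_ * _) mulr_gt0// subr_gt0.
Qed.

(** Existence of the zero is the intermediate value theorem along axis j, and uniqueness is strict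
    monotonicity there. Smoothness is bootstrapped from the formula [dphi] for the derivatives,
    which contains only phi and derivatives of f. W is a box over V in which the zero set is exactly
    the graph. *)
Lemma implicit_function (f : 'rV[R]_m.+1 -> R) j (x0 : 'rV[R]_m.+1) (O : set 'rV[R]_m.+1) :
  open O -> O x0 -> (forall x, O x -> forall k, Cat k f x) -> f x0 = 0 -> 0 < partial j f x0 ->
  exists (V : set 'rV[R]_m) (phi : 'rV[R]_m -> R) (W : set 'rV[R]_m.+1),
  [/\ open V, open W, W x0 /\ W `<=` O,
      forall y, V y -> [/\ W (ins j (phi y) y), f (ins j (phi y) y) = 0 & forall k, Cat k phi y] &
      forall x, W x -> f x = 0 -> V (del j x) /\ phi (del j x) = x 0 j].
Proof.
move=> oO Ox0 Cf f0 p0.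
have cp := Cat_continuous (Cat_partial j (Cf _ Ox0 2%N)).
have /nbhs_ballP[d /= d0 dP] : \forall x \near x0, O x /\ 0 < partial j f x.
  apply: filterI; first exact: open_nbhs_nbhs.
  exact: near_comp_cont cp (near_gt p0).
(* Half the radius, so that the closed box of size e lies in the open ball where the derivative is
   positive. *)
pose e := d / 2; have e0 : 0 < e by rewrite divr_gt0.
pose t0 := x0 0 j; pose y0 := del j x0.
have ball_in t y : `|t - t0| <= e -> `|y - y0| <= e -> O (ins j t y) /\ 0 < partial j f (ins j t y).
  move=> te ye; apply: dP; rewrite -ball_normE /ball_ /= -{1}(insK j x0).
  rewrite distrC; apply: le_lt_trans (ins_norm _ te ye) _.
  by rewrite /e ltr_pdivrMr// mulr_natr mulr2n ltrDl.
have e_t0 t : t0 - e <= t <= t0 + e -> `|t - t0| <= e.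
  by move=> /andP[? ?]; rewrite ler_norml; apply/andP; split; lra.
have mono y t s : `|y - y0| <= e -> t0 - e <= t -> t < s -> s <= t0 + e ->
    f (ins j t y) < f (ins j s y).
  move=> ye tl ts su; apply: mono_j => // c /andP[tc cs].
  have [Oc pc] : O (ins j c y) /\ 0 < partial j f (ins j c y).
    by apply: ball_in => //; apply: e_t0; rewrite (le_trans tl)// (le_trans cs).
  by split=> //; exact: Cat_differentiable (Cf _ Oc 1%N).
have y00 : `|y0 - y0| <= e by rewrite subrr normr0 ltW.
have x0E : ins j t0 y0 = x0 by exact: insK.
have cins (t : R) (y : 'rV[R]_m) : {for y, continuous (fun y => ins j t y)}.
  apply: continuous_row => i; case: (unliftP j i) => [b ->|->].
    by apply: near_eq_continuous (@continuous_coord _ _ b y); apply: near_all => w; rewrite ins_lift.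
  by apply: (@near_eq_continuous _ _ (fun=> t)); [apply: near_all => w; rewrite ins_j|exact: cst_continuous].
have fcont t y : `|t - t0| <= e -> `|y - y0| <= e -> {for y, continuous (fun y => f (ins j t y))}.
  move=> te ye; have [Oc _] := ball_in _ _ te ye.
  exact: (@continuous_comp _ _ _ (fun y => ins j t y) f y (cins t y) (Cat_continuous (Cf _ Oc 0%N))).
have fup : 0 < f (ins j (t0 + e) y0) by rewrite -f0 -x0E; apply: mono => //; lra.
have fdn : f (ins j (t0 - e) y0) < 0 by rewrite -f0 -x0E; apply: mono => //; lra.
have near_lt (t c : R) : t < c -> \forall s \near t, s < c by exact: lt_nbhsl.
have /nbhs_ballP[h /= h0 hP] : \forall y \near y0,
   [/\ `|y - y0| < e, 0 < f (ins j (t0 + e) y) & f (ins j (t0 - e) y) < 0].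
  have te1 : `|t0 + e - t0| <= e by rewrite addrAC subrr add0r ger0_norm// ltW.
  have te2 : `|t0 - e - t0| <= e by rewrite addrAC subrr add0r normrN ger0_norm// ltW.
  have H1 := near_comp_cont (fcont _ _ te1 y00) (near_gt fup).
  have H2 := near_comp_cont (fcont _ _ te2 y00) (near_lt _ _ fdn).
  have H3 : \forall y \near y0, `|y - y0| < e.
    by apply/nbhs_ballP; exists e => //= y; rewrite -ball_normE /ball_ /= distrC.
  by apply: filterS2 (filterI H1 H2) H3 => y [].
pose V := [set y : 'rV[R]_m | `|y - y0| < h].
have oball k (c : 'rV[R]_k) (q : R) : open [set y | `|y - c| < q].
  have := @ball_open _ 'rV[R]_k c q; rewrite (_ : ball c q = [set y | `|y - c| < q])//.
  by rewrite -ball_normE; apply/seteqP; split => y /=; rewrite /ball_ /= distrC.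
have VP y : V y -> [/\ `|y - y0| <= e, 0 < f (ins j (t0 + e) y) & f (ins j (t0 - e) y) < 0].
  move=> Vy; have [|a b c] := hP y; first by rewrite -ball_normE /ball_ /= distrC.
  by split=> //; exact: ltW.
have root y : V y -> exists t, [/\ t0 - e < t, t < t0 + e & f (ins j t y) = 0].
  move=> /VP[ye up dn].
  have cf : {within `[t0 - e, t0 + e], continuous (fun t => f (ins j t y))}.
    apply: derivable_within_continuous => t; rewrite in_itv /= => tI.
    have [Oc _] := ball_in _ _ (e_t0 _ tI) ye.
    apply/derivable1P.
    have E : (fun h : R => f (ins j (h *: 1 + t) y)) = (fun h : R => f (h *: delta_mx 0 j + ins j t y)).
      apply/funext => s; congr f; rewrite [s *: 1]mulr1.
      apply/rowP => i; rewrite !mxE eqxx /=; case: unliftP => [b ->|->].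
        by rewrite lift_neq !mulr0 add0r.
      by rewrite eqxx mulr1.
    rewrite E; apply/(derivable1P f (ins j t y) (delta_mx 0 j)); apply: diff_derivable.
    exact: Cat_differentiable (Cf _ Oc 1%N).
  have [||t tI ft] := @IVT R (fun t => f (ins j t y)) (t0 - e) (t0 + e) 0 _ cf.
  - by lra.
  - by rewrite (min_idPl (ltW (lt_trans dn up))) (max_idPr (ltW (lt_trans dn up))) !ltW.
  exists t; move: tI; rewrite in_itv /= => /andP[t1 t2]; split => //.
    by rewrite lt_neqAle t1 andbT; apply/eqP => tE; move: dn; rewrite tE ft ltxx.
  by rewrite lt_neqAle t2 andbT; apply/eqP => tE; move: up; rewrite -tE ft ltxx.
pose phi y := xget 0 [set t | [/\ t0 - e < t, t < t0 + e & f (ins j t y) = 0]].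
have phiP y : V y -> [/\ t0 - e < phi y, phi y < t0 + e & f (ins j (phi y) y) = 0].
  by move=> /root[t Ht]; rewrite /phi; case: xgetP => [s -> //|/(_ t)].
have uniq y t : V y -> t0 - e < t -> t < t0 + e -> f (ins j t y) = 0 -> phi y = t.
  move=> Vy t1 t2 ft; have [p1 p2 fp] := phiP y Vy; have [ye _ _] := VP y Vy.
  case: (ltgtP (phi y) t) => // ltt.
    by have := mono y _ _ ye (ltW p1) ltt (ltW t2); rewrite ft fp ltxx.
  by have := mono y _ _ ye (ltW t1) ltt (ltW p2); rewrite ft fp ltxx.
have oV : open V by exact: oball.
have nV y : V y -> \forall z \near y, V z by move=> Vy; exact: open_nbhs_nbhs.
have phi_ball y : V y -> `|phi y - t0| <= e.
  by move=> Vy; have [p1 p2 _] := phiP y Vy; apply: e_t0; rewrite !ltW.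
have phi_cont y : V y -> {for y, continuous phi}.
  move=> Vy; apply: continuous_near_le => q q0.
  have [p1 p2 fp] := phiP y Vy; have [ye _ _] := VP y Vy.
  (* Heights just above and below phi y, within q of it and inside the box. f has strict signs
     there, which persist for nearby z and trap phi z in between. *)
  have [tu [u1 u2 u3]] : exists tu, [/\ phi y < tu, tu <= phi y + q & tu < t0 + e].
    exists (Num.min (phi y + q) ((phi y + (t0 + e)) / 2)); rewrite lt_min ge_min lexx gt_min; split => //.
      by apply/andP; split; lra.
    by apply/orP; right; lra.
  have [td [d1 d2 d3]] : exists td, [/\ td < phi y, phi y - q <= td & t0 - e < td].
    exists (Num.max (phi y - q) ((phi y + (t0 - e)) / 2)); rewrite gt_max le_max lexx lt_max; split => //.
      by apply/andP; split; lra.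
    by apply/orP; right; lra.
  have tub : `|tu - t0| <= e by apply: e_t0; apply/andP; split; lra.
  have tdb : `|td - t0| <= e by apply: e_t0; apply/andP; split; lra.
  have fu : 0 < f (ins j tu y) by rewrite -fp; apply: mono => //; lra.
  have fd : f (ins j td y) < 0 by rewrite -fp; apply: mono => //; lra.
  have H1 := near_comp_cont (fcont _ _ tub ye) (near_gt fu).
  have H2 := near_comp_cont (fcont _ _ tdb ye) (near_lt _ _ fd).
  apply: filterS2 (filterI H1 H2) (nV y Vy) => z [h1 h2] Vz.
  have [q1 q2 fz] := phiP z Vz; have [ze _ _] := VP z Vz.
  have z1 : phi z <= tu.
    rewrite leNgt; apply/negP => lt1.
    have A : t0 - e <= tu by clear - p1 u1 e0; lra.
    by have := mono z _ _ ze A lt1 (ltW q2); rewrite fz ltNge (ltW h1).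
  have z2 : td <= phi z.
    rewrite leNgt; apply/negP => lt1.
    have A : td <= t0 + e by clear - p2 d1 e0; lra.
    by have := mono z _ _ ze (ltW q1) lt1 A; rewrite fz ltNge (ltW h2).
  by rewrite ler_norml; apply/andP; split; lra.
pose g y := ins j (phi y) y.
have Og y : V y -> O (g y) /\ 0 < partial j f (g y).
  by move=> Vy; apply: ball_in; [exact: phi_ball|have [] := VP y Vy].
have Cg k y : Cat k phi y -> forall i, Cat k (fun y => g y 0 i) y.
  move=> Cp i; case: (unliftP j i) => [b ->|->].
    by apply: eq_Cat (Cat_coord k b y) => w; rewrite ins_lift.
  by apply: eq_Cat Cp => w; rewrite ins_j.
have gcont y : V y -> {for y, continuous g}.
  move=> Vy; apply: continuous_row => i; case: (unliftP j i) => [b ->|->].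
    by apply: near_eq_continuous (@continuous_coord _ _ b y); apply: near_all => w; rewrite ins_lift.
  by apply: near_eq_continuous (phi_cont y Vy); apply: near_all => w; rewrite ins_j.
pose dphi b y := - (partial (lift j b) f (g y) / partial j f (g y)).
have dphiP b y : V y -> is_derive y (delta_mx 0 b) phi (dphi b y).
  move=> Vy; have [Oy pjy] := Og y Vy; have [ye _ _] := VP y Vy.
  pose Q x := - (partial (lift j b) f x / partial j f x).
  have cQ : {for g y, continuous Q}.
    have CQ : Cat 0 Q (g y).
      apply: CatN; apply: CatM; first exact: Cat_partial (Cf _ Oy 1%N).
      by apply: CatV; [rewrite gt_eqF|exact: Cat_partial (Cf _ Oy 1%N)].
    exact: Cat_continuous CQ.
  suff C : (fun s : R => s^-1 *: ((phi \o shift y) (s *: delta_mx 0 b) - phi y)) @ 0^' --> dphi b y.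
    by split; [apply/cvg_ex; eexists; exact: C|apply/cvg_lim].
  apply/cvgrPdist_le => /= q q0.
  have /nbhs_ballP[d1 /= d10 d1P] : \forall x \near g y, `|Q (g y) - Q x| <= q.
    by have /cvgrPdist_le := cQ; apply.
  have /nbhs_ballP[d2 /= d20 d2P] : \forall z \near y, V z /\ `|phi y - phi z| < d1.
    apply: filterI; first exact: nV.
    by have /cvgrPdist_lt := phi_cont y Vy; apply.
  have d3 : 0 < Num.min d1 d2 by rewrite lt_min d10.
  rewrite near_withinE; apply/nbhs_ballP; exists (Num.min d1 d2) => //= s.
  rewrite -ball_normE /ball_ /= sub0r normrN lt_min => /andP[hd1 hd2] hn0.
  pose yh := s *: delta_mx 0 b + y.
  have ne : `|delta_mx 0 b : 'rV[R]_m| <= 1.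
    by apply: norm_le_coord => // i; rewrite !mxE; case: (_ && _); rewrite ?normr1 ?normr0.
  have yhb (c : R) : 0 <= c <= 1 -> V ((c * s) *: delta_mx 0 b + y) /\
      `|phi y - phi ((c * s) *: delta_mx 0 b + y)| < d1.
    move=> /andP[c0 c1]; apply: d2P; rewrite -ball_normE /ball_ /= opprD addrCA subrr addr0 normrN.
    rewrite normrZ (le_lt_trans _ hd2)// normrM ger0_norm//.
    by rewrite -mulrA -[leRHS]mul1r ler_pM ?mulr_ge0// ler_piMr.
  have [Vyh phyh] : V yh /\ `|phi y - phi yh| < d1.
    by have := yhb 1; rewrite mul1r ler01 lexx; apply.
  set D := phi yh - phi y.
  (* The chord between two points of the graph. f vanishes at both ends, so the mean value theorem
     gives a linear relation between D and s with coefficients taken at [xi], and the difference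
     quotient D / s equals [Q xi]. *)
  pose w : 'rV[R]_m.+1 := D *: delta_mx 0 j + s *: delta_mx 0 (lift j b).
  have wE (c : R) : c *: w + g y = ins j (c * D + phi y) ((c * s) *: delta_mx 0 b + y).
    apply/rowP => i; rewrite /g !mxE !eqxx /=; case: unliftP => [b' ->|->].
      by rewrite lift_neq !mxE eqxx /= (inj_eq lift_inj) mulr0 add0r mulrA.
    by rewrite eqxx eq_sym lift_neq mulr0 addr0 mulr1.
  have Ow' (c : R) : 0 <= c <= 1 -> O (c *: w + g y) /\ 0 < partial j f (c *: w + g y).
    move=> c01; rewrite wE; have [Vc _] := yhb c c01; have [yce _ _] := VP _ Vc.
    apply: ball_in yce.
    have -> : c * D + phi y - t0 = c * (phi yh - t0) + (1 - c) * (phi y - t0) by rewrite /D; ring.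
    exact: conv_norm_le c01 (phi_ball _ Vyh) (phi_ball _ Vy).
  have Ow (c : R) : 0 <= c <= 1 -> O (c *: w + g y) by move=> /Ow'[].
  have [|c c01] := @mvt_line _ _ f (g y) w.
    by move=> c c01; apply: diff_derivable; exact: Cat_differentiable (Cf _ (Ow _ c01) 1%N).
  have w1 : w + g y = g yh by have := wE 1; rewrite scale1r !mul1r subrK.
  have [_ _ fyh] := phiP _ Vyh; have [_ _ fy] := phiP _ Vy.
  rewrite w1 {1}/g fyh {1}/g fy subrr; set xi := c *: w + g y.
  have Oxi : O xi by exact: Ow.
  have df := Cat_differentiable (Cf _ Oxi 1%N).
  rewrite derive_partial//.
  rewrite (bigD1 j)//= [X in _ + X](bigD1 (lift j b)) ?lift_neq//= big1 ?addr0; last first.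
    move=> i /andP[ij ib]; rewrite !mxE eqxx /= (negbTE ij) (negbTE ib) !mulr0 addr0 mul0r.
    by [].
  rewrite !mxE !eqxx /= lift_neq eq_sym lift_neq !mulr0 addr0 add0r !mulr1 => E.
  have xid : `|g y - xi| < d1.
    rewrite distrC /xi addrK; apply: le_lt_trans (_ : `|w| < d1).
      rewrite normrZ; case/andP: c01 => c0 c1; rewrite ger0_norm//.
      by rewrite ler_piMl.
    apply: le_lt_trans (_ : Num.max `|D| `|s| < d1); last by rewrite gt_max distrC phyh.
    apply: norm_le_coord => [|i]; first by rewrite le_max normr_ge0.
    rewrite !mxE eqxx /=; case: (unliftP j i) => [b' ->|->].
      rewrite lift_neq mulr0 add0r normrM le_max; apply/orP; right.
      by case: (_ == _); rewrite ?normr1 ?normr0 ?mulr1 ?mulr0.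
    by rewrite eqxx eq_sym lift_neq mulr0 addr0 mulr1 le_max lexx.
  have pjxi : partial j f xi != 0 by have [_ /gt_eqF ->] := Ow' _ c01.
  have -> : s^-1 *: (phi (s *: delta_mx 0 b + y) - phi y) = Q xi.
    rewrite -/yh -/D -[_ *: _]/(_ * _) /Q.
    move: E pjxi; move: (partial j f xi) (partial (lift j b) f xi) => u v E u0.
    have -> : D = - (s * v) / u by apply: (mulIf u0); rewrite divfK//; lra.
    by field; rewrite u0 hn0.
  by apply: d1P; rewrite -ball_normE.
(* Since [dphi] involves phi undifferentiated, phi of class C^k makes its derivatives of class C^k,
   a gain of one order. *)
have Cphi k y : V y -> Cat k phi y.
  elim: k y => [|k IH] y Vy; first by apply: filterS (nV y Vy).
  have Cd b z : V z -> Cat k (dphi b) z.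
    move=> Vz; have [Oz pz] := Og z Vz.
    apply: CatN; apply: CatM; first by apply: (@Cat_comp _ _ _ _ (partial (lift j b) f) g) (Cg _ _ (IH z Vz)); exact: Cat_partial (Cf _ Oz k.+1).
    apply: CatV; first by rewrite gt_eqF.
    by apply: (@Cat_comp _ _ _ _ (partial j f) g) (Cg _ _ (IH z Vz)); exact: Cat_partial (Cf _ Oz k.+1).
  have pE b : \forall z \near y, dphi b z = partial b phi z.
    by apply: filterS (nV y Vy) => z Vz; have [_ <-] := dphiP b z Vz.
  split; last by move=> b; apply: Cat_ext (Cd b y Vy); exact: pE.
  apply: filterS (nV y Vy) => z Vz; apply: differentiable_partial.
    by apply: filterS (nV z Vz) => w Vw b; have [] := dphiP b w Vw.
  move=> b; apply: (@near_eq_continuous _ _ (dphi b)).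
    by apply: filterS (nV z Vz) => w Vw; have [_ <-] := dphiP b w Vw.
  exact: Cat_continuous (Cd b z Vz).
exists V, phi, [set x | [/\ V (del j x), t0 - e < x 0 j & x 0 j < t0 + e]]; split.
- exact: oV.
- rewrite openE => x [Vx x1 x2].
  have c1 := @continuous_coord _ _ j x.
  have c2 : {for x, continuous (fun x => del j x)}.
    apply: continuous_row => b.
    by apply: near_eq_continuous (@continuous_coord _ _ (lift j b) x); apply: near_all => w; rewrite mxE.
  have H1 := near_comp_cont c1 (near_gt x1).
  have H2 := near_comp_cont c1 (near_lt _ _ x2).
  have H3 := near_comp_cont c2 (nV _ Vx).
  by apply: filterS2 (filterI H1 H2) H3 => z [].
- split; first by rewrite /= -/y0 /V /= subrr normr0; split => //; rewrite /t0; lra.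
  move=> x [Vx x1 x2]; rewrite -(insK j x); have [ye _ _] := VP _ Vx.
  by have [] := @ball_in (x 0 j) (del j x) (e_t0 _ _) ye; rewrite ?(ltW x1) ?(ltW x2).
- move=> y Vy; have [p1 p2 fp] := phiP y Vy; split => //; last by move=> k; exact: Cphi.
  by rewrite /= del_ins ins_j.
- by move=> x [Vx x1 x2] fx; split=> //; apply: uniq => //; rewrite insK.
Qed.

End ImplicitFunction.

(** * Functions on a Riemannian manifold *)

Section NearInvariance.
Context {R : realType} {n : nat}.
Implicit Types (x : 'rV[R]_n) (f h : 'rV[R]_n -> R) (a : 'rV[R]_n -> 'M[R]_n).

Lemma near_dvec f h x : (\forall y \near x, f y = h y) -> dvec f x = dvec h x.
Proof. by move=> E; apply/rowP => k; rewrite !mxE; exact: near_partial. Qed.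

Lemma near_gpair a f h f' h' x : (\forall y \near x, f y = f' y) ->
  (\forall y \near x, h y = h' y) -> gpair a f h x = gpair a f' h' x.
Proof. by move=> E1 E2; rewrite /gpair (near_dvec E1) (near_dvec E2). Qed.

Lemma near_cgrad a a' f f' x : (\forall y \near x, a y = a' y) ->
  (\forall y \near x, f y = f' y) -> \forall y \near x, cgrad a f y = cgrad a' f' y.
Proof.
move=> Ea Ef.
have Ed : \forall y \near x, dvec f y = dvec f' y.
  have := @near_forall _ x 'I_n (fun k y => partial k f y = partial k f' y) (fun k => near_eq_partial k Ef).
  by apply: filterS => y H; apply/rowP => k; rewrite !mxE.
by apply: filterS2 Ea Ed => y ea ed; rewrite /cgrad ea ed.
Qed.

Lemma near_lap a a' f f' x : (\forall y \near x, a y = a' y) ->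
  (\forall y \near x, f y = f' y) -> lap a f x = lap a' f' x.
Proof.
move=> Ea Ef; rewrite /lap (nbhs_singleton Ea); congr (_ * _); apply: eq_bigr => k _.
apply: near_partial; apply: filterS2 Ea (near_cgrad Ea Ef) => y ea ec.
by rewrite ea ec.
Qed.

End NearInvariance.

Section CkComponents.
Context {R : realType}.

Definition coordf n (b : 'I_n) (v : 'rV[R]_n) : R^o := v 0 b.

Lemma coordf_linear n (b : 'I_n) : linear (coordf b).
Proof. by move=> c u v; rewrite /coordf !mxE. Qed.

HB.instance Definition _ n (b : 'I_n) :=
  GRing.isLinear.Build R 'rV[R]_n R^o _ (coordf b) (@coordf_linear n b).

Lemma Ck_coord l n k o (O : set 'rV[R]_l) (F : 'rV[R]_l -> 'rV[R]_n) (x : 'rV[R]_l) b :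
  open O -> O x -> Ck o O F -> order_le o k -> Cat k (fun y => F y 0 b) x.
Proof.
move=> oO Ox CF ok.
have CL : Ck o O (coordf b \o F).
  by apply: Ck_linear => // y; exact: continuous_coord.
exact: Ck_Cat oO Ox (Ck_Some ok CL).
Qed.

End CkComponents.

Section Charts.
Context {R : realType} {n : nat} {M : topologicalType} {X : manifold R n M}.
Implicit Types (i j : idx X) (p q : M) (f h : M -> R).

Lemma near_chart i p : dom i p ->
  \forall x \near crd i p, dom i (pt i x) /\ crd i (pt i x) = x.
Proof.
move=> ip; have : \forall x \near crd i p, (crd i @` dom i) x.
  by apply: open_nbhs_nbhs; split; [exact: img_open|exists p].
by apply: filterS => x [q iq <-]; rewrite crdK.
Qed.

Lemma near_dom i p : dom i p -> \forall q \near p, dom i q.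
Proof. by move=> ip; apply: open_nbhs_nbhs; split=> //; exact: dom_open. Qed.

Lemma near_pt i p (P : set M) : dom i p -> (\forall q \near p, P q) ->
  \forall x \near crd i p, P (pt i x).
Proof.
by move=> ip Pp; apply: near_comp_cont (pt_continuous ip) _; rewrite crdK.
Qed.

Lemma near_crd i p (P : set 'rV[R]_n) : dom i p -> (\forall x \near crd i p, P x) ->
  \forall q \near p, P (crd i q).
Proof. by move=> ip; exact: near_comp_cont (crd_continuous ip). Qed.

(* [CM k f p] : f is of class C^k near p. *)
Definition CM k f p := forall i, dom i p -> Cat k (f \o pt i) (crd i p).

(** Continuity is demanded separately because the coordinates of F y mean something only as long as
    F y stays in the chart. *)
Definition SM l k (F : 'rV[R]_l -> M) (z : 'rV[R]_l) :=
  {for z, continuous F} /\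
  forall i, dom i (F z) -> forall b, Cat k (fun y => crd i (F y) 0 b) z.

Definition tmap i j x := crd j (pt i x).

Lemma tmap_Cat i j p k b : dom i p -> dom j p ->
  Cat k (fun x => tmap i j x 0 b) (crd i p).
Proof.
move=> ip jp; have [Z [F [oZ Zp dF FP]]] := @transition_smooth _ _ _ X i j p I ip jp.
have := Ck_coord (k := k) b oZ Zp dF I; apply: Cat_ext.
have On : \forall x \near crd i p, Z x by exact: open_nbhs_nbhs.
apply: filterS2 (near_chart ip) On => x [ix xE] Ox.
by have [|_ E] := FP (pt i x) I ix; rewrite ?xE// -{1}xE E.
Qed.

Lemma tmapE i p j : dom i p -> tmap i j (crd i p) = crd j p.
Proof. by move=> ip; rewrite /tmap crdK. Qed.

Lemma near_tmap f i j p : dom i p -> dom j p ->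
  \forall x \near crd i p, (f \o pt j) (tmap i j x) = (f \o pt i) x.
Proof.
move=> ip jp; apply: filterS (near_pt ip (near_dom jp)) => x jx.
by rewrite /= /tmap crdK.
Qed.

Lemma CM_chart i p k f : dom i p -> Cat k (f \o pt i) (crd i p) -> CM k f p.
Proof.
move=> ip Cf j jp; apply: Cat_ext (near_tmap f jp ip) _.
apply: (@Cat_comp _ _ _ _ (f \o pt i) (tmap j i)); first by rewrite tmapE.
by move=> b; exact: tmap_Cat.
Qed.

Lemma CM_near k f p : CM k f p -> \forall q \near p, CM k f q.
Proof.
move=> Cf; have ip := chart_atP X p.
have := near_crd ip (Cat_near (Cf _ ip)).
by apply: filterS2 (near_dom ip) => q iq; exact: CM_chart.
Qed.

Lemma CM_ext k f h p : (\forall q \near p, f q = h q) -> CM k f p -> CM k h p.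
Proof. by move=> E Cf i ip; apply: Cat_ext (Cf i ip); exact: (near_pt ip E). Qed.

Lemma CM_le (j k : nat) f p : (j <= k)%N -> CM k f p -> CM j f p.
Proof. by move=> jk Cf i ip; apply: Cat_le jk (Cf i ip). Qed.

Lemma CM_cst k c p : CM k (fun=> c) p.
Proof. by move=> i ip; exact: Cat_cst. Qed.

Lemma CMD k f h p : CM k f p -> CM k h p -> CM k (fun q => f q + h q) p.
Proof. by move=> Cf Ch i ip; apply: CatD; [exact: Cf|exact: Ch]. Qed.

Lemma CMM k f h p : CM k f p -> CM k h p -> CM k (fun q => f q * h q) p.
Proof. by move=> Cf Ch i ip; apply: CatM; [exact: Cf|exact: Ch]. Qed.

Lemma CMV k f p : f p != 0 -> CM k f p -> CM k (fun q => (f q)^-1) p.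
Proof. by move=> f0 Cf i ip; apply: CatV; [rewrite /= crdK|exact: Cf]. Qed.

Lemma CM_sum k I (r : seq I) (P : pred I) (F : I -> M -> R) p :
  (forall l : I, CM k (F l) p) -> CM k (fun q => \sum_(l <- r | P l) F l q) p.
Proof.
move=> CF i ip; apply: (@Cat_sum _ _ _ _ r P (fun l => F l \o pt i)) => l; exact: CF.
Qed.

Lemma CM_continuous k f p : CM k f p -> {for p, continuous f}.
Proof.
move=> Cf; have ip := chart_atP X p; set i := chart_at X p in ip.
have c1 := Cat_continuous (Cf _ ip).
have : {for p, continuous ((f \o pt i) \o crd i)}.
  exact: continuous_comp (crd_continuous ip) c1.
by apply: near_eq_continuous; apply: filterS (near_dom ip) => q iq /=; rewrite crdK.
Qed.

Lemma Cfun_CM o k (W : set M) f p : open W -> order_le o k -> Cfun X o W f -> W p -> CM k f p.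
Proof.
move=> oW ok Cf Wp; have ip := chart_atP X p; apply: (CM_chart ip).
have [Z [F [oZ Zp dF FP]]] := Cf _ tt _ Wp ip I.
have := Ck_Cat oZ Zp (Ck_Some ok dF); apply: Cat_ext.
have On : \forall x \near crd (chart_at X p) p, Z x by exact: open_nbhs_nbhs.
have Wn : \forall x \near crd (chart_at X p) p, W (pt (chart_at X p) x).
  by apply: near_pt => //; exact: open_nbhs_nbhs.
apply: filterS2 (filterI (near_chart ip) On) Wn => x [[ix xE] Ox] Wx.
by have [|_ E] := FP (pt (chart_at X p) x) Wx ix; rewrite ?xE// -{1}xE E.
Qed.

Lemma SM_CM l k (F : 'rV[R]_l -> M) z f : SM k F z -> CM k f (F z) ->
  Cat k (fun y => f (F y)) z.
Proof.
move=> [cF CF] Cf; have ip := chart_atP X (F z); set i := chart_at _ _ in ip.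
have C := @Cat_comp _ _ _ k (f \o pt i) (fun y => crd i (F y)) z (Cf _ ip) (CF _ ip).
apply: Cat_ext C; apply: filterS (near_comp_cont cF (near_dom ip)) => y iy.
by rewrite /= crdK.
Qed.

Lemma SM_chart l k (F : 'rV[R]_l -> M) z i : {for z, continuous F} -> dom i (F z) ->
  (forall b, Cat k (fun y => crd i (F y) 0 b) z) -> SM k F z.
Proof.
move=> cF ip CF; split=> // j jp b.
have C := @Cat_comp _ _ _ k (fun x => tmap i j x 0 b) (fun y => crd i (F y)) z (tmap_Cat k b ip jp) CF.
apply: Cat_ext C; apply: filterS (near_comp_cont cF (near_dom ip)) => y iy.
by rewrite tmapE.
Qed.

End Charts.

Arguments CM {R n M} X k f p.
Arguments SM {R n M} X {l} k F z.

(** * Pairings, Laplacian and Hessian of functions on the manifold *)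

Section Metric.
Context {R : realType} {n : nat} {M : topologicalType} {X : manifold R n M} (g : metric X).
Implicit Types (i j : idx X) (p q : M) (f h : M -> R).

Lemma gmx_Cat k i p : dom i p -> CatMx k (gmx g i) (crd i p).
Proof.
move=> ip a b.
have H := @Ck_Some R 'rV[R]_n R^o None k _ _ I (@gmx_smooth _ _ _ _ g i a b).
by apply: Ck_Cat H; [exact: img_open|exists p].
Qed.

Lemma gmx_posdef i p : dom i p -> posdef (gmx g i (crd i p)).
Proof. by move=> ip; split; [exact: gmx_sym|exact: gmx_pos]. Qed.

Lemma gmx_near_posdef i p : dom i p -> \forall x \near crd i p, posdef (gmx g i x).
Proof.
by move=> ip; apply: filterS (near_chart ip) => x [ix <-]; exact: gmx_posdef.
Qed.

Lemma gmx_near_sym i p : dom i p -> \forall x \near crd i p, (gmx g i x)^T = gmx g i x.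
Proof. by move=> /gmx_near_posdef; apply: filterS => x []. Qed.

Lemma transitionE i j p : dom i p -> dom j p -> transition i j p = jac (tmap i j) (crd i p).
Proof.
move=> ip jp; rewrite /transition jacobianE// => b.
by have := tmap_Cat 1 b ip jp => /Cat_differentiable.
Qed.

Lemma gmx_pull i j p : dom i p -> dom j p ->
  \forall x \near crd i p, gmx g i x = pull (tmap i j) (gmx g j) x.
Proof.
move=> ip jp; apply: filterS2 (near_chart ip) (near_pt ip (near_dom jp)) => x [ix xE] jx.
rewrite -{1}xE (gmx_change g ix jx) (transitionE ix jx) xE.
by rewrite /pull /tmap.
Qed.

(** The metric of one chart is the pull-back of that of the other, so a singular Jacobian would make
    its determinant zero. *)
Lemma jac_tmap_unit i j p : dom i p -> dom j p -> jac (tmap i j) (crd i p) \in unitmx.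
Proof.
move=> ip jp; have := posdef_det (gmx_posdef ip).
rewrite (nbhs_singleton (gmx_pull ip jp)) /pull !det_mulmx => d0.
rewrite unitmxE unitfE; apply/eqP => E; move: d0; rewrite E !mul0r ltxx.
by [].
Qed.

Lemma gpair_chart f h i j p : dom i p -> dom j p -> CM X 1 f p -> CM X 1 h p ->
  gpair (gmx g i) (f \o pt i) (h \o pt i) (crd i p) =
  gpair (gmx g j) (f \o pt j) (h \o pt j) (crd j p).
Proof.
move=> ip jp Cf Ch; rewrite -(near_gpair _ (near_tmap f ip jp) (near_tmap h ip jp)).
rewrite -[in RHS](tmapE j ip) -gpair_comp; first last.
- by rewrite tmapE//; apply: posdef_unit; exact: gmx_posdef.
- exact: jac_tmap_unit.
- by move=> b; apply: Cat_differentiable (tmap_Cat 1 b ip jp).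
- by rewrite tmapE//; apply: Cat_differentiable (Ch j jp).
- by rewrite tmapE//; apply: Cat_differentiable (Cf j jp).
by rewrite /gpair (nbhs_singleton (gmx_pull ip jp)).
Qed.

Lemma lap_chart f i j p : dom i p -> dom j p -> CM X 2 f p ->
  lap (gmx g i) (f \o pt i) (crd i p) = lap (gmx g j) (f \o pt j) (crd j p).
Proof.
move=> ip jp Cf; rewrite -[in RHS](tmapE j ip) -lap_comp; first last.
- exact: jac_tmap_unit.
- by move=> b; exact: (tmap_Cat 2 b ip jp).
- by rewrite tmapE//; exact: (Cf j jp).
- by rewrite tmapE//; exact: gmx_posdef.
- by rewrite tmapE//; exact: gmx_Cat.
by apply/esym/near_lap; [apply: filterS (gmx_pull ip jp)|exact: near_tmap].
Qed.

Definition ip f h p := inner g p (grad g f p) (grad g h p).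

Lemma ip_chart f h i p : dom i p -> CM X 1 f p -> CM X 1 h p ->
  ip f h p = gpair (gmx g i) (f \o pt i) (h \o pt i) (crd i p).
Proof.
move=> di Cf Ch; have dc := chart_atP X p.
rewrite (gpair_chart di dc Cf Ch) /ip /inner /ev /grad /local_grad /gpair /dvec.
have pd := gmx_posdef dc; rewrite trmx_mul /ginv (posdef_inv_sym pd) !mulmxA.
by rewrite -[X in (X *m _ *m _) 0 0]mulmxA mulVmx ?mulmx1//; exact: posdef_unit.
Qed.

Lemma laplacian_chart f i p : dom i p -> CM X 2 f p ->
  laplacian g f p = lap (gmx g i) (f \o pt i) (crd i p).
Proof. by move=> di Cf; rewrite (lap_chart di (chart_atP X p) Cf). Qed.

Lemma ip_near_chart f h i p : dom i p -> CM X 1 f p -> CM X 1 h p ->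
  \forall x \near crd i p, gpair (gmx g i) (f \o pt i) (h \o pt i) x = (ip f h \o pt i) x.
Proof.
move=> di Cf Ch; have H1 := near_pt di (CM_near Cf); have H2 := near_pt di (CM_near Ch).
apply: filterS3 (near_chart di) H1 H2 => x [dx xE] Cfx Chx.
by rewrite /= (ip_chart dx Cfx Chx) xE.
Qed.

Lemma CM_ip k f h p : CM X k.+1 f p -> CM X k.+1 h p -> CM X k (ip f h) p.
Proof.
move=> Cf Ch; have di := chart_atP X p; apply: (CM_chart di).
have C := Cat_gpair (gmx_Cat k di) (gmx_posdef di) (Cf _ di) (Ch _ di).
apply: Cat_ext C.
exact: ip_near_chart (CM_le _ Cf) (CM_le _ Ch).
Qed.

Lemma ipC f h p : CM X 1 f p -> CM X 1 h p -> ip f h p = ip h f p.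
Proof.
move=> Cf Ch; have di := chart_atP X p.
by rewrite !(ip_chart di)//; apply: gpairC; exact: gmx_posdef.
Qed.

Lemma ip_ge0 f p : CM X 1 f p -> 0 <= ip f f p.
Proof. by move=> Cf; apply: posdef_ge0; exact: gmx_posdef (chart_atP X p). Qed.

Lemma ip_near f f' h p : (\forall q \near p, f q = f' q) -> CM X 1 f p -> CM X 1 h p ->
  ip f h p = ip f' h p.
Proof.
move=> E Cf Ch; have di := chart_atP X p.
rewrite (ip_chart di Cf Ch) (ip_chart di (CM_ext E Cf) Ch).
by apply: near_gpair; [exact: (near_pt di E)|exact: near_all].
Qed.

(** The common source of the sum, product and chain rules for [ip]: only the coordinate derivatives
    at the point p matter, and c1, c2 may be values frozen at p. *)
Lemma ip_lin f f1 f2 c1 c2 h p : CM X 1 f p -> CM X 1 f1 p -> CM X 1 f2 p -> CM X 1 h p ->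
  (forall i k, dom i p -> partial k (f \o pt i) (crd i p) =
     c1 * partial k (f1 \o pt i) (crd i p) + c2 * partial k (f2 \o pt i) (crd i p)) ->
  ip f h p = c1 * ip f1 h p + c2 * ip f2 h p.
Proof.
move=> Cf C1 C2 Ch H; have di := chart_atP X p.
rewrite (ip_chart di Cf Ch) (ip_chart di C1 Ch) (ip_chart di C2 Ch) /gpair.
have -> : dvec (f \o pt (chart_at X p)) (crd (chart_at X p) p) =
   c1 *: dvec (f1 \o pt (chart_at X p)) (crd (chart_at X p) p) +
   c2 *: dvec (f2 \o pt (chart_at X p)) (crd (chart_at X p) p).
  have L (u v : 'rV[R]_n) k : (c1 *: u + c2 *: v) 0 k = c1 * u 0 k + c2 * v 0 k by rewrite !mxE.
  by apply/rowP => k; rewrite L [LHS]mxE [dvec (f1 \o _) _ 0 k]mxE [dvec (f2 \o _) _ 0 k]mxE; exact: H.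
move: (dvec _ _) (dvec _ _) (dvec _ _) (invmx _) => u v w A.
by rewrite !mulmxDl -!scalemxAl [LHS]mxE [X in X + _ = _]mxE [X in _ + X = _]mxE.
Qed.

Lemma ipDl f1 f2 h p : CM X 1 f1 p -> CM X 1 f2 p -> CM X 1 h p ->
  ip (fun q => f1 q + f2 q) h p = ip f1 h p + ip f2 h p.
Proof.
move=> C1 C2 Ch; rewrite (ip_lin (c1 := 1) (c2 := 1) (CMD C1 C2) C1 C2 Ch) ?mul1r ?mul1r//.
move=> i k di; rewrite !mul1r.
exact: (partialD k (Cat_differentiable (C1 i di)) (Cat_differentiable (C2 i di))).
Qed.

Lemma ipMl f1 f2 h p : CM X 1 f1 p -> CM X 1 f2 p -> CM X 1 h p ->
  ip (fun q => f1 q * f2 q) h p = f2 p * ip f1 h p + f1 p * ip f2 h p.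
Proof.
move=> C1 C2 Ch; apply: (ip_lin (CMM C1 C2) C1 C2 Ch) => i k di.
have := partialM k (Cat_differentiable (C1 i di)) (Cat_differentiable (C2 i di)).
rewrite /comp (crdK di) => E; apply: etrans E _; congr (_ + _); exact: mulrC.
Qed.

Lemma CM_comp1 (F : R -> R) f p : CM X 1 f p -> (\forall t \near f p, derivable F t 1) ->
  (\forall t \near f p, {for t, continuous ('D_1 F)}) ->
  CM X 1 (fun q => F (f q)) p.
Proof.
move=> Cf dF cF i di.
have Cfi := Cf i di; have cf := Cat_continuous Cfi.
have E : (f \o pt i) (crd i p) = f p by rewrite /comp (crdK di).
apply: (@Cat_comp1 _ _ 0 F (f \o pt i) _ Cfi); first by rewrite E.
have H1 : \forall x \near crd i p, {for (f \o pt i) x, continuous ('D_1 F)}.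
  by apply: (near_comp_cont (P := fun t => {for t, continuous ('D_1 F)}) cf); rewrite E.
have H2 := Cat_near (CatW Cfi).
apply: filterS2 H1 H2 => x h1 h2; exact: continuous_comp (Cat_continuous h2) h1.
Qed.

Lemma ip_comp1 (F : R -> R) f h p : CM X 1 f p -> CM X 1 h p ->
  CM X 1 (fun q => F (f q)) p -> derivable F (f p) 1 ->
  ip (fun q => F (f q)) h p = 'D_1 F (f p) * ip f h p.
Proof.
move=> Cf Ch CF dF; rewrite (ip_lin (c1 := 'D_1 F (f p)) (c2 := 0) CF Cf Cf Ch) ?mul0r ?addr0//.
move=> i k di; rewrite mul0r addr0.
have := @partial_comp1 _ _ F (f \o pt i) (crd i p) k (Cat_differentiable (Cf i di)).
by rewrite /comp (crdK di); apply.
Qed.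

(** Contracting symbols of the second kind with df is the same as contracting those of the first
    kind with grad f, by symmetry of the inverse matrix. *)
Lemma hessian_mxE i f p : dom i p -> hessian_mx g i f (crd i p) =
  chess (gmx g i) (f \o pt i) (crd i p).
Proof.
move=> di; apply/matrixP => a b; rewrite !mxE; congr (_ - _).
have sg := posdef_inv_sym (gmx_posdef di).
have sE c d : ginv g i (crd i p) c d = ginv g i (crd i p) d c.
  by rewrite /ginv -[in LHS]sg mxE.
transitivity (\sum_c 2^-1 * \sum_d (partial c (f \o pt i) (crd i p) * ginv g i (crd i p) c d) *
    (partial a (fun y => gmx g i y b d) (crd i p) + partial b (fun y => gmx g i y a d) (crd i p)
     - partial d (fun y => gmx g i y a b) (crd i p))).
  apply: eq_bigr => c _; rewrite /christoffel -mulrA mulr_suml; congr (_ * _).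
  apply: eq_bigr => d _; rewrite mulrAC; congr (_ * _); exact: mulrC.
rewrite -mulr_sumr exchange_big /=; congr (_ * _); apply: eq_bigr => d _.
rewrite -mulr_suml; congr (_ * _); rewrite [RHS]mxE; apply: eq_bigr => c _.
by rewrite [in RHS]mxE.
Qed.

Lemma hessian_ip f r p : CM X 2 f p -> CM X 2 r p ->
  ip f (ip r f) p *+ 2 - ip r (ip f f) p = hessian g r p (grad g f p) (grad g f p) *+ 2.
Proof.
move=> Cf Cr; have di := chart_atP X p; set i := chart_at X p in di.
rewrite /hessian /ev -/i (hessian_mxE r di).
rewrite -(hess_gpair (gmx_near_sym di) (gmx_Cat 1 di) (gmx_posdef di) (Cf i di) (Cr i di)).
have Cf1 := CM_le (leqnSn 1) Cf; have Cr1 := CM_le (leqnSn 1) Cr.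
rewrite (ip_chart di Cf1 (CM_ip Cr Cf)) (ip_chart di Cr1 (CM_ip Cf Cf)).
rewrite (near_gpair (gmx g i) (near_all _ (fun=> erefl)) (ip_near_chart di Cr1 Cf1)).
by rewrite (near_gpair (gmx g i) (near_all _ (fun=> erefl)) (ip_near_chart di Cf1 Cf1)).
Qed.

Lemma laplacian_trace f p : CM X 2 f p ->
  let i := chart_at X p in
  laplacian g f p = \tr (invmx (gmx g i (crd i p)) *m hessian_mx g i f (crd i p)).
Proof.
move=> Cf i; have di : dom i p := chart_atP X p; rewrite (laplacian_chart di Cf) hessian_mxE//.
by apply: lap_trace; [exact: gmx_near_sym|exact: gmx_Cat|exact: gmx_posdef|exact: Cf].
Qed.

End Metric.

(** * Geodesics *)

Section RealLemmas.
Context {R : realType}.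
Implicit Types (f df : R -> R) (s t a b : R).

Lemma is_derive_near f h t (d : R) : (\forall s \near t, f s = h s) ->
  is_derive t 1 f d -> is_derive t 1 h d.
Proof.
move=> E [df dfE]; split.
  exact: near_eq_derivable E df.
by rewrite -dfE; apply/esym; exact: (@near_eq_derive _ R R f h t).
Qed.

Lemma is_derive_affine f k t0 t (d : R) : is_derive (k * t + t0) 1 f d ->
  is_derive t 1 (fun s : R => f (k * s + t0)) (k * d).
Proof.
move=> df; have dg : is_derive t 1 (fun s : R => k * s + t0) k.
  have E : (fun s : R => k * s + t0) = (k *: (@id R) + cst t0) by apply/funext => s.
  by rewrite E; apply: is_derive_eq; rewrite addr0 -[_ *: _]/(_ * _) mulr1.
have := @is_derive1_comp R f (fun s : R => k * s + t0) t d k df dg.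
by rewrite mulrC.
Qed.

Lemma is_derive_continuous f t (d : R) : is_derive t 1 f d -> {for t, continuous f}.
Proof. by move=> [df _]; apply: differentiable_continuous; apply/derivable1_diffP. Qed.

Lemma mvt_seg f df a b : a <= b -> (forall s, a <= s <= b -> is_derive s 1 f (df s)) ->
  exists2 c, a <= c <= b & f b - f a = df c * (b - a).
Proof.
move=> ab H; have [||c cab E] := @MVT_segment R f df a b ab.
- by move=> s; rewrite in_itv /= => /andP[s1 s2]; apply: H; rewrite !ltW.
- apply: derivable_within_continuous => s; rewrite in_itv /= => /H.
  by case.
by exists c => //; move: cab; rewrite in_itv.
Qed.

Lemma deriv_bound f df a b C : a <= b -> (forall s, a <= s <= b -> is_derive s 1 f (df s)) ->
  (forall s, a <= s <= b -> `|df s| <= C) -> `|f b - f a| <= C * (b - a).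
Proof.
move=> ab H B; have [c cab ->] := mvt_seg ab H.
by rewrite normrM (ger0_norm (_ : 0 <= b - a)) ?subr_ge0// ler_wpM2r ?subr_ge0//; exact: B.
Qed.

(** The product of f with exp(-L s) is nonincreasing. *)
Lemma gronwall f df L T : 0 <= T -> (forall s, 0 <= s <= T -> is_derive s 1 f (df s)) ->
  (forall s, 0 <= s <= T -> df s <= L * f s) -> f T <= expR (L * T) * f 0.
Proof.
move=> T0 H B.
pose h s := f s * expR (- L * s).
have dh s : 0 <= s <= T -> is_derive s 1 h (df s * expR (- L * s) + f s * (- L * expR (- L * s))).
  move=> sT; have df' := H s sT.
  have de : is_derive s 1 (fun s : R => expR (- L * s)) (- L * expR (- L * s)).
    have := @is_derive_affine expR (- L) 0 s (expR (- L * s)).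
    rewrite (_ : (fun s => expR (- L * s + 0)) = (fun s => expR (- L * s))); last first.
      by apply/funext => u; rewrite addr0.
    by apply; rewrite addr0; exact: is_derive_expR.
  have E : h = f * (fun s : R => expR (- L * s)) by [].
  by rewrite E; apply: is_derive_eq; rewrite /GRing.scale /= addrC mulrC [X in _ + X]mulrC mulrC.
have [c cT E] := mvt_seg T0 dh.
have : h T - h 0 <= 0.
  rewrite E subr0; apply: mulr_le0_ge0 => //.
  have -> : df c * expR (- L * c) + f c * (- L * expR (- L * c)) =
    (df c - L * f c) * expR (- L * c) by ring.
  by rewrite mulr_le0_ge0 ?expR_ge0// subr_le0; exact: B.
rewrite /h mulr0 expR0 mulr1 subr_le0 mulNr expRN => le.
by rewrite mulrC -ler_pdivrMr ?expR_gt0.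
Qed.

(** The continuity method. The supremum of the times up to which P holds is reached by the first
    assumption and cannot be smaller than T by the second; P 0 comes from the first assumption,
    which is vacuous there. *)
Lemma real_induction (P : R -> Prop) T :
  (forall t, 0 <= t <= T -> (forall s, 0 <= s < t -> P s) -> P t) ->
  (forall t, 0 <= t < T -> P t -> exists2 e, 0 < e & forall s, t <= s <= t + e -> s <= T -> P s) ->
  forall t, 0 <= t <= T -> P t.
Proof.
move=> cl op t /andP[t0 tT]; apply: contrapT => nP.
pose A := [set s : R | 0 <= s <= T /\ forall u, 0 <= u <= s -> P u].
have P0 : P 0.
  apply: cl => [|s]; first by rewrite lexx (le_trans t0).
  by move=> /andP[s0 s1]; have := le_lt_trans s0 s1; rewrite ltxx.
have A0 : A 0.
  split; first by rewrite lexx (le_trans t0).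
  by move=> u u0; have -> : u = 0 by apply/eqP; rewrite eq_le andbC.
have sA : has_sup A by split; [exists 0|exists T => s [/andP[]]].
pose m := sup A.
have m0 : 0 <= m by apply: sup_upper_bound.
have mt : m <= T by apply: sup_le_ub => [|s [/andP[]]]; first exact: (ex_intro _ 0 A0).
have lt_m s : 0 <= s < m -> P s.
  move=> /andP[s0 sm]; have e0 : 0 < m - s by rewrite subr_gt0.
  have [u Au] := sup_adherent e0 sA; rewrite -/m subKr => su.
  by apply: (Au.2); rewrite s0 ltW.
have Pm : P m by apply: cl => //; rewrite m0.
have [mT|mT] := eqVneq m T.
  apply: nP; have [->|tm] := eqVneq t m; first by [].
  by apply: lt_m; rewrite t0 lt_neqAle tm mT.
have [|e e0 H] := op m _ Pm; first by rewrite m0 lt_neqAle mT.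
pose m' := Num.min (m + e) T.
have mm' : m < m' by rewrite lt_min ltrDl e0 lt_neqAle mT.
suff Am' : A m' by have := sup_upper_bound sA Am'; rewrite leNgt mm'.
split; first by rewrite (le_trans m0 (ltW mm'))/= ge_min lexx orbT.
move=> u /andP[u0]; rewrite le_min => /andP[ue uT].
have [um|mu] := ltP u m; first by apply: lt_m; rewrite u0.
by apply: H => //; rewrite mu.
Qed.

Lemma Cat_lip n (f : 'rV[R]_n -> R) (z : 'rV[R]_n) : Cat 1 f z ->
  exists L e : R, [/\ 0 <= L, 0 < e & forall y y', `|y - z| <= e -> `|y' - z| <= e ->
    `|f y - f y'| <= L * `|y - y'| /\ `|f y| <= L].
Proof.
move=> Cf.
have c0 := Cat_continuous Cf.
have H0 : \forall y \near z, `|f y - f z| <= 1.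
  have /cvgrPdist_le/(_ 1 ltr01) := c0; apply: filterS => y; by rewrite distrC.
have H1 : \forall y \near z, forall a : 'I_n, `|partial a f y - partial a f z| <= 1.
  apply: near_forall => a.
  have /cvgrPdist_le/(_ 1 ltr01) := Cat_continuous (Cat_partial a Cf).
  by apply: filterS => y; rewrite distrC.
have H2 := Cat_near Cf.
have /nbhs_ballP[d /= d0 dP] : \forall y \near z, [/\ `|f y - f z| <= 1,
    (forall a : 'I_n, `|partial a f y - partial a f z| <= 1) & Cat 1 f y].
  by apply: filterS3 H0 H1 H2.
pose L := \sum_(a < n) (`|partial a f z| + 1) + (`|f z| + 1).
have S0 : 0 <= \sum_(a < n) (`|partial a f z| + 1) by apply: sumr_ge0 => a _; rewrite addr_ge0.
exists L, (d / 2); split.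
- by rewrite addr_ge0// addr_ge0.
- by rewrite divr_gt0.
move=> y y' hy hy'.
have inb w : `|w - z| <= d / 2 -> ball z d w.
  rewrite -ball_normE /ball_ /= distrC => /le_lt_trans; apply.
  by rewrite ltr_pdivrMr// mulr_natr mulr2n ltrDl.
have fy : `|f y| <= L.
  have [h _ _] := dP _ (inb _ hy).
  have : `|f y| <= `|f z| + 1 by rewrite -(subrK (f z) (f y)) addrC (le_trans (ler_normD _ _))// lerD2l.
  by move=> /le_trans; apply; rewrite lerDr.
split=> //.
have seg (c : R) : 0 <= c <= 1 -> ball z d (c *: (y - y') + y').
  move=> /andP[c0' c1]; apply: inb.
  have -> : c *: (y - y') + y' - z = c *: (y - z) + (1 - c) *: (y' - z).
    apply/rowP => k; rewrite !mxE; ring.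
  apply: le_trans (ler_normD _ _) _; rewrite !normrZ (ger0_norm c0') (ger0_norm (_ : 0 <= 1 - c)) ?subr_ge0//.
  have a1 : c * `|y - z| <= c * (d / 2) by rewrite ler_wpM2l.
  have a2 : (1 - c) * `|y' - z| <= (1 - c) * (d / 2) by rewrite ler_wpM2l ?subr_ge0.
  apply: le_trans (lerD a1 a2) _; rewrite -mulrDl addrC subrK mul1r; exact: lexx.
have [|c c01] := @mvt_line _ _ f y' (y - y').
  by move=> c /seg/dP[_ _ Cc]; apply: diff_derivable; exact: Cat_differentiable Cc.
rewrite subrK => ->; have [_ h Cc] := dP _ (seg c c01).
rewrite derive_partial; last exact: Cat_differentiable Cc.
apply: le_trans (ler_norm_sum _ _ _) _.
apply: le_trans (_ : \sum_(a < n) (`|partial a f z| + 1) * `|y - y'| <= _).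
  apply: ler_sum => a _; rewrite normrM mulrC ler_pM//; last exact: coord_le.
  rewrite -(subrK (partial a f z) (partial a f _)) addrC.
  by apply: le_trans (ler_normD _ _) _; rewrite lerD2l; exact: h.
by rewrite -mulr_suml ler_wpM2r// lerDl addr_ge0.
Qed.

Lemma energy_ineq (x y w q : R) : w ^+ 2 <= q ->
  2 * x * y + 2 * y * w <= 2 * (x ^+ 2 + y ^+ 2) + q.
Proof.
move=> h; have h1 := sqr_ge0 (x - y); have h2 := sqr_ge0 (y - w); have h3 := sqr_ge0 x.
have P : 0 <= (x - y) ^+ 2 + (y - w) ^+ 2 + x ^+ 2 + (q - w ^+ 2) by apply: addr_ge0; [apply: addr_ge0 => //; exact: addr_ge0|rewrite subr_ge0].
rewrite -subr_ge0; apply: le_trans P _; rewrite le_eqVlt; apply/orP; left; apply/eqP; ring.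
Qed.

Lemma continuous_dist (T : topologicalType) (V : normedModType R) (F : T -> V) z (x : T) :
  {for x, continuous F} -> {for x, continuous (fun y => `|F y - z|)}.
Proof. by move=> cF; apply: cvg_norm; apply: cvgB cF _; exact: for_cst. Qed.

Lemma compact_ball_at n (x0 : 'rV[R]_n) (e : R) : compact [set x : 'rV[R]_n | `|x - x0| <= e].
Proof.
have -> : [set x : 'rV[R]_n | `|x - x0| <= e] = (fun v => v + x0) @` [set v : 'rV[R]_n | `|v| <= e].
  apply/seteqP; split => [x xe|_ [v ve <-]] /=; last by rewrite addrK.
  by exists (x - x0) => //=; rewrite subrK.
apply: continuous_compact; last exact: compact_ball.
have c (x : 'rV[R]_n) : {for x, continuous (fun v : 'rV[R]_n => v + x0)}.
  by apply: continuousD; [exact: for_id|exact: for_cst].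
by apply: continuous_subspaceT => x; exact: c.
Qed.

End RealLemmas.

Section Geodesics.
Context {R : realType} {n : nat} {M : topologicalType} {X : manifold R n M} (g : metric X).
Implicit Types (i j : idx X) (p q : M) (c : R -> M) (x v w : 'rV[R]_n) (s t : R).

Definition xc i c (k : 'I_n) s : R := crd i (c s) 0 k.
Definition vc i c (k : 'I_n) : R -> R := derive1 (xc i c k).
Definition vrow i c s : 'rV[R]_n := \row_k vc i c k s.

(** The acceleration prescribed by the geodesic equation, as a function on pairs (position,
    velocity) written as one row. *)
Definition Gam i (k : 'I_n) (z : 'rV[R]_(n + n)) : R :=
  - \sum_a \sum_b christoffel g i (lsubmx z) a b k * z 0 (rshift n a) * z 0 (rshift n b).

Definition phase i c s : 'rV[R]_(n + n) := row_mx (crd i (c s)) (vrow i c s).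

(** The geodesic equation as a first-order system in every chart. Compared with [geodesic] there is
    no C^2 requirement to carry along, so affine changes of parameter are easy. *)
Definition geo c := continuous c /\ forall i t, dom i (c t) -> forall k,
  is_derive t 1 (xc i c k) (vc i c k t) /\
  is_derive t 1 (vc i c k) (Gam i k (phase i c t)).

Lemma near_curve c i t : continuous c -> dom i (c t) -> \forall s \near t, dom i (c s).
Proof. by move=> cc it; exact: near_comp_cont (cc t) (near_dom it). Qed.

Lemma geodesic_geo c : geodesic g c -> geo c.
Proof.
move=> [C2 ode].
have loc i t : dom i (c t) -> exists (Z : set R) (F : R -> 'rV[R]_n),
    [/\ open Z, Z t, @Ck R R^o 'rV[R]_n (Some 2%N) Z F &
        forall s, Z s -> dom i (c s) /\ F s = crd i (c s)].
  move=> it; have [Z [F [oZ Zt CF FP]]] := C2 tt i t I I it.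
  by exists Z, F; split=> // s Zs; apply: FP.
split=> [t|i t it k].
  have it := chart_atP X (c t); set i := chart_at X (c t) in it.
  have [Z [F [oZ Zt CF FP]]] := loc i t it.
  have cF : {for t, continuous F} by have [+ _] := CF [::] t Zt; apply.
  have Zn : \forall s \near t, Z s by exact: open_nbhs_nbhs.
  have E1 : F t = crd i (c t) by have [] := FP t Zt.
  have : {for t, continuous (pt i \o F)}.
    by apply: continuous_comp => //; rewrite E1; exact: pt_continuous.
  apply: near_eq_continuous; apply: filterS Zn => s Zs.
  by have [is_ E] := FP s Zs; rewrite /comp E crdK.
have [Z [F [oZ Zt CF FP]]] := loc i t it.
have Zn s : Z s -> \forall u \near s, Z u by move=> Zs; exact: open_nbhs_nbhs.
have En s : Z s -> \forall u \near s, F u = (crd i \o c) u.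
  by move=> /Zn; apply: filterS => u Zu; have [] := FP u Zu.
have dF s : Z s -> derivable F s 1 by move=> Zs; have [_ +] := CF [::] s Zs; apply.
have dX s : Z s -> derivable (crd i \o c) s 1.
  by move=> Zs; apply: near_eq_derivable (En s Zs) (dF s Zs).
have vE s l : Z s -> derive1 (crd i \o c) s 0 l = vc i c l s.
  move=> Zs; rewrite /vc !derive1E derive_mx ?mxE//; exact: dX.
have D1E s : Z s -> \forall u \near s, ('D_1 F) u = derive1 (crd i \o c) u.
  move=> /Zn; apply: filterS => u Zu; rewrite derive1E; exact: near_eq_derive (En u Zu).
have d2 : derivable (derive1 (crd i \o c)) t 1.
  apply: near_eq_derivable (D1E t Zt) _.
  by have [_ +] := CF [:: 1] t Zt; apply.
split.
  split; last by rewrite /vc derive1E.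
  by have /derivable_mxP := dX t Zt; apply.
have /derivable_mxP d2k := d2.
have Ev : \forall s \near t, derive1 (crd i \o c) s 0 k = vc i c k s.
  by apply: filterS (Zn t Zt) => s; exact: vE.
have H : is_derive t 1 (fun s : R => derive1 (crd i \o c) s 0 k) (Gam i k (phase i c t)).
  split; first exact: d2k.
  have := ode i t it k; rewrite derive1E derive_mx// mxE => /eqP; rewrite addr_eq0 => /eqP ->.
  rewrite /Gam /phase row_mxKl; congr (- _); apply: eq_bigr => a _; apply: eq_bigr => b _.
  by rewrite !row_mxEr /vrow !mxE !vE.
exact: is_derive_near Ev H.
Qed.

Lemma geo_affine c k t0 : geo c -> geo (fun s => c (k * s + t0)).
Proof.
move=> [cc H]; set c' := fun s => _.
have ca s : {for s, continuous (fun s : R => k * s + t0)}.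
  apply: cvgD; last exact: for_cst.
  by apply: cvgM; [exact: for_cst|exact: for_id].
have vE i s : dom i (c' s) -> forall l, is_derive s 1 (xc i c' l) (k * vc i c l (k * s + t0)).
  by move=> is_ l; have [d1 _] := H i (k * s + t0) is_ l; exact: (is_derive_affine d1).
have vE' i s : dom i (c' s) -> forall l, vc i c' l s = k * vc i c l (k * s + t0).
  by move=> is_ l; have [_ E] := vE i s is_ l; rewrite -E /vc derive1E.
have cc' : continuous c' by move=> s; exact: (@continuous_comp _ _ _ (fun s : R => k * s + t0) c s (ca s) (cc _)).
split=> // i t it l; split; first by rewrite vE'//; exact: vE.
have [_ d2] := H i (k * t + t0) it l.
have := is_derive_affine d2 => d2'.
have d3 : is_derive t 1 (fun s : R => k * vc i c l (k * s + t0)) (k * (k * Gam i l (phase i c (k * t + t0)))).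
  have E : (fun s : R => k * vc i c l (k * s + t0)) = k *: (fun s : R => vc i c l (k * s + t0)) by [].
  by rewrite E; apply: is_derive_eq.
have -> : Gam i l (phase i c' t) = k * (k * Gam i l (phase i c (k * t + t0))).
  rewrite /Gam !mulrN !mulr_sumr; congr (- _); apply: eq_bigr => a _.
  rewrite !mulr_sumr; apply: eq_bigr => b _; rewrite /phase !row_mxKl !row_mxEr /vrow.
  by rewrite ![(\row__ _) _ _]mxE !vE' //; ring.
apply: is_derive_near d3; apply: filterS (near_curve cc' it) => s is_.
by rewrite vE'.
Qed.

Lemma christoffel_Cat k i p a b d : dom i p -> Cat k (fun x => christoffel g i x a b d) (crd i p).
Proof.
move=> di; have C l := gmx_Cat g l di.
have Ci : CatMx k (fun x => invmx (gmx g i x)) (crd i p).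
  by apply: CatMx_inv (C k) _; rewrite gt_eqF//; apply: posdef_det; exact: gmx_posdef.
apply: CatZ; apply: Cat_sum => e; apply: CatM; first exact: Ci.
apply: CatB; [apply: CatD|]; apply: Cat_partial; exact: C.
Qed.

Lemma Gam_Cat k i p l v : dom i p -> Cat k (Gam i l) (row_mx (crd i p) v).
Proof.
move=> di; apply: CatN; apply: Cat_sum => a; apply: Cat_sum => b.
apply: CatM; last exact: Cat_coord.
apply: CatM; last exact: Cat_coord.
apply: (@Cat_comp _ _ _ _ (fun x => christoffel g i x a b l) (fun z : 'rV[R]_(n + n) => lsubmx z)).
  by rewrite row_mxKl; exact: christoffel_Cat.
by move=> e; apply: eq_Cat (Cat_coord k (lshift n e) _) => z; rewrite mxE.
Qed.

Lemma phase_continuous i c t : geo c -> dom i (c t) -> {for t, continuous (phase i c)}.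
Proof.
move=> [_ H] dt; apply: continuous_row => k; case: (split_ordP k) => l E.
  apply: (@near_eq_continuous _ _ (xc i c l)); first by apply: near_all => s; rewrite E row_mxEl.
  by have [dx _] := H i t dt l; exact: is_derive_continuous dx.
apply: (@near_eq_continuous _ _ (vc i c l)); first by apply: near_all => s; rewrite E row_mxEr mxE.
by have [_ dx] := H i t dt l; exact: is_derive_continuous dx.
Qed.

(** Geodesics with initial data near (p, v) stay in one chart for a common time T and depend on
    these data in a Lipschitz way. A continuity argument keeps the phase in a ball where [Gam] is
    bounded and Lipschitz; Gronwall's inequality for the squared distance of two phases does the
    rest. *)
Lemma geo_local i p v : dom i p -> exists e T K : R, [/\ 0 < e, 0 < T, 0 <= K &
  (forall c, geo c -> dom i (c 0) -> `|phase i c 0 - row_mx (crd i p) v| <= e ->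
     forall s, 0 <= s <= T -> dom i (c s) /\ forall k, `|vc i c k s| <= K) /\
  (forall c1 c2, geo c1 -> geo c2 -> dom i (c1 0) -> dom i (c2 0) ->
     `|phase i c1 0 - row_mx (crd i p) v| <= e -> `|phase i c2 0 - row_mx (crd i p) v| <= e ->
     forall s, 0 <= s <= T -> forall k,
       `|xc i c1 k s - xc i c2 k s| <= K * `|phase i c1 0 - phase i c2 0| /\
       `|vc i c1 k s - vc i c2 k s| <= K * `|phase i c1 0 - phase i c2 0|)].
Proof.
move=> dp; set z := row_mx _ v.
have /choice[L0 LP] : forall k, exists L0 : R, exists e : R, [/\ 0 <= L0, 0 < e &
    forall y y', `|y - z| <= e -> `|y' - z| <= e ->
    `|Gam i k y - Gam i k y'| <= L0 * `|y - y'| /\ `|Gam i k y| <= L0].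
  by move=> k; exact: Cat_lip (Gam_Cat 1 k v dp).
have [e0 eP] := choice LP.
(* One constant for the velocities in the ball, at most |v| + 1, for the values of [Gam] and for
   their Lipschitz constants. *)
pose L := 1 + `|v| + \sum_k L0 k.
have S0 : 0 <= \sum_k L0 k by apply: sumr_ge0 => k _; have [] := eP k.
have L1 : 1 <= L by rewrite /L -addrA lerDl addr_ge0.
have L0L k : L0 k <= L.
  rewrite /L (bigD1 k)//= addrCA lerDl.
  by rewrite !addr_ge0//; apply: sumr_ge0 => j _; have [] := eP j.
have [e1 e10 e1P] : exists2 e1 : R, 0 < e1 & forall x, `|x - crd i p| <= e1 ->
    dom i (pt i x) /\ crd i (pt i x) = x.
  have /nbhs_ballP[d /= d0 dP] := near_chart dp.
  exists (d / 2); first by rewrite divr_gt0.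
  move=> x hx; apply: dP; rewrite -ball_normE /ball_ /= distrC (le_lt_trans hx)//.
  by rewrite ltr_pdivrMr// mulr_natr mulr2n ltrDl.
have [e2 [e20 e21 e2e e2k]] : exists e2 : R, [/\ 0 < e2, e2 <= 1, e2 <= e1 & forall k, e2 <= e0 k].
  exists (Num.min (Num.min e1 1) (\big[Num.min/1]_k e0 k)); split.
  - rewrite !lt_min e10 ltr01/=; elim/big_ind: _ => // [a b a0 b0|k _]; first by rewrite lt_min a0.
    by have [] := eP k.
  - by rewrite !ge_min lexx orbT.
  - by rewrite !ge_min lexx.
  - by move=> k; rewrite ge_min; apply/orP; right; exact: bigmin_le_cond.
have nrow (x x' : 'rV[R]_n) w w' (C : R) : `|row_mx x w - row_mx x' w'| <= C <->
    `|x - x'| <= C /\ `|w - w'| <= C.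
  have E : row_mx x w - row_mx x' w' = row_mx (x - x') (w - w').
    by rewrite opp_row_mx add_row_mx.
  rewrite E; split=> [H|[H1 H2]].
    have C0 := le_trans (normr_ge0 _) H.
    split; apply: norm_le_coord => // k; [rewrite -(row_mxEl _ (w - w'))|rewrite -(row_mxEr (x - x'))];
      exact: le_trans (coord_le _ _) H.
  apply: norm_le_coord => [|k]; first exact: le_trans H1.
  case: (split_ordP k) => l ->; rewrite ?row_mxEl ?row_mxEr; exact: le_trans (coord_le _ _) _.
(* Up to time T the phase moves by at most L T = e2 / 4; starting within e2 / 4 of z, it remains
   within e2 / 2, strictly inside the ball of radius e2. *)
pose T := e2 / (4 * L).
have LL0 : 0 < 4 * L by rewrite mulr_gt0// (lt_le_trans ltr01).
have T0 : 0 < T by rewrite divr_gt0.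
have TL : L * T = e2 / 4 by rewrite /T; field; apply/eqP => E; move: L1; rewrite E; lra.
pose good c s := dom i (c s) /\ `|phase i c s - z| < e2.
have vL c s k : good c s -> `|vc i c k s| <= L.
  move=> [_ /ltW/nrow[_ h]].
  have : `|vrow i c s| <= `|v| + 1.
    rewrite -(subrK v (vrow i c s)) addrC (le_trans (ler_normD _ _))// lerD2l.
    exact: le_trans h e21.
  have := coord_le (vrow i c s) k; rewrite mxE => h1 h2.
  by apply: le_trans h1 (le_trans h2 _); rewrite /L [1 + _]addrC lerDl.
have GL c s k : good c s -> `|Gam i k (phase i c s)| <= L.
  move=> [_ /ltW h]; have [_ _ /(_ (phase i c s) (phase i c s))[]] := eP k.
  - exact: le_trans h (e2k k).
  - exact: le_trans h (e2k k).
  by move=> _ h'; exact: le_trans h' (L0L k).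
have xcE c s : crd i (c s) = \row_k xc i c k s by apply/rowP => k; rewrite mxE.
have stay c : geo c -> dom i (c 0) -> `|phase i c 0 - z| <= e2 / 4 ->
    forall s, 0 <= s <= T -> good c s.
  move=> [cc H] d0 z0; apply: real_induction => [t /andP[t0 tT] gd|t tT gt].
    have [->|tn0] := eqVneq t 0.
      split=> //; apply: le_lt_trans z0 _; rewrite ltr_pdivrMr// ltr_pMr// ltr1n.
      by [].
    have tp : 0 < t by rewrite lt_neqAle eq_sym tn0.
    have half s : 0 <= s < t -> `|phase i c s - z| <= e2 / 2.
      move=> /andP[s0 st].
      have gs u : 0 <= u <= s -> good c u by move=> /andP[u0 us]; apply: gd; rewrite u0 (le_lt_trans us).
      have bnd : `|phase i c s - phase i c 0| <= e2 / 4.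
        have st' : L * (s - 0) <= e2 / 4.
          by rewrite -TL subr0 ler_wpM2l ?(le_trans ler01)// (le_trans (ltW st)).
        apply/nrow; split; apply: norm_le_coord; rewrite ?divr_ge0 ?(ltW e20)// => k.
          rewrite !xcE !mxE; apply: le_trans st'.
          apply: (@deriv_bound _ (xc i c k) (vc i c k)) => // u us.
            by have [du _] := gs u us; have [] := H i u du k.
          exact: vL (gs u us).
        rewrite !mxE; apply: le_trans st'.
        apply: (@deriv_bound _ (vc i c k) (fun s => Gam i k (phase i c s))) => // u us.
          by have [du _] := gs u us; have [] := H i u du k.
        exact: GL (gs u us).
      rewrite -(subrK (phase i c 0) (phase i c s)) -addrA (le_trans (ler_normD _ _))//.
      have -> : e2 / 2 = e2 / 4 + e2 / 4 by field.
      by rewrite lerD.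
    (* The coordinate ball is compact, so its image is closed in the Hausdorff space M; the limit c
       t of points of this image cannot leave the domain of the chart. *)
    pose B := [set x : 'rV[R]_n | `|x - crd i p| <= e2 / 2].
    have BP x : B x -> dom i (pt i x) /\ crd i (pt i x) = x.
      move=> Bx; apply: e1P; apply: le_trans Bx _; apply: le_trans e2e.
      by rewrite ler_pdivrMr// ler_peMr ?ler1n// ltW.
    have cK : compact (pt i @` B).
      apply: continuous_compact.
        apply: continuous_in_subspaceT => x; rewrite inE => /BP[dx xE].
        by rewrite -xE; exact: pt_continuous.
      exact: compact_ball_at.
    have clK := compact_closed (manifold_hausdorff X) cK.
    have ct : (pt i @` B) (c t).
      apply: contrapT => nK.
      have : \forall q \near c t, (~` (pt i @` B)) q.
        by apply: open_nbhs_nbhs; split=> //; exact: closed_openC.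
      move=> /(near_comp_cont (cc t)) /nbhs_ballP[d /= d0' dP].
      pose s := Num.max 0 (t - d / 2).
      have st : 0 <= s < t by rewrite le_max lexx gt_max tp ltrBlDr ltrDl divr_gt0.
      apply: (dP s).
        rewrite -ball_normE /ball_ /= ger0_norm ?subr_ge0; last by case/andP: st => _ /ltW.
        rewrite ltrBlDr -ltrBlDl lt_max; apply/orP; right; rewrite ltrD2l ltrN2.
        by rewrite ltr_pdivrMr// mulr_natr mulr2n ltrDl.
      have [ds _] := gd s st; have /nrow[h _] := half s st.
      by exists (crd i (c s)) => //; exact: crdK.
    have dt : dom i (c t) by case: ct => x /BP[dx _] <-.
    split=> //.
    suff h : `|phase i c t - z| <= e2 / 2.
      by apply: le_lt_trans h _; rewrite ltr_pdivrMr// ltr_pMr// ltr1n.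
    rewrite leNgt; apply/negP => h.
    have cp : {for t, continuous (fun s => `|phase i c s - z|)}.
      by apply: continuous_dist; exact: phase_continuous.
    have /nbhs_ballP[d /= d0' dP] := near_comp_cont cp (near_gt h).
    pose s := Num.max 0 (t - d / 2).
    have st : 0 <= s < t by rewrite le_max lexx gt_max tp ltrBlDr ltrDl divr_gt0.
    have := half s st; rewrite leNgt => /negP; apply; apply: dP.
    rewrite -ball_normE /ball_ /= ger0_norm ?subr_ge0; last by case/andP: st => _ /ltW.
    rewrite ltrBlDr -ltrBlDl lt_max; apply/orP; right; rewrite ltrD2l ltrN2.
    by rewrite ltr_pdivrMr// mulr_natr mulr2n ltrDl.
  have [dt ht] := gt.
  have cp : {for t, continuous (fun s => `|phase i c s - z|)}.
    by apply: continuous_dist; exact: phase_continuous.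
  have h1 : \forall s \near t, `|phase i c s - z| < e2.
    by apply: (near_comp_cont (P := fun y => y < e2) cp); exact: lt_nbhsl.
  have /nbhs_ballP[d /= d0' dP] : \forall u \near t, dom i (c u) /\ `|phase i c u - z| < e2.
    exact: filterI (near_curve cc dt) h1.
  exists (d / 2); first by rewrite divr_gt0.
  move=> s /andP[ts st] sT; apply: dP; rewrite -ball_normE /ball_ /= distrC ger0_norm ?subr_ge0//.
  rewrite ltrBlDl; apply: le_lt_trans st _; rewrite ltrD2l.
  by rewrite ltr_pdivrMr// mulr_natr mulr2n ltrDl.
have e24 : 0 < e2 / 4 by rewrite divr_gt0.
(* Summing [energy_ineq] over the n coordinates bounds the derivative of E by 2 E + n L^2 E. *)
pose La : R := 2 + n%:R * L ^+ 2.
have La0 : 0 <= La by rewrite addr_ge0// mulr_ge0// exprn_ge0// (le_trans ler01).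
pose K0 : R := 2 * n%:R * expR (La * T).
have K00 : 0 <= K0 by rewrite !mulr_ge0// expR_ge0.
have L00 : 0 <= L by rewrite (le_trans ler01).
(* At least 1, hence K0 <= K^2, which turns the bound on squares into one on distances; it also
   dominates the bound L on velocities. *)
pose K := K0 + L.
have K1 : 1 <= K by rewrite (le_trans L1)// lerDr.
exists (e2 / 4), T, K; split=> //; first exact: le_trans ler01 K1.
split=> [c gc d0 z0 s sT|c1 c2 gc1 gc2 d1 d2 z1 z2 s0 sT k].
  have gs := stay c gc d0 z0 s sT; split; first by case: gs.
  by move=> k; apply: le_trans (vL c s k gs) _; rewrite lerDr.
set N0 := `|phase i c1 0 - phase i c2 0|.
have N00 : 0 <= N0 by exact: normr_ge0.
pose dx k s := xc i c1 k s - xc i c2 k s.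
pose dv k s := vc i c1 k s - vc i c2 k s.
pose dG k s := Gam i k (phase i c1 s) - Gam i k (phase i c2 s).
pose Ek k s := dx k s ^+ 2 + dv k s ^+ 2.
pose E s := \sum_k Ek k s.
pose dE s := \sum_k (2 * dx k s * dv k s + 2 * dv k s * dG k s).
have Ek0 l s : 0 <= Ek l s by rewrite addr_ge0// sqr_ge0.
have EkE l s : Ek l s <= E s by rewrite /E (bigD1 l)//= lerDl sumr_ge0.
have E0 s : 0 <= E s by apply: sumr_ge0.
have g1 s : 0 <= s <= T -> good c1 s by move=> h; exact: (stay c1 gc1 d1 z1 s h).
have g2 s : 0 <= s <= T -> good c2 s by move=> h; exact: (stay c2 gc2 d2 z2 s h).
have derE s : 0 <= s <= T -> is_derive s 1 E (dE s).
  move=> sT'; have [[ds1 _] [ds2 _]] := (g1 s sT', g2 s sT').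
  have dEk l : is_derive s 1 (Ek l) (2 * dx l s * dv l s + 2 * dv l s * dG l s).
    have [x1 v1] := (gc1.2 i s ds1 l); have [x2 v2] := (gc2.2 i s ds2 l).
    have hx : is_derive s 1 (dx l) (dv l s) by exact: is_deriveB x1 x2.
    have hv : is_derive s 1 (dv l) (dG l s) by exact: is_deriveB v1 v2.
    have -> : Ek l = dx l ^+ 2 + dv l ^+ 2 by apply/funext => u; rewrite /Ek !expr2.
    apply: is_derive_eq; rewrite /GRing.scale /= !expr1; ring.
  have -> : E = \sum_(l < n) Ek l by apply/funext => u; rewrite fct_sumE.
  exact: is_derive_sum.
have Nle s : `|phase i c1 s - phase i c2 s| <= Num.sqrt (E s).
  have sq a l s' : a ^+ 2 <= Ek l s' -> `|a| <= Num.sqrt (E s').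
    by move=> h; rewrite -sqrtr_sqr ler_wsqrtr// (le_trans h).
  apply/nrow; split; apply: norm_le_coord; rewrite ?sqrtr_ge0// => l.
    by rewrite !xcE !mxE; apply: (sq _ l); rewrite /Ek lerDl sqr_ge0.
  by rewrite !mxE; apply: (sq _ l); rewrite /Ek lerDr sqr_ge0.
have dEle s : 0 <= s <= T -> dE s <= La * E s.
  move=> sT'; have [[_ /ltW h1] [_ /ltW h2]] := (g1 s sT', g2 s sT').
  have dGl l : dG l s ^+ 2 <= L ^+ 2 * E s.
    have [_ _ /(_ (phase i c1 s) (phase i c2 s))[]] := eP l.
    - exact: le_trans h1 (e2k l).
    - exact: le_trans h2 (e2k l).
    rewrite -/(dG l s) => h _.
    rewrite -(sqr_sqrtr (E0 s)) -exprMn -real_normK ?num_real// ler_sqr ?nnegrE ?mulr_ge0 ?sqrtr_ge0//.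
    apply: le_trans h _; apply: le_trans (_ : L * `|phase i c1 s - phase i c2 s| <= _).
      by apply: ler_wpM2r; [exact: normr_ge0|exact: L0L].
    by rewrite ler_wpM2l.
  apply: le_trans (_ : \sum_(l < n) (2 * Ek l s + L ^+ 2 * E s) <= _).
    apply: ler_sum => l _; have := dGl l; rewrite /Ek.
    exact: energy_ineq.
  rewrite big_split /= -mulr_sumr sumr_const card_ord -[_ *+ n]mulr_natl /La.
  by rewrite [leRHS]mulrDl -[in leRHS]mulrA; exact: lexx.
have EN : E 0 <= 2 * n%:R * N0 ^+ 2.
  apply: le_trans (_ : \sum_(l < n) 2 * N0 ^+ 2 <= _).
    apply: ler_sum => l _; rewrite /Ek mulr_natl mulr2n.
    have sq a : `|a| <= N0 -> a ^+ 2 <= N0 ^+ 2.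
      by move=> h; rewrite -real_normK ?num_real// ler_sqr ?nnegrE ?normr_ge0.
    have /nrow[h1 h2] : `|phase i c1 0 - phase i c2 0| <= N0 by [].
    apply: lerD; apply: sq.
      by apply: le_trans _ h1; apply: le_trans _ (coord_le _ l); rewrite !xcE !mxE.
    by apply: le_trans _ h2; apply: le_trans _ (coord_le _ l); rewrite !mxE.
  by rewrite sumr_const card_ord -[_ *+ n]mulr_natl mulrA [n%:R * 2]mulrC.
have [s00 sT'] := andP sT.
have Es : E s0 <= K0 * N0 ^+ 2.
  have sub u : 0 <= u <= s0 -> 0 <= u <= T by move=> /andP[-> /le_trans ->].
  have := gronwall s00 (fun u h => derE u (sub u h)) (fun u h => dEle u (sub u h)).
  move=> /le_trans; apply; rewrite /K0 mulrAC.
  apply: le_trans (_ : expR (La * T) * (2 * n%:R * N0 ^+ 2) <= _); last by rewrite mulrC.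
  apply: ler_pM; rewrite ?expR_ge0//.
  by rewrite ler_expR ler_wpM2l.
have fin (x : R) : x ^+ 2 <= Ek k s0 -> `|x| <= K * N0.
  move=> h; rewrite -ler_sqr ?nnegrE ?normr_ge0//; last by rewrite mulr_ge0// (le_trans ler01).
  rewrite real_normK ?num_real// exprMn.
  apply: le_trans h _; apply: le_trans (EkE _ _) _; apply: le_trans Es _.
  rewrite ler_wpM2r ?sqr_ge0//; apply: le_trans (_ : K <= _); first by rewrite lerDl.
  by rewrite expr2 ler_peMr// (le_trans ler01).
split; apply: fin; rewrite /Ek; [by rewrite lerDl sqr_ge0|by rewrite lerDr sqr_ge0].
Qed.

End Geodesics.

(** * Uniqueness of geodesics *)

Section GeodesicUniqueness.
Context {R : realType} {n : nat} {M : topologicalType} {X : manifold R n M} (g : metric X).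
Implicit Types (i j : idx X) (p q : M) (c : R -> M) (x v w : 'rV[R]_n) (s t : R).
Local Notation geo := (geo g).
Local Notation Gam := (Gam g).

Lemma left_limit_eq (T : topologicalType) (f h : R -> T) a t : hausdorff_space T -> a < t ->
  {for t, continuous f} -> {for t, continuous h} -> (forall s, a < s < t -> f s = h s) -> f t = h t.
Proof.
move=> hT at_ cf ch H; apply: hT => A B fA hB.
have /nbhs_ballP[d /= d0 dP] : \forall s \near t, A (f s) /\ B (h s).
  by apply: filterI; [exact: (near_comp_cont cf fA)|exact: (near_comp_cont ch hB)].
pose s := Num.max ((a + t) / 2) (t - d / 2).
have st : a < s < t.
  by rewrite lt_max gt_max; apply/andP; split; [apply/orP; left|apply/andP; split]; lra.
have [Af Bh] : A (f s) /\ B (h s).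
  apply: dP; rewrite -ball_normE /ball_ /= ger0_norm ?subr_ge0; last by case/andP: st => _ /ltW.
  rewrite ltrBlDr -ltrBlDl lt_max; apply/orP; right; rewrite ltrD2l ltrN2.
  by rewrite ltr_pdivrMr// mulr_natr mulr2n ltrDl.
by exists (f s); split=> //; rewrite (H _ st).
Qed.

Lemma vc_near i c1 c2 k t : (\forall s \near t, c1 s = c2 s) -> vc i c1 k t = vc i c2 k t.
Proof.
move=> E; rewrite /vc !derive1E; apply: near_eq_derive.
by apply: filterS E => s Es; rewrite /xc Es.
Qed.

Lemma near_itv (a b s : R) (P : R -> Prop) : a < s < b -> (forall u, a < u < b -> P u) ->
  \forall u \near s, P u.
Proof.
move=> /andP[a1 b1] H.
by apply: filterS2 (near_gt a1) (lt_nbhsl b1) => u u1 u2; apply: H; rewrite u1.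
Qed.

Lemma vc_affine i c k t0 s l : geo c -> dom i (c (k * s + t0)) ->
  vc i (fun s => c (k * s + t0)) l s = k * vc i c l (k * s + t0).
Proof.
move=> [cc H] ds; have [d1 _] := H i _ ds l.
by have [_ E] := is_derive_affine d1; rewrite -E /vc derive1E.
Qed.

(** Continuity method for the times at which positions and velocities agree in some chart: limits
    are handled by the Hausdorff property, extension to the right by [geo_local] with equal initial
    phases. *)
Lemma geo_unique i c1 c2 T : geo c1 -> geo c2 -> c1 0 = c2 0 -> dom i (c1 0) ->
  (forall k, vc i c1 k 0 = vc i c2 k 0) -> forall t, 0 <= t <= T -> c1 t = c2 t.
Proof.
move=> g1 g2 e0 d0 v0 t tT.
pose P t := c1 t = c2 t /\ exists2 j : idx X, dom j (c1 t) & forall k, vc j c1 k t = vc j c2 k t.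
suff [] : P t by [].
move: t tT; apply: real_induction => [t /andP[t0 tT] H|t /andP[t0 tT] [et [j dj vj]]].
  have [->|tn0] := eqVneq t 0; first by split=> //; exists i.
  have tp : 0 < t by rewrite lt_neqAle eq_sym tn0.
  have Et s : 0 < s < t -> c1 s = c2 s.
    by move=> /andP[s0 st]; have [|//] := H s; rewrite (ltW s0).
  have e : c1 t = c2 t.
    exact: left_limit_eq (manifold_hausdorff X) tp (g1.1 t) (g2.1 t) Et.
  split=> //; have dj := chart_atP X (c1 t); exists (chart_at X (c1 t)) => // k.
  set j := chart_at X (c1 t) in dj *.
  have [_ w1] := g1.2 j t dj k.
  have [_ w2] : is_derive t 1 (xc j c2 k) (vc j c2 k t) /\ is_derive t 1 (vc j c2 k) (Gam j k (phase j c2 t)).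
    by apply: (g2.2 j t); rewrite -e.
  apply: (left_limit_eq (@Rhausdorff R) tp (is_derive_continuous w1) (is_derive_continuous w2)) => s st.
  by apply: vc_near; exact: near_itv st Et.
pose c1' s := c1 (1 * s + t); pose c2' s := c2 (1 * s + t).
have g1' : geo c1' by exact: geo_affine.
have g2' : geo c2' by exact: geo_affine.
have E0 : 1 * 0 + t = t by rewrite mulr0 add0r.
have dj' : dom j (c2 t) by rewrite -et.
have ph1 : phase j c1' 0 = row_mx (crd j (c1 t)) (vrow j c1 t).
  rewrite /phase; congr row_mx; first by rewrite /c1' E0.
  by apply/rowP => k; rewrite !mxE /c1' vc_affine ?E0// mul1r.
have ph2 : phase j c2' 0 = row_mx (crd j (c1 t)) (vrow j c1 t).
  rewrite /phase; congr row_mx; first by rewrite /c2' E0 et.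
  by apply/rowP => k; rewrite !mxE /c2' vc_affine ?E0// mul1r vj.
have [e [T0 [K [ep T0p K0 [st df]]]]] := geo_local g (vrow j c1 t) dj.
have b1 : `|phase j c1' 0 - row_mx (crd j (c1 t)) (vrow j c1 t)| <= e by rewrite ph1 subrr normr0 ltW.
have b2 : `|phase j c2' 0 - row_mx (crd j (c1 t)) (vrow j c1 t)| <= e by rewrite ph2 subrr normr0 ltW.
have dj1 : dom j (c1' 0) by rewrite /c1' E0.
have dj2 : dom j (c2' 0) by rewrite /c2' E0.
have eq s : t <= s <= t + T0 -> c1 s = c2 s /\ dom j (c1 s).
  move=> /andP[ts sT]; have s' : 0 <= s - t <= T0 by rewrite subr_ge0 ts lerBlDl.
  have Es : 1 * (s - t) + t = s by rewrite mul1r subrK.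
  have [D1 _] := st c1' g1' dj1 b1 _ s'; have [D2 _] := st c2' g2' dj2 b2 _ s'.
  move: D1 D2; rewrite /c1' /c2' Es => D1 D2; split=> //.
  rewrite -(crdK D1) -(crdK D2); congr pt; apply/rowP => k.
  have [h _] := df c1' c2' g1' g2' dj1 dj2 b1 b2 _ s' k.
  move: h; rewrite ph1 ph2 subrr normr0 mulr0 normr_le0 subr_eq0 => /eqP.
  by rewrite /xc /c1' /c2' Es.
exists (T0 / 2); first by rewrite divr_gt0.
move=> s /andP[ts sT'] _.
have sT : s < t + T0 by apply: le_lt_trans sT' _; rewrite ltrD2l ltr_pdivrMr// mulr_natr mulr2n ltrDl.
have [es ds] : c1 s = c2 s /\ dom j (c1 s) by apply: eq; rewrite ts ltW.
split=> //; exists j => // k; have [->|tns] := eqVneq s t; first exact: vj.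
apply: vc_near; apply: (@near_itv t (t + T0)) => [|u /andP[u1 u2]].
  by rewrite lt_neqAle eq_sym tns ts.
by have [] // := eq u; rewrite !ltW.
Qed.

End GeodesicUniqueness.


Section CurveCalculus.
Context {R : realType} {n : nat}.

Lemma curve_chain (f : 'rV[R]_n -> R) (x : R -> 'rV[R]_n) (v : 'rV[R]_n) (t : R) :
  differentiable f (x t) -> (forall l, is_derive t 1 (fun s : R => x s 0 l) (v 0 l)) ->
  is_derive t 1 (fun s : R => f (x s)) (\sum_l v 0 l * partial l f (x t)).
Proof.
move=> df dx; have dx1 : derivable x t 1.
  by apply/derivable_mxP => i l; rewrite ord1; case: (dx l).
have dx2 : differentiable x t by apply/derivable1_diffP.
have dfx : differentiable (f \o x) t by exact: differentiable_comp.
split; first by apply: diff_derivable.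
have E : 'd x t 1 = v.
  rewrite -deriveE// derive_mx//; apply/rowP => l; rewrite mxE; by case: (dx l).
rewrite -(derive_partial v df) !deriveE//.
have := @diff_comp _ R _ _ x f t dx2 df; rewrite /comp => ->.
by rewrite /= E.
Qed.

Lemma is_derive_form (p q : R -> 'rV[R]_n) (A : R -> 'M[R]_n) (p' q' : 'rV[R]_n) (A' : 'M[R]_n) (t : R) :
  (forall l, is_derive t 1 (fun s : R => p s 0 l) (p' 0 l)) ->
  (forall l, is_derive t 1 (fun s : R => q s 0 l) (q' 0 l)) ->
  (forall k l, is_derive t 1 (fun s : R => A s k l) (A' k l)) ->
  is_derive t 1 (fun s : R => (p s *m A s *m (q s)^T) 0 0)
    ((p' *m A t *m (q t)^T) 0 0 + (p t *m A' *m (q t)^T) 0 0 + (p t *m A t *m q'^T) 0 0).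
Proof.
move=> dp dq dA.
have -> : (fun s : R => (p s *m A s *m (q s)^T) 0 0) =
    \sum_(k < n) \sum_(l < n) (fun s : R => p s 0 k * A s k l * q s 0 l).
  apply/funext => s; rewrite formE fct_sumE; apply: eq_bigr => k _; rewrite fct_sumE.
  by [].
rewrite !formE -!big_split /=; apply: is_derive_sum => k.
rewrite -!big_split /=; apply: is_derive_sum => l.
have -> : (fun s : R => p s 0 k * A s k l * q s 0 l) =
   ((fun s : R => p s 0 k) * (fun s : R => A s k l)) * (fun s : R => q s 0 l) by [].
have h1 := dp k; have h2 := dA k l; have h3 := dq l.
apply: is_derive_eq; rewrite /GRing.scale /=.
have -> : ((fun s : R => p s 0 k) * (fun s : R => A s k l)) t = p t 0 k * A t k l by [].
by move: (p t 0 k) (A t k l) (q t 0 l) (p' 0 k) (A' k l) (q' 0 l) => a b c d e f; ring.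
Qed.

End CurveCalculus.

(** * Conservation of speed along geodesics *)

Section Energy.
Context {R : realType} {n : nat} {M : topologicalType} {X : manifold R n M} (g : metric X).
Implicit Types (i j : idx X) (p q : M) (c : R -> M) (x v w : 'rV[R]_n) (s t : R).
Local Notation geo := (geo g).
Local Notation Gam := (Gam g).

(** Pairing the acceleration with w through the metric cancels the inverse matrix in the symbols of
    the second kind and leaves those of the first kind. *)
Lemma Gam_cov i p v w : dom i p ->
  ((\row_k Gam i k (row_mx (crd i p) v)) *m gmx g i (crd i p) *m w^T) 0 0 =
  - (v *m chris (gmx g i) (crd i p) w *m v^T) 0 0.
Proof.
move=> dp; set A := gmx g i (crd i p).
have pd : posdef A := gmx_posdef g dp.
pose S a b d := partial a (fun y => gmx g i y b d) (crd i p) +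
   partial b (fun y => gmx g i y a d) (crd i p) - partial d (fun y => gmx g i y a b) (crd i p).
pose W := A *m w^T.
have WE d : \sum_k invmx A k d * W k 0 = w 0 d.
  transitivity ((invmx A *m W) d 0).
    by rewrite mxE; apply: eq_bigr => k _; rewrite -[in LHS](posdef_inv_sym pd) mxE.
  by rewrite /W mulmxA mulVmx ?mul1mx ?mxE//; exact: posdef_unit.
rewrite -mulmxA -/W mxE formE.
transitivity (- \sum_k \sum_a \sum_b v 0 a * v 0 b * (2^-1 * \sum_d S a b d * (invmx A k d * W k 0))).
  rewrite -sumrN; apply: eq_bigr => k _; rewrite mxE /Gam row_mxKl mulNr; congr (- _).
  rewrite mulr_suml; apply: eq_bigr => a _; rewrite mulr_suml; apply: eq_bigr => b _.
  rewrite !row_mxEr /christoffel /ginv -/A.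
  have -> : \sum_d S a b d * (invmx A k d * W k 0) = (\sum_d invmx A k d * S a b d) * W k 0.
    by rewrite mulr_suml; apply: eq_bigr => d _; rewrite mulrA [S _ _ _ * _]mulrC.
  rewrite -/(S a b _); move: (\sum_d _) (W k 0) (v 0 a) (v 0 b) => s1 s2 s3 s4; ring.
congr (- _); rewrite exchange_big /=; apply: eq_bigr => a _.
rewrite exchange_big /=; apply: eq_bigr => b _.
rewrite -mulr_sumr -mulr_sumr exchange_big /= [chris _ _ _ a b]mxE.
rewrite [RHS]mulrAC; congr (_ * (_ * _)).
by apply: eq_bigr => d _; rewrite -mulr_sumr WE mulrC.
Qed.

Definition C1c c := continuous c /\ forall i t, dom i (c t) -> forall k,
  is_derive t 1 (xc i c k) (vc i c k t) /\ {for t, continuous (vc i c k)}.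

Lemma geo_C1c c : geo c -> C1c c.
Proof.
move=> [cc H]; split=> // i t dt k; have [h1 h2] := H i t dt k; split=> //.
exact: is_derive_continuous h2.
Qed.

Lemma C1c_xc i c t k : C1c c -> dom i (c t) -> is_derive t 1 (fun s => crd i (c s) 0 k) (vrow i c t 0 k).
Proof. by move=> [_ H] dt; rewrite mxE; have [] := H i t dt k. Qed.

Lemma C1c_comp i c t (f : M -> R) : C1c c -> dom i (c t) -> CM X 1 f (c t) ->
  is_derive t 1 (fun s => f (c s)) (\sum_l vrow i c t 0 l * partial l (f \o pt i) (crd i (c t))).
Proof.
move=> Cc dt Cf.
have H : \forall s \near t, (f \o pt i) (crd i (c s)) = f (c s).
  by apply: filterS (near_curve Cc.1 dt) => s ds; rewrite /= crdK.
apply: is_derive_near H _; apply: (@curve_chain _ _ (f \o pt i) (fun s => crd i (c s))).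
  exact: Cat_differentiable (Cf i dt).
by move=> l; exact: C1c_xc.
Qed.

Lemma vrow_chart i j c t : C1c c -> dom i (c t) -> dom j (c t) ->
  vrow j c t = vrow i c t *m jac (tmap i j) (crd i (c t)).
Proof.
move=> Cc di dj; apply/rowP => k; rewrite [RHS]mxE.
have H : \forall s \near t, tmap i j (crd i (c s)) 0 k = xc j c k s.
  by apply: filterS (near_curve Cc.1 di) => s ds; rewrite /= tmapE.
have D := is_derive_near H (@curve_chain _ _ (fun x => tmap i j x 0 k) (fun s => crd i (c s)) (vrow i c t) t
   (Cat_differentiable (tmap_Cat 1 k di dj)) (fun l => C1c_xc l Cc di)).
have [_ E] := D; rewrite [LHS]mxE /vc derive1E E; apply: eq_bigr => l _.
by congr (_ * _); rewrite [RHS]mxE.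
Qed.

Definition en i c t : R := (vrow i c t *m gmx g i (crd i (c t)) *m (vrow i c t)^T) 0 0.

Lemma en_chart i j c t : C1c c -> dom i (c t) -> dom j (c t) -> en i c t = en j c t.
Proof.
move=> Cc di dj; rewrite /en (vrow_chart Cc di dj) (nbhs_singleton (gmx_pull g di dj)) /pull.
by rewrite tmapE// trmx_mul !mulmxA.
Qed.

Lemma velocityE c t : C1c c -> velocity (X := X) c t = vrow (chart_at X (c t)) c t.
Proof.
move=> Cc; have di := chart_atP X (c t); apply/rowP => k.
rewrite /velocity [RHS]mxE /vc !derive1E derive_mx ?mxE//.
by apply/derivable_mxP => a l; rewrite ord1; have [] := C1c_xc l Cc di.
Qed.

Lemma speedE i c t : C1c c -> dom i (c t) -> speed g c t = Num.sqrt (en i c t).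
Proof.
move=> Cc di; rewrite -(en_chart Cc (chart_atP X (c t)) di) /speed (velocityE t Cc).
by [].
Qed.

(** The two acceleration terms, rewritten by [Gam_cov] and [chris_form], cancel the derivative of
    the metric along the curve. *)
Lemma en_derive i c t : geo c -> dom i (c t) -> is_derive t 1 (en i c) 0.
Proof.
move=> gc di; have Cc := geo_C1c gc; set x := crd i (c t).
have dv l : is_derive t 1 (fun s => vrow i c s 0 l) ((\row_k Gam i k (phase i c t)) 0 l).
  rewrite mxE; have [_ h] := gc.2 i t di l.
  by apply: is_derive_near h; apply: near_all => s; rewrite mxE.
pose A' : 'M[R]_n := \sum_k vrow i c t 0 k *: dM k (gmx g i) x.
have dA k l : is_derive t 1 (fun s => gmx g i (crd i (c s)) k l) (A' k l).
  have := @curve_chain _ _ (fun y => gmx g i y k l) (fun s => crd i (c s)) (vrow i c t) t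
    (Cat_differentiable (gmx_Cat g 1 di k l)) (fun l => C1c_xc l Cc di).
  rewrite /A' summxE; have -> // : \sum_(l0 < n) vrow i c t 0 l0 * partial l0 (fun y => gmx g i y k l) (crd i (c t)) =
     \sum_i0 (vrow i c t 0 i0 *: dM i0 (gmx g i) x) k l.
  by apply: eq_bigr => a _; rewrite [RHS]mxE; congr (_ * _); rewrite [RHS]mxE.
have := is_derive_form dv dv dA; rewrite -/(en i c) => H; apply: is_derive_eq H _.
set V := vrow i c t; rewrite -/x.
rewrite [X in _ + X]form_tr (gmx_sym g di) /phase -/x -/V (Gam_cov _ _ di).
rewrite chris_form; last exact: gmx_near_sym.
have -> : (V *m A' *m V^T) 0 0 = \sum_k V 0 k * (V *m dM k (gmx g i) x *m V^T) 0 0.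
  rewrite /A' mulmx_sumr mulmx_suml summxE; apply: eq_bigr => k _.
  by rewrite -scalemxAr -scalemxAl [LHS]mxE.
by move: (\sum_k _) => q; field.
Qed.

Lemma speed_const c t s : geo c -> speed g c t = speed g c s.
Proof.
move=> gc; have Cc := geo_C1c gc.
pose F (u : R) := inner g (c u) (velocity (X := X) c u) (velocity (X := X) c u).
have FE u : F u = en (chart_at X (c u)) c u by rewrite /F velocityE.
have dF (u : R) : is_derive u 1 F 0.
  have di := chart_atP X (c u).
  apply: is_derive_near (en_derive gc di).
  apply: filterS (near_curve gc.1 di) => w dw; rewrite FE.
  exact: en_chart (chart_atP X _).
suff E (u w : R) : u <= w -> F u = F w.
  by rewrite /speed -!/(F _); have [/E->|/ltW/E->] := leP t s.
move=> uw; have [z _] := mvt_seg uw (fun z _ => dF z).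
by clear; move: (F u) (F w) => x y; rewrite mul0r => /eqP; rewrite subr_eq0 => /eqP.
Qed.

Lemma speed_affine c k t0 t : geo c -> speed g (fun s => c (k * s + t0)) t = `|k| * speed g c (k * t + t0).
Proof.
move=> gc; have gc' := geo_affine k t0 gc; have di := chart_atP X (c (k * t + t0)).
rewrite (speedE (geo_C1c gc') di) (speedE (geo_C1c gc) di).
have -> : en (chart_at X (c (k * t + t0))) (fun s => c (k * s + t0)) t =
    k ^+ 2 * en (chart_at X (c (k * t + t0))) c (k * t + t0).
  rewrite /en; have -> : vrow (chart_at X (c (k * t + t0))) (fun s => c (k * s + t0)) t =
      k *: vrow (chart_at X (c (k * t + t0))) c (k * t + t0).
    by apply/rowP => l; rewrite !mxE (vc_affine l gc di).
  by rewrite linearZ/= -!scalemxAl -scalemxAr !mxE mulrA expr2.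
by rewrite sqrtrM ?sqr_ge0// sqrtr_sqr.
Qed.

End Energy.

(** * The polar parametrization of the end *)

Section Covectors.
Context {R : realType} {n : nat}.
Implicit Types (u v w : 'rV[R]_n).

Definition dotv u v : R := (u *m v^T) 0 0.

Lemma dotvE u v : dotv u v = \sum_k u 0 k * v 0 k.
Proof. by rewrite /dotv mxE; apply: eq_bigr => k _; rewrite mxE. Qed.

Lemma dotvv_ge0 u : 0 <= dotv u u.
Proof. by rewrite dotvE; apply: sumr_ge0 => k _; rewrite -expr2 sqr_ge0. Qed.

Lemma dotvv_eq0 u : dotv u u = 0 -> u = 0.
Proof.
rewrite dotvE => /eqP; rewrite psumr_eq0 => [/allP H|k _]; last by rewrite -expr2 sqr_ge0.
apply/rowP => k; rewrite mxE; apply/eqP; rewrite -sqrf_eq0 expr2.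
by have := H k; rewrite mem_index_enum => /(_ isT).
Qed.

Lemma dotvC u v : dotv u v = dotv v u.
Proof. by rewrite !dotvE; apply: eq_bigr => k _; rewrite mulrC. Qed.

Lemma dotvB u v w : dotv u (v - w) = dotv u v - dotv u w.
Proof. by rewrite /dotv linearB/= mulmxBr !mxE. Qed.

Lemma dotvZ c u v : dotv u (c *: v) = c * dotv u v.
Proof. by rewrite /dotv linearZ/= -scalemxAr mxE. Qed.

(* Testing with v = b - c a for c slightly above <a,b>/|a|^2 gives equality in
   Cauchy-Schwarz. *)
Lemma half_space_eq (a b : 'rV[R]_n) : a != 0 -> b != 0 ->
  (forall v, dotv a v < 0 -> dotv b v <= 0) -> exists2 k, 0 < k & b = k *: a.
Proof.
move=> a0 b0 H.
have A0 : 0 < dotv a a.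
  by rewrite lt_neqAle dotvv_ge0 andbT eq_sym; apply/eqP => /dotvv_eq0/eqP; apply/negP.
have B0 : 0 < dotv b b.
  by rewrite lt_neqAle dotvv_ge0 andbT eq_sym; apply/eqP => /dotvv_eq0/eqP; apply/negP.
set A := dotv a a in A0; set B := dotv b b in B0; set C := dotv a b.
have T c : C < c * A -> B <= c * C.
  move=> h; have := H (b - c *: a); rewrite !dotvB !dotvZ -/A -/B -/C (dotvC b a) -/C.
  by rewrite subr_lt0 subr_le0; exact.
have C0 : 0 < C.
  rewrite ltNge; apply/negP => C0.
  have := T 1; rewrite !mul1r => /(_ (le_lt_trans C0 A0)) /(lt_le_trans B0); rewrite ltNge C0.
  by [].
have AB : A * B <= C ^+ 2.
  rewrite leNgt; apply/negP => h.
  have d0 : 0 < A * B - C ^+ 2 by rewrite subr_gt0.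
  have := T ((C + (A * B - C ^+ 2) / (2 * C)) / A).
  rewrite divfK ?gt_eqF// ltrDl divr_gt0 ?mulr_gt0// => /(_ isT).
  rewrite mulrAC ler_pdivlMr// mulrDl.
  have -> : (A * B - C ^+ 2) / (2 * C) * C = (A * B - C ^+ 2) / 2 by field; rewrite gt_eqF.
  by rewrite -expr2 [B * A]mulrC; move: d0; move: (A * B) (C ^+ 2) => x y; lra.
exists (C / A); first by rewrite divr_gt0.
apply/eqP; rewrite -subr_eq0; apply/eqP/dotvv_eq0/eqP; rewrite eq_le dotvv_ge0 andbT.
rewrite dotvB dotvC dotvB !dotvZ [dotv (b - _) a]dotvC dotvB dotvZ (dotvC b a) -/A -/B -/C.
have -> : B - C / A * C - C / A * (C - C / A * A) = (A * B - C ^+ 2) / A by field; rewrite gt_eqF.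
by rewrite ler_pdivrMr// mul0r subr_le0.
Qed.

End Covectors.

(** * Defining functions and outward normals of the boundary *)

Section BoundaryPoints.
Context {R : realType} {n : nat} {M : topologicalType} {X : manifold R n M} (g : metric X).
Context {U : set M} (hU : open U).
Implicit Types (i j : idx X) (p q : M) (W : set M) (f : M -> R).

Definition bd p := boundary U p.

Lemma bd_notin p : bd p -> ~ U p.
Proof. by move=> [_]; rewrite /interior => H Up; apply: H; exact: open_nbhs_nbhs. Qed.

Lemma bd_closure p : bd p -> closure U p.
Proof. by case. Qed.

Lemma def_CM k W f p : defining_function g U W f -> W p -> CM X k f p.
Proof. by move=> [oW Cf _ _] Wp; exact: (@Cfun_CM _ _ _ X None k W f p oW I Cf Wp). Qed.

(** f >= 0 at p because U is open and misses its boundary; f > 0 would persist nearby, where U is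
    met. *)
Lemma def_zero W f p : defining_function g U W f -> W p -> bd p -> f p = 0.
Proof.
move=> df Wp bp; have [oW Cf Uf _] := df.
have f0 : 0 <= f p by rewrite leNgt; apply/negP => /(Uf p Wp); exact: bd_notin.
apply/eqP; rewrite eq_le f0 andbT leNgt; apply/negP => fp.
have c := CM_continuous (def_CM 0 df Wp).
have Wn : \forall q \near p, W q by exact: open_nbhs_nbhs.
have [q [Uq [fq Wq]]] := bd_closure bp (filterI (near_comp_cont c (near_gt fp)) Wn).
by have := (Uf q Wq).1 Uq; rewrite ltNge (ltW fq).
Qed.

Lemma near_derive_neg (F : R -> R) (d : R) : is_derive (0 : R) 1 F d -> d < 0 ->
  \forall s \near (0 : R)^'+, F s < F 0.
Proof.
move=> [dF dE] d0.
have : (fun s : R => s^-1 *: (F (s *: 1 + 0) - F 0)) @ 0^' --> d by rewrite -dE; exact: dF.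
move=> /cvgrPdist_lt /(_ (- d)); rewrite oppr_gt0 => /(_ d0).
rewrite near_withinE => /nbhs_ballP[e /= e0 eP].
exists e => //= s /=; rewrite sub0r normrN => se s0.
have := eP s; rewrite -ball_normE /ball_ /= sub0r normrN => /(_ se).
rewrite gt_eqF// => /(_ isT).
rewrite addr0 [s *: 1]mulr1 -[_ *: _]/(_ * _) => H; rewrite -subr_lt0; move: H.
move: (F s - F 0) => y; rewrite ltr_norml opprK => /andP[h1 _].
have : s^-1 * y < 0 by lra.
by rewrite pmulr_rlt0 ?invr_gt0.
Qed.

Lemma line_derive_pt i p h v : dom i p -> CM X 1 h p ->
  is_derive (0 : R) 1 (fun s : R => h (pt i (s *: v + crd i p)))
    (dotv (dvec (h \o pt i) (crd i p)) v).
Proof.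
move=> di Ch; have dh := Cat_differentiable (Ch i di).
have := @curve_chain _ _ (h \o pt i) (fun s : R => s *: v + crd i p) v 0.
rewrite scale0r add0r => /(_ dh).
have H l : is_derive (0 : R) 1 (fun s : R => (s *: v + crd i p) 0 l) (v 0 l).
  have -> : (fun s : R => (s *: v + crd i p) 0 l) = (fun s : R => v 0 l * s + crd i p 0 l).
    by apply/funext => s; rewrite !mxE mulrC.
  by have := @is_derive_affine _ id (v 0 l) (crd i p 0 l) 0 1; rewrite mulr1; apply.
move=> /(_ H); rewrite dotvE; set d1 := \sum_l _; set d2 := \sum_k _.
by have -> // : d1 = d2 by apply: eq_bigr => l _; rewrite mxE mulrC.
Qed.

Lemma near_line_pt i p v (Q : M -> Prop) : dom i p -> (\forall q \near p, Q q) ->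
  \forall s \near (0 : R)^'+, Q (pt i (s *: v + crd i p)).
Proof.
move=> di Qn; have cl : {for (0 : R), continuous (fun s : R => s *: v + crd i p)}.
  by apply: cvgD; [apply: cvgZl; exact: for_id|exact: for_cst].
have : \forall s \near (0 : R), Q (pt i (s *: v + crd i p)).
  apply: (near_comp_cont (P := fun x => Q (pt i x)) cl); rewrite scale0r add0r.
  exact: near_pt di Qn.
exact: cvg_within.
Qed.

(** Moving from p against the differential of f makes f negative at once, so U accumulates at p. *)
Lemma def_bd W f p : defining_function g U W f -> W p -> f p = 0 -> boundary U p.
Proof.
move=> df Wp fp; have [oW _ Uf gf] := df; have di := chart_atP X p; set i := chart_at X p in di.
have nz : dvec (f \o pt i) (crd i p) != 0.
  have := gf p Wp fp; apply: contra => /eqP E.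
  by rewrite /grad /local_grad -/i -/(dvec (f \o pt i) (crd i p)) E mul0mx.
split; last by move=> /interior_subset /(Uf p Wp); rewrite fp ltxx.
move=> B pB; set v := - dvec (f \o pt i) (crd i p).
have dn : dotv (dvec (f \o pt i) (crd i p)) v < 0.
  rewrite /v -scaleN1r dotvZ mulN1r oppr_lt0 lt_neqAle dotvv_ge0 andbT eq_sym.
  by apply/eqP => /dotvv_eq0/eqP; apply/negP.
have n1 : \forall s \near (0 : R)^'+, f (pt i (s *: v + crd i p)) < 0.
  have := near_derive_neg (line_derive_pt v di (def_CM 1 df Wp)) dn.
  by rewrite scale0r add0r crdK// fp.
have Wn : \forall q \near p, W q by exact: open_nbhs_nbhs.
have [s [[h1 h2] h3]] := filter_ex (filterI (filterI n1 (near_line_pt v di Wn)) (near_line_pt v di pB)).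
by exists (pt i (s *: v + crd i p)); split=> //; apply/(Uf _ h2).
Qed.

(** A direction along which f decreases while f' increases would contain points near p that lie in U
    according to f and outside U according to f'. Hence the two differentials satisfy the condition
    of [half_space_eq]. *)
Lemma normal_unique W W' f f' p : defining_function g U W f -> defining_function g U W' f' ->
  W p -> W' p -> bd p -> exists2 k, 0 < k & grad g f' p = k *: grad g f p.
Proof.
move=> df df' Wp Wp' bp; have [_ _ Uf gf] := df; have [_ _ Uf' gf'] := df'.
have fp := def_zero df Wp bp; have fp' := def_zero df' Wp' bp.
set i := chart_at X p; have di : dom i p := chart_atP X p.
have gE h : grad g h p = dvec (h \o pt i) (crd i p) *m ginv g i (crd i p) by [].
have nz h : grad g h p != 0 -> dvec (h \o pt i) (crd i p) != 0.
  by apply: contra => /eqP E; rewrite gE E mul0mx.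
have [|k k0 kE] := half_space_eq (nz _ (gf p Wp fp)) (nz _ (gf' p Wp' fp')); last first.
  by exists k => //; rewrite !gE kE -scalemxAl.
move=> v dv; rewrite leNgt; apply/negP => dv'.
have line h (Ch : CM X 1 h p) := line_derive_pt v di Ch.
have Z (h : M -> R) : h (pt i ((0 : R) *: v + crd i p)) = h p by rewrite scale0r add0r crdK.
have n1 : \forall s \near (0 : R)^'+, f (pt i (s *: v + crd i p)) < 0.
  by have := near_derive_neg (line f (def_CM 1 df Wp)) dv; rewrite Z fp.
have n2 : \forall s \near (0 : R)^'+, - f' (pt i (s *: v + crd i p)) < 0.
  have := near_derive_neg (is_deriveN (line f' (def_CM 1 df' Wp'))).
  by rewrite oppr_lt0 !fctE Z fp' oppr0; apply.
have nW : \forall s \near (0 : R)^'+, W (pt i (s *: v + crd i p)) /\ W' (pt i (s *: v + crd i p)).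
  have [oW _ _ _] := df; have [oW' _ _ _] := df'.
  have Wn : \forall q \near p, W q /\ W' q by apply: filterI; apply: open_nbhs_nbhs.
  exact: near_line_pt di Wn.
have [s [[h1 h2] [h3 h4]]] := filter_ex (filterI (filterI n1 n2) nW).
have := (Uf _ h3).2 h1 => /(Uf' _ h4); rewrite ltNge => /negP; apply.
by move: h2; rewrite oppr_lt0 => /ltW.
Qed.

End BoundaryPoints.

(** * The exponential map along a normal ray *)

Section Expm.
Context {R : realType} {n : nat} {M : topologicalType} {X : manifold R n M} (g : metric X).
Context {U : set M} (hU : open U).
Implicit Types (p q : M) (z : M * 'rV[R]_n) (c : R -> M).
Local Notation N := (outward_normal_bundle g U).

Lemma normal_bd z : N z -> bd (U := U) z.1. Proof. by case. Qed.

Lemma normal_scale z (s : R) : N z -> 0 < s -> N (z.1, s *: z.2).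
Proof.
move=> [b [W [f [k [df Wz k0 zE]]]]] s0; split=> //; exists W, f, (s * k).
by split=> //=; [rewrite mulr_gt0|rewrite zE scalerA].
Qed.

(** Without a suitable geodesic [expm] returns its default, the base point, which lies in the
    closure of U. A value outside the closure therefore comes from a geodesic, and no existence
    theorem is called for. *)
Lemma expm_geo z : N z -> ~ closure U (expm g z) ->
  exists c, [/\ geodesic g c, c 0 = z.1, velocity (X := X) c 0 = z.2 & expm g z = c 1].
Proof.
move=> Nz; rewrite /expm; case: xgetP => [q -> [c [gc c0 v0] <-] _|H nc].
  by exists c.
by exfalso; apply: nc; apply: bd_closure; exact: normal_bd.
Qed.

Context (hexp : forall z, N z -> ~ closure U (expm g z)).

(** The geodesic behind the value at s v and the reparametrized curve t -> c(s t) have the same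
    initial position and velocity. *)
Lemma expm_ray z c (s : R) : N z -> geo g c -> c 0 = z.1 -> velocity (X := X) c 0 = z.2 -> 0 < s ->
  expm g (z.1, s *: z.2) = c s.
Proof.
move=> Nz gc c0 v0 s0; have Ns := normal_scale Nz s0.
have [c' [/geodesic_geo gc' c'0 v'0 ->]] := expm_geo Ns (hexp Ns).
have gc2 := geo_affine s 0 gc; rewrite /= in c'0 v'0.
have di := chart_atP X z.1; set i := chart_at X z.1 in di.
have -> : c s = (fun t => c (s * t + 0)) 1 by rewrite mulr1 addr0.
apply: (@geo_unique _ _ _ _ g i c' (fun t => c (s * t + 0)) 1 gc' gc2).
- by rewrite mulr0 add0r c0.
- by rewrite c'0.
- move=> k; rewrite (vc_affine k gc) mulr0 add0r; last by rewrite c0.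
  have E1 := velocityE 0 (geo_C1c gc'); have E2 := velocityE 0 (geo_C1c gc).
  rewrite c'0 v'0 in E1; rewrite c0 v0 in E2.
  have := congr1 (fun v : 'rV[R]_n => v 0 k) E1; rewrite E2 -/i.
  by rewrite !mxE => ->.
- by rewrite ler01 lexx.
Qed.

End Expm.

Section PairMaps.
Context {R : realType}.
Local Notation V2 n := ('rV[R]_n * 'rV[R]_n : normedModType R)%type.

(** [tangent_charts] takes values in a product of row spaces while [Cat] speaks of functions of one
    row; smoothness is carried across this linear identification. *)
Definition unpair n (x : 'rV[R]_(n + n)) : V2 n := (lsubmx x, rsubmx x).

Lemma unpair_linear n : linear (@unpair n).
Proof. by move=> c u v; rewrite /unpair !linearP. Qed.

HB.instance Definition _ n :=
  GRing.isLinear.Build R 'rV[R]_(n + n) (V2 n) _ (@unpair n) (@unpair_linear n).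

Lemma unpair_continuous n : continuous (@unpair n).
Proof.
move=> x; apply: (@cvg_pair _ _ _ (nbhs x) (nbhs (lsubmx x)) (nbhs (rsubmx x)) _ _ _ (fun x => lsubmx x) (fun x => rsubmx x)).
  apply: (@continuous_row _ _ _ (fun x : 'rV[R]_(n + n) => lsubmx x)) => j.
  apply: (@near_eq_continuous _ _ (fun y : 'rV[R]_(n + n) => y 0 (lshift n j)) _ x); last exact: continuous_coord.
  by apply: near_all => y; rewrite mxE.
apply: (@continuous_row _ _ _ (fun x : 'rV[R]_(n + n) => rsubmx x)) => j.
apply: (@near_eq_continuous _ _ (fun y : 'rV[R]_(n + n) => y 0 (rshift n j)) _ x); last exact: continuous_coord.
by apply: near_all => y; rewrite mxE.
Qed.

Definition coordp n (b : bool) (j : 'I_n) (z : V2 n) : R^o := (if b then z.1 else z.2) 0 j.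

Lemma coordp_linear n b (j : 'I_n) : linear (coordp b j).
Proof. by move=> c u v; rewrite /coordp; case: b; rewrite !mxE. Qed.

HB.instance Definition _ n b (j : 'I_n) :=
  GRing.isLinear.Build R (V2 n) R^o _ (coordp b j) (@coordp_linear n b j).

Lemma coordp_continuous n b (j : 'I_n) : continuous (coordp b j).
Proof.
move=> [u v]; case: b; rewrite /coordp /=.
  apply: (@continuous_comp _ _ _ fst (fun w : 'rV[R]_n => w 0 j)); first exact: cvg_fst.
  exact: continuous_coord.
apply: (@continuous_comp _ _ _ snd (fun w : 'rV[R]_n => w 0 j)); first exact: cvg_snd.
exact: continuous_coord.
Qed.

Lemma Ck_pair_dom n k (Z : set (V2 n)) (F : V2 n -> 'rV[R]_n) x b :
  open Z -> Z (unpair x) -> Ck None Z F -> Cat k (fun y => F (unpair y) 0 b) x.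
Proof.
move=> oZ Zx CF; have C := Ck_precomp (L := @unpair n) (@unpair_continuous n) CF.
apply: (Ck_coord (k := k) b _ _ C I); last exact: Zx.
by apply: open_comp oZ => y _; exact: unpair_continuous.
Qed.

Lemma Ck_pair_cod n k (Z : set 'rV[R]_n) (F : 'rV[R]_n -> V2 n) x b j :
  open Z -> Z x -> Ck None Z F -> Cat k (fun y => coordp b j (F y)) x.
Proof.
move=> oZ Zx CF.
have C := Ck_linear (L := coordp b j) (@coordp_continuous n b j) oZ CF.
exact: Ck_Cat oZ Zx (@Ck_Some _ _ _ None k _ _ I C).
Qed.

End PairMaps.

Section GradientCharts.
Context {R : realType} {n : nat} {M : topologicalType} {X : manifold R n M} (g : metric X).
Implicit Types (i j : idx X) (p q : M) (f h : M -> R).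

Lemma grad_chart f i p : dom i p -> CM X 1 f p ->
  grad g f p *m transition (chart_at X p) i p = cgrad (gmx g i) (f \o pt i) (crd i p).
Proof.
move=> di Cf; have dc := chart_atP X p; set c := chart_at X p in dc *.
rewrite (transitionE dc di).
have E := cgrad_comp (psi := tmap c i) (a := gmx g i) (f := f \o pt i) (z := crd c p).
rewrite tmapE // in E; rewrite -E; first last.
- by apply: posdef_unit; exact: gmx_posdef.
- exact: jac_tmap_unit.
- by move=> j; apply: Cat_differentiable (tmap_Cat 1 j dc di).
- exact: Cat_differentiable (Cf i di).
congr (_ *m _); rewrite /grad /local_grad /cgrad /ginv.
rewrite -(nbhs_singleton (gmx_pull g dc di)); congr (_ *m _).
by apply/esym/near_dvec; exact: near_tmap.
Qed.

Lemma inner_chart i p (v w : 'rV[R]_n) : dom i p ->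
  inner g p v w = ((v *m transition (chart_at X p) i p) *m gmx g i (crd i p) *m
    (w *m transition (chart_at X p) i p)^T) 0 0.
Proof.
move=> di; rewrite /inner /ev (gmx_change g (chart_atP X p) di).
by rewrite trmx_mul !mulmxA.
Qed.

End GradientCharts.

(** * Local parametrizations of the boundary *)

Section BoundaryPatch.
Context {R : realType} {m : nat} {M : topologicalType} {X : manifold R (1 + m) M} (g : metric X).
Context {U : set M} (hU : open U).

(** In the chart [bi], the zero set of the defining function [bf] is a graph, parametrized by [bG]
    over [bV] with inverse [bY]. The inverse is the map that drops one coordinate, hence it is
    smooth everywhere and not only on the zero set. *)
Record bpatch := BPatch {
  bi : idx X;
  bW : set M;
  bf : M -> R;
  bV : set 'rV[R]_m;
  bG : 'rV[R]_m -> 'rV[R]_(1 + m);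
  bY : 'rV[R]_(1 + m) -> 'rV[R]_m;
  bO : set 'rV[R]_(1 + m);
  b_def : defining_function g U bW bf;
  bV_open : open bV;
  bO_open : open bO;
  bO_dom : forall x, bO x -> [/\ dom bi (pt bi x), crd bi (pt bi x) = x & bW (pt bi x)];
  bG_prop : forall y, bV y -> [/\ bO (bG y), bf (pt bi (bG y)) = 0,
    (forall k b, Cat k (fun y => bG y 0 b) y) & bY (bG y) = y];
  bY_prop : forall x, bO x -> bf (pt bi x) = 0 -> bV (bY x) /\ bG (bY x) = x;
  bY_Cat : forall k b x, Cat k (fun x => bY x 0 b) x
}.

Lemma bpatch_exists p : smooth_boundary g U -> boundary U p ->
  exists P : bpatch, dom (bi P) p /\ bO P (crd (bi P) p).
Proof.
move=> sb bp; have [W [f [df Wp]]] := sb p bp.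
have [oW Cf Uf gf] := df; have fp : f p = 0 := def_zero hU df Wp bp.
pose i := chart_at X p; have di : dom i p := chart_atP X p.
have nz : dvec (f \o pt i) (crd i p) != 0.
  have := gf p Wp fp; apply: contra => /eqP E.
  by rewrite /grad /local_grad -/i -/(dvec (f \o pt i) (crd i p)) E mul0mx.
have [j pj] : exists j, partial j (f \o pt i) (crd i p) != 0.
  apply: contrapT => nj; move/eqP: nz; apply; apply/rowP => j; rewrite !mxE.
  by apply/eqP; apply: contrapT => /negP h; apply: nj; exists j.
(* [implicit_function] asks for a positive derivative; a factor 1 or -1 arranges this without
   changing the zeros of f. *)
pose sg : R := if 0 < partial j (f \o pt i) (crd i p) then 1 else -1.
have sg0 : sg != 0 by rewrite /sg; case: ifP; rewrite ?oppr_eq0 oner_neq0.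
pose F x := sg * (f \o pt i) x.
pose O := [set x | dom i (pt i x) /\ crd i (pt i x) = x /\ W (pt i x)]^°.
have Wn : \forall q \near p, W q by exact: open_nbhs_nbhs.
have oO : open O by exact: open_interior.
have Op : O (crd i p).
  rewrite /O /interior; apply: filterS2 (near_chart di) (near_pt di Wn) => x [d1 d2] w.
  by split.
have Osub x : O x -> [/\ dom i (pt i x), crd i (pt i x) = x & W (pt i x)].
  by move=> /interior_subset [d1 [d2 w]].
have CF x : O x -> forall k, Cat k F x.
  move=> /Osub[d1 d2 w] k; apply: CatZ; rewrite -d2.
  exact: (def_CM k df w d1).
have F0 : F (crd i p) = 0 by rewrite /F /= crdK// fp mulr0.
have pF : 0 < partial j F (crd i p).
  rewrite partialZ; last exact: Cat_differentiable (def_CM 1 df Wp di).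
  move: pj; rewrite /sg; move: (partial j _ _) => x x0; case: ifP => h; first by rewrite mul1r.
  by rewrite mulN1r oppr_gt0 lt_neqAle x0 leNgt h.
have [V [phi [Q [oV oQ [Qp QO] VP QP]]]] := @implicit_function R m F j (crd i p) O oO Op CF F0 pF.
have F_f x : F x = 0 -> f (pt i x) = 0.
  by rewrite /F => /eqP; rewrite mulf_eq0 (negbTE sg0) => /eqP.
have f_F x : f (pt i x) = 0 -> F x = 0 by rewrite /F /= => ->; rewrite mulr0.
have CG y k b : V y -> Cat k (fun y => ins j (phi y) y 0 b) y.
  move=> Vy; have [_ _ Cp] := VP y Vy; case: (unliftP j b) => [l ->|->].
    by apply: eq_Cat (Cat_coord k l y) => z; rewrite ins_lift.
  by apply: eq_Cat (Cp k) => z; rewrite ins_j.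
unshelve eexists (@BPatch i W f V (fun y => ins j (phi y) y) (del j) Q df oV oQ _ _ _ _).
- by move=> x /QO /Osub.
- move=> y Vy; have [h1 h2 _] := VP y Vy; split=> //; first exact: F_f.
  + by move=> k b; exact: CG.
  + exact: del_ins.
- move=> x Ox fx; have [h1 h2] := QP x Ox (f_F _ fx); split=> //.
  by rewrite h2 insK.
- by move=> k b x; apply: eq_Cat (Cat_coord k (lift j b) x) => z; rewrite mxE.
by [].
Qed.

End BoundaryPatch.

Arguments bpatch {R m M X} g U.

(** The diffeomorphism part of the end hypothesis, with a smooth inverse [rh] of the exponential map
    fixed once and for all. *)
Record radial_data (R : realType) (n : nat) (M : topologicalType) (X : manifold R n M)
    (g : metric X) (U : set M) := RadialData {
  r_open : open U;
  r_bij : set_bij (outward_normal_bundle g U) (~` closure U) (expm g);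
  r_C : Cmap (@tangent_charts R n M X) X None (outward_normal_bundle g U) (expm g);
  rh : M -> M * 'rV[R]_n;
  r_K : forall z, outward_normal_bundle g U z -> rh (expm g z) = z;
  r_Ci : Cmap X (@tangent_charts R n M X) None (~` closure U) rh
}.

(** * Polar coordinates and their inverse *)

Section PolarMap.
Context {R : realType} {m : nat} {M : topologicalType} {X : manifold R (1 + m) M} (g : metric X).
Context {U : set M} (D : radial_data g U).
Local Notation N := (outward_normal_bundle g U).
Local Notation TC := (@tangent_charts R (1 + m) M X).
Local Notation E q := (~ closure U q).
Local Notation hU := (r_open D).
Local Notation hbij := (r_bij D).
Local Notation hC := (r_C D).
Local Notation h := (rh D).
Local Notation hK := (r_K D).
Local Notation hCi := (r_Ci D).
Implicit Types (i j : idx X) (p q : M) (y : 'rV[R]_m) (w : 'rV[R]_(1 + m)).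

Lemma expm_E z : N z -> E (expm g z).
Proof. by case: hbij => hf _ _ /hf. Qed.

Lemma E_open : open (~` closure U).
Proof. by apply: closed_openC; exact: closed_closure. Qed.

Lemma h_in q : E q -> N (h q) /\ expm g (h q) = q.
Proof. by case: hbij => _ _ hs /hs[z Nz <-]; rewrite hK. Qed.

Definition foot q := (h q).1.
(** The length of the normal vector that the exponential map sends to q; [dist_rho] identifies it
    with the distance to U. *)
Definition rho q : R := Num.sqrt (inner g (foot q) (h q).2 (h q).2).

Lemma foot_bd q : E q -> boundary U (foot q).
Proof. by move=> /h_in[[]]. Qed.

Lemma h_chart k i j q : E q -> dom j q -> dom i (foot q) -> exists F : 'rV[R]_(1 + m) -> 'rV[R]_(1 + m) * 'rV[R]_(1 + m),
  [/\ \forall q' \near q, dom i (foot q') /\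
        F (crd j q') = (crd i (foot q'), (h q').2 *m transition (chart_at X (foot q')) i (foot q')),
      {for crd j q, continuous (fun x => (F x).1)} &
      forall b l, Cat k (fun x => coordp b l (F x)) (crd j q)].
Proof.
move=> Eq dj di; have [Z [F [oZ Zq CF FP]]] := r_Ci (r := D) (i := j) (j := i) Eq dj di.
exists F; split.
- have En : \forall q' \near q, E q' by apply: open_nbhs_nbhs; split=> //; exact: E_open.
  have Zn : \forall q' \near q, Z (crd j q').
    by apply: near_comp_cont (crd_continuous dj) _; exact: open_nbhs_nbhs.
  by apply: filterS3 En Zn (near_dom dj) => q' Eq' Zq' dq'; exact: FP.
- have cF : {for crd j q, continuous F} by have [+ _] := CF [::] _ Zq; apply.
  by apply: (@continuous_comp _ _ _ F fst (crd j q) cF); exact: cvg_fst.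
- by move=> b l; exact: (Ck_pair_cod k b l oZ Zq CF).
Qed.

Lemma foot_continuous q : E q -> {for q, continuous foot}.
Proof.
move=> Eq; have dj := chart_atP X q; have di := chart_atP X (foot q).
set j := chart_at X q in dj; set i := chart_at X (foot q) in di.
have [F [FP cF _]] := h_chart 0 Eq dj di.
have E1 : (F (crd j q)).1 = crd i (foot q) by have [_ ->] := nbhs_singleton FP.
have c1 : {for q, continuous (fun q' => (F (crd j q')).1)}.
  exact: (@continuous_comp _ _ _ (crd j) (fun x => (F x).1) q (crd_continuous dj) cF).
have : {for q, continuous (fun q' => pt i (F (crd j q')).1)}.
  by apply: (@continuous_comp _ _ _ (fun q' => (F (crd j q')).1) (pt i)) => //; rewrite E1; exact: pt_continuous.
by apply: near_eq_continuous; apply: filterS FP => q' [d ->] /=; rewrite crdK.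
Qed.

Lemma CM_h k i q b l : E q -> dom i (foot q) ->
  CM X k (fun q' => (if b then crd i (foot q') else
    (h q').2 *m transition (chart_at X (foot q')) i (foot q')) 0 l) q.
Proof.
move=> Eq di; have dj := chart_atP X q; set j := chart_at X q in dj.
have [F [FP _ CF]] := h_chart k Eq dj di.
apply: (CM_chart dj); apply: Cat_ext (CF b l).
apply: filterS2 (near_pt dj FP) (near_chart dj) => x [d Fx] [dx xE].
by rewrite xE in Fx; rewrite /coordp Fx /=; case: b.
Qed.

Lemma inner_scale p (c : R) (v : 'rV[R]_(1 + m)) : inner g p (c *: v) (c *: v) = c ^+ 2 * inner g p v v.
Proof. by rewrite /inner /ev linearZ/= -!scalemxAl -scalemxAr !mxE mulrA expr2. Qed.

Lemma inner_gt0 p (v : 'rV[R]_(1 + m)) : v != 0 -> 0 < inner g p v v.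
Proof. by move=> v0; exact: (gmx_posdef g (chart_atP X p)).2. Qed.

Lemma normal_vec z : N z -> exists W f k, [/\ defining_function g U W f, W z.1, 0 < k & z.2 = k *: grad g f z.1] /\ z.2 != 0.
Proof.
move=> [b [W [f [k [df Wz k0 zE]]]]]; exists W, f, k; split=> //.
have [_ _ _ gf] := df.
have fz : f z.1 = 0 := def_zero hU df Wz b.
by rewrite zE scaler_eq0 negb_or (gt_eqF k0) /=; exact: gf _ Wz fz.
Qed.

Lemma rho_gt0 q : E q -> 0 < rho q.
Proof.
move=> /h_in[/normal_vec[W [f [k [_ v0]]]] _]; rewrite /rho sqrtr_gt0; exact: inner_gt0.
Qed.

(** Normal vectors are nonzero, so rho is the square root of a positive smooth function. *)
Lemma CM_rho k q : E q -> CM X k rho q.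
Proof.
move=> Eq; have dj := chart_atP X q; have di := chart_atP X (foot q).
set j := chart_at X q in dj; set i := chart_at X (foot q) in di.
have Cg a b : CM X k (fun q' => gmx g i (crd i (foot q')) a b) q.
  have C := @Cat_comp _ _ _ k (fun x => gmx g i x a b) (fun x => crd i (foot (pt j x))) (crd j q).
  apply: (CM_chart dj); apply: C; first by rewrite crdK//; exact: gmx_Cat.
  by move=> l; exact: (CM_h k true l Eq di dj).
pose v q' := (h q').2 *m transition (chart_at X (foot q')) i (foot q').
have Cv l : CM X k (fun q' => v q' 0 l) q := CM_h k false l Eq di.
have Cs : CM X k (fun q' => (v q' *m gmx g i (crd i (foot q')) *m (v q')^T) 0 0) q.
  apply: (@CM_ext _ _ _ _ k (fun q' => \sum_a \sum_b v q' 0 a * gmx g i (crd i (foot q')) a b * v q' 0 b)).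
    by apply: near_all => q'; rewrite formE.
  by apply: CM_sum => a; apply: CM_sum => b; apply: CMM; [apply: CMM|].
have near_i : \forall q' \near q, dom i (foot q') := near_comp_cont (foot_continuous Eq) (near_dom di).
apply: (CM_chart dj).
have S : Cat k (fun x => Num.sqrt (((fun q' => (v q' *m gmx g i (crd i (foot q')) *m (v q')^T) 0 0) \o pt j) x)) (crd j q).
  apply: Cat_sqrt; last exact: Cs.
  rewrite /= crdK// /v -(inner_chart g _ _ di); have := rho_gt0 Eq.
  by rewrite /rho sqrtr_gt0.
apply: Cat_ext S; apply: filterS (near_pt dj near_i) => x dx.
by rewrite /= /rho (inner_chart g _ _ dx).
Qed.

Context (P : bpatch g U).
Local Notation i := (bi P).
Local Notation f := (bf P).

Definition bpsi y := pt i (bG P y).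
Definition bnu y : 'rV[R]_(1 + m) := (Num.sqrt (ip g f f (bpsi y)))^-1 *: grad g f (bpsi y).
Definition zz w : M * 'rV[R]_(1 + m) := (bpsi (rsubmx w), w 0 (lshift m 0) *: bnu (rsubmx w)).
(** Polar coordinates: w consists of the radius s, its first entry, and of the parameter y of the
    boundary point from which the normal geodesic starts. *)
Definition Theta w := expm g (zz w).
Definition Zs w := 0 < w 0 (lshift m 0) /\ bV P (rsubmx w).
Definition bD q := [/\ E q, dom i (foot q) & bO P (crd i (foot q))].
Definition bYc q := bY P (crd i (foot q)).

Lemma bpsiP y : bV P y -> [/\ dom i (bpsi y), crd i (bpsi y) = bG P y, bW P (bpsi y), f (bpsi y) = 0 & boundary U (bpsi y)].
Proof.
move=> Vy; have [Oy fy _ _] := bG_prop Vy; have [d c w] := bO_dom Oy.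
by split=> //; exact: def_bd (b_def P) w fy.
Qed.

Lemma bnorm_gt0 y : bV P y -> 0 < ip g f f (bpsi y).
Proof.
move=> Vy; have [d _ w fy _] := bpsiP Vy; have [_ _ _ gf] := b_def P.
by apply: inner_gt0; exact: gf.
Qed.

Lemma bnu_unit y : bV P y -> inner g (bpsi y) (bnu y) (bnu y) = 1.
Proof.
move=> Vy; have n0 := bnorm_gt0 Vy; rewrite inner_scale -/(ip g f f (bpsi y)).
by rewrite exprVn sqr_sqrtr ?ltW// mulVf// gt_eqF.
Qed.

Lemma zz_N w : Zs w -> N (zz w).
Proof.
move=> [w0 Vw]; have [d _ W0 fy b] := bpsiP Vw; split=> //.
exists (bW P), f, (w 0 (lshift m 0) / Num.sqrt (ip g f f (bpsi (rsubmx w)))).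
split=> //; first exact: b_def.
  by rewrite divr_gt0// sqrtr_gt0; exact: bnorm_gt0.
by rewrite /zz /bnu /= scalerA.
Qed.

Lemma h_Theta w : Zs w -> h (Theta w) = zz w.
Proof. by move=> Zw; apply: hK; exact: zz_N. Qed.

Lemma Theta_E w : Zs w -> E (Theta w).
Proof. by move=> Zw; apply: expm_E; exact: zz_N. Qed.

Lemma foot_Theta w : Zs w -> foot (Theta w) = bpsi (rsubmx w).
Proof. by move=> Zw; rewrite /foot h_Theta. Qed.

Lemma rho_Theta w : Zs w -> rho (Theta w) = w 0 (lshift m 0).
Proof.
move=> Zw; have [w0 Vw] := Zw; rewrite /rho foot_Theta// h_Theta// inner_scale bnu_unit// mulr1.
by rewrite sqrtr_sqr gtr0_norm.
Qed.

Lemma bYc_Theta w : Zs w -> bYc (Theta w) = rsubmx w /\ bD (Theta w).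
Proof.
move=> Zw; have [w0 Vw] := Zw; have [d c W0 fy b] := bpsiP Vw.
have [Oy _ _ yE] := bG_prop Vw.
by split; [rewrite /bYc foot_Theta// c|split; rewrite ?foot_Theta// ?c//; exact: Theta_E].
Qed.

(** The normal vector at the foot of q is built with its own defining function; by [normal_unique]
    it is a positive multiple of the unit normal of the patch, and that multiple is rho q. *)
Lemma bD_Theta q : bD q -> Zs (cs (rho q) (bYc q)) /\ Theta (cs (rho q) (bYc q)) = q.
Proof.
move=> [Eq d Oq]; have [Nq hq] := h_in Eq; have bq := foot_bd Eq; have r0 := rho_gt0 Eq.
have [d' c' W0] := bO_dom Oq; rewrite crdK// in W0.
have fq := def_zero hU (b_def P) W0 bq.
have [Vy Gy] := bY_prop Oq (etrans (congr1 f (crdK d)) fq).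
have Zq : Zs (cs (rho q) (bYc q)) by split; rewrite ?csl// row_mxKr.
split=> //; rewrite /Theta -[RHS]hq; congr (expm g _).
have psiE : bpsi (bYc q) = foot q by rewrite /bpsi /bYc Gy crdK.
rewrite /zz row_mxKr csl psiE [RHS]surjective_pairing; congr pair.
have [W [f' [k [[df' Wz k0 zE] _]]]] := normal_vec Nq.
have [k' k'0 E1] := normal_unique hU (b_def P) df' W0 Wz bq.
rewrite /bnu psiE.
have gE : (h q).2 = (k * k') *: grad g f (foot q) by rewrite zE E1 scalerA.
have n0 : 0 < ip g f f (foot q) by rewrite -psiE; exact: bnorm_gt0.
have -> : rho q = k * k' * Num.sqrt (ip g f f (foot q)).
  rewrite /rho gE inner_scale sqrtrM ?sqr_ge0// sqrtr_sqr gtr0_norm// mulr_gt0//.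
by rewrite gE scalerA mulfK// gt_eqF// sqrtr_gt0.
Qed.

Lemma bD_near q : bD q -> \forall q' \near q, bD q'.
Proof.
move=> [Eq d Oq]; have c := foot_continuous Eq.
have H1 : \forall q' \near q, E q' by apply: open_nbhs_nbhs; split=> //; exact: E_open.
have H2 : \forall p \near foot q, bO P (crd i p).
  by apply: near_comp_cont (crd_continuous d) _; apply: open_nbhs_nbhs; split=> //; exact: bO_open.
apply: filterS3 H1 (near_comp_cont c (near_dom d)) (near_comp_cont c H2) => q' ? ? ?.
by split.
Qed.

Lemma CM_bYc k q b : bD q -> CM X k (fun q' => bYc q' 0 b) q.
Proof.
move=> [Eq d Oq]; have dj := chart_atP X q; set j := chart_at X q in dj.
apply: (CM_chart dj).
apply: (@Cat_comp _ _ _ k (fun x => bY P x 0 b) (fun x => crd i (foot (pt j x)))).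
  exact: bY_Cat.
by move=> l; exact: (CM_h k true l Eq d dj).
Qed.

Lemma Zs_open : open Zs.
Proof.
rewrite openE => w [w0 Vw].
have c : {for w, continuous (fun w : 'rV[R]_(1 + m) => rsubmx w)}.
  apply: continuous_row => l.
  apply: (@near_eq_continuous _ _ (fun y : 'rV[R]_(1 + m) => y 0 (rshift 1 l)) _ w); last exact: continuous_coord.
  by apply: near_all => y; rewrite mxE.
have H1 := near_comp_cont (@continuous_coord R _ (lshift m 0) w) (near_gt w0).
have H2 : \forall w' \near w, bV P (rsubmx w').
  by apply: near_comp_cont c _; apply: open_nbhs_nbhs; split=> //; exact: bV_open.
by apply: filterS2 H1 H2 => w' ? ?; split.
Qed.

Lemma Zs_near w : Zs w -> \forall w' \near w, Zs w'.
Proof. by move=> Zw; apply: open_nbhs_nbhs; split=> //; exact: Zs_open. Qed.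

Lemma Cat_rsub k (F : 'rV[R]_m -> R) w : Cat k F (rsubmx w) ->
  Cat k (fun w : 'rV[R]_(1 + m) => F (rsubmx w)) w.
Proof.
move=> CF; apply: (@Cat_comp _ _ _ k F (fun w : 'rV[R]_(1 + m) => rsubmx w)) => // l.
by apply: eq_Cat (Cat_coord k (rshift 1 l) w) => y; rewrite mxE.
Qed.

Definition bcg y := cgrad (gmx g i) (f \o pt i) (bG P y).
Definition bnn y := gpair (gmx g i) (f \o pt i) (f \o pt i) (bG P y).

Lemma bnnE y : bV P y -> bnn y = ip g f f (bpsi y).
Proof.
move=> Vy; have [dy cy Wy _ _] := bpsiP Vy.
by rewrite (ip_chart g dy (def_CM 1 (b_def P) Wy) (def_CM 1 (b_def P) Wy)) cy.
Qed.

Lemma bnuE y : bV P y ->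
  bnu y *m transition (chart_at X (bpsi y)) i (bpsi y) = (Num.sqrt (bnn y))^-1 *: bcg y.
Proof.
move=> Vy; have [d' c' W' _ _] := bpsiP Vy.
by rewrite /bnu -!scalemxAl (grad_chart g d' (def_CM 1 (b_def P) W')) c' bnnE.
Qed.

Lemma Cat_bG k y l : bV P y -> Cat k (fun y => bG P y 0 l) y.
Proof. by move=> Vy; have [_ _ C _] := bG_prop Vy. Qed.

Lemma Cat_bf k y : bV P y -> Cat k (f \o pt i) (bG P y).
Proof.
by move=> Vy; have [dy cy Wy _ _] := bpsiP Vy; rewrite -cy; exact: (def_CM k (b_def P) Wy dy).
Qed.

Lemma CatMx_bG k y : bV P y -> CatMx k (gmx g i) (bG P y) /\ posdef (gmx g i (bG P y)).
Proof.
move=> Vy; have [dy cy _ _ _] := bpsiP Vy; rewrite -cy.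
by split; [exact: gmx_Cat|exact: gmx_posdef].
Qed.

Lemma Cat_bnn k y : bV P y -> Cat k (fun y => (Num.sqrt (bnn y))^-1) y.
Proof.
move=> Vy; have [Ca pa] := CatMx_bG k Vy.
have n0 : 0 < bnn y by rewrite bnnE//; exact: bnorm_gt0.
apply: CatV; first by rewrite gt_eqF// sqrtr_gt0.
apply: Cat_sqrt => //; apply: (@Cat_comp _ _ _ k (gpair (gmx g i) (f \o pt i) (f \o pt i)) (bG P)).
  exact: Cat_gpair Ca pa (Cat_bf k.+1 Vy) (Cat_bf k.+1 Vy).
by move=> l; exact: Cat_bG.
Qed.

Lemma Cat_bcg k y l : bV P y -> Cat k (fun y => bcg y 0 l) y.
Proof.
move=> Vy; have [Ca pa] := CatMx_bG k Vy.
apply: (@Cat_comp _ _ _ k (fun x => cgrad (gmx g i) (f \o pt i) x 0 l) (bG P)).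
  exact: (Cat_cgrad Ca pa (Cat_bf k.+1 Vy)).
by move=> l'; exact: Cat_bG.
Qed.

(** Smoothness of the exponential map on the normal bundle only means that near each vector it
    extends to a smooth [F] in tangent charts. Composing F with [L], the smooth chart expression of
    [zz], avoids any manifold structure on the bundle. *)
Lemma Theta_SM k w : Zs w -> SM X k Theta w.
Proof.
move=> Zw; have [w0 Vw] := Zw; have [d c W0 fy b] := bpsiP Vw.
have dj := chart_atP X (Theta w); set j := chart_at X (Theta w) in dj.
have [Z [F [oZ Zq CF FP]]] := r_C D (i := i) (j := j) (zz_N Zw) d dj.
pose L w : 'rV[R]_((1 + m) + (1 + m)) :=
  row_mx (bG P (rsubmx w)) ((w 0 (lshift m 0) * (Num.sqrt (bnn (rsubmx w)))^-1) *: bcg (rsubmx w)).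
have LE w' : Zs w' -> crd (c := TC) i (zz w') = unpair (L w').
  move=> Zw'; have [_ Vw'] := Zw'; have [d' c' _ _ _] := bpsiP Vw'.
  by rewrite /= /unpair row_mxKl row_mxKr c' -scalemxAl bnuE// scalerA.
have CL l : Cat k (fun w => L w 0 l) w.
  case: (split_ordP l) => l' ->.
    by apply: eq_Cat (Cat_rsub (Cat_bG k l' Vw)) => y; rewrite row_mxEl.
  apply: (@eq_Cat _ _ _ (fun w : 'rV[R]_(1 + m) =>
      w 0 (lshift m 0) * (Num.sqrt (bnn (rsubmx w)))^-1 * bcg (rsubmx w) 0 l')).
    by move=> y; rewrite row_mxEr [RHS]mxE.
  apply: CatM; last exact: Cat_rsub (Cat_bcg k l' Vw).
  apply: CatM; first exact: Cat_coord.
  exact: Cat_rsub (Cat_bnn k Vw).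
have cL : {for w, continuous L} by apply: continuous_row => l; exact: Cat_continuous (CL l).
have cu : {for w, continuous (fun w => unpair (L w))}.
  exact: (@continuous_comp _ _ _ L (@unpair R (1 + m)) w cL (@unpair_continuous R (1 + m) (L w))).
have ZL : Z (unpair (L w)) by rewrite -LE.
have H : \forall w' \near w, dom j (Theta w') /\ F (unpair (L w')) = crd j (Theta w').
  have H1 : \forall w' \near w, Z (unpair (L w')).
    by apply: near_comp_cont cu _; exact: open_nbhs_nbhs.
  apply: filterS2 (Zs_near Zw) H1 => w' Zw' ZLw'.
  have [_ Vw'] := Zw'; have [d' _ _ _ _] := bpsiP Vw'.
  have [] := FP (zz w') (zz_N Zw') d'; first by rewrite LE.
  by rewrite LE.
have CT b' : Cat k (fun w' => crd j (Theta w') 0 b') w.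
  have C := @Cat_comp _ _ _ k (fun x => F (unpair x) 0 b') L w (Ck_pair_dom k b' oZ ZL CF) CL.
  by apply: Cat_ext C; apply: filterS H => w' [_ ->].
apply: (SM_chart _ dj CT).
have [_ Ew] := nbhs_singleton H.
have cF : {for unpair (L w), continuous F} by have [+ _] := CF [::] _ ZL; apply.
have c2 : {for w, continuous (fun w' => F (unpair (L w')))}.
  exact: (@continuous_comp _ _ _ (fun w => unpair (L w)) F w cu cF).
have : {for w, continuous (fun w' => pt j (F (unpair (L w'))))}.
  by apply: (@continuous_comp _ _ _ (fun w' => F (unpair (L w'))) (pt j)) => //; rewrite Ew; exact: pt_continuous.
by apply: near_eq_continuous; apply: filterS H => w' [d' ->]; rewrite crdK.
Qed.

End PolarMap.

Lemma derive0_eq (R : realType) (F : R -> R) (s t : R) : s <= t ->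
  (forall u, s <= u <= t -> is_derive u 1 F 0) -> F t = F s.
Proof. by move=> st /(mvt_seg st)[c _]; rewrite mul0r => /eqP; rewrite subr_eq0 => /eqP. Qed.

(** The a's are the terms of d_0 g_0b and the b's those of d_b g_00 in polar coordinates. The
    equations are the geodesic equation, the Christoffel formula and symmetries; together they say
    d_0 g_0b = (1/2) d_b g_00. *)
Lemma gauss_arith (R : realFieldType) (a1 a2 a3 b1 b2 b3 c S1 S2 : R) :
  a1 = - c -> c = S1 - 2^-1 * S2 -> a2 = S1 -> b2 = S2 -> b1 = b3 -> a3 = b3 ->
  b1 + b2 + b3 = 0 -> a1 + a2 + a3 = 0.
Proof. by move=> -> -> -> -> -> ->; lra. Qed.

Section FormDerivative.
Context {R : realType} {N n : nat}.

Lemma add3_entry (u v z : 'M[R]_1) : (u + v + z) 0 0 = u 0 0 + v 0 0 + z 0 0.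
Proof. by rewrite !mxE. Qed.

Lemma partial_form (p q : 'rV[R]_N -> 'rV[R]_n) (A : 'rV[R]_N -> 'M[R]_n) l (w : 'rV[R]_N) :
  CatMx 1 p w -> CatMx 1 A w -> CatMx 1 q w ->
  partial l (fun w => (p w *m A w *m (q w)^T) 0 0) w =
  (dM l p w *m A w *m (q w)^T) 0 0 + (p w *m dM l A w *m (q w)^T) 0 0 +
  (p w *m A w *m (dM l q w)^T) 0 0.
Proof.
move=> Cp CA Cq; have CpA := CatMx_mul Cp CA.
transitivity (dM l (fun w => p w *m A w *m (q w)^T) w 0 0); first by rewrite [RHS]mxE.
rewrite (dM_mul l (CatMx_diff CpA) (CatMx_diff (CatMx_tr Cq))).
rewrite (dM_mul l (CatMx_diff Cp) (CatMx_diff CA)) dM_tr mulmxDl.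
exact: add3_entry.
Qed.

End FormDerivative.

(** * The metric in polar coordinates *)

Section PolarMetric.
Context {R : realType} {m : nat} {M : topologicalType} {X : manifold R (1 + m) M} (g : metric X).
Context {U : set M} (D : radial_data g U) (P : bpatch g U).
Implicit Types (i j : idx X) (p q : M) (y : 'rV[R]_m) (w : 'rV[R]_(1 + m)) (f h : M -> R).

Definition Xc j w := crd j (Theta P w).
Definition PGj j w := pull (Xc j) (gmx g j) w.
(** The chart at the image point may jump with w, so regularity is read off [PGj] with a fixed
    chart, which agrees with [PG] nearby by [PG_near]. *)
Definition PG w := PGj (chart_at X (Theta P w)) w.

Lemma Xc_Cat k j w b : Zs P w -> dom j (Theta P w) -> Cat k (fun w => Xc j w 0 b) w.
Proof. by move=> Zw dj; have [_] := Theta_SM D k Zw; apply. Qed.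

Lemma Theta_near w (Q : M -> Prop) : Zs P w -> (\forall q \near Theta P w, Q q) ->
  \forall w' \near w, Q (Theta P w').
Proof. by move=> Zw; have [c _] := Theta_SM D 0 Zw; exact: near_comp_cont c. Qed.

(** The functions rho and [bYc], read in the chart, form a smooth left inverse of the polar map, so
    the Jacobian has a one-sided inverse. *)
Lemma jac_Xc_unit j w : Zs P w -> dom j (Theta P w) -> jac (Xc j) w \in unitmx.
Proof.
move=> Zw dj.
pose Psi x : 'rV[R]_(1 + m) := cs (rho D (pt j x)) (bYc D P (pt j x)).
have PsiK : \forall w' \near w, Psi (Xc j w') = w'.
  apply: filterS2 (Zs_near Zw) (Theta_near Zw (near_dom dj)) => w' Zw' dj'.
  rewrite /Psi /Xc crdK// rho_Theta// (bYc_Theta D Zw').1.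
  by by rewrite [RHS]csP.
have [_ bDw] := bYc_Theta D Zw; have [Ew _ _] := bDw.
have dPsi b : differentiable (fun x => Psi x 0 b) (Xc j w).
  apply: (@Cat_differentiable _ _ 0); move: b; apply: split_ord1 => [|b].
    by apply: eq_Cat (CM_rho D 1 Ew dj) => x; rewrite /Psi csl.
  by apply: eq_Cat (CM_bYc 1 b bDw dj) => x; rewrite /Psi csr.
have dX b : differentiable (fun w => Xc j w 0 b) w.
  by apply: Cat_differentiable (Xc_Cat 1 b Zw dj).
have := jac_comp dPsi dX.
have -> : jac (fun w => Psi (Xc j w)) w = 1%:M.
  apply/matrixP => a b; rewrite !mxE.
  rewrite (@near_partial _ _ _ (fun w : 'rV[R]_(1 + m) => w 0 b)).
    by rewrite partial_coord eq_sym.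
  by apply: filterS PsiK => w' ->.
by move=> /esym/mulmx1_unit[].
Qed.

Lemma PG_chart j w : Zs P w -> dom j (Theta P w) -> PG w = PGj j w.
Proof.
move=> Zw dj; rewrite /PG; set c := chart_at X _; have dc : dom c (Theta P w) := chart_atP X _.
rewrite /PGj /pull.
have -> : jac (Xc c) w = jac (Xc j) w *m jac (tmap j c) (Xc j w).
  rewrite -jac_comp; first last.
  - by move=> b; apply: Cat_differentiable (Xc_Cat 1 b Zw dj).
  - by move=> b; apply: Cat_differentiable (tmap_Cat 1 b dj dc).
  apply/matrixP => a b; rewrite !mxE; apply: near_partial.
  apply: filterS (Theta_near Zw (near_dom dj)) => w' dj'.
  by rewrite /Xc tmapE.
rewrite [in RHS]/Xc (nbhs_singleton (gmx_pull g dj dc)) /pull tmapE//.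
by rewrite trmx_mul !mulmxA.
Qed.

Lemma PG_near j w : Zs P w -> dom j (Theta P w) -> \forall w' \near w, PG w' = PGj j w'.
Proof.
move=> Zw dj; apply: filterS2 (Zs_near Zw) (Theta_near Zw (near_dom dj)) => w' Zw' dj'.
exact: PG_chart.
Qed.

Lemma PG_Cat k w : Zs P w -> CatMx k PG w.
Proof.
move=> Zw; have dj := chart_atP X (Theta P w); set j := chart_at X _ in dj.
have CJ : CatMx k (jac (Xc j)) w by apply: Cat_jac => b; exact: Xc_Cat.
have Cg : CatMx k (fun w => gmx g j (Xc j w)) w.
  move=> a b; apply: (@Cat_comp _ _ _ k (fun x => gmx g j x a b) (Xc j)).
    exact: gmx_Cat.
  by move=> l; exact: Xc_Cat.
have C : CatMx k (PGj j) w by apply: CatMx_mul; [exact: CatMx_mul|exact: CatMx_tr].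
move=> a b; apply: Cat_ext (C a b).
by apply: filterS (PG_near Zw dj) => w' ->.
Qed.

Lemma PG_posdef w : Zs P w -> posdef (PG w).
Proof.
move=> Zw; have dj := chart_atP X (Theta P w).
by apply: posdef_pull; [exact: gmx_posdef|exact: jac_Xc_unit].
Qed.

Lemma near_Xc f j w : Zs P w -> dom j (Theta P w) ->
  \forall w' \near w, (f \o pt j) (Xc j w') = f (Theta P w').
Proof.
by move=> Zw dj; apply: filterS (Theta_near Zw (near_dom dj)) => w' dj'; rewrite /= /Xc crdK.
Qed.

Lemma PG_gpair f h w : Zs P w -> CM X 1 f (Theta P w) -> CM X 1 h (Theta P w) ->
  gpair PG (fun w => f (Theta P w)) (fun w => h (Theta P w)) w = ip g f h (Theta P w).
Proof.
move=> Zw Cf Ch; have dj := chart_atP X (Theta P w); set j := chart_at X _ in dj.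
rewrite (ip_chart g dj Cf Ch) -(near_gpair _ (near_Xc f Zw dj) (near_Xc h Zw dj)).
rewrite -[RHS](gpair_comp (psi := Xc j)).
- by rewrite /gpair (PG_chart Zw dj).
- exact: Cat_differentiable (Cf j dj).
- exact: Cat_differentiable (Ch j dj).
- by move=> b; apply: Cat_differentiable (Xc_Cat 1 b Zw dj).
- exact: jac_Xc_unit.
- by apply: posdef_unit; exact: gmx_posdef.
Qed.

Lemma PG_lap f w : Zs P w -> CM X 2 f (Theta P w) ->
  lap PG (fun w => f (Theta P w)) w = laplacian g f (Theta P w).
Proof.
move=> Zw Cf; have dj := chart_atP X (Theta P w); set j := chart_at X _ in dj.
rewrite (laplacian_chart g dj Cf).
rewrite -[RHS](lap_comp (psi := Xc j)).
- by apply: near_lap; [exact: PG_near|apply: filterS (near_Xc f Zw dj)].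
- exact: gmx_Cat.
- exact: gmx_posdef.
- exact: (Cf j dj).
- by move=> b; exact: Xc_Cat.
- exact: jac_Xc_unit.
Qed.

(** If the metric has first row (1, 0, ..., 0), its inverse has the same one, and the gradient of
    rho is the radial coordinate field. *)
Lemma PG_rho f w : Zs P w -> CM X 1 f (Theta P w) ->
  (forall b, PG w (lshift m 0) b = (b == lshift m 0)%:R) ->
  ip g (rho D) f (Theta P w) = partial (lshift m 0) (fun w => f (Theta P w)) w.
Proof.
move=> Zw Cf row0; have [_ [Ew _ _]] := bYc_Theta D Zw.
rewrite -(PG_gpair Zw (CM_rho D 1 Ew) Cf) /gpair.
have dr : dvec (fun w => rho D (Theta P w)) w = delta_mx 0 (lshift m 0).
  apply/rowP => b; rewrite mxE (@near_partial _ _ _ (fun w : 'rV[R]_(1 + m) => w 0 (lshift m 0))).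
    by rewrite partial_coord mxE eqxx eq_sym.
  by apply: filterS (Zs_near Zw) => w' Zw'; exact: rho_Theta.
have pd := PG_posdef Zw.
have rE : delta_mx 0 (lshift m 0) *m PG w = delta_mx 0 (lshift m 0) :> 'rV[R]_(1 + m).
  apply/rowP => b; rewrite -rowE mxE row0 mxE eqxx /=; by [].
have rI : delta_mx 0 (lshift m 0) *m invmx (PG w) = delta_mx 0 (lshift m 0) :> 'rV[R]_(1 + m).
  by rewrite -{1}rE mulmxK//; exact: posdef_unit.
by rewrite dr rI -rowE !mxE.
Qed.

Lemma ray_exists y : bV P y -> exists c, [/\ geo g c, c 0 = bpsi P y, velocity (X := X) c 0 = bnu P y &
  forall s : R, 0 < s -> c s = Theta P (cs s y)].
Proof.
move=> Vy; have Z1 s : 0 < s -> Zs P (cs s y) by move=> s0; split; rewrite ?csl ?row_mxKr.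
have N1 := zz_N (Z1 1 ltr01).
have e1 : (zz P (cs 1 y)).1 = bpsi P y by rewrite /zz row_mxKr.
have e2 : (zz P (cs 1 y)).2 = bnu P y by rewrite /zz row_mxKr csl /= scale1r.
have [c [gc c0 v0 _]] := expm_geo N1 (expm_E D N1).
exists c; rewrite -e1 -e2; split=> //; first exact: geodesic_geo.
move=> s s0; have <- := expm_ray (expm_E D) N1 (geodesic_geo gc) c0 v0 s0.
by rewrite e1 e2 /Theta /zz row_mxKr csl.
Qed.

Definition Jr j (l : 'I_(1 + m)) w : 'rV[R]_(1 + m) := \row_k partial l (fun w => Xc j w 0 k) w.
Definition Hr j (l l' : 'I_(1 + m)) w : 'rV[R]_(1 + m) :=
  \row_k partial l (partial l' (fun w => Xc j w 0 k)) w.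
Definition Sg j (v : 'rV[R]_(1 + m)) x : 'M[R]_(1 + m) := \sum_k v 0 k *: dM k (gmx g j) x.

Lemma form_entry (J A : 'M[R]_(1 + m)) l l' :
  (J *m A *m J^T) l l' = (row l J *m A *m (row l' J)^T) 0 0.
Proof.
by rewrite -row_mul [RHS]mxE [LHS]mxE; apply: eq_bigr => k _; rewrite !mxE.
Qed.

Lemma PGjE j w l l' : PGj j w l l' = (Jr j l w *m gmx g j (Xc j w) *m (Jr j l' w)^T) 0 0.
Proof.
have E k : Jr j k w = row k (jac (Xc j) w) by apply/rowP => a; rewrite !mxE.
by rewrite !E -form_entry.
Qed.

Lemma partial_PGj j w l0 l l' : Zs P w -> dom j (Theta P w) ->
  partial l0 (fun w => PGj j w l l') w =
  (Hr j l0 l w *m gmx g j (Xc j w) *m (Jr j l' w)^T) 0 0 +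
  (Jr j l w *m Sg j (Jr j l0 w) (Xc j w) *m (Jr j l' w)^T) 0 0 +
  (Jr j l w *m gmx g j (Xc j w) *m (Hr j l0 l' w)^T) 0 0.
Proof.
move=> Zw dj; rewrite (eq_partial _ _ (fun w => PGjE j w l l')).
have CJ k : CatMx 1 (Jr j k) w.
  by move=> a b; apply: eq_Cat (Cat_partial k (Xc_Cat 2 b Zw dj)) => z; rewrite mxE.
have CA : CatMx 1 (fun w => gmx g j (Xc j w)) w.
  move=> a b; apply: (@Cat_comp _ _ _ 1 (fun x => gmx g j x a b) (Xc j)); first exact: gmx_Cat.
  by move=> k; exact: Xc_Cat.
have EH k : dM l0 (Jr j k) w = Hr j l0 k w.
  apply/matrixP => a b; rewrite [LHS]mxE [RHS]mxE.
  by apply: eq_partial => z; rewrite mxE.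
have ES : dM l0 (fun w => gmx g j (Xc j w)) w = Sg j (Jr j l0 w) (Xc j w).
  apply/matrixP => a b; rewrite [LHS]mxE (@partial_comp _ _ _ (fun x => gmx g j x a b) (Xc j)); first last.
  - by move=> k; apply: Cat_differentiable (Xc_Cat 1 k Zw dj).
  - exact: Cat_differentiable (gmx_Cat g 1 dj a b).
  rewrite /Sg summxE; apply: eq_bigr => k _; rewrite [RHS]mxE mulrC; congr (_ * _).
    by rewrite [RHS]mxE.
  by rewrite [RHS]mxE.
have F (p q u1 v1 u3 v3 : 'rV[R]_(1 + m)) (A u2 v2 : 'M[R]_(1 + m)) : u1 = v1 -> u2 = v2 -> u3 = v3 ->
  (u1 *m A *m q^T) 0 0 + (p *m u2 *m q^T) 0 0 + (p *m A *m u3^T) 0 0 =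
  (v1 *m A *m q^T) 0 0 + (p *m v2 *m q^T) 0 0 + (p *m A *m v3^T) 0 0 by move=> -> -> ->.
exact: etrans (partial_form l0 (CJ l) CA (CJ l')) (F _ _ _ _ _ _ _ _ _ (EH l) ES (EH l')).
Qed.

Lemma partial_cs0 (F : 'rV[R]_(1 + m) -> R) (s : R) y : differentiable F (cs s y) ->
  is_derive s 1 (fun t : R => F (cs t y)) (partial (lshift m 0) F (cs s y)).
Proof.
move=> dF.
have H l : is_derive s 1 (fun t : R => cs t y 0 l) ((delta_mx 0 (lshift m 0) : 'rV[R]_(1 + m)) 0 l).
  move: l; apply: split_ord1 => [|b].
    rewrite mxE !eqxx; apply: (is_derive_near _ (@is_derive_id _ _ s 1)).
    by apply: near_all => t; rewrite csl.
  rewrite mxE eq_rlshift andbF.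
    apply: (is_derive_near _ (@is_derive_cst _ _ _ (y 0 b) s 1)).
    by apply: near_all => t; rewrite csr.
have := @curve_chain _ _ F (fun t : R => cs t y) _ s dF H.
rewrite (bigD1 (lshift m 0))//= big1 ?addr0 => [|l ll]; last by rewrite !mxE (negbTE ll) mul0r.
by rewrite mxE !eqxx mul1r.
Qed.

Lemma Zs_cs s y : 0 < s -> bV P y -> Zs P (cs s y).
Proof. by move=> s0 Vy; split; rewrite ?csl ?row_mxKr. Qed.

Section Ray.
Context (y : 'rV[R]_m) (Vy : bV P y) (c : R -> M) (gc : geo g c).
Context (cT : forall s : R, 0 < s -> c s = Theta P (cs s y)).

Lemma near_ray (s : R) (Q : R -> Prop) : 0 < s -> (forall t, 0 < t -> Q t) -> \forall t \near s, Q t.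
Proof. by move=> s0 H; apply: filterS (near_gt s0) => t /H. Qed.

Lemma vc_ray j (s : R) k : 0 < s -> dom j (c s) ->
  vc j c k s = partial (lshift m 0) (fun w => Xc j w 0 k) (cs s y).
Proof.
move=> s0 dj; rewrite cT// in dj.
have dX := Cat_differentiable (Xc_Cat 1 k (Zs_cs s0 Vy) dj).
have H : \forall t \near s, Xc j (cs t y) 0 k = xc j c k t.
  by apply: near_ray s0 _ => t t0; rewrite /xc cT.
by have [_ E] := is_derive_near H (partial_cs0 dX); rewrite -E /vc derive1E.
Qed.

Lemma vrow_ray j (s : R) : 0 < s -> dom j (c s) -> vrow j c s = Jr j (lshift m 0) (cs s y).
Proof. by move=> s0 dj; apply/rowP => k; rewrite [LHS]mxE [RHS]mxE vc_ray. Qed.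

Lemma Hr_ray j (s : R) : 0 < s -> dom j (c s) ->
  Hr j (lshift m 0) (lshift m 0) (cs s y) =
  \row_k Gam g j k (row_mx (crd j (c s)) (Jr j (lshift m 0) (cs s y))).
Proof.
move=> s0 dj; apply/rowP => k; rewrite [LHS]mxE [RHS]mxE.
have [_ dv] := gc.2 j s dj k.
have dj' := dj; rewrite cT// in dj'.
have dX := Cat_differentiable (Cat_partial (lshift m 0) (Xc_Cat 2 k (Zs_cs s0 Vy) dj')).
have H : \forall t \near s, partial (lshift m 0) (fun w => Xc j w 0 k) (cs t y) = vc j c k t.
  apply: filterS2 (near_gt s0) (near_curve gc.1 dj) => t t0 dt.
  by rewrite vc_ray.
have [_ <-] := is_derive_near H (partial_cs0 dX); have [_ ->] := dv.
by rewrite /phase (vrow_ray s0 dj).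
Qed.

End Ray.

(** Rays are geodesics whose initial velocity is a unit normal, and speed is conserved. *)
Lemma PG00 w : Zs P w -> PG w (lshift m 0) (lshift m 0) = 1.
Proof.
move=> Zw; rewrite [w]csP; set s := w 0 _; set y := rsubmx w; have [s0 Vy] := Zw.
have [c [gc c0 v0 cT]] := ray_exists Vy.
have Zc := Zs_cs s0 Vy; have dj := chart_atP X (Theta P (cs s y)); set j := chart_at X _ in dj.
have dj' : dom j (c s) by rewrite cT.
rewrite (PG_chart Zc dj) PGjE -(vrow_ray Vy cT s0 dj').
rewrite -[X in (_ *m gmx g j X *m _) 0 0]/(crd j (Theta P (cs s y))) -cT// -/(en g j c s).
have := speed_const s 0 gc; rewrite (speedE g (geo_C1c gc) dj').
rewrite /speed v0 c0 bnu_unit// sqrtr1 => /(congr1 (fun x => x ^+ 2)); rewrite expr1n sqr_sqrtr//.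
by apply: posdef_ge0; exact: gmx_posdef.
Qed.

Lemma Hr_sym j w l l' : Zs P w -> dom j (Theta P w) -> Hr j l l' w = Hr j l' l w.
Proof.
move=> Zw dj; apply/rowP => k; rewrite [LHS]mxE [RHS]mxE; apply: partial_sym.
exact: Xc_Cat.
Qed.

Lemma Sg_form j x v (u u' : 'rV[R]_(1 + m)) :
  (u *m Sg j v x *m u'^T) 0 0 = \sum_k v 0 k * (u *m dM k (gmx g j) x *m u'^T) 0 0.
Proof.
rewrite /Sg mulmx_sumr mulmx_suml summxE; apply: eq_bigr => k _.
by rewrite -scalemxAr -scalemxAl [LHS]mxE.
Qed.

Lemma Sg_form_sym j x v (u u' : 'rV[R]_(1 + m)) :
  (forall k, (dM k (gmx g j) x)^T = dM k (gmx g j) x) ->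
  (u *m Sg j v x *m u'^T) 0 0 = \sum_k v 0 k * (u' *m dM k (gmx g j) x *m u^T) 0 0.
Proof.
move=> sym; rewrite Sg_form; apply: eq_bigr => k _.
by rewrite (form_tr u) sym.
Qed.

(** By the geodesic equation and the equality of mixed derivatives this is half the derivative of
    g_00 in direction b, and g_00 is constant by [PG00]. *)
Lemma partial_PG0b w b : Zs P w -> partial (lshift m 0) (fun w => PG w (lshift m 0) b) w = 0.
Proof.
move=> Zw; have dj := chart_atP X (Theta P w); set j := chart_at X _ in dj.
have E l l' l0 : partial l0 (fun w => PG w l l') w = partial l0 (fun w => PGj j w l l') w.
  by apply: near_partial; apply: filterS (PG_near Zw dj) => z ->.
have Z00 : partial b (fun w => PG w (lshift m 0) (lshift m 0)) w = 0.
  rewrite (@near_partial _ _ _ (fun=> 1)) ?partial_cst//.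
  by apply: filterS (Zs_near Zw) => z; exact: PG00.
rewrite (E _ _ b) in Z00; rewrite (E _ _ (lshift m 0)).
rewrite (partial_PGj b (lshift m 0) (lshift m 0) Zw dj) in Z00.
rewrite (partial_PGj (lshift m 0) (lshift m 0) b Zw dj); move: Z00.
have [s0 Vy] := Zw; have [c [gc c0 v0 cT]] := ray_exists Vy.
have wE := csP w; set s := w 0 _ in s0 wE; set y := rsubmx w in Vy cT wE.
have cw : c s = Theta P w by rewrite cT// -wE.
have dj' : dom j (c s) by rewrite cw.
have HG := Hr_ray Vy gc cT s0 dj'; rewrite -wE cw in HG.
have sym k : (dM k (gmx g j) (Xc j w))^T = dM k (gmx g j) (Xc j w).
  exact: dM_sym (gmx_near_sym g dj).
apply: gauss_arith.
- by rewrite HG; exact: (Gam_cov g _ _ dj).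
- exact: chris_form (gmx_near_sym g dj).
- exact: Sg_form_sym sym.
- exact: Sg_form.
- by rewrite form_tr; have -> : (gmx g j (Xc j w))^T = gmx g j (Xc j w) by exact: gmx_sym.
- by rewrite (Hr_sym (lshift m 0) b Zw dj).
Qed.

Lemma partial_line (F : 'rV[R]_(1 + m) -> R) b w : differentiable F w ->
  is_derive (0 : R) 1 (fun s : R => F (s *: delta_mx 0 b + w)) (partial b F w).
Proof.
move=> dF; have := @line_derive _ _ F w (delta_mx 0 b) 0.
by rewrite scale0r add0r; apply; exact: diff_derivable.
Qed.

Lemma PG0b_const b y s t : bV P y -> 0 < s -> s <= t ->
  PG (cs s y) (lshift m 0) b = PG (cs t y) (lshift m 0) b.
Proof.
move=> Vy s0 st.
have H u : s <= u <= t -> is_derive u 1 (fun u : R => PG (cs u y) (lshift m 0) b) 0.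
  move=> /andP[su _]; have Zu := Zs_cs (lt_le_trans s0 su) Vy.
  rewrite -(partial_PG0b b Zu); apply: (@partial_cs0 (fun w => PG w (lshift m 0) b)).
  exact: Cat_differentiable (PG_Cat 1 Zu _ _).
exact/esym/(derive0_eq st H).
Qed.

End PolarMetric.

Lemma derive_le_lip (R : realType) (F : R -> R) (d B : R) : is_derive (0 : R) 1 F d ->
  (\forall s \near (0 : R), `|F s - F 0| <= B * `|s|) -> `|d| <= B.
Proof.
move=> [dF dE] H; rewrite leNgt; apply/negP => Bd.
have : (fun s : R => s^-1 *: (F (s *: 1 + 0) - F 0)) @ 0^' --> d by rewrite -dE; exact: dF.
move=> /cvgrPdist_lt /(_ (`|d| - B)); rewrite subr_gt0 => /(_ Bd) h1.
have h2 : \forall s \near (0 : R)^', `|F s - F 0| <= B * `|s| by exact: cvg_within H.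
have h3 : \forall s \near (0 : R)^', s != 0 by rewrite near_withinE; exact: filterE.
have [s [[h1s h2s] s0]] := @filter_ex _ _ (Proper_dnbhs_numFieldType (0 : R)) _ (filterI (filterI h1 h2) h3).
move: h1s; rewrite addr0 [s *: 1]mulr1 -[_ *: _]/(_ * _) => h1s.
have : `|s^-1 * (F s - F 0)| <= B.
  by rewrite normrM normfV mulrC ler_pdivrMr// normr_gt0.
move: h1s; move: (s^-1 * (F s - F 0)) => x h1s xB.
have : `|d| <= `|d - x| + `|x| by rewrite -{1}(subrK x d) ler_normD.
by lra.
Qed.

Lemma Cat_lip_row (R : realType) (k n : nat) (F : 'rV[R]_k -> 'rV[R]_n) (y : 'rV[R]_k) :
  (forall l, Cat 1 (fun y => F y 0 l) y) ->
  exists C e : R, [/\ 0 <= C, 0 < e & forall y', `|y' - y| <= e -> `|F y' - F y| <= C * `|y' - y|].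
Proof.
move=> CF.
have /choice[L0 LP] : forall l, exists L0 : R, exists e : R, [/\ 0 <= L0, 0 < e &
    forall z z' : 'rV[R]_k, `|z - y| <= e -> `|z' - y| <= e -> `|F z 0 l - F z' 0 l| <= L0 * `|z - z'| /\ `|F z 0 l| <= L0].
  by move=> l; exact: Cat_lip (CF l).
have [e0 eP] := choice LP.
have S0 : 0 <= \sum_l L0 l by apply: sumr_ge0 => l _; have [] := eP l.
have e1 : 0 < \big[Num.min/1]_l e0 l.
  by elim/big_ind: _ => // [a b a0 b0|l _]; [rewrite lt_min a0|have [] := eP l].
exists (\sum_l L0 l), (\big[Num.min/1]_l e0 l); split=> // y' hy'.
apply: norm_le_coord => [|l]; first exact: mulr_ge0.
have [L00 e00 /(_ y' y)[]] := eP l.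
- by apply: le_trans hy' _; exact: bigmin_le_cond.
- by rewrite subrr normr0 ltW.
rewrite !mxE => h _; apply: le_trans h _; apply: ler_wpM2r; first exact: normr_ge0.
rewrite (bigD1 l)//= lerDl; apply: sumr_ge0 => a _; have [] := eP a; by [].
Qed.

Lemma continuous_sumf (R : realType) (T : topologicalType) (I : Type) (s : seq I) (F : I -> T -> R) x :
  (forall i, {for x, continuous (F i)}) -> {for x, continuous (fun y => \sum_(i <- s) F i y)}.
Proof.
move=> cF; elim: s => [|i s IH].
  by apply: (@near_eq_continuous _ _ (fun=> 0)); [apply: near_all => y; rewrite big_nil|exact: for_cst].
apply: (@near_eq_continuous _ _ (fun y => F i y + \sum_(j <- s) F j y)).
  by apply: near_all => y; rewrite big_cons.
by apply: cvgD; [exact: cF|exact: IH].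
Qed.

(** * The Gauss lemma *)

Section GaussLemma.
Context {R : realType} {m : nat} {M : topologicalType} {X : manifold R (1 + m) M} (g : metric X).
Context {U : set M} (D : radial_data g U) (P : bpatch g U).
Implicit Types (j : idx X) (p q : M) (y : 'rV[R]_m) (w : 'rV[R]_(1 + m)) (f h : M -> R).
Local Notation i := (bi P).

Lemma cs_line s y b (t : R) :
  cs s (t *: delta_mx 0 b + y) = t *: delta_mx 0 (rshift 1 b) + cs s y.
Proof.
apply/rowP; apply: split_ord1 => [|l].
  by rewrite csl [RHS]mxE csl [X in X + _]mxE [X in _ * X + _]mxE eq_lrshift andbF mulr0 add0r.
by rewrite csr [RHS]mxE csr [LHS]mxE; congr (_ + _); rewrite [LHS]mxE [RHS]mxE; congr (_ * _); rewrite [LHS]mxE [RHS]mxE (inj_eq (@rshift_inj _ _)).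
Qed.

(** The initial phase of the ray that starts at the boundary point with parameter y
    ([phase_ray]). *)
Definition Ph y := row_mx (bG P y) ((Num.sqrt (bnn P y))^-1 *: bcg P y).

Lemma Cat_Ph k y l : bV P y -> Cat k (fun y => Ph y 0 l) y.
Proof.
move=> Vy; case: (split_ordP l) => l' ->.
  by apply: eq_Cat (Cat_bG k l' Vy) => z; rewrite row_mxEl.
apply: (@eq_Cat _ _ _ (fun y => (Num.sqrt (bnn P y))^-1 * bcg P y 0 l')) => [z|].
  by rewrite row_mxEr [RHS]mxE.
by apply: CatM; [exact: Cat_bnn|exact: Cat_bcg].
Qed.

Lemma phase_ray y c : bV P y -> geo g c -> c 0 = bpsi P y -> velocity (X := X) c 0 = bnu P y ->
  dom i (c 0) /\ phase i c 0 = Ph y.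
Proof.
move=> Vy gc c0 v0; have [d cE _ _ _] := bpsiP Vy.
split; first by rewrite c0.
rewrite /phase c0 cE; congr row_mx.
have di : dom i (c 0) by rewrite c0.
rewrite (vrow_chart (geo_C1c gc) (chart_atP X (c 0)) di).
rewrite -(transitionE (chart_atP X (c 0)) di) -(velocityE 0 (geo_C1c gc)) v0 c0.
exact: bnuE.
Qed.

(* The variation field of the rays extends continuously to s = 0, where it is
   the derivative of the parametrization of the boundary. *)
Lemma ray_variation y b : bV P y -> exists T B : R, 0 < T /\
  forall c, geo g c -> c 0 = bpsi P y -> velocity (X := X) c 0 = bnu P y ->
    forall s, 0 < s <= T -> dom i (Theta P (cs s y)) /\ forall k,
    `|Jr P i (rshift 1 b) (cs s y) 0 k - partial b (fun y => bG P y 0 k) y| <= B * s.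
Proof.
move=> Vy; have [d cE _ _ _] := bpsiP Vy.
have [C [e1 [C0 e10 LP]]] := Cat_lip_row (fun l => Cat_Ph 1 l Vy).
have [e [T [K [e0 T0 K0 [st df]]]]] := geo_local g ((Num.sqrt (bnn P y))^-1 *: bcg P y) d.
rewrite cE -/(Ph y) in st df.
exists T, (K * C); split=> // c gc c0 v0 s /andP[s0 sT].
have [dc0 ph0] := phase_ray Vy gc c0 v0.
have sT' : 0 <= s <= T by rewrite ltW.
have z0 : `|phase i c 0 - Ph y| <= e by rewrite ph0 subrr normr0 ltW.
have cT u : 0 < u -> c u = Theta P (cs u y).
  move=> u0; have [c' [gc' c'0 v'0 c'T]] := ray_exists D Vy.
  rewrite -c'T//; have [dc'0 ph'0] := phase_ray Vy gc' c'0 v'0.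
  apply: (geo_unique gc gc' _ dc0 (T := u)); rewrite ?c0 ?c'0 ?lexx ?ltW// => k.
  have : phase i c 0 = phase i c' 0 by rewrite ph0.
  move=> /eq_row_mx[_] /rowP/(_ k); by rewrite !mxE.
have [ds _] := st c gc dc0 z0 s sT'.
have dTs : dom i (Theta P (cs s y)) by rewrite -cT.
split=> // k.
pose yh (t : R) := t *: delta_mx 0 b + y.
have cy : {for (0 : R), continuous yh}.
  by apply: cvgD; [apply: cvgZl; exact: for_id|exact: for_cst].
have yh0 : yh 0 = y by rewrite /yh scale0r add0r.
have nV : \forall t \near (0 : R), bV P (yh t).
  apply: (near_comp_cont cy); rewrite yh0; apply: open_nbhs_nbhs; split=> //; exact: bV_open.
pose e2 := Num.min e1 (e / (C + 1)).
have C1 : 0 < C + 1 by rewrite ltr_wpDl.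
have e20 : 0 < e2 by rewrite lt_min e10 divr_gt0.
have nb : \forall t \near (0 : R), `|t| <= e2.
  apply/nbhs_ballP; exists e2 => // t; rewrite -ball_normE /ball_ /= sub0r normrN.
  exact: ltW.
have yhn (t : R) : `|yh t - y| <= `|t|.
  rewrite /yh addrK normrZ ler_piMr//; apply: norm_le_coord => // a.
  by rewrite !mxE; case: (_ && _); rewrite ?normr1 ?normr0.
pose F t := Xc P i (cs s (yh t)) 0 k; pose G t := bG P (yh t) 0 k.
have dF : is_derive (0 : R) 1 F (Jr P i (rshift 1 b) (cs s y) 0 k).
  rewrite mxE; have := partial_line (rshift 1 b) (Cat_differentiable (Xc_Cat D 1 k (Zs_cs s0 Vy) dTs)).
  by apply: is_derive_near; apply: near_all => t; rewrite /F cs_line.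
have dG : is_derive (0 : R) 1 G (partial b (fun y => bG P y 0 k) y).
  have := @line_derive _ _ (fun y => bG P y 0 k) y (delta_mx 0 b) 0.
  rewrite scale0r add0r; apply; apply: diff_derivable.
  exact: Cat_differentiable (Cat_bG 1 k Vy).
have dFG : is_derive (0 : R) 1 (F - G) (Jr P i (rshift 1 b) (cs s y) 0 k - partial b (fun y => bG P y 0 k) y).
  exact: is_deriveB.
apply: (derive_le_lip dFG).
apply: filterS2 nV nb => t Vt te.
have [ct [gt ct0 vt0 ctT]] := ray_exists D Vt.
have [dt0 pht] := phase_ray Vt gt ct0 vt0.
have ye1 : `|yh t - y| <= e1.
  by apply: le_trans (yhn t) _; apply: le_trans te _; rewrite ge_min lexx.
have zt' : `|phase i ct 0 - Ph y| <= C * `|t|.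
  by rewrite pht; apply: le_trans (LP _ ye1) _; rewrite ler_wpM2l.
have zt : `|phase i ct 0 - Ph y| <= e.
  apply: le_trans zt' _; apply: le_trans (_ : C * (e / (C + 1)) <= _).
    by rewrite ler_wpM2l//; apply: le_trans te _; rewrite ge_min lexx orbT.
  by rewrite mulrA ler_pdivrMr// [C * e]mulrC ler_wpM2l ?ltW// ltrDl.
(* By [geo_local] the velocities of the two rays differ by at most K times the distance of their
   initial phases; integration over [0, s] yields the factor s. *)
have bnd : `|(xc i ct k s - xc i c k s) - (xc i ct k 0 - xc i c k 0)| <= K * (C * `|t|) * (s - 0).
  apply: (@deriv_bound _ (xc i ct k - xc i c k) (fun u => vc i ct k u - vc i c k u)) => [|u us|u us].
  - exact: ltW.
  - have uT : 0 <= u <= T by case/andP: us => -> /le_trans ->.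
    have [du _] := st c gc dc0 z0 u uT; have [du' _] := st ct gt dt0 zt u uT.
    have [h1 _] := gc.2 i u du k; have [h2 _] := gt.2 i u du' k.
    exact: is_deriveB.
  - have uT : 0 <= u <= T by case/andP: us => -> /le_trans ->.
    have [_ h] := df ct c gt gc dt0 dc0 zt z0 u uT k.
    apply: le_trans h _; rewrite ler_wpM2l//.
    by rewrite ph0.
have E1 : F t = xc i ct k s by rewrite /F /Xc /xc ctT.
have E2 : F 0 = xc i c k s by rewrite /F /Xc /xc yh0 cT.
have E3 : G t = xc i ct k 0.
  have := congr1 (fun z : 'rV[R]_((1 + m) + (1 + m)) => z 0 (lshift _ k)) pht.
  by rewrite /phase /Ph !row_mxEl.
have E4 : G 0 = xc i c k 0.
  have := congr1 (fun z : 'rV[R]_((1 + m) + (1 + m)) => z 0 (lshift _ k)) ph0.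
  by rewrite /phase /Ph !row_mxEl /G yh0.
have -> : (F - G) t - (F - G) 0 = (xc i ct k s - xc i c k s) - (xc i ct k 0 - xc i c k 0).
  rewrite !fctE E1 E2 E3 E4; move: (xc _ _ _ _) (xc _ _ _ _) (xc _ _ _ _) (xc _ _ _ _) => x1 x2 x3 x4.
  ring.
apply: le_trans bnd _; rewrite subr0 le_eqVlt; apply/orP; left; apply/eqP; ring.
Qed.

(** The product of the radial field with the b-th coordinate field is constant along the ray. As s
    tends to 0 the first becomes normal and the second tangent to the boundary, so the constant is
    smaller than every positive bound. *)
Lemma PG0b w b : Zs P w -> PG P w (lshift m 0) (rshift 1 b) = 0.
Proof.
move=> Zw; rewrite [w]csP; set s := w 0 _; set y := rsubmx w; have [s0 Vy] := Zw.
have [c [gc c0 v0 cT]] := ray_exists D Vy.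
have [dc0 ph0] := phase_ray Vy gc c0 v0.
have [T [B [T0 H]]] := ray_variation b Vy.
have {}H u := H c gc c0 v0 u.
set om := PG _ _ _ _.
have omE u : 0 < u -> PG P (cs u y) (lshift m 0) (rshift 1 b) = om.
  move=> u0; have [us|su] := leP u s; first exact: (PG0b_const D _ Vy u0 us).
  by apply/esym; exact: (PG0b_const D _ Vy s0 (ltW su)).
pose a u := vrow i c u *m gmx g i (crd i (c u)).
pose G' k := partial b (fun y => bG P y 0 k) y.
(* The initial velocity of the ray is, as a covector, a multiple of the differential of [bf], which
   kills tangent vectors because [bf] vanishes along the whole patch. *)
have a0 : \sum_k a 0 0 k * G' k = 0.
  have [Ca pa] := CatMx_bG 1 Vy; have [d cE _ _ _] := bpsiP Vy.
  have aE : a 0 = (Num.sqrt (bnn P y))^-1 *: dvec (bf P \o pt i) (bG P y).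
    have /eq_row_mx[x0 vr0] : phase i c 0 = Ph y by [].
    rewrite /a vr0 x0 -scalemxAl /bcg /cgrad mulmxKV//; exact: posdef_unit.
  have Z : partial b (fun y => (bf P \o pt i) (bG P y)) y = 0.
    rewrite (@near_partial _ _ _ (fun=> 0)) ?partial_cst//.
    have : \forall z \near y, bV P z by apply: open_nbhs_nbhs; split=> //; exact: bV_open.
    by apply: filterS => z Vz; have [_ fz _ _] := bG_prop Vz.
  rewrite (@partial_comp _ _ _ (bf P \o pt i) (bG P)) in Z; first last.
  - by move=> l; exact: Cat_differentiable (Cat_bG 1 l Vy).
  - exact: Cat_differentiable (Cat_bf 1 Vy).
  transitivity ((Num.sqrt (bnn P y))^-1 * 0); last by rewrite mulr0.
  rewrite -[X in _ = _ * X]Z mulr_sumr; apply: eq_bigr => k _.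
  by rewrite aE [X in X * _]mxE [X in _ * X * _]mxE mulrA.
have ca k : {for (0 : R), continuous (fun u => a u 0 k)}.
  have E : (fun u => a u 0 k) = (fun u => \sum_l vc i c l u * gmx g i (crd i (c u)) l k).
    by apply/funext => u; rewrite mxE; apply: eq_bigr => l _; rewrite [X in X * _]mxE.
  rewrite E; apply: continuous_sumf => l.
  apply: cvgM.
    by have [_] := (geo_C1c gc).2 i 0 dc0 l.
  apply: (@continuous_comp _ _ _ (fun u => crd i (c u)) (fun x => gmx g i x l k)).
    exact: (@continuous_comp _ _ _ c (crd i) 0 (gc.1 0) (crd_continuous dc0)).
  exact: Cat_continuous (gmx_Cat g 0 dc0 l k).
apply/eqP; rewrite -normr_eq0 eq_le normr_ge0 andbT leNgt; apply/negP => om0.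
(* A bound for the product at radius u in which the coordinate field is replaced by its limit with
   an error B u; it is continuous and vanishes at 0. *)
pose Bd (u : R) : R := `|\sum_k a u 0 k * G' k| + \sum_k `|a u 0 k| * (B * u).
have cB : {for (0 : R), continuous Bd}.
  apply: cvgD.
    apply: cvg_norm; apply: continuous_sumf => l.
    by apply: cvgM; [exact: ca|exact: for_cst].
  apply: continuous_sumf => l.
  apply: cvgM; first by apply: cvg_norm; exact: ca.
  by apply: cvgM; [exact: for_cst|exact: for_id].
have B0 : Bd 0 = 0.
  by rewrite /Bd a0 normr0 add0r big1// => k _; rewrite !mulr0.
have n1 : \forall u \near (0 : R), Bd u < `|om|.
  by apply: (near_comp_cont (P := fun z => z < `|om|) cB); rewrite B0; exact: lt_nbhsl.
have n2 : \forall u \near (0 : R)^'+, Bd u < `|om| by exact: cvg_within n1.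
have n3 : \forall u \near (0 : R)^'+, u < T by exact: nbhs_right_lt.
have n4 : \forall u \near (0 : R)^'+, 0 < u by exact: nbhs_right_gt.
have [u [[h1 h2] u0]] := @filter_ex _ _ (at_right_proper_filter (0 : R)) _ (filterI (filterI n2 n3) n4).
have uT : 0 < u <= T by rewrite u0 ltW.
have [dT HJ] := H u uT.
move: h1; rewrite ltNge => /negP; apply.
have du : dom i (c u) by rewrite cT.
rewrite -(omE u u0) (PG_chart D (Zs_cs u0 Vy) dT) PGjE -(vrow_ray D Vy cT u0 du).
have -> : (vrow i c u *m gmx g i (Xc P i (cs u y)) *m (Jr P i (rshift 1 b) (cs u y))^T) 0 0 =
    \sum_k a u 0 k * G' k + \sum_k a u 0 k * (Jr P i (rshift 1 b) (cs u y) 0 k - G' k).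
  rewrite -big_split /= mxE; apply: eq_bigr => k _; rewrite -mulrDr addrCA subrr addr0.
  by rewrite /a cT// [X in _ * X = _]mxE.
apply: le_trans (ler_normD _ _) _; rewrite lerD2l.
apply: le_trans (ler_norm_sum _ _ _) _; apply: ler_sum => k _.
by rewrite normrM ler_wpM2l//; exact: HJ.
Qed.

Lemma PG_row0 w b : Zs P w -> PG P w (lshift m 0) b = (b == lshift m 0)%:R.
Proof.
move=> Zw; move: b; apply: split_ord1 => [|b]; first by rewrite eqxx PG00.
by rewrite eq_rlshift PG0b.
Qed.

End GaussLemma.

(** * The distance function *)

Section Primitive.
Context {R : realType}.

Lemma primitive01 (f : R -> R) : continuous f -> exists F : R -> R,
  (forall t : R, 0 <= t <= 1 -> is_derive t 1 F (f t)) /\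
  (\int[lebesgue_measure]_(t in `[0%R, 1%R]) (f t)%:E)%E = (F 1 - F 0)%:E.
Proof.
move=> cf.
(* The interval exceeds [0, 1] on both sides so that the primitive has two-sided derivatives at 0
   and 1. *)
have If : lebesgue_measure.-integrable [set` Interval (BLeft (-1 : R)) (BRight 2)] (EFin \o f).
  apply: continuous_compact_integrable; first exact: segment_compact.
  by apply: continuous_subspaceT => x; exact: cf.
pose F (x : R) := \int[lebesgue_measure]_(t in [set` Interval (BLeft (-1)) (BRight x)]) f t.
have dF (t : R) : 0 <= t <= 1 -> is_derive t 1 F (f t).
  move=> /andP[t0 t1]; have t2 : t < 2 by lra.
  have [|d1 d2] := continuous_FTC1 t2 If _ (cf t); first by rewrite /= lte_fin; lra.
  by split; [exact: d1|rewrite -derive1E].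
exists F; split=> //.
rewrite (@continuous_FTC2 _ f F 0 1)//.
- by apply: continuous_subspaceT => x; exact: cf.
- split.
  + by move=> x; rewrite in_itv /= => /andP[x0 x1]; case: (dF x _) => //; rewrite !ltW.
  + apply: cvg_at_right_filter; have := @is_derive_continuous _ _ _ _ (dF 0 _); apply.
    by rewrite lexx ler01.
  + apply: cvg_at_left_filter; have := @is_derive_continuous _ _ _ _ (dF 1 _); apply.
    by rewrite lexx ler01.
- move=> x; rewrite in_itv /= => /andP[x0 x1]; rewrite derive1E.
  by case: (dF x _) => //; rewrite !ltW.
Qed.

(** Cauchy-Schwarz for the covector d of norm 1: the form is nonnegative at v - t u, where u is the
    vector dual to d. *)
Lemma posdef_cs n (A : 'M[R]_n) (d v : 'rV[R]_n) : posdef A ->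
  (d *m invmx A *m d^T) 0 0 = 1 -> (\sum_l v 0 l * d 0 l) ^+ 2 <= (v *m A *m v^T) 0 0.
Proof.
move=> pd d1; set t := \sum_l _.
have [u [Au uu]] : exists u : 'rV[R]_n, A *m u^T = d^T /\ (u *m d^T) 0 0 = 1.
  exists (d *m invmx A); rewrite trmx_mul (posdef_inv_sym pd) mulmxA mulmxV ?mul1mx//.
  exact: posdef_unit.
have tE : (v *m d^T) 0 0 = t by rewrite mxE; apply: eq_bigr => l _; rewrite mxE.
have := posdef_ge0 pd (v - t *: u).
have -> : ((v - t *: u) *m A *m (v - t *: u)^T) 0 0 = (v *m A *m v^T) 0 0 - t ^+ 2.
  have -> : (v - t *: u)^T = v^T - t *: u^T by rewrite !linearB/= linearZ.
  rewrite !mulmxBl !mulmxBr -!scalemxAr -!scalemxAl.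
  rewrite -!mulmxA Au.
  have uv : (u *m (A *m v^T)) 0 0 = t.
    have := form_tr u v A; rewrite pd.1 -!mulmxA Au => ->; exact: tE.
  move: uv uu tE; move: (v *m (A *m v^T)) (v *m d^T) (u *m (A *m v^T)) (u *m d^T) => x1 x2 x3 x4 h3 h4 h2.
  rewrite !mxE h2 h3 h4; ring.
by rewrite subr_ge0.
Qed.

End Primitive.

Section CurveRegularity.
Context {R : realType} {n : nat} {M : topologicalType} {X : manifold R n M} (g : metric X).
Implicit Types (i j : idx X) (p q : M) (c : R -> M).

Lemma Ccurve_C1c c : Ccurve (X := X) (Some 1%N) c -> C1c (X := X) c.
Proof.
move=> Cc.
have loc i t : dom i (c t) -> exists (Z : set R) (F : R -> 'rV[R]_n),
    [/\ open Z, Z t, @Ck R R^o 'rV[R]_n (Some 1%N) Z F &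
        forall s, Z s -> dom i (c s) /\ F s = crd i (c s)].
  move=> it; have [Z [F [oZ Zt CF FP]]] := Cc tt i t I I it.
  by exists Z, F; split=> // s Zs; apply: FP.
have Zn (Z : set R) s : open Z -> Z s -> \forall u \near s, Z u by move=> oZ Zs; exact: open_nbhs_nbhs.
split=> [t|i t it k].
  have it := chart_atP X (c t); set i := chart_at X (c t) in it.
  have [Z [F [oZ Zt CF FP]]] := loc i t it.
  have cF : {for t, continuous F} by have [+ _] := CF [::] t Zt; apply.
  have [_ E1] := FP t Zt.
  have : {for t, continuous (pt i \o F)}.
    by apply: continuous_comp => //; rewrite E1; exact: pt_continuous.
  apply: near_eq_continuous; apply: filterS (Zn _ _ oZ Zt) => s Zs.
  by have [is_ E] := FP s Zs; rewrite /comp E crdK.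
have [Z [F [oZ Zt CF FP]]] := loc i t it.
have En s : Z s -> \forall u \near s, F u 0 k = xc i c k u.
  by move=> Zs; apply: filterS (Zn _ _ oZ Zs) => u Zu; have [_ E] := FP u Zu; rewrite E.
have dF s : Z s -> derivable F s 1 by move=> Zs; have [_ +] := CF [::] s Zs; apply.
have dX s : Z s -> is_derive s 1 (xc i c k) (('D_1 F) s 0 k).
  move=> Zs; apply: is_derive_near (En s Zs) _; split.
    by have /derivable_mxP := dF s Zs; apply.
  by rewrite derive_mx ?mxE//; exact: dF.
have vE s : Z s -> ('D_1 F) s 0 k = vc i c k s.
  by move=> Zs; have [_ E] := dX s Zs; rewrite -E /vc derive1E.
split; first by rewrite -vE//; exact: dX.
have c1 : {for t, continuous ('D_1 F)} by have [+ _] := CF [:: 1] t Zt; apply.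
have c2 : {for t, continuous (fun s => ('D_1 F) s 0 k)}.
  exact: (@continuous_comp _ _ _ ('D_1 F) (fun v : 'rV[R]_n => v 0 k) t c1 (@continuous_coord _ _ k _)).
by apply: near_eq_continuous c2; apply: filterS (Zn _ _ oZ Zt) => s; exact: vE.
Qed.

(** This direction admits geodesics among the curves that compete in the definition of the
    distance. *)
Lemma C1c_Ccurve c : C1c (X := X) c -> Ccurve (X := X) (Some 1%N) c.
Proof.
move=> Cc [] j t _ _ dj.
have oZ : open (c @^-1` dom j) by apply: open_comp (dom_open j) => s _; exact: Cc.1.
exists (c @^-1` dom j), (crd j \o c); split=> //.
have dx s k : dom j (c s) -> is_derive s 1 (fun s => (crd j \o c) s 0 k) (vc j c k s).
  by move=> ds; have [] := Cc.2 j s ds k.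
have dF s (v : R) : dom j (c s) -> derivable (crd j \o c : R^o -> 'rV[R]_n) s v.
  move=> ds; have -> : v = v *: (1 : R) by rewrite [_ *: _]mulr1.
  apply: derivableZv; apply/derivable_mxP => i' k; rewrite ord1.
  by case: (dx s k ds).
have DF s (v : R) : dom j (c s) -> 'D_v (crd j \o c : R^o -> 'rV[R]_n) s = v *: vrow j c s.
  move=> ds; have {1}-> : v = v *: (1 : R) by rewrite [_ *: _]mulr1.
  rewrite deriveZv; last exact: dF.
  congr (_ *: _); rewrite derive_mx; last exact: dF.
  by apply/rowP => k; rewrite !mxE; case: (dx s k ds).
have D1 u v : dom j (c u) -> {for u, continuous ('D_v (crd j \o c : R^o -> 'rV[R]_n))}.
  move=> du; apply: continuous_row => k; apply: (@near_eq_continuous _ _ (fun s => v * vc j c k s)).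
    by apply: filterS (near_curve Cc.1 du) => s ds; rewrite DF// !mxE.
  by apply: cvgM; [exact: for_cst|have [] := Cc.2 j u du k].
case=> [|v []] => [u du|u du|v' s u du].
- split=> [_|_ v]; last exact: dF.
  by apply: continuous_row => k; exact: is_derive_continuous (dx u k du).
- by split=> [_|/= h]; [exact: D1|].
- by split=> /= h.
Qed.

Lemma speed_continuous c : C1c (X := X) c -> continuous (speed g c).
Proof.
move=> Cc t; have di := chart_atP X (c t); set i := chart_at X (c t) in di.
have ce : {for t, continuous (en g i c)}.
  have cv k : {for t, continuous (fun s => vrow i c s 0 k)}.
    by have [_ h] := Cc.2 i t di k; apply: near_eq_continuous h; apply: near_all => s; rewrite mxE.
  have cg k l : {for t, continuous (fun s => gmx g i (crd i (c s)) k l)}.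
    apply: (@continuous_comp _ _ _ (fun u => crd i (c u)) (fun x => gmx g i x k l)).
      exact: (@continuous_comp _ _ _ c (crd i) t (Cc.1 t) (crd_continuous di)).
    exact: Cat_continuous (gmx_Cat g 0 di k l).
  apply: (@near_eq_continuous _ _ (fun s => \sum_k \sum_l vrow i c s 0 k * gmx g i (crd i (c s)) k l * vrow i c s 0 l)).
    by apply: near_all => s; rewrite /en formE.
  apply: continuous_sumf => k; apply: continuous_sumf => l.
  by apply: cvgM; [apply: cvgM; [exact: cv|exact: cg]|exact: cv].
have : {for t, continuous (fun s => Num.sqrt (en g i c s))}.
  exact: (@continuous_comp _ _ _ (en g i c) (@Num.sqrt R) t ce (@sqrt_continuous _ _)).
apply: near_eq_continuous; apply: filterS (near_curve Cc.1 di) => s ds.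
by rewrite (speedE g Cc ds).
Qed.

End CurveRegularity.

(** * A finite cover of the end by patches *)

Section Cover.
Context {R : realType} {m : nat} {M : ptopologicalType} {X : manifold R (1 + m) M} (g : metric X).
Context {U : set M} (D : radial_data g U).
Context (cbd : compact (boundary U)) (sb : smooth_boundary g U).
Implicit Types (p q : M) (y : 'rV[R]_m) (w : 'rV[R]_(1 + m)).
Local Notation E q := (~ closure U q).

(* A triple z consists of a boundary patch and of the centre and radius of a ball in
   its parameter domain. *)
Definition in_patch (z : bpatch g U * 'rV[R]_m * R) q :=
  bD D z.1.1 q /\ `|bYc D z.1.1 q - z.1.2| < z.2.

Definition good_patch (z : bpatch g U * 'rV[R]_m * R) :=
  0 < z.2 /\ forall y, `|y - z.1.2| <= z.2 -> bV z.1.1 y.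

(** Compactness of the boundary gives finitely many patches around the feet, and a point of the end
    belongs to a patch as soon as its foot does, whatever its radius. *)
Lemma finite_cover q0 : E q0 -> exists K : nat, exists z : 'I_K -> bpatch g U * 'rV[R]_m * R,
  (forall k, good_patch (z k)) /\ forall q, E q -> exists k, in_patch (z k) q.
Proof.
move=> Eq0.
pose near_p (z : bpatch g U * 'rV[R]_m * R) (p : M) := [/\ dom (bi z.1.1) p,
  bO z.1.1 (crd (bi z.1.1) p) & `|bY z.1.1 (crd (bi z.1.1) p) - z.1.2| < z.2].
have ex p : boundary U p -> exists z, good_patch z /\ \forall q \near p, near_p z q.
  move=> bp; have [P [dp Op]] := bpatch_exists (r_open D) sb bp.
  have [d c W0] := bO_dom Op; rewrite crdK// in W0.
  have fp := def_zero (r_open D) (b_def P) W0 bp.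
  have [Vy _] := bY_prop Op (etrans (congr1 (bf P) (crdK dp)) fp).
  set y := bY P _ in Vy.
  have /nbhs_ballP[e /= e0 eP] : \forall y' \near y, bV P y'.
    by apply: open_nbhs_nbhs; split=> //; exact: bV_open.
  exists (P, y, e / 2); split.
    split; first by rewrite divr_gt0.
    move=> y' /= hy; apply: eP; rewrite -ball_normE /ball_ /= distrC (le_lt_trans hy)//.
    by rewrite ltr_pdivrMr// mulr_natr mulr2n ltrDl.
  have cY : {for crd (bi P) p, continuous (fun x => bY P x)}.
    by apply: continuous_row => b; exact: Cat_continuous (bY_Cat P 0 b _).
  have n1 : \forall x \near crd (bi P) p, `|bY P x - y| < e / 2.
    have c1 := @continuous_dist _ _ _ _ y _ cY.
    apply: (near_comp_cont (P := fun t => t < e / 2) c1); rewrite subrr normr0.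
    by apply: lt_nbhsl; rewrite divr_gt0.
  have n2 : \forall x \near crd (bi P) p, bO P x.
    by apply: open_nbhs_nbhs; split=> //; exact: bO_open.
  by apply: filterS3 (near_dom dp) (near_crd dp n1) (near_crd dp n2) => q dq h1 h2; split.
(* A default value: the choice below assigns a patch to every point of M, on the boundary or not. *)
have [z0 z0P] : exists z0, good_patch z0.
  have [[b _] _] := h_in D Eq0; have [z [gz _]] := ex _ b; by exists z.
have ex' p : exists z, good_patch z /\ (boundary U p -> \forall q \near p, near_p z q).
  have [bp|nb] := pselect (boundary U p); last by exists z0.
  by have [z [gz h]] := ex p bp; exists z.
have [zz zP] := choice ex'.
have := cbd; rewrite compact_cover => /(_ M setT (fun p => [set q | near_p (zz p) q]^°)).
case=> [p _|p bp|S _ cov].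
- exact: open_interior.
- exists p => //; have [_ h] := zP p; exact: h.
pose s := finmap.enum_fset S; exists (size s), (fun k => zz (nth point s k)).
split=> [k|q Eq]; first by have [] := zP (nth point s k).
have [p pS] := cov _ (foot_bd D Eq).
move=> /interior_subset[d Oq hq].
have ps : p \in s by [].
have lt : (index p s < size s)%N by rewrite index_mem.
exists (Ordinal lt); rewrite /= nth_index//.
Qed.

Definition slab s1 s2 := [set q | E q /\ s1 <= rho D q <= s2].

Lemma compact_box (s1 s2 : R) y (e : R) :
  compact [set w : 'rV[R]_(1 + m) | s1 <= w 0 (lshift m 0) <= s2 /\ `|rsubmx w - y| <= e].
Proof.
have c1 : continuous (fun w : 'rV[R]_(1 + m) => w 0 (lshift m 0)) by move=> w; exact: continuous_coord.
have c2 : continuous (fun w : 'rV[R]_(1 + m) => `|rsubmx w - y|).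
  move=> w; apply: continuous_dist; apply: continuous_row => l.
  apply: (@near_eq_continuous _ _ (fun w : 'rV[R]_(1 + m) => w 0 (rshift 1 l)) _ w); last exact: continuous_coord.
  by apply: near_all => z; rewrite mxE.
apply: bounded_closed_compact; last first.
  have -> : [set w : 'rV[R]_(1 + m) | s1 <= w 0 (lshift m 0) <= s2 /\ `|rsubmx w - y| <= e] =
     ((fun w : 'rV[R]_(1 + m) => w 0 (lshift m 0)) @^-1` [set t | s1 <= t]) `&`
     ((fun w : 'rV[R]_(1 + m) => w 0 (lshift m 0)) @^-1` [set t | t <= s2]) `&`
     ((fun w : 'rV[R]_(1 + m) => `|rsubmx w - y|) @^-1` [set t | t <= e]).
    by apply/seteqP; split => [w [/andP[? ?] ?]|w [[/= a b] c]] //; split=> //; rewrite a.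
  apply: closedI; [apply: closedI|].
  - by apply: closed_comp; [move=> w _; exact: c1|exact: closed_ge].
  - by apply: closed_comp; [move=> w _; exact: c1|exact: closed_le].
  - by apply: closed_comp; [move=> w _; exact: c2|exact: closed_le].
exists (`|s1| + `|s2| + (`|e| + `|y|)); split; first exact: num_real.
move=> C hC w [/andP[w1 w2] w3]; apply: le_trans (ltW hC).
apply: norm_le_coord; first by rewrite !addr_ge0.
apply: split_ord1 => [|l].
  have h1 := ler_norm s2; have h2 := ler_norm (- s1); rewrite normrN in h2.
  have p1 := normr_ge0 e; have p2 := normr_ge0 y; have p3 := normr_ge0 s1; have p4 := normr_ge0 s2.
  by rewrite ler_norml; apply/andP; split; lra.
have h : `|rsubmx w| <= `|e| + `|y|.
  rewrite -(subrK y (rsubmx w)); apply: le_trans (ler_normD _ _) _; rewrite lerD2r.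
  exact: le_trans w3 (ler_norm e).
have -> : w 0 (rshift 1 l) = rsubmx w 0 l by rewrite mxE.
by apply: le_trans (coord_le _ _) _; apply: le_trans h _; rewrite lerDr addr_ge0.
Qed.

Lemma bigsetU_ordP K (F : 'I_K -> set M) q :
  (\big[setU/set0]_(k < K) F k) q <-> exists k, F k q.
Proof.
rewrite -bigcup_seq; split=> [[k _ Fk]|[k Fk]]; first by exists k.
by exists k => //=; rewrite mem_index_enum.
Qed.

(** A finite union of images of compact boxes in polar coordinates. It is closed in M, not merely in
    the end, so a curve that runs in the slab cannot escape from the end in the limit. *)
Lemma slab_closed s1 s2 : 0 < s1 -> closed (slab s1 s2).
Proof.
move=> s10; have [[q0 Eq0]|nE] := pselect (exists q, E q); last first.
  have -> : slab s1 s2 = set0 by apply/seteqP; split=> // q [Eq _]; apply: nE; exists q.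
  exact: closed0.
have [K [z [gz cov]]] := finite_cover Eq0.
pose B k := [set w : 'rV[R]_(1 + m) | s1 <= w 0 (lshift m 0) <= s2 /\ `|rsubmx w - (z k).1.2| <= (z k).2].
have BZ k w : B k w -> Zs (z k).1.1 w.
  by move=> [/andP[w1 _] w3]; split; [exact: lt_le_trans w1|have [_] := gz k; exact].
have -> : slab s1 s2 = \big[setU/set0]_(k < K) (Theta (z k).1.1 @` B k).
  apply/seteqP; split => [q [Eq sq]|q].
    have [k [bq hq]] := cov q Eq; have [Zq Tq] := bD_Theta bq.
    apply/bigsetU_ordP; exists k; exists (cs (rho D q) (bYc D (z k).1.1 q)) => //.
    by split; rewrite ?csl// row_mxKr ltW.
  move=> /bigsetU_ordP[k [w Bw <-]]; have Zw := BZ k w Bw.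
  have h1 := Theta_E D Zw; have [h2 _] := Bw.
  by split; [exact: h1|rewrite rho_Theta].
apply: closed_bigsetU => k _; apply: compact_closed; first exact: manifold_hausdorff X.
apply: continuous_compact; last exact: compact_box.
apply: continuous_in_subspaceT => w; rewrite inE => /BZ Zw.
by have [] := Theta_SM D 0 Zw.
Qed.

End Cover.

(** * The distance to U is the radial coordinate *)

Section Distance.
Context {R : realType} {m : nat} {M : ptopologicalType} {X : manifold R (1 + m) M} (g : metric X).
Context {U : set M} (D : radial_data g U).
Context (cbd : compact (boundary U)) (sb : smooth_boundary g U).
Implicit Types (p q : M) (c : R -> M) (s t : R).
Local Notation E q := (~ closure U q).

Lemma patch_at q : E q -> exists P, bD D P q.
Proof.
move=> Eq; have [P [d Oq]] := bpatch_exists (r_open D) sb (foot_bd D Eq).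
by exists P; split.
Qed.

Lemma ip_rho_Theta (f : M -> R) P q : bD D P q -> CM X 1 f q ->
  ip g (rho D) f q = partial (lshift m 0) (fun w => f (Theta P w)) (cs (rho D q) (bYc D P q)).
Proof.
move=> bq Cf; have [Zw Tw] := bD_Theta bq.
have Cf' : CM X 1 f (Theta P (cs (rho D q) (bYc D P q))) by rewrite Tw.
have := PG_rho D Zw Cf' (fun b => PG_row0 D b Zw).
by rewrite [in LHS]Tw.
Qed.

Lemma ip_rho q : E q -> ip g (rho D) (rho D) q = 1.
Proof.
move=> Eq; have [P bq] := patch_at Eq; rewrite (ip_rho_Theta bq (CM_rho D 1 Eq)).
have [Zw _] := bD_Theta bq.
rewrite (@near_partial _ _ _ (fun w : 'rV[R]_(1 + m) => w 0 (lshift m 0))).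
  by rewrite partial_coord eqxx.
by apply: filterS (Zs_near Zw) => w Zw'; exact: rho_Theta.
Qed.

(** The gradient of rho has norm 1 by [ip_rho], so [posdef_cs] applies. *)
Lemma rho_speed c t : C1c (X := X) c -> E (c t) ->
  exists2 d, is_derive t 1 (fun s : R => rho D (c s)) d & `|d| <= speed g c t.
Proof.
move=> Cc Et; have di := chart_atP X (c t); set i := chart_at X (c t) in di.
have Cr := CM_rho D 1 Et.
exists (\sum_l vrow i c t 0 l * partial l (rho D \o pt i) (crd i (c t))); first exact: C1c_comp.
rewrite (speedE g Cc di) -sqrtr_sqr ler_sqrt; last by apply: posdef_ge0; exact: gmx_posdef.
have := @posdef_cs _ _ (gmx g i (crd i (c t))) (dvec (rho D \o pt i) (crd i (c t))) (vrow i c t) (gmx_posdef g di).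
have := ip_rho Et; rewrite (ip_chart g di Cr Cr) /gpair => h /(_ h).
have -> // : \sum_l vrow i c t 0 l * dvec (rho D \o pt i) (crd i (c t)) 0 l =
  \sum_l vrow i c t 0 l * partial l (rho D \o pt i) (crd i (c t)).
by apply: eq_bigr => l _; rewrite [X in _ * X]mxE.
Qed.

Lemma E_near q : E q -> \forall q' \near q, E q'.
Proof. by move=> Eq; apply: open_nbhs_nbhs; split=> //; exact: E_open. Qed.

Lemma C1c_affine c k t0 : C1c (X := X) c -> C1c (X := X) (fun s => c (k * s + t0)) /\
  forall t, speed g (fun s => c (k * s + t0)) t = `|k| * speed g c (k * t + t0).
Proof.
move=> [cc H]; set c' := fun s => _.
have ca s : {for s, continuous (fun s : R => k * s + t0)}.
  apply: cvgD; last exact: for_cst.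
  by apply: cvgM; [exact: for_cst|exact: for_id].
have vE (i : idx X) s l : dom i (c' s) -> is_derive s 1 (xc i c' l) (k * vc i c l (k * s + t0)).
  by move=> is_; have [d1 _] := H i (k * s + t0) is_ l; exact: (is_derive_affine d1).
have vE' (i : idx X) s l : dom i (c' s) -> vc i c' l s = k * vc i c l (k * s + t0).
  by move=> is_; have [_ Ev] := vE i s l is_; rewrite -Ev /vc derive1E.
have cc' : continuous c' by move=> s; exact: (@continuous_comp _ _ _ (fun s : R => k * s + t0) c s (ca s) (cc _)).
have Cc' : C1c (X := X) c'.
  split=> // i t dt l; split; first by rewrite vE'//; exact: vE.
  apply: (@near_eq_continuous _ _ (fun s => k * vc i c l (k * s + t0))).
    by apply: filterS (near_curve cc' dt) => s ds; rewrite vE'.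
  apply: cvgM; first exact: for_cst.
  have [_ h] := H i (k * t + t0) dt l.
  exact: (@continuous_comp _ _ _ (fun s : R => k * s + t0) (vc i c l) t (ca t) h).
split=> // t; have di := chart_atP X (c' t).
rewrite (speedE g Cc' di) (speedE g (conj cc H) (di : dom _ (c (k * t + t0)))) /en.
have -> : vrow (chart_at X (c' t)) c' t = k *: vrow (chart_at X (c' t)) c (k * t + t0).
  by apply/rowP => l; rewrite [LHS]mxE vE'// [RHS]mxE [X in _ = _ * X]mxE.
rewrite linearZ/= -!scalemxAl -scalemxAr [X in Num.sqrt X]mxE [X in Num.sqrt (_ * X)]mxE mulrA -expr2.
by rewrite sqrtrM ?sqr_ge0// sqrtr_sqr.
Qed.

(** Suppose the curve is too short. As long as it stays in the end, rho changes by no more than the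
    length covered, so it stays in a slab with s1 > 0. This slab is closed, so by [real_induction]
    the curve never leaves the end, although it finishes in U. *)
Lemma rho_le_length c (I : R -> R) : C1c (X := X) c ->
  (forall t, 0 <= t <= 1 -> is_derive t 1 I (speed g c t)) -> E (c 0) -> U (c 1) ->
  rho D (c 0) <= I 1 - I 0.
Proof.
move=> Cc dI E0 U1; rewrite leNgt; apply/negP => lt.
have Imono s t : 0 <= s -> s <= t -> t <= 1 -> I s <= I t.
  move=> s0 st t1.
  have dI' z : s <= z <= t -> is_derive z 1 I (speed g c z).
    by move=> /andP[z1 z2]; apply: dI; rewrite (le_trans s0)// (le_trans z2).
  have [z /andP[z1 z2] E1] := mvt_seg st dI'.
  by rewrite -subr_ge0 E1 mulr_ge0 ?subr_ge0// sqrtr_ge0.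
pose P t := E (c t) /\ `|rho D (c t) - rho D (c 0)| <= I t - I 0.
suff [] : P 1 by move=> E1 _; apply: E1; exact: subset_closure.
pose s1 := rho D (c 0) - (I 1 - I 0); pose s2 := rho D (c 0) + (I 1 - I 0).
have s10 : 0 < s1 by rewrite /s1 subr_gt0.
have inslab t : 0 <= t <= 1 -> P t -> slab D s1 s2 (c t).
  move=> /andP[t0 t1] [Et]; have := Imono _ _ t0 t1 (lexx 1); have := Imono _ _ (lexx 0) t0 t1.
  move=> h1 h2; rewrite ler_norml => /andP[h3 h4]; split=> //.
  by rewrite /s1 /s2; apply/andP; split; lra.
have crho t : E (c t) -> {for t, continuous (fun s => `|rho D (c s) - rho D (c 0)|)}.
  move=> Et; have [d dd _] := rho_speed Cc Et.
  exact: (@continuous_dist _ _ _ (fun s : R => rho D (c s)) _ _ (is_derive_continuous dd)).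
apply: (@real_induction _ P 1) => [t /andP[t0 t1] H|t /andP[t0 t1] [Et ht]|]; last by rewrite ler01 lexx.
  have [->|tn0] := eqVneq t 0; first by split=> //; rewrite !subrr normr0.
  have tp : 0 < t by rewrite lt_neqAle eq_sym tn0.
  have left (Q : R -> Prop) : (\forall s \near t, Q s) -> exists s, [/\ 0 <= s, s < t & Q s].
    move=> /nbhs_ballP[d /= d0 dP]; exists (Num.max 0 (t - d / 2)); split.
    - by rewrite le_max lexx.
    - by rewrite gt_max tp ltrBlDr ltrDl divr_gt0.
    - apply: dP; rewrite -ball_normE /ball_ /= ger0_norm ?subr_ge0; last first.
        by rewrite ge_max t0 gerBl divr_ge0// ltW.
      rewrite ltrBlDr -ltrBlDl lt_max; apply/orP; right; rewrite ltrD2l ltrN2.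
      by rewrite ltr_pdivrMr// mulr_natr mulr2n ltrDl.
  have St : slab D s1 s2 (c t).
    apply: contrapT => nS.
    have : \forall q \near c t, (~` slab D s1 s2) q.
      by apply: open_nbhs_nbhs; split=> //; apply: closed_openC; exact: slab_closed cbd sb _ _ s10.
    move=> /(near_comp_cont (Cc.1 t)) /left[s [h0 h1 h2]]; apply: h2; apply: inslab.
      by rewrite h0 (le_trans (ltW h1)).
    by apply: H; rewrite h0.
  have [Et _] := St; split=> //; rewrite leNgt; apply/negP => h.
  have c2 : {for t, continuous (fun s => `|rho D (c s) - rho D (c 0)| - (I s - I 0))}.
    apply: cvgB; first exact: crho.
    apply: cvgB; last exact: for_cst.
    by apply: (is_derive_continuous (dI t _)); rewrite t0.
  have h' : 0 < `|rho D (c t) - rho D (c 0)| - (I t - I 0) by rewrite subr_gt0.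
  have [s [h0 h1]] := left _ (near_comp_cont c2 (near_gt h')).
  rewrite subr_gt0 ltNge => /negP; apply.
  by have [|_] := H s; rewrite ?h0.
have /nbhs_ballP[d /= d0 dP] : \forall s \near t, E (c s).
  exact: near_comp_cont (Cc.1 t) (E_near Et).
exists (d / 2); first by rewrite divr_gt0.
have Ed s : t <= s <= t + d / 2 -> E (c s).
  move=> /andP[ts st]; apply: dP; rewrite -ball_normE /ball_ /= distrC ger0_norm ?subr_ge0//.
  rewrite ltrBlDl; apply: le_lt_trans st _; rewrite ltrD2l.
  by rewrite ltr_pdivrMr// mulr_natr mulr2n ltrDl.
move=> s /andP[ts st] sT; split; first by apply: Ed; rewrite ts.
(* Taken with e = 1 and e = -1, this bounds the change of rho in absolute value. *)
have sgn (e : R) : `|e| = 1 -> e * (rho D (c s) - rho D (c t)) <= I s - I t.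
  move=> e1; pose F u := I u - e * rho D (c u).
  have dF u : t <= u <= s -> exists2 d, is_derive u 1 F d & 0 <= d.
    move=> /andP[tu us]; have Eu : E (c u) by apply: Ed; rewrite tu (le_trans us).
    have [b db hb] := rho_speed Cc Eu.
    have u01 : 0 <= u <= 1 by rewrite (le_trans t0)//= (le_trans us).
    exists (speed g c u - e * b).
      have dI' := dI u u01; have dr : is_derive u 1 (fun s : R => e * rho D (c s)) (e * b).
        have -> : (fun s : R => e * rho D (c s)) = e *: (fun s : R => rho D (c s)) by [].
        exact: is_deriveZ.
      exact: is_deriveB dI' dr.
    rewrite subr_ge0; apply: le_trans (ler_norm _) _; rewrite normrM e1 mul1r; exact: hb.
  have /choice[df dfP] u : exists d, t <= u <= s -> is_derive u 1 F d /\ 0 <= d.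
    have [h|h] := pselect (t <= u <= s); last by exists 0.
    by have [d' ? ?] := dF u h; exists d'.
  have [z zs E1] := mvt_seg ts (fun u h => (dfP u h).1).
  have : 0 <= F s - F t by rewrite E1 mulr_ge0 ?subr_ge0//; have [] := dfP z zs.
  by rewrite /F; move: (I s) (I t) (rho D (c s)) (rho D (c t)) => x1 x2 x3 x4; lra.
have := sgn 1 (normr1 _); have := sgn (-1) (normrN1 _); move: ht.
rewrite !ler_norml; move: (I s) (I t) (I 0) (rho D (c s)) (rho D (c t)) (rho D (c 0)) => x1 x2 x3 x4 x5 x6.
by move=> /andP[? ?] ? ?; apply/andP; split; lra.
Qed.

(** Lower bound: curves from U to q, reversed, fall under [rho_le_length]. Upper bound: the ray to q
    has length rho q, but it starts on the boundary, which the open set U misses; prolonged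
    backwards by a small u it starts in U. *)
Lemma dist_rho q : E q -> dist_set g U q = rho D q.
Proof.
move=> Eq; rewrite /dist_set; set S := [set Defs.edist g p q | p in U].
suff : ereal_inf S = (rho D q)%:E by rewrite /S => ->.
apply/eqP; rewrite eq_le; apply/andP; split; last first.
  apply: le_ereal_inf_tmp => _ [p Up <-]; apply: le_ereal_inf_tmp => _ [c [Cc c0 c1] <-].
  have Cc1 := Ccurve_C1c Cc; have [Cr spr] := C1c_affine (-1) 1 Cc1.
  have [I [dI ->]] := primitive01 (@speed_continuous _ _ _ _ g _ Cc1).
  have dI' t : 0 <= t <= 1 -> is_derive t 1 (fun t => - I (-1 * t + 1)) (speed g (fun s => c (-1 * s + 1)) t).
    move=> /andP[t0 t1]; rewrite spr normrN1 mul1r.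
    have t01 : 0 <= -1 * t + 1 <= 1 by apply/andP; split; lra.
    apply: (is_derive_eq (is_deriveN (is_derive_affine (dI _ t01)))).
    by rewrite [-1 * speed _ _ _]mulN1r opprK.
  have := rho_le_length Cr dI'; rewrite /= mulr0 add0r mulr1 addNr c0 c1 lee_fin => h.
  by apply: le_trans (h Eq Up) _; rewrite opprK addrC.
have [P bq] := patch_at Eq; have [Zw Tw] := bD_Theta bq.
set s := rho D q in Zw Tw *; set y := bYc D P q in Zw Tw.
have [s0 Vy] := Zw; rewrite csl in s0; rewrite row_mxKr in Vy.
have [c [gc c0 v0 cT]] := ray_exists D Vy.
have cs_ : c s = q by rewrite cT.
have sp1 t : speed g c t = 1.
  by rewrite (speed_const t 0 gc) /speed v0 c0 bnu_unit// sqrtr1.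
have [d cE W0 fy by_] := bpsiP Vy.
(* The ray run backwards from its foot: [bf] decreases at first, so the curve enters U. *)
pose c' (u : R) := c (-1 * u + 0).
have gc' : geo g c' := geo_affine (-1) 0 gc.
have c'0 : c' 0 = bpsi P y by rewrite /c' mulr0 addr0.
have di := chart_atP X (c 0); set i := chart_at X (c 0) in di.
have Cf : CM X 1 (bf P) (c' 0) by rewrite c'0; exact: def_CM (b_def P) W0.
have di' : dom i (c' 0) by rewrite c'0 -c0.
have df := C1c_comp (geo_C1c gc') di' Cf.
have n0 := bnorm_gt0 Vy.
have dneg : \sum_l vrow i c' 0 0 l * partial l (bf P \o pt i) (crd i (c' 0)) < 0.
  have vE : vrow i c' 0 = - bnu P y.
    apply/rowP => k; rewrite [LHS]mxE /c' (vc_affine k gc) mulr0 addr0// mulN1r.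
    by rewrite -v0 (velocityE 0 (geo_C1c gc)) !mxE.
  have iE : i = chart_at X (bpsi P y) by rewrite /i c0.
  have -> : \sum_l vrow i c' 0 0 l * partial l (bf P \o pt i) (crd i (c' 0)) =
     - ((Num.sqrt (ip g (bf P) (bf P) (bpsi P y)))^-1 * ip g (bf P) (bf P) (bpsi P y)).
    rewrite vE c'0 /bnu iE; set j := chart_at X _.
    have dj : dom j (bpsi P y) := chart_atP X _.
    have -> : ip g (bf P) (bf P) (bpsi P y) = \sum_l grad g (bf P) (bpsi P y) 0 l * partial l (bf P \o pt j) (crd j (bpsi P y)).
      by rewrite (ip_chart g dj (def_CM 1 (b_def P) W0) (def_CM 1 (b_def P) W0)) gpairE.
    set k0 := (Num.sqrt _)^-1.
    rewrite mulr_sumr -sumrN; apply: eq_bigr => l _; rewrite mulrA -mulNr; congr (_ * _).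
    by rewrite [LHS]mxE; congr (- _); rewrite [LHS]mxE.
  by rewrite oppr_lt0 mulr_gt0// invr_gt0 sqrtr_gt0.
have n1 := near_derive_neg df dneg; rewrite c'0 fy in n1.
have [oW _ Uf _] := b_def P.
have n2 : \forall u \near (0 : R)^'+, bW P (c' u).
  apply: cvg_within; apply: (near_comp_cont (gc'.1 0)); rewrite c'0.
  by apply: open_nbhs_nbhs; split.
apply/lee_addgt0Pr => e e0.
have n3 : \forall u \near (0 : R)^'+, u < e by exact: nbhs_right_lt.
have n4 : \forall u \near (0 : R)^'+, 0 < u by exact: nbhs_right_gt.
have [u [[[h1 h2] h3] h4]] := @filter_ex _ _ (at_right_proper_filter (0 : R)) _ (filterI (filterI (filterI n1 n2) n3) n4).
have Uu : U (c' u) by apply/(Uf _ h2).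
(* From c' u to q in unit time, at constant speed s + u. *)
pose gam t := c ((s + u) * t + - u).
have gg : geo g gam := geo_affine _ _ gc.
apply: (@le_trans _ _ (Defs.edist g (c' u) q)); first by apply: ereal_inf_lbound; exists (c' u).
apply: (@le_trans _ _ (\int[lebesgue_measure]_(t in `[0%R, 1%R]) (speed g gam t)%:E)%E).
  apply: ereal_inf_lbound; exists gam => //; split.
  - exact: C1c_Ccurve (geo_C1c gg).
  - by rewrite /gam /c' mulr0 add0r mulN1r addr0.
  - by rewrite /gam mulr1 addrK.
have sE t : speed g gam t = s + u.
  by rewrite (speed_affine _ _ _ gc) sp1 mulr1 ger0_norm// addr_ge0 ?ltW.
under eq_integral do rewrite sE.
rewrite integral_cst//= lebesgue_measure_itv/= lte_fin ltr01 oppr0 adde0 mule1 -EFinD lee_fin lerD2l.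
exact: ltW.
Qed.

End Distance.

(** * Flux through the level hypersurfaces *)

Section PositivePartSquare.
Context {R : realType}.

(** A profile of class C^1 is smooth enough, because the partition of unity is differentiated only
    once. *)
Definition psq (s : R) : R := Num.max 0 s ^+ 2.

Lemma psq_derive (t : R) : is_derive t 1 psq (2 * Num.max 0 t).
Proof.
apply: is_derive_bound => e e0.
apply/nbhs_ballP; exists e => // s; rewrite -ball_normE /ball_ /= distrC => se.
apply: le_trans (_ : `|s - t| ^+ 2 <= _); last by rewrite expr2 ler_wpM2r// ltW.
rewrite real_normK ?num_real// /psq.
have [t0|t0] := leP 0 t; have [s0|s0] := leP 0 s; rewrite ?(max_r t0) ?(max_r s0) ?(max_l (ltW t0)) ?(max_l (ltW s0)).
- by rewrite (_ : _ - _ - _ = (s - t) ^+ 2) ?ger0_norm ?sqr_ge0//; ring.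
- have h := mulr_le0_ge0 (ltW s0) t0; have h1 := sqr_ge0 s; have h2 := sqr_ge0 t.
  by rewrite ler_norml; apply/andP; split; lra.
- have h := mulr_ge0_le0 s0 (ltW t0); have h1 := sqr_ge0 s; have h2 := sqr_ge0 t.
  by rewrite ler_norml; apply/andP; split; lra.
- by rewrite (_ : _ - _ - _ = 0) ?normr0 ?sqr_ge0//; ring.
Qed.

Lemma continuous_psq' : continuous (fun t : R => 2 * Num.max 0 t).
Proof.
move=> t; apply: cvgM; first exact: for_cst.
by apply: (@continuous_max _ _ (fun=> 0) id); [exact: for_cst|exact: for_id].
Qed.

Lemma Cat_psq n (f : 'rV[R]_n -> R) (x : 'rV[R]_n) : Cat 1 f x -> Cat 1 (fun y => psq (f y)) x.
Proof.
move=> Cf; apply: Cat_comp1 => //.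
  by apply: near_all => t; case: (psq_derive t).
have H := Cat_near (CatW Cf); apply: filterS H => y /Cat_continuous cf.
have E : (fun y => 'D_1 psq (f y)) = (fun y => 2 * Num.max 0 (f y)).
  by apply/funext => z; case: (psq_derive (f z)).
by rewrite E; exact: (@continuous_comp _ _ _ f (fun t : R => 2 * Num.max 0 t) y cf (@continuous_psq' _)).
Qed.

Lemma psq_ge0 s : 0 <= psq s. Proof. exact: sqr_ge0. Qed.

Lemma psq_gt0 s : 0 < s -> 0 < psq s.
Proof. by move=> s0; rewrite /psq max_r ?ltW// exprn_gt0. Qed.

Lemma psq_eq0 s : s <= 0 -> psq s = 0.
Proof. by move=> s0; rewrite /psq max_l// expr0n. Qed.

End PositivePartSquare.

(** * A partition of unity on the end *)

Section Bumps.
Context {R : realType} {m : nat} {M : ptopologicalType} {X : manifold R (1 + m) M} (g : metric X).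
Context {U : set M} (D : radial_data g U).
Implicit Types (p q : M) (y : 'rV[R]_m) (w : 'rV[R]_(1 + m)).
Local Notation E q := (~ closure U q).

(** The first clause asks for vanishing in a neighbourhood, so that a function given in the
    coordinates of a patch and by 0 elsewhere remains regular across the edge of the patch. *)
Definition supported (z : bpatch g U * 'rV[R]_m * R) (f : M -> R) :=
  (forall q, E q -> ~ bD D z.1.1 q -> \forall q' \near q, f q' = 0) /\
  forall q, bD D z.1.1 q -> z.2 < `|bYc D z.1.1 q - z.1.2| -> f q = 0.

(** The norm on rows is the maximum norm, so the product over the coordinates is positive exactly on
    the ball of [in_patch] when the radius is positive. *)
Definition bump (z : bpatch g U * 'rV[R]_m * R) q : R :=
  if `[< bD D z.1.1 q >] then
    \prod_l psq (z.2 ^+ 2 - (bYc D z.1.1 q 0 l - z.1.2 0 l) ^+ 2)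
  else 0.

Lemma bump_ge0 z q : 0 <= bump z q.
Proof. by rewrite /bump; case: asboolP => // _; apply: prodr_ge0 => l _; exact: psq_ge0. Qed.

Lemma bump_gt0 z q : in_patch D z q -> 0 < bump z q.
Proof.
move=> [bq hq]; rewrite /bump asboolT//; apply: prodr_gt0 => l _; apply: psq_gt0.
rewrite subr_gt0 -real_normK ?num_real// ltr_pXn2r// ?nnegrE//.
  have := coord_le (bYc D z.1.1 q - z.1.2) l; rewrite !mxE => h; exact: le_lt_trans h hq.
by rewrite (le_trans _ (ltW hq)).
Qed.

Lemma far_coord (y : 'rV[R]_m) (e : R) : 0 <= e -> e < `|y| -> exists l, e < `|y 0 l|.
Proof.
move=> e0 ey; apply: contrapT => nl; move: ey; rewrite ltNge => /negP; apply.
by apply: norm_le_coord => // l; rewrite leNgt; apply/negP => h; apply: nl; exists l.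
Qed.

Lemma bump_far z q : good_patch z -> bD D z.1.1 q -> z.2 < `|bYc D z.1.1 q - z.1.2| -> bump z q = 0.
Proof.
move=> [e0 _] bq /far_coord[]; first exact: ltW.
move=> l; rewrite !mxE => hl; rewrite /bump asboolT// (bigD1 l)//= psq_eq0 ?mul0r//.
rewrite subr_le0 -[leRHS]real_normK ?num_real// ler_pXn2r// ?nnegrE// ltW//.
Qed.

(** The closed ball has a compact, hence closed, image in the boundary. A foot outside this image
    stays outside under small displacements of q. *)
Lemma bump_supported z : good_patch z -> supported z (bump z).
Proof.
move=> gz; split=> [q Eq nb|q]; last exact: bump_far.
have [e0 zV] := gz; set P := z.1.1 in nb zV *.
pose B := [set y | `|y - z.1.2| <= z.2].
have cB : compact (bpsi P @` B).
  apply: continuous_compact; last exact: compact_ball_at.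
  apply: continuous_in_subspaceT => y; rewrite inE => /zV Vy.
  have [dy cy _ _ _] := bpsiP Vy.
  apply: (@continuous_comp _ _ _ (bG P) (pt (bi P))).
    by apply: continuous_row => l; exact: Cat_continuous (Cat_bG 0 l Vy).
  by rewrite -cy; exact: pt_continuous.
have clB := compact_closed (manifold_hausdorff X) cB.
have nf : ~ (bpsi P @` B) (foot D q).
  move=> [y /zV Vy yE]; apply: nb; have [dy cy _ _ _] := bpsiP Vy.
  have [Oy _ _ _] := bG_prop Vy; split; rewrite -?yE ?cy//.
have : \forall p \near foot D q, (~` (bpsi P @` B)) p.
  by apply: open_nbhs_nbhs; split=> //; exact: closed_openC.
move=> /(near_comp_cont (foot_continuous Eq)); apply: filterS => q' hq'.
have [bq'|nbq'] := pselect (bD D P q'); last by rewrite /bump asboolF.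
apply: bump_far => //; rewrite ltNge; apply/negP => h; apply: hq'.
have [Zw Tw] := bD_Theta bq'; exists (bYc D P q') => //.
by rewrite -[in RHS]Tw (foot_Theta D Zw) row_mxKr.
Qed.

Lemma CM_bump z q : good_patch z -> E q -> CM X 1 (bump z) q.
Proof.
move=> gz Eq; have [bq|nb] := pselect (bD D z.1.1 q); last first.
  have [h _] := bump_supported gz.
  apply: (@CM_ext _ _ _ _ 1 (fun=> 0)); last exact: CM_cst.
  by apply: filterS (h q Eq nb) => q' ->.
apply: (@CM_ext _ _ _ _ 1 (fun q => \prod_l psq (z.2 ^+ 2 - (bYc D z.1.1 q 0 l - z.1.2 0 l) ^+ 2))).
  by apply: filterS (bD_near bq) => q' bq'; rewrite /bump asboolT.
move=> i di; apply: (@Cat_prod _ _ _ _ _ _ (fun l => (fun q => psq (z.2 ^+ 2 - (bYc D z.1.1 q 0 l - z.1.2 0 l) ^+ 2)) \o pt i)) => l.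
apply: (@Cat_psq _ _ (fun x => z.2 ^+ 2 - (bYc D z.1.1 (pt i x) 0 l - z.1.2 0 l) ^+ 2)).
have C : Cat 1 (fun x => bYc D z.1.1 (pt i x) 0 l - z.1.2 0 l) (crd i q).
  by apply: CatB; [exact: CM_bYc bq i di|exact: Cat_cst].
by apply: CatB; [exact: Cat_cst|apply: eq_Cat (CatM C C) => x; rewrite expr2].
Qed.

Context (K : nat) (z : 'I_K -> bpatch g U * 'rV[R]_m * R).
Context (gz : forall k, good_patch (z k)) (cov : forall q, E q -> exists k, in_patch D (z k) q).

Definition chi k q := bump (z k) q / \sum_j bump (z j) q.

Lemma sum_bump_gt0 q : E q -> 0 < \sum_j bump (z j) q.
Proof.
move=> /cov[k /bump_gt0 b0]; rewrite (bigD1 k)//= ltr_pwDl//.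
by apply: sumr_ge0 => j _; exact: bump_ge0.
Qed.

Lemma chi_ge0 k q : 0 <= chi k q.
Proof. by rewrite divr_ge0 ?bump_ge0//; apply: sumr_ge0 => j _; exact: bump_ge0. Qed.

Lemma sum_chi q : E q -> \sum_k chi k q = 1.
Proof. by move=> Eq; rewrite -mulr_suml divff// gt_eqF// sum_bump_gt0. Qed.

Lemma CM_chi k q : E q -> CM X 1 (chi k) q.
Proof.
move=> Eq; apply: CMM; first exact: CM_bump.
apply: CMV; first by rewrite gt_eqF// sum_bump_gt0.
by apply: CM_sum => j; exact: CM_bump.
Qed.

Lemma supportedM (zz : bpatch g U * 'rV[R]_m * R) (f h : M -> R) : supported zz f -> supported zz (fun q => f q * h q).
Proof.
move=> [h1 h2]; split=> [q Eq nb|q bq far]; last by rewrite h2// mul0r.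
by apply: filterS (h1 q Eq nb) => q' ->; rewrite mul0r.
Qed.

Lemma chi_supported k : supported (z k) (chi k).
Proof. by apply: supportedM; exact: bump_supported. Qed.

Lemma ip_near0 (f h : M -> R) q : (\forall q' \near q, f q' = 0) -> CM X 1 h q -> ip g f h q = 0.
Proof.
move=> f0 Ch; have C0 : CM X 1 (fun=> 0) q by exact: CM_cst.
have n0 : \forall q' \near q, (fun=> 0) q' = f q' by apply: filterS f0 => q' ->.
have Cf := CM_ext n0 C0.
have e1 : ip g f h q = ip g (fun=> 0) h q by exact: ip_near f0 Cf Ch.
have e2 : ip g (fun=> 0 + 0) h q = _ := ipDl g C0 C0 Ch.
by rewrite e1; move: e2; rewrite addr0 => /eqP; rewrite -subr_eq0 opprD addNKr oppr_eq0 => /eqP.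
Qed.

Lemma supported_near0 (zz : bpatch g U * 'rV[R]_m * R) (f : M -> R) q : supported zz f -> E q ->
  ~ (bD D zz.1.1 q /\ `|bYc D zz.1.1 q - zz.1.2| <= zz.2) -> \forall q' \near q, f q' = 0.
Proof.
move=> [h1 h2] Eq nb; have [bq|nbq] := pselect (bD D zz.1.1 q); last exact: h1.
have far : zz.2 < `|bYc D zz.1.1 q - zz.1.2| by rewrite ltNge; apply/negP => h; exact: nb.
have cY : {for q, continuous (fun q => bYc D zz.1.1 q)}.
  by apply: continuous_row => l; exact: CM_continuous (CM_bYc 0 l bq).
have c1 := @continuous_dist _ _ _ _ zz.1.2 _ cY.
by apply: filterS2 (bD_near bq) (near_comp_cont c1 (near_gt far)) => q' bq' far'; exact: h2.
Qed.

End Bumps.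

Lemma for_mulr (R : realType) (T : topologicalType) (f h : T -> R) x :
  {for x, continuous f} -> {for x, continuous h} -> {for x, continuous (fun y => f y * h y)}.
Proof. exact: cvgM. Qed.

Lemma for_addr (R : realType) (T : topologicalType) (f h : T -> R) x :
  {for x, continuous f} -> {for x, continuous h} -> {for x, continuous (fun y => f y + h y)}.
Proof. exact: cvgD. Qed.

(** * Integrals over level hypersurfaces *)

Section LevelIntegrals.
Context {R : realType} {m : nat} {M : ptopologicalType} {X : manifold R (1 + m) M} (g : metric X).
Context {U : set M} (D : radial_data g U) (cbd : compact (boundary U)) (sb : smooth_boundary g U).
Implicit Types (p q : M) (w : 'rV[R]_(1 + m)).
Local Notation E q := (~ closure U q).
Local Notation patch := (bpatch g U * 'rV[R]_m * R)%type.

(** The volume density in polar coordinates. As the metric is block diagonal with corner 1 there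
    ([det_PG]), it is also the area density of the level hypersurfaces. *)
Definition sd (P : bpatch g U) w := Num.sqrt (\det (PG P w)).

Definition pb (P : bpatch g U) (f : M -> R) w : R :=
  if `[< bV P (rsubmx w) >] then f (Theta P w) * sd P w else 0.

Definition Jt (zz : patch) (t : R) (f : M -> R) : R := It (fun y => pb zz.1.1 f (cs t y)).

Definition lsupp (zz : patch) (t : R) (f : M -> R) := forall q, E q -> rho D q = t ->
  {for q, continuous f} /\
  (f q != 0 -> bD D zz.1.1 q /\ `|bYc D zz.1.1 q - zz.1.2| <= zz.2).

Definition zB (zz : patch) : R := `|zz.1.2| + zz.2.

Lemma sd_Cat k P w : Zs P w -> Cat k (sd P) w.
Proof.
move=> Zw; apply: Cat_sqrt; last exact: Cat_det (PG_Cat D k Zw).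
exact: posdef_det (PG_posdef D Zw).
Qed.

Lemma pbE P f w : bV P (rsubmx w) -> pb P f w = f (Theta P w) * sd P w.
Proof. by move=> Vw; rewrite /pb asboolT. Qed.

Lemma zB_ge0 zz : good_patch zz -> 0 <= zB zz.
Proof. by move=> [e0 _]; rewrite addr_ge0// ltW. Qed.

Lemma zB_le (zz : patch) (y : 'rV[R]_m) : `|y - zz.1.2| <= zz.2 -> `|y| <= zB zz.
Proof.
move=> h; rewrite /zB addrC -lerBlDr; apply: le_trans h.
by have := lerB_dist y zz.1.2.
Qed.

Lemma rsub_cs (t : R) (y : 'rV[R]_m) : rsubmx (cs t y) = y.
Proof. exact: row_mxKr. Qed.

Lemma Theta_level zz (t : R) (y : 'rV[R]_m) : 0 < t -> bV zz y ->
  [/\ Zs zz (cs t y), E (Theta zz (cs t y)), rho D (Theta zz (cs t y)) = t,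
     bD D zz (Theta zz (cs t y)) & bYc D zz (Theta zz (cs t y)) = y].
Proof.
move=> t0 Vy; have Zw := Zs_cs t0 Vy; have [Y1 b1] := bYc_Theta D Zw.
by split=> //; [exact: (Theta_E D Zw)|rewrite (rho_Theta D Zw) csl|rewrite Y1 rsub_cs].
Qed.

Lemma continuous_Theta_cs (P : bpatch g U) (t : R) (y : 'rV[R]_m) : 0 < t -> bV P y ->
  {for y, continuous (fun y => Theta P (cs t y))}.
Proof.
move=> t0 Vy; have [cT _] := Theta_SM D 0 (Zs_cs t0 Vy).
apply: (@continuous_comp _ _ _ (fun y => cs t y) (Theta P) y) => //.
by apply: continuous_cs; [exact: for_cst|exact: for_id].
Qed.

Lemma continuous_pb_part (P : bpatch g U) (t : R) (y : 'rV[R]_m) : 0 < t -> bV P y ->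
  {for y, continuous (fun y => sd P (cs t y))}.
Proof.
move=> t0 Vy; apply: (@continuous_comp _ _ _ (fun y => cs t y) (sd P) y).
  by apply: continuous_cs; [exact: for_cst|exact: for_id].
exact: (Cat_continuous (sd_Cat 0 (Zs_cs t0 Vy))).
Qed.

Lemma closed_ball_at (y0 : 'rV[R]_m) (e : R) : closed [set y : 'rV[R]_m | `|y - y0| <= e].
Proof. by apply: compact_closed; [exact: norm_hausdorff|exact: compact_ball_at]. Qed.

Lemma KB_pb zz (t : R) f : 0 < t -> good_patch zz -> lsupp zz t f ->
  KB (zB zz) (fun y => pb zz.1.1 f (cs t y)).
Proof.
move=> t0 [e0 zV] hf.
have far y : pb zz.1.1 f (cs t y) != 0 -> `|y - zz.1.2| <= zz.2.
  have [Vy|nV] := pselect (bV zz.1.1 y); last by rewrite /pb rsub_cs asboolF ?eqxx.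
  rewrite pbE ?rsub_cs// mulf_eq0 negb_or => /andP[fn _].
  have [Zw Ew rw bw Yw] := Theta_level t0 Vy.
  by have [_ /(_ fn)[_]] := hf _ Ew rw; rewrite Yw.
split=> [|y /far]; last exact: zB_le.
apply: (@continuous_zero_ext _ _ (bV zz.1.1) [set y | `|y - zz.1.2| <= zz.2]) => //.
- exact: bV_open.
- exact: closed_ball_at.
- move=> y Vy; have nV : \forall y' \near y, bV zz.1.1 y'.
    by apply: open_nbhs_nbhs; split=> //; exact: bV_open.
  apply: (@near_eq_continuous _ _ (fun y => f (Theta zz.1.1 (cs t y)) * sd zz.1.1 (cs t y)) _ y).
    by apply: filterS nV => y' Vy'; rewrite pbE ?rsub_cs.
  have [Zw Ew rw bw Yw] := Theta_level t0 Vy; have [cf _] := hf _ Ew rw.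
  apply: for_mulr; last exact: continuous_pb_part.
  exact: (@continuous_comp _ _ _ (fun y => Theta zz.1.1 (cs t y)) f y (continuous_Theta_cs t0 Vy) cf).
- by move=> y nK; apply/eqP; apply: contrapT => /negP /far.
Qed.

Lemma lsuppZ zz (t : R) c f : lsupp zz t f -> lsupp zz t (fun q => c * f q).
Proof.
move=> hf q Eq rq; have [cf sf] := hf q Eq rq; split.
  by apply: cvgM; [exact: for_cst|exact: cf].
by rewrite mulf_eq0 negb_or => /andP[_ /sf].
Qed.

Lemma lsuppD zz (t : R) f h : lsupp zz t f -> lsupp zz t h -> lsupp zz t (fun q => f q + h q).
Proof.
move=> hf hh q Eq rq; have [cf sf] := hf q Eq rq; have [ch sh] := hh q Eq rq; split.
  by apply: cvgD; [exact: cf|exact: ch].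
have [f0|/sf//] := eqVneq (f q) 0; have [h0|/sh//] := eqVneq (h q) 0.
by rewrite f0 h0 addr0 eqxx.
Qed.

Lemma lsupp_max zz (t : R) f : lsupp zz t f -> lsupp zz t (fun q => Num.max 0 (f q)).
Proof.
move=> hf q Eq rq; have [cf sf] := hf q Eq rq; split.
  by apply: (@continuous_max _ _ (fun=> 0) f); [exact: for_cst|exact: cf].
have [f0|/sf//] := eqVneq (f q) 0; by rewrite f0 maxxx eqxx.
Qed.

Lemma JtD zz (t : R) f h : 0 < t -> good_patch zz -> lsupp zz t f -> lsupp zz t h ->
  Jt zz t (fun q => f q + h q) = Jt zz t f + Jt zz t h.
Proof.
move=> t0 gz hf hh; rewrite /Jt -(ItD (zB_ge0 gz) (KB_pb t0 gz hf) (KB_pb t0 gz hh)).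
congr It; apply/funext => y; rewrite /pb; case: asboolP => _; last by rewrite addr0.
by rewrite mulrDl.
Qed.

Lemma JtZ zz (t : R) c f : 0 < t -> good_patch zz -> lsupp zz t f ->
  Jt zz t (fun q => c * f q) = c * Jt zz t f.
Proof.
move=> t0 gz hf; rewrite /Jt -(ItZ c (zB_ge0 gz) (KB_pb t0 gz hf)).
congr It; apply/funext => y; rewrite /pb; case: asboolP => _; last by rewrite mulr0.
by rewrite mulrA.
Qed.

Lemma det_PG (P : bpatch g U) w : Zs P w -> \det (PG P w) = \det (drsubmx (PG P w : 'M[R]_(1 + m, 1 + m))).
Proof.
move=> Zw; have [sy _] := PG_posdef D Zw.
have e : PG P w = block_mx 1%:M 0 0 (drsubmx (PG P w : 'M[R]_(1 + m, 1 + m))).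
  have r0 b : PG P w (lshift m 0) b = (b == lshift m 0)%:R := PG_row0 D b Zw; move: (PG P w) sy r0 => A sy r0.
  rewrite -[LHS](@submxK _ 1 m 1 m); congr (block_mx _ _ _ _); apply/matrixP => a b.
  - by rewrite !mxE (ord1 a) (ord1 b) r0 eqxx.
  - by rewrite !mxE (ord1 a) r0 eq_rlshift.
  - by rewrite -sy !mxE (ord1 b) r0 eq_rlshift.
by rewrite {1}e det_ublock det1 mul1r.
Qed.

Lemma pullback_PG (P : bpatch g U) (t : R) (y : 'rV[R]_m) : 0 < t -> bV P y ->
  pullback_metric g (fun y : 'rV[R]_m => Theta P (cs t y) : M) y = drsubmx (PG P (cs t y) : 'M[R]_(1 + m, 1 + m)).
Proof.
move=> t0 Vy; have Zw := Zs_cs t0 Vy; rewrite /pullback_metric /PG.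
set i := chart_at X _; have di : dom i (Theta P (cs t y)) := chart_atP X _.
have Cx b : Cat 1 (fun w => Xc P i w 0 b) (cs t y) := Xc_Cat D 1 b Zw di.
have Ccs c : Cat 1 (fun y : 'rV[R]_m => cs t y 0 c) y.
  elim/split_ord1: c => [|c]; first by apply: eq_Cat (Cat_cst _ t y) => z; rewrite csl.
  by apply: eq_Cat (Cat_coord _ c y) => z; rewrite csr.
have Cc b : Cat 1 (fun y => Xc P i (cs t y) 0 b) y := Cat_comp (Cx b) Ccs.
have -> : 'J (crd i \o (fun y : 'rV[R]_m => Theta P (cs t y))) y = dsubmx (jac (Xc P i) (cs t y) : 'M[R]_(1 + m, 1 + m)).
  rewrite (@jacobianE _ _ _ (fun y => Xc P i (cs t y)) y) => [|b]; last exact: Cat_differentiable (Cc b).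
  apply/matrixP => a b; rewrite !mxE.
  exact: (partial_cs (f := fun w => Xc P i w 0 b) a (Cat_differentiable (Cx b))).
rewrite /PGj /pull /Xc; set J := jac _ _; set A := gmx g i _.
rewrite -[in RHS](@vsubmxK _ 1 m (1 + m) J) mul_col_mx tr_col_mx mul_col_row.
by rewrite block_mxKdr.
Qed.

Lemma Theta_Cmap (P : bpatch g U) (t : R) : 0 < t ->
  Cmap (id_chart 'rV[R]_m) X None (bV P) (fun y : 'rV[R]_m => Theta P (cs t y) : M).
Proof.
move=> t0 [] j y Vy _ dy; pose O := [set y' | bV P y' /\ dom j (Theta P (cs t y'))].
have oO : open O.
  rewrite openE => y' [Vy' dy'].
  have nV : \forall y'' \near y', bV P y'' by apply: open_nbhs_nbhs; split=> //; exact: bV_open.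
  have nd := near_comp_cont (continuous_Theta_cs t0 Vy') (near_dom dy').
  by apply: filterS2 nV nd.
exists O, (fun y => crd j (Theta P (cs t y))); split=> [//|//||y' Vy' _ [_ dy']//].
apply: Cat_Ck => // y' [Vy' dy'] k b.
apply: (Cat_comp (f := fun w => Xc P j w 0 b) (F := fun y => cs t y)).
  by apply: (Xc_Cat D) => //; exact: Zs_cs.
move=> c; elim/split_ord1: c => [|c]; first by apply: eq_Cat (Cat_cst _ t y') => z; rewrite csl.
by apply: eq_Cat (Cat_coord _ c y') => z; rewrite csr.
Qed.

Definition lrestr (t : R) (f : M -> R) q : R := if `[< E q /\ rho D q = t >] then f q else 0.

(** A superlevel set at height c >= 0 is the intersection of a closed slab with an open set; below 0
    it is everything, as f >= 0. *)
Lemma measurable_lrestr (t : R) (f : M -> R) : 0 < t ->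
  (forall q, E q -> rho D q = t -> {for q, continuous f} /\ 0 <= f q) ->
  measurable_fun [set: borel M] (lrestr t f : borel M -> R).
Proof.
move=> t0 hf; apply: (@measurability _ _ (borel M) _ [set: borel M] _ _ (RGenOInfty.measurableE R)) => // _ [_ [c -> <-]].
rewrite setTI; have [c0|c0] := ltP c 0.
  rewrite (_ : _ @^-1` _ = setT); first exact: measurableT.
  apply/seteqP; split=> // q _; rewrite /= in_itv/= andbT /lrestr; case: asboolP => // -[Eq rq].
  by apply: lt_le_trans c0 _; have [] := hf q Eq rq.
have -> : (lrestr t f : borel M -> R) @^-1` `]c, +oo[%classic =
    slab D t t `&` interior [set q | c < f q].
  apply/seteqP; split=> q; rewrite /= in_itv/= andbT /lrestr.
    case: asboolP => [[Eq rq] h|_]; last by rewrite ltNge c0.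
    split; first by split=> //; rewrite rq lexx.
    by have [cf _] := hf q Eq rq; exact: near_comp_cont cf (near_gt h).
  move=> [[Eq /andP[r1 r2]] /interior_subset h]; rewrite asboolT//; split=> //.
  by apply/le_anti; rewrite r1 r2.
apply: measurableI; last by apply: sub_sigma_algebra; exact: open_interior.
have cl : closed (slab D t t) := slab_closed cbd sb t0.
rewrite -[slab D t t]setCK; apply: measurableC; apply: sub_sigma_algebra.
exact: closed_openC.
Qed.

Context (t : R) (t0 : 0 < t) (mu : {measure set (borel M) -> \bar R}).
Context (hmu : area_measure g (level_set g U t) mu).

(** For fixed t the polar map parametrizes a piece of S(t), with induced metric the lower right
    block of [PG]; [integral_local] then passes from the measure of sets to the integral of
    functions. *)
Lemma Jt_integral zz f : good_patch zz -> lsupp zz t f ->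
  (forall q, E q -> rho D q = t -> 0 <= f q) ->
  (\int[mu]_(q in [set: borel M]) (lrestr t f q)%:E)%E = (Jt zz t f)%:E.
Proof.
move=> gz hf f0; have [e0 zV] := gz; set P := zz.1.1.
have lE y : bV P y -> lrestr t f (Theta P (cs t y)) = f (Theta P (cs t y)).
  by move=> Vy; have [_ Ew rw _ _] := Theta_level t0 Vy; rewrite /lrestr asboolT.
rewrite (@integral_local _ _ _ mu (bV P) [set y | `|y - zz.1.2| <= zz.2]
  (fun y => Theta P (cs t y)) (fun y => sd P (cs t y)) (lrestr t f) (zB zz)).
- congr (EFin (It _)); apply/funext => y; rewrite /pb rsub_cs; case: asboolP => // Vy.
  by rewrite lE.
- exact: zB_ge0.
- exact: bV_open.
- exact: compact_ball_at.
- exact: zV.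
- by move=> y; exact: zB_le.
- by move=> y _; exact: sqrtr_ge0.
- by move=> y Vy; exact: continuous_pb_part.
- move=> A mA AV.
  rewrite (hmu (V := bV P) (psi := fun y : 'rV[R]_m => Theta P (cs t y) : M)) //.
  + congr integral_rV; apply/funext => y; case: asboolP => // -[Vy _].
    by rewrite (pullback_PG t0 Vy) -(det_PG (Zs_cs t0 Vy)).
  + exact: bV_open.
  + exact: Theta_Cmap.
  + move=> y y'; rewrite !inE => Vy Vy' e.
    by have [_ _ _ _ <-] := Theta_level t0 Vy; have [_ _ _ _ <-] := Theta_level t0 Vy'; rewrite e.
  + move=> _ [y Vy <-]; have [_ Ew rw _ _] := Theta_level t0 Vy.
    by split=> //; rewrite (dist_rho D cbd sb Ew).
  + move=> y Vy; rewrite (pullback_PG t0 Vy) -(det_PG (Zs_cs t0 Vy)).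
    exact: posdef_det (PG_posdef D (Zs_cs t0 Vy)).
- by apply: measurable_lrestr => // q Eq rq; split; [have [] := hf q Eq rq|exact: f0].
- by move=> q; rewrite /lrestr; case: asboolP => // -[Eq rq]; exact: f0.
- move=> q; rewrite /lrestr; case: asboolP => [[Eq rq] fn|]; last by rewrite eqxx.
  have [_ /(_ fn)[bq Yq]] := hf q Eq rq; have [Zw Tw] := bD_Theta bq.
  by exists (bYc D P q); [exact: zV|rewrite -rq].
- move=> y Vy; have nV : \forall y' \near y, bV P y'.
    by apply: open_nbhs_nbhs; split=> //; exact: bV_open.
  apply: (@near_eq_continuous _ _ (fun y => f (Theta P (cs t y))) _ y).
    by apply: filterS nV => y' Vy'; rewrite /= lE.
  have [Zw Ew rw bw Yw] := Theta_level t0 Vy; have [cf _] := hf _ Ew rw.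
  exact: (@continuous_comp _ _ _ (fun y => Theta P (cs t y)) f y (continuous_Theta_cs t0 Vy) cf).
- move=> y Vy; rewrite lE//; have [_ Ew rw _ Yw] := Theta_level t0 Vy.
  by move=> fn; have [_ /(_ fn)[_]] := hf _ Ew rw; rewrite Yw.
Qed.

Context (K : nat) (z : 'I_K -> patch) (gz : forall k, good_patch (z k)).

Lemma Jt_sum_integral (f : 'I_K -> M -> R) : (forall k, lsupp (z k) t (f k)) ->
  (forall k q, E q -> rho D q = t -> 0 <= f k q) ->
  (\int[mu]_(q in [set: borel M]) (lrestr t (fun q => \sum_k f k q)%R q)%:E)%E =
  (\sum_k Jt (z k) t (f k))%:E.
Proof.
move=> hf f0; rewrite -sumEFin.
under [RHS]eq_bigr => k _ do rewrite -(Jt_integral (gz k) (hf k) (f0 k)).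
rewrite -ge0_integral_sum//.
- apply: eq_integral => q _; rewrite sumEFin; congr EFin; rewrite /lrestr.
  by case: asboolP => // _; rewrite big1.
- move=> k; apply/measurable_EFinP; apply: measurable_lrestr => // q Eq rq.
  by split; [have [] := hf k q Eq rq|exact: f0].
- by move=> k q _; rewrite lee_fin /lrestr; case: asboolP => // -[Eq rq]; exact: f0.
Qed.

(** Only the sum over the patches has a sign, and the patches use different coordinates. Splitting
    each f k into positive and negative parts turns both sums into integrals against the same
    measure, where the pointwise inequality can be used. *)
Lemma Jt_sum_ge0 (f : 'I_K -> M -> R) : (forall k, lsupp (z k) t (f k)) ->
  (forall q, E q -> rho D q = t -> 0 <= \sum_k f k q) -> 0 <= \sum_k Jt (z k) t (f k).
Proof.
move=> hf f0; pose fp k q := Num.max 0 (f k q); pose fm k q := Num.max 0 (-1 * f k q).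
have hp k : lsupp (z k) t (fp k) by exact: lsupp_max.
have hm k : lsupp (z k) t (fm k) by apply: lsupp_max; exact: lsuppZ.
have e k : Jt (z k) t (f k) = Jt (z k) t (fp k) + -1 * Jt (z k) t (fm k).
  rewrite -(JtZ (-1) t0 (gz k) (hm k)) -(JtD t0 (gz k) (hp k) (lsuppZ (-1) (hm k))).
  congr (Jt _ _ _); apply/funext => q; rewrite /fp /fm !mulN1r.
  by have [h|h] := leP 0 (f k q); [rewrite max_l ?subr0// oppr_le0|rewrite max_r ?sub0r ?opprK// oppr_ge0 ltW].
under eq_bigr do rewrite e; rewrite big_split/= -mulr_sumr mulN1r subr_ge0 -lee_fin.
have ge k q : 0 <= fp k q /\ 0 <= fm k q by rewrite /fp /fm !le_max lexx.
have pm q : \sum_k f k q = \sum_k fp k q - \sum_k fm k q.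
  rewrite -sumrB; apply: eq_bigr => k _; rewrite /fp /fm mulN1r.
  by have [h|h] := leP 0 (f k q); [rewrite max_l ?subr0// oppr_le0|rewrite max_r ?sub0r ?opprK// oppr_ge0 ltW].
rewrite -(Jt_sum_integral hp) => [|k q _ _]; last by case: (ge k q).
rewrite -(Jt_sum_integral hm) => [|k q _ _]; last by case: (ge k q).
have mS h : (forall k, lsupp (z k) t (h k)) -> (forall k q, 0 <= h k q) ->
    measurable_fun [set: borel M] (lrestr t (fun q => \sum_k h k q) : borel M -> R).
  move=> hh h0; apply: measurable_lrestr => // q Eq rq; split; last by apply: sumr_ge0 => k _; exact: h0.
  by apply: continuous_sumf => k; have [] := hh k q Eq rq.
apply: ge0_le_integral => //.
- by move=> q _; rewrite lee_fin /lrestr; case: asboolP => // _; apply: sumr_ge0 => k _; case: (ge k q).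
- by apply/measurable_EFinP; apply: mS => // k q; case: (ge k q).
- by apply/measurable_EFinP; apply: mS => // k q; case: (ge k q).
- move=> q _; rewrite lee_fin /lrestr; case: asboolP => // -[Eq rq].
  by have := f0 q Eq rq; rewrite pm subr_ge0.
Qed.

End LevelIntegrals.

Lemma It_sum (R : realType) k (B : R) (I : Type) (s : seq I) (F : I -> 'rV[R]_k -> R) : 0 <= B ->
  (forall i, KB B (F i)) ->
  KB B (fun v => \sum_(i <- s) F i v) /\ It (fun v => \sum_(i <- s) F i v) = \sum_(i <- s) It (F i).
Proof.
move=> B0 hF; elim: s => [|a s [IH1 IH2]].
  have -> : (fun v => \sum_(i <- [::]) F i v) = (fun=> 0) by apply/funext => v; rewrite big_nil.
  by rewrite big_nil; split; [exact: KB0|exact: It0].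
have -> : (fun v => \sum_(i <- a :: s) F i v) = (fun v => F a v + \sum_(i <- s) F i v).
  by apply/funext => v; rewrite big_cons.
by rewrite big_cons -IH2; split; [exact: KBD|exact: (ItD B0)].
Qed.

Lemma Rint_pos (R : realType) (g1 : R -> R) (B s0 : R) : continuous g1 -> (forall s, g1 s != 0 -> `|s| <= B) ->
  (forall s, 0 <= g1 s) -> 0 < g1 s0 -> 0 < \int[lebesgue_measure]_(s in [set: R]) g1 s.
Proof.
move=> cg sg g0 gs; have [ig _] := integrable_KB cg sg.
have [c0 cc] : 0 < g1 s0 / 2 /\ g1 s0 / 2 < g1 s0 by split; lra.
have /nbhs_ballP[e e0 he] : \forall s \near s0, g1 s0 / 2 < g1 s.
  exact: near_comp_cont (@cg s0) (near_gt cc).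
have e0' : 0 < e := e0.
pose b := s0 + e / 2; have b0 : s0 < b by rewrite ltrDl divr_gt0.
have be : b - s0 < e by rewrite addrC addKr; lra.
have he' s : s \in `[s0, b] -> g1 s0 / 2 <= g1 s.
  rewrite in_itv/= => /andP[h1 h2]; apply/ltW/he; rewrite -ball_normE /ball_/= distrC ger0_norm ?subr_ge0//; lra.
have mg : measurable_fun [set: R] (EFin \o g1).
  by apply/measurable_EFinP; exact: continuous_measurable_fun.
rewrite /Rintegral fine_gt0//; apply/andP; split; last first.
  have /integrableP[_] := ig; apply: le_lt_trans; apply: ge0_le_integral => //.
  - by move=> s _; rewrite lee_fin.
  - exact: measurableT_comp.
  - by move=> s _; exact: lee_abs.
apply: (@lt_le_trans _ _ (\int[lebesgue_measure]_(s in `[s0, b]) (g1 s0 / 2)%:E)%E).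
  rewrite integral_cst//= lebesgue_measure_itv/= lte_fin b0.
  by rewrite -EFinB -EFinM lte_fin mulr_gt0// subr_gt0.
apply: (@le_trans _ _ (\int[lebesgue_measure]_(s in `[s0, b]) (g1 s)%:E)%E).
  apply: ge0_le_integral => //.
  - by move=> s _; rewrite lee_fin ltW.
  - by apply: measurable_funS mg.
apply: (@ge0_subset_integral _ _ _ lebesgue_measure `[s0, b]%classic [set: R] (measurable_itv _) measurableT (EFin \o g1)) => //.
by move=> s _; rewrite lee_fin.
Qed.

Lemma It_pos (R : realType) k (B : R) (h : 'rV[R]_k -> R) v0 : 0 <= B -> KB B h -> (forall v, 0 <= h v) ->
  0 < h v0 -> 0 < It h.
Proof.
move=> B0; elim: k => [|k IH] in h v0 * => Kh h0 hv; first by rewrite /= (thinmx0 v0) in hv *.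
rewrite (csP v0) in hv; have [cs1 cs2] := It_section B0 Kh.
change (0 < \int[lebesgue_measure]_(s in [set: R]) It (fun v => h (cs s v))).
apply: (@Rint_pos R (fun s => It (fun v => h (cs s v))) B ((v0 : 'rV[R]_(1 + k)) 0 (lshift k 0)) cs1 cs2).
  by move=> s; apply: (It_ge0 B0 (KB_cs s Kh)) => v.
exact: IH (KB_cs _ Kh) _ hv.
Qed.

Lemma near_rsub (R : realType) m (w : 'rV[R]_(1 + m)) (y : 'rV[R]_m) (e : R) :
  e < `|rsubmx w - y| -> \forall w' \near w, e < `|rsubmx w' - y|.
Proof.
move=> h; have c : {for w, continuous (fun w : 'rV[R]_(1 + m) => rsubmx w)}.
  apply: continuous_row => l; rewrite (_ : (fun _ => _) = (fun w : 'rV[R]_(1 + m) => w 0 (rshift 1 l))).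
    exact: continuous_coord.
  by apply/funext => v; rewrite mxE.
exact: near_comp_cont (@continuous_dist _ _ _ _ y _ c) (near_gt h).
Qed.

Lemma Cat_lap (R : realType) n (a : 'rV[R]_n -> 'M[R]_n) (f : 'rV[R]_n -> R) x :
  CatMx 1 a x -> posdef (a x) -> Cat 2 f x -> Cat 0 (lap a f) x.
Proof.
move=> Ca pa Cf; have d0 := posdef_det pa.
have Cs : Cat 1 (fun y => Num.sqrt (\det (a y))) x by apply: Cat_sqrt => //; exact: Cat_det.
apply: CatM.
  by apply: CatV; [rewrite gt_eqF// sqrtr_gt0|exact: CatW].
apply: Cat_sum => k; apply: Cat_partial.
exact: CatM Cs (Cat_cgrad Ca pa Cf 0 k).
Qed.

Lemma laplacian_continuous (R : realType) n (M : topologicalType) (X : manifold R n M) (g : metric X)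
  (f : M -> R) q : CM X 2 f q -> {for q, continuous (laplacian g f)}.
Proof.
move=> Cf; set i := chart_at X q; have di : dom i q := chart_atP X q.
have e : \forall q' \near q, lap (gmx g i) (f \o pt i) (crd i q') = laplacian g f q'.
  by apply: filterS2 (near_dom di) (CM_near Cf) => q' d' C'; rewrite (laplacian_chart g d' C').
apply: near_eq_continuous e _.
apply: (@continuous_comp _ _ _ (crd i) (lap (gmx g i) (f \o pt i))); first exact: crd_continuous.
exact: Cat_continuous (Cat_lap (gmx_Cat g 1 di) (gmx_posdef g di) (Cf i di)).
Qed.

(** * The derivative of the flux *)

Section Flux.
Context {R : realType} {m : nat} {M : ptopologicalType} {X : manifold R (1 + m) M} (g : metric X).
Context {U : set M} (D : radial_data g U) (cbd : compact (boundary U)) (sb : smooth_boundary g U).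
Context (r0 : R) (r0_gt0 : 0 < r0).
Implicit Types (p q : M) (w : 'rV[R]_(1 + m)).
Local Notation Ee q := (~ closure U q).
Local Notation Er q := (~ closure U q /\ r0 < rho D q).
Local Notation patch := (bpatch g U * 'rV[R]_m * R)%type.
Local Notation o0 := (lshift m 0).

Lemma near_above w : r0 < w 0 o0 -> \forall w' \near w, r0 < (w' : 'rV[R]_(1 + m)) 0 o0.
Proof. by move=> h; exact: near_comp_cont (@continuous_coord _ _ o0 w) (near_gt h). Qed.

Lemma near_bV (P : bpatch g U) w : r0 < w 0 o0 -> bV P (rsubmx w) ->
  \forall w' \near w, r0 < (w' : 'rV[R]_(1 + m)) 0 o0 /\ bV P (rsubmx (w' : 'rV[R]_(1 + m))).
Proof.
move=> h Vw; have Zw : Zs P w by split=> //; exact: lt_trans h.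
by apply: filterS2 (near_above h) (Zs_near Zw) => w' h' [_ V'].
Qed.

Lemma ip_one (h : M -> R) q : CM X 1 h q -> ip g (fun=> 1) h q = 0.
Proof.
move=> Ch; have C1 : CM X 1 (fun=> 1) q by exact: CM_cst.
have e : ip g (fun=> 1 * 1) h q = _ := ipMl g C1 C1 Ch.
by move: e; rewrite !mul1r => /eqP; rewrite -subr_eq0 opprD addrA subrr sub0r oppr_eq0 => /eqP.
Qed.

Lemma ip_sum (I : Type) (s : seq I) (F : I -> M -> R) (h : M -> R) q :
  (forall i, CM X 1 (F i) q) -> CM X 1 h q ->
  ip g (fun q => \sum_(i <- s) F i q) h q = \sum_(i <- s) ip g (F i) h q.
Proof.
move=> CF Ch; elim: s => [|a s IH].
  by rewrite big_nil; apply: ip_near0 => //; apply: near_all => q'; rewrite big_nil.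
have -> : (fun q => \sum_(i <- a :: s) F i q) = (fun q => F a q + \sum_(i <- s) F i q).
  by apply/funext => v; rewrite big_cons.
by rewrite big_cons -IH; exact: (ipDl g (CF a) (CM_sum _ _ CF) Ch).
Qed.

Section OneField.
Context (zz : patch) (gz : good_patch zz) (chi phi f : M -> R).
Context (Cchi : forall q, Ee q -> CM X 1 chi q) (schi : supported D zz chi).
Context (Cphi : forall q, Er q -> CM X 1 phi q) (Cf : forall q, Er q -> CM X 2 f q).
Local Notation P := (zz.1.1).

(** The polar components of chi phi grad f times the volume density, extended by 0: their coordinate
    divergence is the density times the Riemannian divergence [dYf] ([div_Fld]). *)
Definition Fld k w : R := if `[< bV P (rsubmx w) >] then
  sd P w * ((chi (Theta P w) * phi (Theta P w)) * cgrad (PG P) (fun w => f (Theta P w)) w 0 k) else 0.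

Definition dYf q := chi q * (ip g phi f q + phi q * laplacian g f q) + phi q * ip g chi f q.

Lemma ThE w : r0 < w 0 o0 -> bV P (rsubmx w) -> Zs P w /\ Er (Theta P w).
Proof.
move=> h Vw; have Zw : Zs P w by split=> //; exact: lt_trans h.
by split=> //; rewrite (rho_Theta D Zw); split=> //; exact: (Theta_E D Zw).
Qed.

Lemma Fld_zero k w : r0 < w 0 o0 -> zz.2 < `|rsubmx w - zz.1.2| -> Fld k w = 0.
Proof.
move=> h far; rewrite /Fld; case: asboolP => // Vw; have [Zw [Ew rw]] := ThE h Vw.
have [Y1 b1] := bYc_Theta D Zw; have [_ sz] := schi.
by rewrite (sz _ b1) ?Y1// !mul0r mulr0.
Qed.

Lemma Fld_near k w : r0 < w 0 o0 -> bV P (rsubmx w) -> \forall w' \near w,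
  sd P w' * ((chi (Theta P w') * phi (Theta P w')) * cgrad (PG P) (fun w => f (Theta P w)) w' 0 k) = Fld k w'.
Proof. by move=> h Vw; apply: filterS (near_bV h Vw) => w' [_ V']; rewrite /Fld asboolT. Qed.

Lemma Fld_near0 k w : r0 < w 0 o0 -> ~ bV P (rsubmx w) -> \forall w' \near w, 0 = Fld k w'.
Proof.
move=> h nV; have far : zz.2 < `|rsubmx w - zz.1.2|.
  by rewrite ltNge; apply/negP => le; apply: nV; have [_ zV] := gz; exact: zV.
by apply: filterS2 (near_above h) (near_rsub far) => w' h' far'; rewrite Fld_zero.
Qed.

Lemma Cchiphi w : r0 < w 0 o0 -> bV P (rsubmx w) ->
  Cat 1 (fun w => chi (Theta P w) * phi (Theta P w)) w.
Proof.
move=> h Vw; have [Zw Ew] := ThE h Vw; have S1 := Theta_SM D 1 Zw.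
by apply: CatM; [exact: SM_CM S1 (Cchi (proj1 Ew))|exact: SM_CM S1 (Cphi Ew)].
Qed.

Lemma CfTheta w : r0 < w 0 o0 -> bV P (rsubmx w) -> Cat 2 (fun w => f (Theta P w)) w.
Proof. by move=> h Vw; have [Zw Ew] := ThE h Vw; exact: SM_CM (Theta_SM D 2 Zw) (Cf Ew). Qed.

Lemma Fld_Cat k w : r0 < w 0 o0 -> Cat 1 (Fld k) w.
Proof.
move=> h; have [Vw|nV] := pselect (bV P (rsubmx w)); last first.
  exact: Cat_ext (Fld_near0 k h nV) (Cat_cst 1 0 w).
have [Zw Ew] := ThE h Vw.
apply: Cat_ext (Fld_near k h Vw) _.
have C3 : CatMx 1 (cgrad (PG P) (fun w => f (Theta P w))) w.
  by apply: Cat_cgrad; [exact: (PG_Cat D 1 Zw)|exact: (PG_posdef D Zw)|exact: CfTheta].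
exact: CatM (sd_Cat D 1 Zw) (CatM (Cchiphi h Vw) (C3 0 k)).
Qed.

Lemma Fld0 w : r0 < w 0 o0 ->
  Fld o0 w = pb P (fun q => chi q * (phi q * ip g (rho D) f q)) w.
Proof.
move=> h; rewrite /Fld /pb; case: asboolP => // Vw; have [Zw Ew] := ThE h Vw.
rewrite -(ipC g (CM_le (leqnSn 1) (Cf Ew)) (CM_rho D 1 (proj1 Ew))).
rewrite -(PG_gpair D Zw (CM_le (leqnSn 1) (Cf Ew)) (CM_rho D 1 (proj1 Ew))).
have pr k : partial k (fun w => rho D (Theta P w)) w = (o0 == k)%:R.
  rewrite -(partial_coord k o0 w); apply: near_partial.
  by apply: filterS (Zs_near Zw) => w' Zw'; rewrite (rho_Theta D Zw').
rewrite gpairE (bigD1 o0)//= big1 => [|k ko]; last by rewrite pr eq_sym (negbTE ko) mulr0.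
by rewrite pr eqxx mulr1 addr0 mulrC !mulrA.
Qed.

Lemma div_Fld w : r0 < w 0 o0 -> \sum_k partial k (Fld k) w = pb P dYf w.
Proof.
move=> h; rewrite /pb; case: asboolP => Vw; last first.
  rewrite big1// => k _; rewrite -(near_partial k (Fld_near0 k h Vw)); exact: partial_cst.
have [Zw Ew] := ThE h Vw.
have Cf1 : CM X 1 f (Theta P w) := CM_le (leqnSn 1) (Cf Ew).
have Cc : CM X 1 chi (Theta P w) := Cchi (proj1 Ew).
have Cp : CM X 1 phi (Theta P w) := Cphi Ew.
under eq_bigr => k _ do rewrite -(near_partial k (Fld_near k h Vw)).
have e1 := div_scaled (PG_Cat D 1 Zw) (PG_posdef D Zw) (CfTheta h Vw) (Cchiphi h Vw).
have e2 : gpair (PG P) (fun w => f (Theta P w)) (fun w => chi (Theta P w) * phi (Theta P w)) w =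
    ip g f (fun q => chi q * phi q) (Theta P w) := PG_gpair D Zw Cf1 (CMM Cc Cp).
have e3 := PG_lap D Zw (Cf Ew).
apply: (etrans e1); rewrite e2 e3 (ipC g Cf1 (CMM Cc Cp)) (ipMl g Cc Cp Cf1) /dYf /sd.
by move: (Num.sqrt _) (ip _ _ _ _) (ip _ _ _ _) (laplacian _ _ _) (chi _) (phi _) => *; ring.
Qed.

(** The radial component of the field is the integrand of the flux ([Fld0]). Its radial derivative
    may be completed to the full divergence, because tangential derivatives of a compactly supported
    function of y integrate to 0. *)
Lemma flux_derive t0 : r0 < t0 -> is_derive (t0 : R) 1
  (fun t => Jt zz t (fun q => chi q * (phi q * ip g (rho D) f q))) (Jt zz t0 dYf).
Proof.
move=> h0; have B0 := zB_ge0 gz.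
have csr0 t (v : 'rV[R]_m) : r0 < t -> r0 < cs t v 0 o0 by rewrite csl.
have sup k t (v : 'rV[R]_m) : r0 < t -> Fld k (cs t v) != 0 -> `|v - zz.1.2| <= zz.2.
  move=> ht; apply: contra_neqT; rewrite -ltNge => far.
  by apply: Fld_zero; [exact: csr0|rewrite rsub_cs].
have nt := near_gt h0.
have [||K0 dF] := @It_param_derive _ _ (zB zz) (Fld o0) t0 B0.
- by apply: filterS nt => t ht v; apply: Fld_Cat; exact: csr0.
- by apply: filterS nt => t ht v /(sup _ _ _ ht); exact: zB_le.
have e : \forall t \near t0, It (fun v => Fld o0 (cs t v)) =
    Jt zz t (fun q => chi q * (phi q * ip g (rho D) f q)).
  apply: filterS nt => t ht; rewrite /Jt; congr It; apply/funext => v.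
  by apply: Fld0; exact: csr0.
apply: is_derive_eq (is_derive_near e dF) _.
(* The tangential part of the divergence, which is added at no cost. *)
pose G (b : 'I_m) (v : 'rV[R]_m) := partial (rshift 1 b) (Fld (rshift 1 b)) (cs t0 v).
have CF k v : Cat 1 (fun y : 'rV[R]_m => Fld k (cs t0 y)) v.
  apply: (Cat_comp (f := Fld k) (F := fun y => cs t0 y)); first by apply: Fld_Cat; exact: csr0.
  move=> c; elim/split_ord1: c => [|c]; first by apply: eq_Cat (Cat_cst _ t0 v) => ?; rewrite csl.
  by apply: eq_Cat (Cat_coord _ c v) => ?; rewrite csr.
have GE b : G b = partial b (fun y => Fld (rshift 1 b) (cs t0 y)).
  apply/funext => v; rewrite /G (partial_cs (f := Fld (rshift 1 b)))//.
  by apply: (@Cat_differentiable _ _ 0); apply: Fld_Cat; exact: csr0.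
have sF k v : Fld k (cs t0 v) != 0 -> `|v| <= zB zz by move=> /(sup _ _ _ h0); exact: zB_le.
have KG b : KB (zB zz) (G b).
  rewrite GE; split=> [v|v]; first exact: Cat_continuous (Cat_partial b (CF _ v)).
  move=> hv; rewrite leNgt; apply/negP => lt; move: hv; apply/negP/negPn/eqP.
  exact: (zero_partial b (sF (rshift 1 b)) lt).
have [KS SE] := It_sum (index_enum 'I_m) B0 KG.
have -> : Jt zz t0 dYf = It (fun v => partial o0 (Fld o0) (cs t0 v) + \sum_b G b v).
  rewrite /Jt; congr It; apply/funext => v; rewrite -div_Fld; last exact: csr0.
  by rewrite big_split_ord big_ord1.
rewrite (ItD B0 K0 KS) SE big1 ?addr0// => b _; rewrite GE.
exact: It_partial B0 (CF _) (sF _).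
Qed.

Lemma lsupp_chi t h : (forall q, Ee q -> rho D q = t -> {for q, continuous h}) ->
  lsupp D zz t (fun q => chi q * h q).
Proof.
move=> ch q Eq rq; split; first by apply: for_mulr; [exact: CM_continuous (Cchi Eq)|exact: ch].
move=> n0; apply: contrapT => nb; have /nbhs_singleton c0 := supported_near0 schi Eq nb.
by move: n0; rewrite c0 mul0r eqxx.
Qed.

Lemma lsupp_dYf t : r0 < t -> lsupp D zz t dYf.
Proof.
move=> h0 q Eq rq; have Eq' : Er q by rewrite rq.
have Cf1 : CM X 1 f q := CM_le (leqnSn 1) (Cf Eq').
split.
  have cI1 := CM_continuous (CM_ip g (Cphi Eq') Cf1).
  have cI2 := CM_continuous (CM_ip g (Cchi Eq) Cf1).
  have cL := laplacian_continuous (g := g) (Cf Eq').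
  have cc := CM_continuous (Cchi Eq); have cp := CM_continuous (Cphi Eq').
  exact: (for_addr (for_mulr cc (for_addr cI1 (for_mulr cp cL))) (for_mulr cp cI2)).
move=> n0; apply: contrapT => nb; have c0 := supported_near0 schi Eq nb.
move: n0; rewrite /dYf (ip_near0 g c0 Cf1) (nbhs_singleton c0).
by rewrite mul0r mulr0 addr0 eqxx.
Qed.

End OneField.

Section TwoFields.
Context (dA : R -> {measure set (borel M) -> \bar R}).
Context (hdA : forall t : R, 0 < t -> area_measure g (level_set g U t) (dA t)).
Context (K : nat) (z : 'I_K -> patch) (gz : forall k, good_patch (z k)).
Context (cov : forall q, Ee q -> exists k, in_patch D (z k) q).
Local Notation ch k := (chi D z k).

Definition lcont t (h : M -> R) := forall q, Ee q -> rho D q = t -> {for q, continuous h}.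

(* The integral of h over the level hypersurface {rho = t}. *)
Definition SJ t (h : M -> R) := \sum_k Jt (z k) t (fun q => ch k q * h q).

Let lsc k t h : lcont t h -> lsupp D (z k) t (fun q => ch k q * h q).
Proof. by move=> chh; apply: lsupp_chi => //; [move=> q; exact: CM_chi|exact: chi_supported]. Qed.

Lemma SJ_ge0 t h : 0 < t -> lcont t h -> (forall q, Ee q -> rho D q = t -> 0 <= h q) -> 0 <= SJ t h.
Proof.
move=> t0 cth h0; apply: (Jt_sum_ge0 cbd sb t0 (hdA t0) gz) => [k|q Eq rq]; first exact: lsc.
by apply: sumr_ge0 => k _; rewrite mulr_ge0 ?chi_ge0 ?h0.
Qed.

Lemma SJD t f h : 0 < t -> lcont t f -> lcont t h ->
  SJ t (fun q => f q + h q) = SJ t f + SJ t h.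
Proof.
move=> t0 cf cth; rewrite /SJ -big_split; apply: eq_bigr => k _ /=.
rewrite -(JtD t0 (gz k) (lsc k cf) (lsc k cth)); congr (Jt _ _ _); apply/funext => q.
by rewrite mulrDr.
Qed.

Lemma SJZ t c h : 0 < t -> lcont t h -> SJ t (fun q => c * h q) = c * SJ t h.
Proof.
move=> t0 cth; rewrite /SJ mulr_sumr; apply: eq_bigr => k _ /=.
rewrite -(JtZ c t0 (gz k) (lsc k cth)); congr (Jt _ _ _); apply/funext => q.
by rewrite mulrCA.
Qed.

Lemma lcontD t f h : lcont t f -> lcont t h -> lcont t (fun q => f q + h q).
Proof. by move=> cf cth q Eq rq; apply: for_addr; [exact: cf|exact: cth]. Qed.

Lemma lcontZ t c h : lcont t h -> lcont t (fun q => c * h q).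
Proof. by move=> cth q Eq rq; apply: for_mulr; [exact: for_cst|exact: cth]. Qed.

Lemma SJ_le t f h : 0 < t -> lcont t f -> lcont t h ->
  (forall q, Ee q -> rho D q = t -> f q <= h q) -> SJ t f <= SJ t h.
Proof.
move=> t0 cf cth fh; have := SJ_ge0 t0 (lcontD cth (lcontZ (c := -1) cf)).
rewrite (SJD t0 cth (lcontZ (c := -1) cf)) (SJZ _ t0 cf) mulN1r subr_ge0; apply => q Eq rq.
by rewrite mulN1r subr_ge0 fh.
Qed.

Lemma SJ_integral t h : 0 < t -> lcont t h -> (forall q, Ee q -> rho D q = t -> 0 <= h q) ->
  (\int[dA t]_(q in [set: borel M]) (lrestr D t h q)%:E)%E = (SJ t h)%:E.
Proof.
move=> t0 cth h0; rewrite /SJ.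
rewrite -(Jt_sum_integral (D := D) cbd sb t0 (hdA t0) gz (f := fun k q => ch k q * h q)) => [|k|k q Eq rq].
- apply: eq_integral => q _; congr EFin; rewrite /lrestr; case: asboolP => // -[Eq rq].
  by rewrite -mulr_suml sum_chi ?mul1r.
- exact: lsc.
- by rewrite mulr_ge0 ?chi_ge0 ?h0.
Qed.

Lemma SJ_pos t h q0 : 0 < t -> lcont t h -> (forall q, Ee q -> rho D q = t -> 0 <= h q) ->
  Ee q0 -> rho D q0 = t -> 0 < h q0 -> 0 < SJ t h.
Proof.
move=> t0 cth h0 Eq rq hq; have [k0 pk] := cov Eq; have [bq _] := pk; have [Zw Tw] := bD_Theta bq.
have pos k y : 0 <= pb (z k).1.1 (fun q => ch k q * h q) (cs t y).
  rewrite /pb rsub_cs; case: asboolP => // Vy.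
  have [_ Ew rw _ _] := Theta_level D t0 Vy.
  by rewrite mulr_ge0 ?sqrtr_ge0// mulr_ge0 ?chi_ge0// h0.
have KBk k := KB_pb t0 (gz k) (lsc k cth).
have ge k : 0 <= Jt (z k) t (fun q => ch k q * h q).
  exact: (It_ge0 (zB_ge0 (gz k)) (KBk k) (pos k)).
rewrite /SJ (bigD1 k0)//= ltr_pwDl ?sumr_ge0//.
apply: (It_pos (v0 := bYc D (z k0).1.1 q0) (zB_ge0 (gz k0)) (KBk k0) (pos k0)).
rewrite -rq in t0 *; have [_ Vy] := Zw; rewrite pbE// Tw mulr_gt0//.
  by rewrite mulr_gt0// divr_gt0 ?bump_gt0// (sum_bump_gt0 cov).
by rewrite sqrtr_gt0; exact: posdef_det (PG_posdef D Zw).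
Qed.

Context (phi1 phi2 f1 f2 : M -> R).
Context (Cp1 : forall q, Er q -> CM X 1 phi1 q) (Cf1 : forall q, Er q -> CM X 2 f1 q).
Context (Cp2 : forall q, Er q -> CM X 1 phi2 q) (Cf2 : forall q, Er q -> CM X 2 f2 q).

Definition flux t := SJ t (fun q => phi1 q * ip g (rho D) f1 q) + SJ t (fun q => phi2 q * ip g (rho D) f2 q).

(** The functions chi add up to the constant 1 on a neighbourhood of q, whose gradient is 0. *)
Lemma sum_chi_ip (f : M -> R) q : Er q -> CM X 1 f q -> \sum_k ip g (ch k) f q = 0.
Proof.
move=> [Eq _] Cf; have Cc k : CM X 1 (ch k) q by exact: CM_chi.
rewrite -(ip_sum (index_enum 'I_K) Cc Cf); apply: etrans (ip_one Cf); apply: (ip_near _ _ _ Cf).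
  by apply: filterS (E_near Eq) => q' Eq'; rewrite sum_chi.
exact: CM_sum.
Qed.

Lemma SJ_derive (phi f : M -> R) t : r0 < t -> (forall q, Er q -> CM X 1 phi q) ->
  (forall q, Er q -> CM X 2 f q) ->
  is_derive t 1 (fun t => SJ t (fun q => phi q * ip g (rho D) f q))
    (\sum_k Jt (z k) t (dYf (ch k) phi f)).
Proof.
move=> ht Cp Cf; rewrite /SJ.
have -> : (fun t => \sum_k Jt (z k) t (fun q => ch k q * (phi q * ip g (rho D) f q))) =
    \sum_k (fun t => Jt (z k) t (fun q => ch k q * (phi q * ip g (rho D) f q))).
  by apply/funext => s; rewrite fct_sumE.
apply: is_derive_sum => k; apply: flux_derive => //; [move=> q; exact: CM_chi|exact: chi_supported].
Qed.

(** The derivatives of the partition of unity in [dYf] have no sign on a single patch but disappear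
    in the sum, by [sum_chi_ip]. The two fields are treated together because only the sum of their
    divergences is assumed nonnegative. *)
Lemma flux_mono s t : (forall q, Er q ->
    0 <= ip g phi1 f1 q + phi1 q * laplacian g f1 q + (ip g phi2 f2 q + phi2 q * laplacian g f2 q)) ->
  r0 < s -> s <= t -> flux s <= flux t.
Proof.
move=> h0 rs st.
have dF u : s <= u <= t -> is_derive u 1 flux
    (\sum_k Jt (z k) u (dYf (ch k) phi1 f1) + \sum_k Jt (z k) u (dYf (ch k) phi2 f2)).
  by move=> /andP[su _]; apply: is_deriveD; apply: SJ_derive => //; exact: lt_le_trans su.
have [c /andP[sc _] e] := mvt_seg st dF; rewrite -subr_ge0 e mulr_ge0 ?subr_ge0//.
have rc : r0 < c by exact: lt_le_trans sc.
have c0 : 0 < c by exact: lt_trans rc.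
have L (phi f : M -> R) k : (forall q, Er q -> CM X 1 phi q) -> (forall q, Er q -> CM X 2 f q) ->
    lsupp D (z k) c (dYf (ch k) phi f).
  by move=> Cp Cf; apply: lsupp_dYf => //; [move=> q; exact: CM_chi|exact: chi_supported].
rewrite -big_split /=; under eq_bigr => k _ do rewrite -(JtD c0 (gz k) (L _ _ k Cp1 Cf1) (L _ _ k Cp2 Cf2)).
apply: (Jt_sum_ge0 cbd sb c0 (hdA c0) gz (f := fun k q => dYf (ch k) phi1 f1 q + dYf (ch k) phi2 f2 q)).
  by move=> k; apply: lsuppD; exact: L.
move=> q Eq rq; have Eq' : Er q by rewrite rq.
have S (phi f : M -> R) : CM X 2 f q -> \sum_k dYf (ch k) phi f q = ip g phi f q + phi q * laplacian g f q.
  move=> Cf; rewrite big_split/= -mulr_suml sum_chi// mul1r -mulr_sumr.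
  by rewrite (sum_chi_ip Eq' (CM_le (leqnSn 1) Cf)) mulr0 addr0.
by rewrite big_split/= !S ?h0//; [exact: Cf2|exact: Cf1].
Qed.

End TwoFields.
End Flux.

(** * Weights *)

Section Weight.
Context {R : realType}.
Implicit Types (t s k : R).

Lemma der_mul (f h : R -> R) t (df dh : R) : is_derive t 1 f df -> is_derive t 1 h dh ->
  is_derive t 1 (fun t => f t * h t) (f t * dh + h t * df).
Proof. by move=> Hf Hh; exact: (is_deriveM Hf Hh). Qed.

Lemma der_scale (c : R) (f : R -> R) t (df : R) : is_derive t 1 f df ->
  is_derive t 1 (fun t => c * f t) (c * df).
Proof. by move=> Hf; exact: (is_deriveZ c Hf). Qed.

Lemma der_add (f h : R -> R) t (df dh : R) : is_derive t 1 f df -> is_derive t 1 h dh ->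
  is_derive t 1 (fun t => f t + h t) (df + dh).
Proof. by move=> Hf Hh; exact: (is_deriveD Hf Hh). Qed.

Lemma der_pow (f : R -> R) t (df : R) n : is_derive t 1 f df ->
  is_derive t 1 (fun t => f t ^+ n.+1) (n.+1%:R * f t ^+ n * df).
Proof.
move=> Hf; elim: n => [|n IH]; first by apply: is_derive_eq Hf _; rewrite expr0 mulr1 mul1r.
have -> : (fun t => f t ^+ n.+2) = (fun t => f t * f t ^+ n.+1) by apply/funext => u; rewrite exprS.
by apply: is_derive_eq (der_mul Hf IH) _; rewrite exprS -[n.+2%:R]natr1; ring.
Qed.

Lemma der_inv (f : R -> R) t (df : R) : f t != 0 -> is_derive t 1 f df ->
  is_derive t 1 (fun t => (f t)^-1) (- ((f t)^-1 ^+ 2 * df)).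
Proof.
move=> f0 Hf; apply: is_derive_eq (is_deriveV f0 Hf) _.
by rewrite /GRing.scale/= mulNr -exprVn.
Qed.

Lemma der_comp (f h : R -> R) t (df dh : R) : is_derive (h t) 1 f df -> is_derive t 1 h dh ->
  is_derive t 1 (fun t => f (h t)) (df * dh).
Proof. by move=> Hf Hh; exact: (is_derive1_comp Hf Hh). Qed.

Lemma bernoulli_le n (x : R) : 0 <= x -> 1 + n%:R * x <= (1 + x) ^+ n.
Proof.
move=> x0; elim: n => [|n IH]; first by rewrite mul0r addr0 expr0.
rewrite exprS; apply: le_trans (ler_wpM2l (addr_ge0 ler01 x0) IH).
have h : 0 <= n%:R * (x * x) by rewrite !mulr_ge0.
by rewrite -natr1; lra.
Qed.

(* With z = (t/T)^s and s = 1/N, the weight phi = k t (1 + s z)^(-N) is bounded, its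
   derivative p = k (1 + s z)^(-N-1) is at least a fixed fraction of k on (0, T], and
   t p' is of order k s. *)
Section Formula.
Context (T k : R) (n : nat) (T0 : 0 < T) (k0 : 0 < k).
Let s : R := (n.+1%:R)^-1.
Let z t : R := expR (s * (ln t - ln T)).
Let q t : R := (1 + s * z t)^-1.
Let es : n.+1%:R * s = 1. Proof. by rewrite mulfV. Qed.
Let s0 : 0 < s. Proof. by rewrite invr_gt0. Qed.

Definition wphi t := k * (t * q t ^+ n.+1).
Definition wp t := k * q t ^+ n.+2.
Definition wdp t := - (k * (n.+2%:R * q t ^+ n.+3 * (s ^+ 2 * z t / t))).

Let z0 t : 0 < z t. Proof. exact: expR_gt0. Qed.
Let sz0 t : 0 < 1 + s * z t. Proof. by rewrite addr_gt0// mulr_gt0. Qed.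
Let q0 t : 0 < q t. Proof. by rewrite invr_gt0. Qed.
Let q1 t : q t <= 1. Proof. by rewrite invf_le1// lerDl ltW// mulr_gt0. Qed.

Let dz t : 0 < t -> is_derive t 1 z (z t * (s / t)).
Proof.
move=> t0; have dl := der_add (@is_derive1_ln R t t0) (is_derive_cst (- ln T) t 1).
apply: is_derive_eq (der_comp (is_derive_expR _) (der_scale s dl)) _.
by rewrite addr0.
Qed.

Let dq t : 0 < t -> is_derive t 1 q (- (q t ^+ 2 * (s * (z t * (s / t))))).
Proof.
move=> t0; have h := der_add (is_derive_cst (1 : R) t 1) (der_scale s (dz t0)).
by apply: is_derive_eq (der_inv _ h) _; rewrite ?gt_eqF// add0r.
Qed.

Let dqX m t : 0 < t -> is_derive t 1 (fun t => q t ^+ m.+1)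
  (- (m.+1%:R * q t ^+ m.+2 * (s * (z t * (s / t))))).
Proof.
move=> t0; apply: is_derive_eq (der_pow m (dq t0)) _.
by rewrite -[m.+2]addn2 exprD; ring.
Qed.

Lemma wphi_derive t : 0 < t -> is_derive t 1 wphi (wp t).
Proof.
move=> t0; apply: is_derive_eq (der_scale k (der_mul (is_derive_id t (1 : R)) (dqX n t0))) _.
rewrite /wp mulr1.
have e : q t * (1 + s * z t) = 1 by rewrite mulVf// gt_eqF.
have et : t / t = 1 by rewrite mulfV// gt_eqF.
transitivity (k * (q t ^+ n.+1 * 1 - (n.+1%:R * s) * (t / t) * q t ^+ n.+2 * (s * z t))); first by ring.
have -> : q t ^+ n.+1 = q t ^+ n.+2 * (1 + s * z t) by rewrite [q t ^+ n.+2]exprSr -mulrA e mulr1.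
by rewrite es et; ring.
Qed.

Lemma wp_derive t : 0 < t -> is_derive t 1 wp (wdp t).
Proof.
move=> t0; apply: is_derive_eq (der_scale k (dqX n.+1 t0)) _.
by rewrite /wdp; ring.
Qed.

Lemma wdp_continuous t : 0 < t -> {for t, continuous wdp}.
Proof.
move=> t0; have cz := is_derive_continuous (dz t0); have cq := is_derive_continuous (dqX n.+2 t0).
have cV : {for t, continuous (fun t : R => t^-1)} by apply: cvgV; [rewrite gt_eqF|exact: for_id].
apply: cvgN; apply: cvgM; first exact: for_cst.
apply: cvgM; first by apply: cvgM; [exact: for_cst|exact: cq].
by apply: cvgM; [apply: cvgM; [exact: for_cst|exact: cz]|exact: cV].
Qed.

Lemma wp_ge0 t : 0 <= wp t.
Proof. by rewrite mulr_ge0 ?exprn_ge0 ?ltW. Qed.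

Lemma wp_le t : wp t <= k.
Proof. by rewrite ler_piMr ?(ltW k0)// exprn_ile1// ltW. Qed.

Let zX t : 0 < t -> z t ^+ n.+1 = t / T.
Proof.
by move=> t0; rewrite -expRM_natl mulrA es mul1r expRD expRN !lnK ?posrE.
Qed.

(** With N = n + 1, (1 + s z)^N is at least (s z)^N = N^(-N) t / T, so the factor t is absorbed. *)
Lemma wphi_le t : 0 < t -> wphi t <= k * (T * n.+1%:R ^+ n.+1).
Proof.
move=> t0; rewrite ler_pM2l//.
have h : (s * z t) ^+ n.+1 <= (1 + s * z t) ^+ n.+1.
  by rewrite lerXn2r// ?nnegrE ?mulr_ge0 ?ltW// ltrDr.
rewrite exprVn ler_pdivrMr ?exprn_gt0//; apply: le_trans (ler_wpM2l _ h); last first.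
  by rewrite mulr_ge0 ?exprn_ge0 ?ltW.
have eX : n.+1%:R ^+ n.+1 * s ^+ n.+1 = 1 by rewrite -exprMn es expr1n.
have -> : T * n.+1%:R ^+ n.+1 * (s * z t) ^+ n.+1 = (n.+1%:R ^+ n.+1 * s ^+ n.+1) * (T * (t / T)).
  by rewrite exprMn zX//; ring.
by rewrite eX mul1r mulrCA mulfV ?gt_eqF// mulr1.
Qed.

Lemma wdp_le0 t : 0 < t -> wdp t <= 0.
Proof.
move=> t0; rewrite oppr_le0; apply: mulr_ge0; first exact: ltW.
apply: mulr_ge0; first by apply: mulr_ge0 => //; exact: exprn_ge0 (ltW (q0 t)).
by apply: divr_ge0; [apply: mulr_ge0; [exact: sqr_ge0|exact: ltW]|exact: ltW].
Qed.

(** Here (n+2) s <= 2, and Bernoulli's inequality gives (1 + s z)^(n+1) >= 1 + z, so the powers of q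
    absorb z. One factor s = 1/(n+1) survives and makes the bound small. *)
Lemma wdp_ge t : 0 < t -> - (2 * k / n.+1%:R) <= t * wdp t.
Proof.
move=> t0; rewrite mulrN lerN2.
have -> : t * (k * (n.+2%:R * q t ^+ n.+3 * (s ^+ 2 * z t / t))) =
    k * (n.+2%:R * s * s) * (q t ^+ 2 * (q t ^+ n.+1 * z t)) * (t / t).
  by rewrite -[n.+3]/((2 + n.+1)%N) exprD; ring.
rewrite mulfV ?gt_eqF// mulr1 -/s.
have h1 : n.+2%:R * s <= 2.
  by rewrite ler_pdivrMr// -natrM ler_nat mul2n -addnn addSn addnS ltnS leq_addr.
have h2 : q t ^+ n.+1 * z t <= 1.
  rewrite exprVn mulrC ler_pdivrMr ?exprn_gt0// mul1r.
  apply: le_trans (bernoulli_le _ (ltW (mulr_gt0 s0 (z0 t)))).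
  by rewrite mulrA es mul1r lerDr.
have h3 : q t ^+ 2 * (q t ^+ n.+1 * z t) <= 1.
  apply: mulr_ile1 => //; first exact: sqr_ge0.
    by apply: mulr_ge0; [exact: exprn_ge0 (ltW (q0 t))|exact: ltW].
  by apply: exprn_ile1 => //; exact: ltW.
apply: (@le_trans _ _ (k * (n.+2%:R * s * s) * 1)).
  by rewrite ler_wpM2l// !mulr_ge0// ltW.
have := ler_wpM2l (ltW (mulr_gt0 k0 s0)) h1; rewrite mulr1.
by move: (n.+2%:R) s => N S; lra.
Qed.

(** Up to T one has z <= 1, so (1 + s z)^(n+2) <= exp((n+2)/(n+1)) <= exp 2, uniformly in n. *)
Lemma wp_ge t : 0 < t -> t <= T -> k / expR 2 <= wp t.
Proof.
move=> t0 tT; have z1 : z t <= 1.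
  rewrite -expR0 ler_expR mulr_ge0_le0 ?(ltW s0)// subr_le0 ler_ln//.
rewrite ler_pM2l// exprVn lef_pV2 ?posrE ?expR_gt0 ?exprn_gt0//.
have h : 1 + s * z t <= expR s.
  by apply: le_trans (expR_ge1Dx s); rewrite lerD2l ler_piMr// ltW.
apply: (@le_trans _ _ (expR s ^+ n.+2)); first by rewrite lerXn2r// ?nnegrE ?ltW ?expR_gt0.
rewrite -expRM_natl ler_expR ler_pdivrMr// -natrM ler_nat mul2n -addnn addSn addnS ltnS leq_addr//.
Qed.

End Formula.

(** The conditions are those of [weighted_form_ge0]. From T on the discriminant condition holds for
    every p >= 0, since D1 / t is small and t is large compared with Q^2. Before T it holds because
    p >= K1 lets the cubic term 8 e1 r0 p^3 dominate. The order of choices matters: T and eta, then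
    k, and finally n, which makes the decay of p slow enough for that k. *)
Lemma weight_exists (r0 t0 lam c e1 e2 Q al K : R) :
  0 < r0 -> 0 < t0 -> 0 < lam -> 0 <= c -> 0 < e1 -> 0 < e2 -> 0 <= Q ->
  exists (phi p dp : R -> R) (Phi k eta : R),
  (forall t, 0 < t ->
    [/\ is_derive t 1 phi (p t), is_derive t 1 p (dp t) & {for t, continuous dp}] /\
    [/\ phi t <= Phi, 0 <= p t, p t <= k & (t <= t0 -> K <= p t)]) /\
  forall t, r0 < t ->
    [/\ - eta <= t * dp t, dp t <= 0 & 0 <= eta] /\
    [/\ 2 * p t * eta <= e1 / 4 * (lam + p t ^+ 2), c * eta <= t * (e1 / 4 * lam) &
      (2 * eta + 2 * p t * Q + c * `|al - 1| / t) ^+ 2 <=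
        2 * (e2 + 4 * t * p t) * (e1 * (lam + p t ^+ 2))].
Proof.
move=> r00 t00 lam0 c0 e10 e20 Q0.
pose S := Num.sqrt lam; have S0 : 0 < S by rewrite sqrtr_gt0.
have SS : S ^+ 2 = lam by rewrite sqr_sqrtr// ltW.
(* Chosen so that for x <= 2 d the term 2 x^2 is covered by 2 e1 e2 lam, the part of the right-hand
   side free of t and p. *)
pose d := Num.sqrt (e1 * e2 * lam) / 2.
have d0 : 0 < d by rewrite divr_gt0// sqrtr_gt0 !mulr_gt0.
have dd : 4 * d ^+ 2 = e1 * e2 * lam.
  by rewrite /d expr_div_n sqr_sqrtr ?ltW ?mulr_gt0//; field.
pose D1 := c * `|al - 1|; have D10 : 0 <= D1 by rewrite mulr_ge0.
(* Beyond T both D1 / t <= d and Q^2 <= e1 S t hold; T >= t0 puts (0, t0] in the range where p is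
   large. *)
pose T := Num.max t0 (Num.max (D1 / d) (Q ^+ 2 / (e1 * S))).
have T0 : 0 < T by rewrite lt_max t00.
(* One entry for each of the three conditions on eta: the discriminant, the bound on 2 p eta by way
   of 2 S p <= lam + p^2, and the bound on c eta at radii t >= r0. *)
pose eta := Num.min (d / 2) (Num.min (e1 * S / 4) (r0 * e1 * lam / (4 * (c + 1)))).
have c1 : 0 < c + 1 by rewrite ltr_wpDl.
have a1 : 0 < d / 2 by rewrite divr_gt0.
have a2 : 0 < e1 * S / 4 by rewrite divr_gt0// mulr_gt0.
have a3 : 0 < r0 * e1 * lam / (4 * (c + 1)) by rewrite divr_gt0// !mulr_gt0.
have eta0 : 0 < eta by rewrite !lt_min a1 a2 a3.
have eta1 : 2 * eta <= d by rewrite mulrC -ler_pdivlMr// ge_min lexx.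
have eta2 : eta <= e1 * S / 4 by rewrite !ge_min lexx orbT.
have eta3 : eta <= r0 * e1 * lam / (4 * (c + 1)) by rewrite !ge_min lexx !orbT.
(* A bound for the left-hand side before T, after division by p^2 >= 1; K1 is then taken so large
   that V <= 8 r0 e1 p. *)
pose V := 2 * (2 * eta + D1 / r0) ^+ 2 + 8 * Q ^+ 2.
pose K1 := Num.max K (Num.max 1 (V / (8 * r0 * e1))).
have K10 : 0 < K1 by rewrite !lt_max ltr01 orbT.
pose k := K1 * expR 2; have k0 : 0 < k by rewrite mulr_gt0 ?expR_gt0.
(* Large enough for the bound 2 k / (n+1) of [wdp_ge] to be at most eta. *)
pose n := Num.truncn (2 * k / eta).
have n1 : 2 * k / n.+1%:R <= eta.
  by rewrite ler_pdivrMr// -ler_pdivrMl// [eta^-1 * _]mulrC; exact: ltW (truncnS_gt _).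
exists (wphi T k n), (wp T k n), (wdp T k n), (k * (T * n.+1%:R ^+ n.+1)), k, eta.
have pK t : 0 < t -> t <= T -> K1 <= wp T k n t.
  by move=> t1 tT; have := wp_ge n T0 k0 t1 tT; rewrite /k mulfK// gt_eqF ?expR_gt0.
split=> [t t1|t rt].
  split; split; [exact: wphi_derive|exact: wp_derive|exact: wdp_continuous|exact: wphi_le|
    exact: wp_ge0|exact: wp_le|].
  move=> tt0; apply: le_trans (pK _ t1 _); first by rewrite le_max lexx.
  by rewrite le_max tt0.
have t1 : 0 < t := lt_trans r00 rt.
split; split.
- by apply: le_trans (wdp_ge T n k0 t1); rewrite lerN2.
- exact: wdp_le0.
- exact: ltW.
- have p0 := wp_ge0 T n k0 t; move: (wp _ _ _ _) p0 => P P0.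
  have h : P * eta <= P * (e1 * S / 4) by rewrite ler_wpM2l.
  have h2 : 0 <= e1 * (S - P) ^+ 2 by apply: mulr_ge0; [exact: ltW|exact: sqr_ge0].
  by rewrite -SS; lra.
- apply: (@le_trans _ _ (r0 * (e1 / 4 * lam))); last by rewrite ler_wpM2r// ?(ltW rt)// ltW// mulr_gt0// divr_gt0.
  have h : c * eta <= c * (r0 * e1 * lam / (4 * (c + 1))) by rewrite ler_wpM2l.
  apply: (le_trans h); have -> : c * (r0 * e1 * lam / (4 * (c + 1))) = (c / (c + 1)) * (r0 * (e1 / 4 * lam)).
    by field; rewrite gt_eqF.
  rewrite ler_piMl//; first by rewrite ltW// !mulr_gt0// divr_gt0.
  by rewrite ler_pdivrMr// mul1r lerDl.
- have p0 := wp_ge0 T n k0 t; have pt := pK t t1; rewrite -/D1.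
  move: (wp _ _ _ _) p0 pt => P P0 pt.
  set x := 2 * eta + D1 / t; have x0 : 0 <= x by apply: addr_ge0; [apply: mulr_ge0 => //; exact: ltW|apply: divr_ge0 => //; exact: ltW].
  have sq : (2 * eta + 2 * P * Q + D1 / t) ^+ 2 <= 2 * x ^+ 2 + 8 * (P ^+ 2 * Q ^+ 2).
    have -> : 2 * eta + 2 * P * Q + D1 / t = x + 2 * P * Q by rewrite /x; ring.
    by have := sqr_ge0 (x - 2 * P * Q); nra.
  apply: (le_trans sq).
  have -> : 2 * (e2 + 4 * t * P) * (e1 * (lam + P ^+ 2)) =
     2 * (e1 * e2 * lam) + 2 * (e1 * e2 * P ^+ 2) + 8 * (e1 * t * (P * (lam + P ^+ 2))) by ring.
  have g0 : 0 <= e1 * e2 by exact: ltW (mulr_gt0 e10 e20).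
  have g3 : 0 <= e1 * t by exact: ltW (mulr_gt0 e10 t1).
  have g1 : 0 <= e1 * e2 * P ^+ 2 by apply: mulr_ge0 => //; exact: sqr_ge0.
  have g2 : 0 <= e1 * e2 * lam by apply: mulr_ge0 => //; exact: ltW.
  have [Tt|tT] := leP T t.
    have x1 : x <= 2 * d.
      suff : D1 / t <= d by rewrite /x; lra.
      rewrite ler_pdivrMr// mulrC -ler_pdivrMr//; apply: le_trans Tt.
      by rewrite !le_max lexx !orbT.
    have x2 : x ^+ 2 <= e1 * e2 * lam.
      rewrite -dd (_ : 4 * d ^+ 2 = (2 * d) ^+ 2); last by ring.
      by rewrite ler_pXn2r// nnegrE; apply: mulr_ge0 => //; exact: ltW.
    have hQ : Q ^+ 2 <= e1 * t * (2 * S).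
      have : Q ^+ 2 / (e1 * S) <= t by apply: le_trans Tt; rewrite !le_max lexx !orbT.
      rewrite ler_pdivrMr ?mulr_gt0// => h; have : 0 <= t * (e1 * S) by exact: ltW (mulr_gt0 t1 (mulr_gt0 e10 S0)).
      by lra.
    have hP : P ^+ 2 * Q ^+ 2 <= e1 * t * (P * (lam + P ^+ 2)).
      have h1 : P ^+ 2 * Q ^+ 2 <= P ^+ 2 * (e1 * t * (2 * S)) by rewrite ler_wpM2l ?sqr_ge0.
      apply: (le_trans h1); rewrite mulrCA; apply: ler_wpM2l => //.
      have h3 : 0 <= P * (S - P) ^+ 2 by apply: mulr_ge0 => //; exact: sqr_ge0.
      by rewrite -SS; lra.
    by lra.
  have {}pt := pt (ltW tT).
  have P1 : 1 <= P by apply: le_trans pt; rewrite !le_max lexx orbT.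
  have x1 : x <= 2 * eta + D1 / r0.
    by rewrite lerD2l; apply: ler_wpM2l => //; rewrite lef_pV2 ?posrE//; exact: ltW.
  have hV : 2 * x ^+ 2 + 8 * Q ^+ 2 <= V.
    by rewrite lerD2r ler_wpM2l// ler_pXn2r// nnegrE (le_trans x0).
  have hK : V <= 8 * r0 * e1 * P.
    rewrite mulrC -ler_pdivrMr ?mulr_gt0//; apply: le_trans pt.
    by rewrite !le_max lexx !orbT.
  have P2 : 1 <= P ^+ 2 by rewrite expr_ge1.
  have h1 : 2 * x ^+ 2 <= 2 * x ^+ 2 * P ^+ 2 by rewrite ler_peMr// mulr_ge0// sqr_ge0.
  have h2 : (2 * x ^+ 2 + 8 * Q ^+ 2) * P ^+ 2 <= 8 * r0 * e1 * P * P ^+ 2.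
    by rewrite ler_wpM2r ?sqr_ge0// (le_trans hV).
  have h3 : r0 * (e1 * P * P ^+ 2) <= t * (e1 * P * P ^+ 2).
    by apply: ler_wpM2r; [apply: mulr_ge0; [apply: mulr_ge0 => //; exact: ltW|exact: sqr_ge0]|exact: ltW].
  have h4 : 0 <= e1 * t * (P * lam) by apply: mulr_ge0 => //; apply: mulr_ge0 => //; exact: ltW.
  have -> : e1 * t * (P * (lam + P ^+ 2)) = e1 * t * (P * lam) + t * (e1 * P * P ^+ 2) by ring.
  by lra.
Qed.

End Weight.

(** * Monotonicity of the flux *)

Lemma near_chess (R : realType) n (a : 'rV[R]_n -> 'M[R]_n) (f f' : 'rV[R]_n -> R) x :
  (\forall y \near x, f y = f' y) -> chess a f x = chess a f' x.
Proof.
move=> n0; rewrite /chess; have -> : dsec f x = dsec f' x.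
  by apply/matrixP => k l; rewrite [LHS]mxE [RHS]mxE; apply: near_partial; exact: near_eq_partial.
by rewrite /cgrad (near_dvec n0).
Qed.

Lemma eqP_le (R : realType) (x y : R) : x = y -> x <= y.
Proof. by move=> ->. Qed.

Lemma mx_subZ (R : realType) (A B : 'M[R]_1) (k : R) : (A - k *: B) 0 0 = A 0 0 - k * B 0 0.
Proof. by rewrite !mxE. Qed.

(** * Consequences of the Hessian bounds at a point *)

Section Pointwise.
Context {R : realType} {m : nat} {M : ptopologicalType} {X : manifold R (1 + m) M} (g : metric X).
Implicit Types (p q : M) (f : M -> R) (v w : 'rV[R]_(1 + m)).

Lemma hessian_near f f' q v w : (\forall q' \near q, f q' = f' q') ->
  hessian g f q v w = hessian g f' q v w.
Proof.
move=> n0; have di := chart_atP X q; rewrite /hessian /ev (hessian_mxE g f di) (hessian_mxE g f' di).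
by rewrite (near_chess _ (near_pt di n0)).
Qed.

Lemma grad_near f f' q : (\forall q' \near q, f q' = f' q') -> grad g f q = grad g f' q.
Proof.
move=> n0; rewrite /grad /local_grad; set i := chart_at X q; congr (_ *m _).
apply/rowP => k; rewrite !mxE; apply: near_partial.
exact: near_pt (chart_atP X q) n0.
Qed.

Lemma laplacian_bound (e k : R) f q : CM X 2 f q -> ip g f f q = 1 ->
  (forall v, 0 <= e * (hessian g f q v v - k * (inner g q v v - inner g q (grad g f q) v ^+ 2))) ->
  0 <= e * (laplacian g f q - k * m%:R).
Proof.
move=> Cf f1 hv; have di := chart_atP X q; set i := chart_at X q in di.
have pG := gmx_posdef g di; have [sG _] := pG.
rewrite (laplacian_trace g Cf) -/i; move: f1 hv; rewrite /ip /hessian /inner /ev -/i.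
move: (hessian_mx g i f _) (grad g f q) => H d; move: (gmx g i _) pG sG => G pG sG f1 hv.
pose S := e *: (H - k *: (G - (d *m G)^T *m (d *m G))).
have : 0 <= \tr (invmx G *m S).
  apply: trace_posdef_ge0 => // v; rewrite -scalemxAr -scalemxAl mxE.
  have -> : (v *m (H - k *: (G - (d *m G)^T *m (d *m G))) *m v^T) 0 0 =
      (v *m H *m v^T) 0 0 - k * ((v *m G *m v^T) 0 0 - (d *m G *m v^T) 0 0 ^+ 2); last exact: hv.
    have -> : v *m (H - k *: (G - (d *m G)^T *m (d *m G))) *m v^T =
        v *m H *m v^T - k *: (v *m G *m v^T - 1 *: ((v *m (d *m G)^T) *m (d *m G *m v^T))).
      by rewrite scale1r !(mulmxBr, mulmxBl) -scalemxAr -scalemxAl !(mulmxBr, mulmxBl) !mulmxA.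
    rewrite !mx_subZ mul1r; congr (_ - k * (_ - _)).
    rewrite -[v in v *m (d *m G)^T]trmxK -trmx_mul; move: (d *m G *m v^T) => Z.
    by rewrite mxE big_ord1 mxE expr2.
have -> : \tr (invmx G *m S) = e * (\tr (invmx G *m H) - k * m%:R); last by [].
rewrite /S -scalemxAr mxtraceZ mulmxBr linearB/= -scalemxAr mxtraceZ mulmxBr linearB/=.
rewrite mulVmx ?posdef_unit// mxtrace1 trmx_mul sG !mulmxA mulVmx ?posdef_unit// mul1mx.
have -> : \tr (d^T *m d *m G) = 1 by rewrite -mulmxA mxtrace_mulC -f1 /mxtrace big_ord1.
by rewrite natrD addrAC subrr add0r.
Qed.

Lemma ipZl (c : R) (f h : M -> R) q : CM X 1 f q -> CM X 1 h q ->
  ip g (fun q => c * f q) h q = c * ip g f h q.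
Proof.
move=> Cf Ch; have Cc : CM X 1 (fun q => c * f q) q := CMM (fun i di => Cat_cst 1 c (crd i q)) Cf.
rewrite (ip_lin g (c1 := c) (c2 := 0) Cc Cf Cf Ch) ?mul0r ?addr0// => i k di.
by rewrite mul0r addr0; apply: partialZ; exact: Cat_differentiable (Cf i di).
Qed.

(** The gradient of f + c h has nonnegative square norm, where the constant c is the value at q that
    makes it orthogonal to grad h there. *)
Lemma ip_cauchy f h q : CM X 1 f q -> CM X 1 h q -> ip g h h q = 1 ->
  ip g h f q ^+ 2 <= ip g f f q.
Proof.
move=> Cf Ch h1; pose c := - ip g h f q.
have Cc : CM X 1 (fun=> c) q by exact: CM_cst.
have Cch : CM X 1 (fun q => c * h q) q := CMM Cc Ch.
have CF : CM X 1 (fun q => f q + c * h q) q := CMD Cf Cch.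
have ipc (k : M -> R) : CM X 1 k q -> ip g (fun q => c * h q) k q = c * ip g h k q.
  by move=> Ck; exact: ipZl.
have := ip_ge0 g CF; rewrite (ipDl g Cf Cch CF) (ipc _ CF) (ipC g Cf CF) (ipC g Ch CF).
rewrite (ipDl g Cf Cch Cf) (ipDl g Cf Cch Ch) (ipc _ Cf) (ipc _ Ch) h1 (ipC g Cf Ch) /c.
by move: (ip g h f q) (ip g f f q) => x y; nra.
Qed.

End Pointwise.

(** * The weighted field and the vanishing of u *)

Section Core.
Context {R : realType} {m : nat} {M : ptopologicalType} {X : manifold R (1 + m) M} (g : metric X).
Context {U : set M} (D : radial_data g U) (cbd : compact (boundary U)) (sb : smooth_boundary g U).
Context (r0 : R) (r0_gt0 : 0 < r0).
Implicit Types (q : M).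
Local Notation Ee q := (~ closure U q).
Local Notation Er q := (~ closure U q /\ r0 < rho D q).
Local Notation N := (m%:R : R).

Lemma rho_comp (F dF : R -> R) q : (forall t : R, 0 < t -> is_derive t 1 F (dF t)) ->
  (forall t : R, 0 < t -> {for t, continuous dF}) -> Ee q ->
  CM X 1 (fun q => F (rho D q)) q /\ forall h, CM X 1 h q ->
    ip g (fun q => F (rho D q)) h q = dF (rho D q) * ip g (rho D) h q.
Proof.
move=> HF HdF Eq; have r1 := rho_gt0 D Eq; have Cr := CM_rho D 1 Eq.
have DE (t : R) : 0 < t -> 'D_1 F t = dF t by move=> t0; have [_ ->] := HF t t0.
have C : CM X 1 (fun q => F (rho D q)) q.
  apply: CM_comp1 => //; first by apply: filterS (near_gt r1) => t t0; have [] := HF t t0.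
  apply: filterS (near_gt r1) => t t0.
  apply: (@near_eq_continuous _ _ dF _ t); last exact: HdF.
  by apply: filterS (near_gt t0) => s s0; rewrite DE.
split=> // h Ch; rewrite (ip_comp1 g Cr Ch C) ?DE//; by have [] := HF _ r1.
Qed.

Section Multipliers.
Context (phi p dp : R -> R) (gam c lam : R).
Context (Hphi : forall t : R, 0 < t -> is_derive t 1 phi (p t)).
Context (Hp : forall t : R, 0 < t -> is_derive t 1 p (dp t)).
Context (Hdp : forall t : R, 0 < t -> {for t, continuous dp}).

(** A single exponential, kept in front of all weights and of their derivatives so that the
    positivity of the divergence reduces to that of the remaining factor. *)
Definition wA (t : R) := expR (2 * phi t + gam * ln t).
Definition wB (t : R) := wA t * (2 * p t + c / t).
Definition wC (t : R) := wA t * (lam + 2 * p t ^+ 2 + c * p t / t).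
Definition dwA (t : R) := wA t * (2 * p t + gam / t).
Definition dwB (t : R) := wA t * ((2 * p t + gam / t) * (2 * p t + c / t) + (2 * dp t - c / t ^+ 2)).
Definition dwC (t : R) := wA t * ((2 * p t + gam / t) * (lam + 2 * p t ^+ 2 + c * p t / t)
  + (4 * p t * dp t + c * dp t / t - c * p t / t ^+ 2)).

Let Hinv (t : R) : 0 < t -> is_derive t 1 (fun t : R => t^-1) (- (t^-1 ^+ 2)).
Proof.
move=> t0; have n0 : (fun t : R => t) t != 0 by rewrite gt_eqF.
by apply: is_derive_eq (der_inv n0 (is_derive_id t (1 : R))) _; rewrite mulr1.
Qed.

Lemma wA_derive (t : R) : 0 < t -> is_derive t 1 wA (dwA t).
Proof.
move=> t0; exact: (der_comp (is_derive_expR _)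
  (der_add (der_scale 2 (Hphi t0)) (der_scale gam (is_derive1_ln t0)))).
Qed.

Lemma wB_derive (t : R) : 0 < t -> is_derive t 1 wB (dwB t).
Proof.
move=> t0; apply: is_derive_eq (der_mul (wA_derive t0)
  (der_add (der_scale 2 (Hp t0)) (der_scale c (Hinv t0)))) _.
by rewrite /dwB /dwA -exprVn; move: (wA t) (p t) (dp t) (t^-1) => *; ring.
Qed.

Lemma wC_derive (t : R) : 0 < t -> is_derive t 1 wC (dwC t).
Proof.
move=> t0; have -> : wC = (fun t => wA t * (lam + (2 * p t ^+ 2 + c * (p t * t^-1)))).
  by apply/funext => s; rewrite /wC addrA mulrA.
apply: is_derive_eq (der_mul (wA_derive t0) (der_add (is_derive_cst lam t 1)
  (der_add (der_scale 2 (der_pow 1 (Hp t0))) (der_scale c (der_mul (Hp t0) (Hinv t0)))))) _.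
by rewrite /dwC /dwA -exprVn expr1 /cst; move: (wA t) (p t) (dp t) (t^-1) => *; ring.
Qed.

Lemma dw_continuous (t : R) : 0 < t ->
  [/\ {for t, continuous dwA}, {for t, continuous dwB} & {for t, continuous dwC}].
Proof.
move=> t0; have cA := is_derive_continuous (wA_derive t0).
have cp := is_derive_continuous (Hp t0); have cd := Hdp t0; have cI := is_derive_continuous (Hinv t0).
have cs (k : R) : {for t, continuous (fun=> k)} by exact: for_cst.
have c1 : {for t, continuous (fun t => 2 * p t + gam / t)} := for_addr (for_mulr (cs 2) cp) (for_mulr (cs gam) cI).
have c2 : {for t, continuous (fun t => 2 * p t + c / t)} := for_addr (for_mulr (cs 2) cp) (for_mulr (cs c) cI).
have c3 : {for t, continuous (fun t => lam + 2 * (p t * p t) + c * p t / t)} :=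
  for_addr (for_addr (cs lam) (for_mulr (cs 2) (for_mulr cp cp))) (for_mulr (for_mulr (cs c) cp) cI).
split; first exact: for_mulr cA c1.
- have -> : dwB = (fun t => wA t * ((2 * p t + gam / t) * (2 * p t + c / t) + (2 * dp t + (- c) * (t^-1 * t^-1)))).
    by apply/funext => s; rewrite /dwB -exprVn expr2 mulNr.
  exact: for_mulr cA (for_addr (for_mulr c1 c2) (for_addr (for_mulr (cs 2) cd) (for_mulr (cs (- c)) (for_mulr cI cI)))).
- have -> : dwC = (fun t => wA t * ((2 * p t + gam / t) * (lam + 2 * (p t * p t) + c * p t / t)
      + (4 * p t * dp t + c * dp t / t + (- c) * p t * (t^-1 * t^-1)))).
    by apply/funext => s; rewrite /dwC -exprVn !expr2 !mulNr.
  exact: for_mulr cA (for_addr (for_mulr c1 c3) (for_addr (for_addr (for_mulr (for_mulr (cs 4) cp) cd)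
    (for_mulr (for_mulr (cs c) cd) cI)) (for_mulr (for_mulr (cs (- c)) cp) (for_mulr cI cI)))).
Qed.

Context (u : M -> R) (Cu : forall q, Er q -> CM X 2 u q).

(* The monotone quantity is the flux through the level hypersurfaces of the field
   phi1 grad u + phi2 grad rho, that is of
   A (2 u_r grad u - |grad u|^2 grad rho) + B u grad u + C u^2 grad rho. *)
Definition phi1 q := 2 * (wA (rho D q) * ip g (rho D) u q) + wB (rho D q) * u q.
Definition phi2 q := wC (rho D q) * (u q * u q) + -1 * (wA (rho D q) * ip g u u q).

Lemma CM_phi q : Er q -> CM X 1 phi1 q /\ CM X 1 phi2 q.
Proof.
move=> [Eq rq]; have Cu2 : CM X 2 u q by exact: Cu.
have Cu1 := CM_le (leqnSn 1) Cu2; have Cr := CM_rho D 2 Eq.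
have [CA _] := rho_comp wA_derive (fun t t0 => let: And3 c1 _ _ := dw_continuous t0 in c1) Eq.
have [CB _] := rho_comp wB_derive (fun t t0 => let: And3 _ c1 _ := dw_continuous t0 in c1) Eq.
have [CC _] := rho_comp wC_derive (fun t t0 => let: And3 _ _ c1 := dw_continuous t0 in c1) Eq.
have cst k : CM X 1 (fun=> k) q by exact: CM_cst.
split.
  exact: CMD (CMM (cst 2) (CMM CA (CM_ip g Cr Cu2))) (CMM CB Cu1).
exact: CMD (CMM CC (CMM Cu1 Cu1)) (CMM (cst (-1)) (CMM CA (CM_ip g Cu2 Cu2))).
Qed.

(** The second derivatives of u occur in <grad u_r, grad u> and in the radial derivative of |grad
    u|^2. [hessian_ip] replaces their combination by the Hessian of rho, and the equation removes
    the Laplacian of u. *)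
Lemma div_formula q : Er q -> laplacian g u q + lam * u q = 0 ->
  let t := rho D q in let x := ip g (rho D) u q in let G := ip g u u q in
  let H := hessian g (rho D) q (grad g u q) (grad g u q) in
  ip g phi1 u q + phi1 q * laplacian g u q + (ip g phi2 (rho D) q + phi2 q * laplacian g (rho D) q) =
  dwA t * (2 * x ^+ 2 - G) + 2 * wA t * H + dwB t * (u q * x) + wB t * G
  - lam * u q * (2 * wA t * x + wB t * u q) + dwC t * u q ^+ 2 + 2 * wC t * u q * x
  + (wC t * u q ^+ 2 - wA t * G) * laplacian g (rho D) q.
Proof.
move=> [Eq rq] hu t x G H; have Cu2 : CM X 2 u q by exact: Cu.
have Cu1 := CM_le (leqnSn 1) Cu2; have Cr := CM_rho D 2 Eq; have Cr1 := CM_rho D 1 Eq.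
have [CA IA] := rho_comp wA_derive (fun t t0 => let: And3 c1 _ _ := dw_continuous t0 in c1) Eq.
have [CB IB] := rho_comp wB_derive (fun t t0 => let: And3 _ c1 _ := dw_continuous t0 in c1) Eq.
have [CC IC] := rho_comp wC_derive (fun t t0 => let: And3 _ _ c1 := dw_continuous t0 in c1) Eq.
have Cx := CM_ip g Cr Cu2; have CG := CM_ip g Cu2 Cu2.
have Cuu := CMM Cu1 Cu1; have CAx := CMM CA Cx; have CAG := CMM CA CG.
have cst k : CM X 1 (fun=> k) q by exact: CM_cst.
have e1 : ip g phi1 u q = 2 * (x * (dwA t * x) + wA t * ip g (ip g (rho D) u) u q)
    + (u q * (dwB t * x) + wB t * G).
  have h1 := ipDl g (CMM (cst 2) CAx) (CMM CB Cu1) Cu1.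
  have h2 := ipZl g 2 CAx Cu1; have h3 := ipMl g CA Cx Cu1; have h4 := ipMl g CB Cu1 Cu1.
  by rewrite (IA _ Cu1) in h3; rewrite (IB _ Cu1) in h4; apply: (etrans h1); rewrite h2 h3 h4.
have rr := ip_rho D sb Eq.
have e2 : ip g phi2 (rho D) q = (u q * u q) * dwC t + wC t * (u q * x + u q * x)
    + -1 * (G * dwA t + wA t * ip g (ip g u u) (rho D) q).
  have h1 := ipDl g (CMM CC Cuu) (CMM (cst (-1)) CAG) Cr1.
  have h2 := ipZl g (-1) CAG Cr1; have h3 := ipMl g CA CG Cr1; have h4 := ipMl g CC Cuu Cr1.
  have h5 := ipMl g Cu1 Cu1 Cr1.
  rewrite (IA _ Cr1) rr mulr1 in h3; rewrite (IC _ Cr1) rr mulr1 in h4.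
  by rewrite (ipC g Cu1 Cr1) in h5; apply: (etrans h1); rewrite h2 h3 h4 h5.
have e3 := hessian_ip g Cu2 Cr.
rewrite (ipC g Cu1 Cx) (ipC g Cr1 CG) -/H in e3.
have lu : laplacian g u q = - (lam * u q) by apply/eqP; rewrite -addr_eq0 hu.
rewrite e1 e2 lu /phi1 /phi2 -/t -/x -/G; clear e1 e2 lu.
move: (ip g (ip g (rho D) u) u q) (ip g (ip g u u) (rho D) q) (laplacian g (rho D) q) H e3 => I1 I2 L H.
move: (dwA t) (dwB t) (dwC t) (wA t) (wB t) (wC t) (u q) x G => dA dB dC A B C w x G e3.
have {}e3 : I2 = 2 * I1 - 2 * H by move: e3; rewrite !mulr2n; lra.
by rewrite e3; ring.
Qed.

Lemma wA_gt0 t : 0 < wA t. Proof. exact: expR_gt0. Qed.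

(** Up to the positive factor [wA] the divergence is the form of [weighted_form_ge0], with Z = |grad
    u|^2 - u_r^2; the two-sided bound on the Laplacian of rho is the trace of the one on its
    Hessian. *)
Lemma div_ge0 (a b e1 e2 eta : R) q : Er q -> laplacian g u q + lam * u q = 0 ->
  (forall v, a / rho D q * (inner g q v v - inner g q (grad g (rho D) q) v ^+ 2)
         <= hessian g (rho D) q v v /\
       hessian g (rho D) q v v
         <= b / rho D q * (inner g q v v - inner g q (grad g (rho D) q) v ^+ 2)) ->
  let t := rho D q in
  0 < lam -> 0 <= c -> 0 <= a -> 0 <= p t ->
  0 < e1 -> e1 <= N * a - (c - gam) -> N * b <= 2 * a + (c - gam) ->
  0 < e2 -> e2 <= gam + c - N * b ->
  - eta <= t * dp t -> dp t <= 0 -> 0 <= eta ->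
  2 * p t * eta <= e1 / 4 * (lam + p t ^+ 2) -> c * eta <= t * (e1 / 4 * lam) ->
  (2 * eta + 2 * p t * (N * b + c) + c * `|gam - 1| / t) ^+ 2 <=
     2 * (e2 + 4 * t * p t) * (e1 * (lam + p t ^+ 2)) ->
  0 <= ip g phi1 u q + phi1 q * laplacian g u q + (ip g phi2 (rho D) q + phi2 q * laplacian g (rho D) q).
Proof.
move=> Eq hu hh t lam0 c0 a0 p0 e10 h1 h2 e20 h3 h4 h5 h6 h7 h8 h9.
have t0 : 0 < t := rho_gt0 D (proj1 Eq).
have Cu1 := CM_le (leqnSn 1) (Cu Eq); have Cr1 := CM_rho D 1 (proj1 Eq).
have Cr2 := CM_rho D 2 (proj1 Eq); have rr := ip_rho D sb (proj1 Eq).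
have hG : ip g (rho D) u q ^+ 2 <= ip g u u q := ip_cauchy Cu1 Cr1 rr.
have L1 : 0 <= 1 * (laplacian g (rho D) q - a / t * N).
  by apply: laplacian_bound => // v; rewrite mul1r subr_ge0; case: (hh v).
have L2 : 0 <= -1 * (laplacian g (rho D) q - b / t * N).
  by apply: laplacian_bound => // v; rewrite mulN1r oppr_ge0 subr_le0; case: (hh v).
have [H1 _] := hh (grad g u q).
rewrite -/(ip g u u q) -/(ip g (rho D) u q) in H1.
rewrite (div_formula Eq hu) -/t.
have HE : a * (ip g u u q - ip g (rho D) u q ^+ 2) <= t * hessian g (rho D) q (grad g u q) (grad g u q).
  by rewrite -ler_pdivrMl// mulrA [_^-1 * a]mulrC.
have LE1 : N * a <= t * laplacian g (rho D) q.
  move: L1; rewrite mul1r subr_ge0 => L1; rewrite -ler_pdivrMl//; apply: le_trans L1.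
  by rewrite mulrC [a / t * _]mulrC mulrA.
have LE2 : t * laplacian g (rho D) q <= N * b.
  move: L2; rewrite mulN1r oppr_ge0 subr_le0 => L2; rewrite -ler_pdivlMl//; apply: (le_trans L2).
  by rewrite [leRHS]mulrC [b / t * _]mulrC mulrA.
have Z0 : 0 <= ip g u u q - ip g (rho D) u q ^+ 2 by rewrite subr_ge0.
have F := weighted_form_ge0 (ip g (rho D) u q) (u q) t0 p0 Z0 lam0 c0 (ler0n R m) a0
  HE LE1 LE2 e10 h1 h2 e20 h3 h4 h5 h6 h7 h8 h9.
(* The form times [wA] is the divergence; after generalizing the reciprocals this is a polynomial
   identity. *)
move: F (mulr_ge0 (ltW (wA_gt0 t)) F) => _.
rewrite /dwA /dwB /dwC /wB /wC.
move: (wA t) (ip g u u q) (ip g (rho D) u q) (u q) (laplacian g (rho D) q) (hessian g (rho D) q _ _) => A G x w L H.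
move: (p t) (dp t) (t ^+ 2)^-1 t^-1 => P P' t2 t1; set E1 := (X in 0 <= X -> _); set E2 := (X in _ -> 0 <= X).
by have -> : E1 = E2 by rewrite /E1 /E2; ring.
Qed.

Lemma radial_flux q : Er q -> let t := rho D q in
  phi1 q * ip g (rho D) u q + phi2 q * ip g (rho D) (rho D) q =
  wA t * (2 * ip g (rho D) u q ^+ 2 - ip g u u q + (2 * p t + c / t) * (u q * ip g (rho D) u q)
    + (lam + 2 * p t ^+ 2 + c * p t / t) * u q ^+ 2).
Proof.
move=> [Eq rq] t; rewrite (ip_rho D sb Eq) /phi1 /phi2 -/t /wB /wC.
by move: (wA t) (ip g u u q) (ip g (rho D) u q) (u q) (p t) t^-1 => *; ring.
Qed.

End Multipliers.

Lemma flux_upper (lam c k t P x w G : R) : 0 < r0 -> r0 < t -> 0 <= c -> 0 < lam -> 0 <= P -> P <= k ->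
  x ^+ 2 <= G ->
  2 * x ^+ 2 - G + (2 * P + c / t) * (w * x) + (lam + 2 * P ^+ 2 + c * P / t) * w ^+ 2 <=
  (1 + (2 * k + c / r0) + (lam + 2 * k ^+ 2 + c * k / r0)) * (x ^+ 2 + w ^+ 2).
Proof.
move=> r00 rt c0 lam0 P0 Pk xG; have k0 := le_trans P0 Pk; have t0 := lt_trans r00 rt.
have it : t^-1 <= r0^-1 by rewrite lef_pV2 ?posrE// ltW.
have it0 : 0 <= t^-1 by rewrite invr_ge0 ltW.
have i1 : c / t <= c / r0 by rewrite ler_wpM2l.
have i2 : c * P / t <= c * k / r0 by rewrite ler_pM// ?mulr_ge0// ler_wpM2l.
have i3 : P ^+ 2 <= k ^+ 2 by rewrite lerXn2r.
have i4 : 0 <= c / t by rewrite mulr_ge0.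
have i5 : 0 <= c * P / t by rewrite !mulr_ge0.
have s2 := sqr_ge0 x; have s3 := sqr_ge0 w; have s4 := sqr_ge0 (x - w); have s5 := sqr_ge0 P.
have j1 : (2 * P + c / t) * (w * x) <= (2 * k + c / r0) * (x ^+ 2 + w ^+ 2).
  apply: (@le_trans _ _ ((2 * P + c / t) * (x ^+ 2 + w ^+ 2))).
    by apply: ler_wpM2l; lra.
  by apply: ler_wpM2r; lra.
have j2 : (lam + 2 * P ^+ 2 + c * P / t) * w ^+ 2 <= (lam + 2 * k ^+ 2 + c * k / r0) * (x ^+ 2 + w ^+ 2).
  apply: (@le_trans _ _ ((lam + 2 * P ^+ 2 + c * P / t) * (x ^+ 2 + w ^+ 2))).
    by apply: ler_wpM2l; lra.
  by apply: ler_wpM2r; lra.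
by lra.
Qed.

(** The terms 2 x^2 + 2 P w x + 2 P^2 w^2 equal x^2 + (x + P w)^2 + P^2 w^2, so a large P controls
    w^2 from below while the other losses do not depend on P. *)
Lemma flux_lower (lam c K t P x w G : R) : 0 < t -> 0 <= c -> 0 < lam -> 0 <= K -> K <= P ->
  K ^+ 2 * w ^+ 2 - (c / t * (x ^+ 2 + w ^+ 2) + G) <=
  2 * x ^+ 2 - G + (2 * P + c / t) * (w * x) + (lam + 2 * P ^+ 2 + c * P / t) * w ^+ 2.
Proof.
move=> t0 c0 lam0 K0 KP; have P0 := le_trans K0 KP.
have i3 : K ^+ 2 <= P ^+ 2 by rewrite lerXn2r.
have it0 : 0 <= t^-1 by rewrite invr_ge0 ltW.
have i4 : 0 <= c / t by rewrite mulr_ge0.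
have i5 : 0 <= c * P / t by rewrite !mulr_ge0.
have s2 := sqr_ge0 x; have s3 := sqr_ge0 w; have s4 := sqr_ge0 (x + w); have s5 := sqr_ge0 (x + P * w).
have j1 : K ^+ 2 * w ^+ 2 <= P ^+ 2 * w ^+ 2 by rewrite ler_wpM2r.
have j2 : 0 <= c * P / t * w ^+ 2 by rewrite mulr_ge0.
have j3 : 0 <= c / t * (x ^+ 2 + w ^+ 2 + w * x) by rewrite mulr_ge0//; lra.
have j4 : 0 <= lam * w ^+ 2 by rewrite mulr_ge0// ltW.
by lra.
Qed.

Context (dA : R -> {measure set (borel M) -> \bar R}).
Context (hdA : forall t : R, 0 < t -> area_measure g (level_set g U t) (dA t)).
Context (K : nat) (z : 'I_K -> bpatch g U * 'rV[R]_m * R) (gz : forall k, good_patch (z k)).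
Context (cov : forall q, Ee q -> exists k, in_patch D (z k) q).

Lemma vanishing (a b lam gam : R) (u : M -> R) :
  0 < lam -> 0 < a -> a <= b -> 0 < N -> N * b < (N + 2) * a -> N / 2 * (b - a) < gam ->
  (forall q, Er q -> forall v, a / rho D q * (inner g q v v - inner g q (grad g (rho D) q) v ^+ 2)
         <= hessian g (rho D) q v v /\
       hessian g (rho D) q v v
         <= b / rho D q * (inner g q v v - inner g q (grad g (rho D) q) v ^+ 2)) ->
  (forall q, Er q -> CM X 2 u q) -> (forall q, Er q -> laplacian g u q + lam * u q = 0) ->
  (forall e T : R, 0 < e -> exists2 t : R, T < t &
     t `^ gam * SJ D z t (fun q => ip g (rho D) u q ^+ 2 + u q ^+ 2) < e) ->
  forall q, Er q -> u q = 0.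
Proof.
move=> lam0 a0 ab N0 Nab hgam hh Cu hu hlim q0 Eq0; apply/eqP; apply: contrapT => /negP u0.
pose t0 := rho D q0; have rt0 : r0 < t0 by case: Eq0.
have t00 : 0 < t0 := lt_trans r0_gt0 rt0.
(* The lower end of the interval for kappa. It lies below N a by the pinching of a and b and by the
   bound on gam; [ka] is the midpoint, and [e1], [e2] are the resulting margins. *)
pose mx := Num.max 0 (Num.max (N * b - 2 * a) (N * b - 2 * gam)).
have mx1 : mx < N * a by rewrite !gt_max mulr_gt0//=; apply/andP; split; nra.
have [mx2 mx3 mx4] : [/\ 0 <= mx, N * b - 2 * a <= mx & N * b - 2 * gam <= mx].
  by rewrite !le_max !lexx !orbT.
pose ka := (mx + N * a) / 2.
have [k1 k2] : mx < ka /\ ka < N * a by rewrite /ka; split; lra.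
have gam0 : 0 < gam by apply: le_lt_trans hgam; rewrite mulr_ge0 ?divr_ge0 ?subr_ge0// ltW.
pose c := gam + ka; have c0 : 0 <= c by rewrite /c; lra.
pose e1 := N * a - ka; have e10 : 0 < e1 by rewrite subr_gt0.
pose e2 := 2 * gam + ka - N * b; have e20 : 0 < e2 by rewrite /e2; lra.
have Q0 : 0 <= N * b + c by rewrite addr_ge0// mulr_ge0 ?ltW// (lt_le_trans a0).
have Cx q : Er q -> [/\ CM X 1 u q, CM X 1 (ip g (rho D) u) q & CM X 1 (ip g u u) q].
  move=> Eq; have C2 := Cu q Eq; split; first exact: CM_le C2.
    exact: CM_ip (CM_rho D 2 (proj1 Eq)) C2.
  exact: CM_ip.
have sq t (f : M -> R) : lcont D t f -> lcont D t (fun q => f q ^+ 2).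
  by move=> cf q Eq rq; rewrite (_ : (fun q => f q ^+ 2) = (fun q => f q * f q));
    [apply: for_mulr; exact: cf|apply/funext => ?; rewrite expr2].
have lc t : r0 < t -> [/\ lcont D t u, lcont D t (ip g (rho D) u) & lcont D t (ip g u u)].
  move=> rt; have H q : Ee q -> rho D q = t -> Er q by move=> Eq rq; rewrite rq.
  by split=> q Eq rq; have [c1 c2 c3] := Cx q (H q Eq rq); [exact: CM_continuous c1|exact: CM_continuous c2|exact: CM_continuous c3].
have [cu cx cG] := lc t0 rt0.
pose W := SJ D z t0 (fun q => u q ^+ 2).
have W0 : 0 < W.
  apply: (SJ_pos gz cov t00 (sq _ _ cu) _ (proj1 Eq0)) => //; first by move=> q _ _; exact: sqr_ge0.
  by rewrite lt_neqAle sqr_ge0 eq_sym expf_neq0//.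
pose g2 q := c / t0 * (ip g (rho D) u q ^+ 2 + u q ^+ 2) + ip g u u q.
have cg2 : lcont D t0 g2 by apply: lcontD => //; apply: lcontZ; apply: lcontD; exact: sq.
pose S2 := SJ D z t0 g2.
(* W > 0 because u q0 is nonzero, so Kk is finite; since Kk >= 1, Kk^2 W >= Kk W = W + |S2| > S2. A
   weight with p >= Kk at t0 then makes the flux positive there. *)
pose Kk := 1 + `|S2| / W.
have Kk1 : 1 <= Kk by rewrite lerDl divr_ge0// ltW.
have KW : S2 < Kk ^+ 2 * W.
  apply: (@lt_le_trans _ _ (Kk * W)).
    by rewrite mulrDl mul1r mulfVK ?gt_eqF//; have := ler_norm S2; lra.
  by rewrite ler_wpM2r ?(ltW W0)// ler_eXnr.
have [phi [p [dp [Phi [k [eta [hw1 hw2]]]]]]] :=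
  weight_exists gam Kk r0_gt0 t00 lam0 c0 e10 e20 Q0.
have Hphi (t : R) : 0 < t -> is_derive t 1 phi (p t) by case/hw1 => -[].
have Hp (t : R) : 0 < t -> is_derive t 1 p (dp t) by case/hw1 => -[].
have Hdp (t : R) : 0 < t -> {for t, continuous dp} by case/hw1 => -[].
have CP q (Eq : Er q) := CM_phi gam c lam Hphi Hp Hdp Cu Eq.
pose P1 := phi1 phi p gam c u; pose P2 := phi2 phi p gam c lam u.
pose F t := flux D z P1 P2 u (rho D) t.
have Fmono s t : r0 < s -> s <= t -> F s <= F t.
  apply: (flux_mono cbd sb r0_gt0 hdA gz cov) => [q Eq|q Eq|q Eq|q Eq|q Eq].
  - exact: (proj1 (CP q Eq)).
  - exact: Cu.
  - exact: (proj2 (CP q Eq)).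
  - exact: CM_rho D 2 _ (proj1 Eq).
  - have [[w1 w2 w3] [w4 w5 w6]] := hw2 _ (proj2 Eq).
    have [_ [_ p0 _ _]] := hw1 _ (rho_gt0 D (proj1 Eq)).
    apply: (div_ge0 Hphi Hp Hdp Cu (a := a) (b := b) (e1 := e1) (e2 := e2) (eta := eta)) => //.
    + exact: hu.
    + exact: hh.
    + exact: ltW.
    + by rewrite /e1 /c; lra.
    + by rewrite /c; lra.
    + by rewrite /e2 /c; lra.
pose Y q := P1 q * ip g (rho D) u q + P2 q * ip g (rho D) (rho D) q.
have cP t : r0 < t -> [/\ lcont D t (fun q => P1 q * ip g (rho D) u q),
    lcont D t (fun q => P2 q * ip g (rho D) (rho D) q) & lcont D t Y].
  move=> rt; have [_ cxt _] := lc t rt.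
  have A1 : lcont D t (fun q => P1 q * ip g (rho D) u q).
    move=> q Eq rq; have Eq' : Er q by rewrite rq.
    by apply: for_mulr; [exact: CM_continuous (proj1 (CP q Eq'))|exact: cxt].
  have A2 : lcont D t (fun q => P2 q * ip g (rho D) (rho D) q).
    move=> q Eq rq; have Eq' : Er q by rewrite rq.
    apply: for_mulr; first exact: CM_continuous (proj2 (CP q Eq')).
    exact: CM_continuous (CM_ip g (CM_rho D 1 Eq) (CM_rho D 1 Eq)).
  by split=> //; exact: lcontD.
have FE t : r0 < t -> F t = SJ D z t Y.
  move=> rt; have [A1 A2 _] := cP t rt.
  by rewrite (SJD gz cov (lt_trans r0_gt0 rt) A1 A2).
have YE q : Er q -> Y q = wA phi gam (rho D q) * (2 * ip g (rho D) u q ^+ 2 - ip g u u q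
    + (2 * p (rho D q) + c / rho D q) * (u q * ip g (rho D) u q)
    + (lam + 2 * p (rho D q) ^+ 2 + c * p (rho D q) / rho D q) * u q ^+ 2).
  exact: radial_flux.
have F0 : 0 < F t0.
  have A0 : 0 < wA phi gam t0 by exact: wA_gt0.
  pose V q := wA phi gam t0 * (Kk ^+ 2 * u q ^+ 2 + -1 * g2 q).
  have c1 : lcont D t0 (fun q => Kk ^+ 2 * u q ^+ 2) by apply: lcontZ; exact: sq.
  have c2 : lcont D t0 (fun q => -1 * g2 q) by exact: lcontZ.
  have cV : lcont D t0 (fun q => Kk ^+ 2 * u q ^+ 2 + -1 * g2 q) by exact: lcontD.
  apply: (@lt_le_trans _ _ (SJ D z t0 V)).
    rewrite (SJZ gz cov _ t00 cV) mulr_gt0// (SJD gz cov t00 c1 c2).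
    by rewrite (SJZ gz cov _ t00 (sq _ _ cu)) (SJZ gz cov _ t00 cg2) mulN1r subr_gt0.
  rewrite (FE _ rt0); have [_ _ cY] := cP _ rt0.
  apply: (SJ_le cbd sb hdA gz cov t00 (lcontZ cV) cY) => q Eq rq.
  have Eq' : Er q by rewrite rq.
  rewrite (YE q Eq') rq /V ler_pM2l// mulN1r.
  have [_ [_ _ _ Kp]] := hw1 _ t00; have K0 : 0 <= Kk by exact: le_trans Kk1.
  by apply: flux_lower => //; exact: Kp.
pose C0 := 1 + (2 * k + c / r0) + (lam + 2 * k ^+ 2 + c * k / r0).
have k0 : 0 <= k by have [_ [_ p0 pk _]] := hw1 _ t00; exact: le_trans pk.
have C00 : 0 < C0.
  have j1 : 0 <= c / r0 by rewrite divr_ge0// ltW.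
  have j2 : 0 <= c * k / r0 by rewrite divr_ge0 ?mulr_ge0// ltW.
  by have := sqr_ge0 k; rewrite /C0; lra.
(* exp(2 Phi) bounds e^(2 phi) and C0 comes from [flux_upper]; C1 does not depend on the radius. *)
pose C1 := expR (2 * Phi) * C0; have C10 : 0 < C1 by rewrite mulr_gt0// expR_gt0.
(* A radius beyond t0 at which C1 t^gam times the level integral is below F t0. By [le] that product
   bounds F t from above, which contradicts monotonicity. *)
have [t Tt small] := hlim (F t0 / C1) t0 (divr_gt0 F0 C10).
have rt : r0 < t := lt_trans rt0 Tt; have tt0 : 0 < t := lt_trans r0_gt0 rt.
have [cut cxt cGt] := lc t rt; have [_ _ cYt] := cP t rt.
have cxu : lcont D t (fun q => ip g (rho D) u q ^+ 2 + u q ^+ 2) by apply: lcontD; exact: sq.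
have E1 := SJZ gz cov (C1 * t `^ gam) tt0 cxu.
have le : F t <= C1 * t `^ gam * SJ D z t (fun q => ip g (rho D) u q ^+ 2 + u q ^+ 2).
  apply: (fun h => le_trans h (eqP_le E1)); apply: (le_trans (eqP_le (FE _ rt))).
  apply: (SJ_le cbd sb hdA gz cov tt0 cYt (lcontZ cxu)) => q Eq rq.
  have Eq' : Er q by rewrite rq.
  have [Phit p0 pk _] := proj2 (hw1 _ tt0).
  have Cu1 : CM X 1 u q by have [] := Cx q Eq'.
  have xG := ip_cauchy Cu1 (CM_rho D 1 Eq) (ip_rho D sb Eq).
  rewrite (YE q Eq') rq.
  apply: (@le_trans _ _ (wA phi gam t * (C0 * (ip g (rho D) u q ^+ 2 + u q ^+ 2)))).
    by rewrite ler_pM2l ?wA_gt0//; apply: flux_upper.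
  rewrite mulrA ler_wpM2r ?addr_ge0 ?sqr_ge0// /C1 mulrAC ler_wpM2r ?(ltW C00)//.
  rewrite /wA expRD /powR gt_eqF// ler_wpM2r ?expR_ge0// ler_expR ler_pM2l//.
have F1 := Fmono _ _ rt0 (ltW Tt); move: (SJ D z t _) (F t) (F t0) le small F1 F0 => S Ft Ft0 le small F1 F0.
have := lt_le_trans small (lexx _); rewrite ltr_pdivlMr// mulrC mulrA => lt.
by have := lt_le_trans lt (le_trans F1 le); rewrite ltxx.
Qed.

End Core.

(** * From the lower limit to the vanishing of u *)

Lemma limf_einf0_lt (R : realType) (f : R -> \bar R) (e T : R) : 0 < e ->
  limf_einf f (pinfty_nbhs R) = 0%E -> exists2 t : R, T < t & (f t < e%:E)%E.
Proof.
move=> e0; rewrite limf_einfE => h0.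
have h : (ereal_inf (f @` [set t | (T < t)%R]) < e%:E)%E.
  apply: (@le_lt_trans _ _ 0%E); last by rewrite lte_fin.
  rewrite -h0; apply: ereal_sup_ubound; exists [set t | (T < t)%R] => //.
  by exists T; split=> //; exact: num_real.
by have [_ [t Tt <-] lt] := ereal_inf_lt h; exists t.
Qed.

(** The dimension is written 1 + m to split off the radial coordinate. The functions r and rho agree
    near every point of the end, so the Hessian bounds carry over, and the integrals over S(t)
    become [SJ] through the area measures. *)
Lemma theorem1p1_succ (R : realType) (m : nat) (hn : (2 <= 1 + m)%N)
    (M : ptopologicalType) (X : manifold R (1 + m) M) (g : metric X)
    (U : set M) (hU : open U) (hE : radial_end g U)
    (r : M -> R) (hr : r = dist_set g U)
    (dA : R -> {measure set (borel M) -> \bar R})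
    (hdA : forall t : R, 0 < t -> area_measure g (level_set g U t) (dA t))
    (r0 a b : R) (hr0 : 0 < r0) (ha : 0 < a) (hab : a <= b)
    (hab' : b < ((1 + m)%:R + 1) / ((1 + m)%:R - 1) * a)
    (hess : forall p, outer_region g U r0 p -> forall v : 'rV[R]_(1 + m),
       a / r p * (inner g p v v - differential g r p v ^+ 2)
         <= hessian g r p v v /\
       hessian g r p v v
         <= b / r p * (inner g p v v - differential g r p v ^+ 2))
    (lambda : R) (hlambda : 0 < lambda)
    (u : M -> R) (hu : Cfun X (Some 2%N) (outer_region g U r0) u)
    (hu_eq : forall p, outer_region g U r0 p ->
       laplacian g u p + lambda * u p = 0)
    (hu_nontrivial : exists2 p, outer_region g U r0 p & u p != 0)
    (gamma : R) (hgamma : ((1 + m)%:R - 1) / 2 * (b - a) < gamma) :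
  limf_einf
    (fun t : R => ((t `^ gamma)%:E *
       \int[dA t]_(p in level_set g U t)
         ((inner g p (grad g r p) (grad g u p)) ^+ 2 + `|u p| ^+ 2)%:E)%E)
    (pinfty_nbhs R) <> 0%E.
Proof.
move=> h0; have [cbd _ sb [hbij hC [h hK hCi]]] := hE.
pose D := RadialData hU hbij hC hK hCi.
have outE p : outer_region g U r0 p <-> (~ closure U p /\ r0 < rho D p).
  by split=> -[Eq rq]; split=> //; move: rq; rewrite (dist_rho D cbd sb Eq).
have rE p : ~ closure U p -> \forall q \near p, r q = rho D q.
  by move=> Eq; apply: filterS (E_near Eq) => q Eq'; rewrite hr (dist_rho D cbd sb Eq').
have [q0 oq0 uq0] := hu_nontrivial; have /outE Eq0 := oq0.
have [K [z [gz cov]]] := finite_cover D cbd sb (proj1 Eq0).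
have oo : open (outer_region g U r0).
  rewrite openE => p /outE[Eq rq].
  have cr := CM_continuous (CM_rho D 0 Eq).
  by apply: filterS2 (E_near Eq) (near_comp_cont cr (near_gt rq)) => q Eq' rq'; apply/outE.
have Cu q : ~ closure U q /\ r0 < rho D q -> CM X 2 u q.
  by move=> /outE oq; apply: (@Cfun_CM _ _ _ X (Some 2%N) 2 (outer_region g U r0) u q oo (leqnn 2) hu oq).
have nE : (1 + m)%:R - 1 = m%:R :> R by rewrite natrD addrC addKr.
rewrite nE in hab' hgamma.
have m0 : 0 < m%:R :> R by rewrite ltr0n.
have mb : m%:R * b < (m%:R + 2) * a.
  move: hab'; rewrite mulrAC ltr_pdivlMr// natrD mulrC => lt; apply: lt_le_trans lt _.
  by rewrite mulrC [X in X <= _]mulrC (_ : 1 + m%:R + 1 = m%:R + 2 :> R)//; ring.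
move: uq0; rewrite (vanishing cbd sb hr0 hdA gz cov hlambda ha hab m0 mb hgamma _ Cu _ _ Eq0) ?eqxx//.
- move=> q Eq v; have /outE oq := Eq; have := hess q oq v.
  have rq := rE q (proj1 Eq).
  by rewrite /differential (grad_near g rq) (hessian_near g v v rq) (nbhs_singleton rq).
- by move=> q /outE; exact: hu_eq.
- move=> e T e0; have [t] := limf_einf0_lt (Num.max T r0) e0 h0.
  rewrite gt_max => /andP[Tt rt] lt; exists t => //; have t0 := lt_trans hr0 rt.
  have Er q : ~ closure U q -> rho D q = t -> ~ closure U q /\ r0 < rho D q by move=> Eq ->.
  have cI : lcont D t (fun q => ip g (rho D) u q ^+ 2 + u q ^+ 2).
    move=> q Eq rq; have C2 := Cu q (Er q Eq rq).
    have c1 := CM_continuous (CM_ip g (CM_rho D 2 Eq) C2).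
    have c2 := CM_continuous C2.
    have -> : (fun q => ip g (rho D) u q ^+ 2 + u q ^+ 2) =
      (fun q => ip g (rho D) u q * ip g (rho D) u q + u q * u q) by apply/funext => ?; rewrite !expr2.
    exact: for_addr (for_mulr c1 c1) (for_mulr c2 c2).
  have I : (\int[dA t]_(p in level_set g U t)
         ((inner g p (grad g r p) (grad g u p)) ^+ 2 + `|u p| ^+ 2)%:E)%E =
      (SJ D z t (fun q => ip g (rho D) u q ^+ 2 + u q ^+ 2))%:E.
    rewrite -(SJ_integral cbd sb hdA gz cov t0 cI) => [|q _ _]; last by rewrite addr_ge0 ?sqr_ge0.
    rewrite [LHS]integral_mkcond; apply: eq_integral => q _; rewrite /patch /lrestr.
    have [ql|ql] := boolP (q \in level_set g U t).
      move: ql; rewrite inE => -[Eq dq]; rewrite asboolT; last first.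
        by split=> //; rewrite -(dist_rho D cbd sb Eq).
      by rewrite (grad_near g (rE q Eq)) real_normK ?num_real.
    rewrite asboolF// => -[Eq rq]; move: ql; rewrite notin_setE; apply.
    by split=> //; rewrite (dist_rho D cbd sb Eq).
  by move: lt; rewrite I -EFinM lte_fin.
Qed.

Theorem theorem1p1 (R : realType) (n : nat) (hn : (2 <= n)%N)
    (M : ptopologicalType) (X : manifold R n M) (g : metric X)
    (hM : complete_metric g)
    (U : set M) (hU : open U) (hE : radial_end g U)
    (r : M -> R) (hr : r = dist_set g U)
    (dA : R -> {measure set (borel M) -> \bar R})
    (hdA : forall t : R, 0 < t -> area_measure g (level_set g U t) (dA t))
    (r0 a b : R) (hr0 : 0 < r0) (ha : 0 < a) (hb : 0 < b) (hab : a <= b)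
    (hab' : b < (n%:R + 1) / (n%:R - 1) * a)
    (hess : forall p, outer_region g U r0 p -> forall v : 'rV[R]_n,
       a / r p * (inner g p v v - differential g r p v ^+ 2)
         <= hessian g r p v v /\
       hessian g r p v v
         <= b / r p * (inner g p v v - differential g r p v ^+ 2))
    (b1 : R -> R) (hb1 : forall t, r0 <= t -> 0 < b1 t)
    (hb1_decr : forall s t, r0 <= s -> s <= t -> b1 t <= b1 s)
    (hb1_lim : b1 t @[t --> +oo] --> (0 : R))
    (hric : forall p, outer_region g U r0 p ->
       - ((n%:R - 1) * (b1 (r p) / r p)) <= ricci g p (grad g r p) (grad g r p))
    (lambda : R) (hlambda : 0 < lambda)
    (u : M -> R) (hu : Cfun X (Some 2%N) (outer_region g U r0) u)
    (hu_eq : forall p, outer_region g U r0 p ->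
       laplacian g u p + lambda * u p = 0)
    (hu_nontrivial : exists2 p, outer_region g U r0 p & u p != 0)
    (gamma : R) (hgamma : (n%:R - 1) / 2 * (b - a) < gamma) :
  limf_einf
    (fun t : R => ((t `^ gamma)%:E *
       \int[dA t]_(p in level_set g U t)
         ((inner g p (grad g r p) (grad g u p)) ^+ 2 + `|u p| ^+ 2)%:E)%E)
    (pinfty_nbhs R) <> 0%E.
Proof.
(* Dimension 0 is excluded by [hn], and m.+1 is convertible to 1 + m. *)
destruct n as [|m]; first by [].
exact: (@theorem1p1_succ R m hn M X g U hU hE r hr dA hdA r0 a b hr0 ha hab hab'
  hess lambda hlambda u hu hu_eq hu_nontrivial gamma hgamma).
Qed.
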